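(* Assume (C1)-(C3) (listed in the context). Let $(U_0^\varepsilon)_{\varepsilon>0}$ be equi-Lipschitz continuous functions on $\mathbb{R}$ with $U_0^\varepsilon\to u_0$ locally uniformly as $\varepsilon\to0$. For all $\varepsilon>0$, let $u^\varepsilon$ be the solution (in the sense of the context) of $$u^\varepsilon_t+H\left(\frac t\varepsilon,\frac x\varepsilon,u^\varepsilon_x\right)=0,\qquad u^\varepsilon(0,x)=U_0^\varepsilon(x)\quad\text{for }x\in\mathbb{R}.$$ Then: i) (Homogenization) There exists some $\bar A\in\mathbb{R}$ (the effective flux limiter) such that $u^\varepsilon$ converges locally uniformly as $\varepsilon\to0$ towards the unique (flux-limited) viscosity solution $u^0$ of $$\begin{cases}u^0_t+\bar H_L(u^0_x)=0,& t>0,\ x<0,\\ u^0_t+\bar H_R(u^0_x)=0,& t>0,\ x>0,\\ u^0_t+\max\big(\bar A,\bar H_L^+(u^0_x(t,0^-)),\bar H_R^-(u^0_x(t,0^+))\big)=0,& t>0,\ x=0,\end{cases}\qquad u^0(0,x)=u_0(x),$$ with $\bar H_L:=\bar H_0$ and $\bar H_R:=\bar H_N$. ii) (Qualitative properties of $\bar A$) For $\alpha=1,\dots,N$, let $\langle a_\alpha\rangle=\int_0^1a_\alpha(s)\,ds$. The effective limiter $\bar A$ satisfies the following properties. - For all $\alpha$, $\bar A$ is non-increasing with respect to $\ell_\alpha$. - For $N=1$, $\bar A=\langle a_1\rangle$. - For $N\ge1$, $\bar A\ge\max_{\alpha=1,\dots,N}\langle a_\alpha\rangle$. - For $N\ge2$,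 there exists a critical distance $d_0\ge0$ such that $$\bar A=\max_{\alpha=1,\dots,N}\langle a_\alpha\rangle\quad\text{if}\quad\min_\alpha\ell_\alpha\ge d_0;$$ this distance $d_0$ only depends on $\max_{\alpha=1,\dots,N}\|a_\alpha\|_\infty$, $\max_{\alpha=1,\dots,N}\langle a_\alpha\rangle$ and the $\bar H_\alpha$'s. - We have $\bar A\to\langle\bar a\rangle$ as $(\ell_1,\dots,\ell_{N-1})\to(0,\dots,0)$, where $\bar a(\tau)=\max_{\alpha=1,\dots,N}a_\alpha(\tau)$ and $\langle\bar a\rangle=\int_0^1\bar a(s)\,ds$.
   Context: Data. $N\ge1$; junction points $-\infty=b_0<b_1<\dots<b_N<b_{N+1}=+\infty$; times $0=\tau_0<\tau_1<\dots<\tau_K<1=\tau_{K+1}$, $K\in\mathbb{N}$. For $\alpha\in\{0,\dots,N\}$, $\ell_\alpha=b_{\alpha+1}-b_\alpha$ (so $\ell_0=\ell_N=+\infty$). (C1) The Hamiltonian is $H(t,x,p)=\bar H_\alpha(p)$ if $b_\alpha<x<b_{\alpha+1}$, and at $x=b_\alpha$, $\alpha\ne0$, it is $\max(\bar H_{\alpha-1}^+(p^-),\bar H_\alpha^-(p^+),a_\alpha(t))$, where $p^-$, $p^+$ stand for the left and right space derivatives of the unknown at $b_\alpha$. (C2) The Hamiltonians $\bar H_\alpha:\mathbb{R}\to\mathbb{R}$, $\alpha=0,\dots,N$, are continuous, coercive and quasi-convex (sublevel sets are convex). (C3) The flux limiters $a_\alpha$, $\alpha=1,\dots,N$, satisfy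 $a_\alpha(s+1)=a_\alpha(s)$ and $a_\alpha(s)=A_\alpha^i$ for all $s\in[\tau_i,\tau_{i+1})$, $i=0,\dots,K$, with constants $A_\alpha^i\ge\max_{\beta=\alpha-1,\alpha}(\min\bar H_\beta)$. Monotone parts. With $\bar p^0_\alpha\in\operatorname{argmin}\bar H_\alpha$: $\bar H_\alpha^-(p)=\bar H_\alpha(p)$ if $p<\bar p^0_\alpha$ and $=\bar H_\alpha(\bar p^0_\alpha)$ if $p\ge\bar p^0_\alpha$; $\bar H_\alpha^+(p)=\bar H_\alpha(\bar p^0_\alpha)$ if $p\le\bar p^0_\alpha$ and $=\bar H_\alpha(p)$ if $p>\bar p^0_\alpha$. Viscosity (flux-limited) notion. Test functions are continuous in $(t,x)$ and $C^1$ on each side of each junction point (up to the junction). $u$ is a sub-solution (resp. super-solution) if whenever such a test function $\varphi$ touches the upper semi-continuous envelope $u^*$ from above (resp. the lower semi-continuous envelope $u_*$ from below) locally at a point, the equation holds for $\varphi$ at this point with $\le$ (resp. $\ge$), where at a junction point the junction equation with the one-sided derivatives $\varphi_x(t,x^\pm)$ is used. A solution is both. Uniqueness of $u^0$ is in the usual comparison class of functions with at most linear growth in $x$, locally uniformly in time. Notion of solution for the $\varepsilon$-problem. For $\varepsilon=1$, $u$ is a solution if it is globally Lipschitz continuous in space and time and solves successively, in the flux-limited viscosity sense (i.e. as both a sub-solution and a super-solution, tested with functions $\varphi$ continuous in $(t,x)$ and $C^1$ on each side of each junction point up to the junction, the junction equation with the one-sided derivatives $\varphi_x(t,x^\pm)$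 being used at junction points), the Cauchy problems on the time intervals $[\tau_i+k,\tau_{i+1}+k)$, $i=0,\dots,K$, $k\in\mathbb{N}$ (on each of which the limiters $a_\alpha$ are constant). For general $\varepsilon$, $u^\varepsilon$ is a solution if $(t,x)\mapsto\varepsilon^{-1}u^\varepsilon(\varepsilon t,\varepsilon x)$ is a solution for $\varepsilon=1$. Effective flux limiter. $\bar A$ is the infimum of the set of $\lambda\in\mathbb{R}$ for which there exists a globally Lipschitz function $w:\mathbb{R}\times\mathbb{R}\to\mathbb{R}$, $1$-periodic in $t$, which is a sub-solution of $w_t+H(t,x,w_x)=\lambda$ on each time interval $(\tau_i+k,\tau_{i+1}+k)$, $i=0,\dots,K$, $k\in\mathbb{Z}$; it does not depend on the initial data. In ii), when the $\ell_\alpha$'s vary, the functions $\bar H_\alpha$ and $a_\alpha$ are kept fixed. *)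

(* Defs.v *)
From HB Require Import structures.
From mathcomp Require Import all_boot all_order all_algebra.
From mathcomp Require Import all_classical all_reals all_analysis.
Set Implicit Arguments.
Unset Strict Implicit.
Unset Printing Implicit Defensive.
Import Order.TTheory GRing.Theory Num.Theory.
Import numFieldNormedType.Exports.
Local Open Scope classical_set_scope.
Local Open Scope ring_scope.

(* A Hamiltonian on the line with [njct] junction points.  Only the values
   [jpoint a] and [limiter a] for 1 <= a <= njct, and [ham a] and [pmin a] for
   a <= njct are ever used; [pmin a] is meant to be a minimizer of [ham a]. *)
Record hamiltonian (R : realType) := Hamiltonian {
  njct : nat;
  jpoint : nat -> R;
  ham : nat -> R -> R;
  pmin : nat -> R;
  limiter : nat -> R -> R }.

(* Extended junction points: b_0 = -oo and b_{N+1} = +oo. *)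
Definition epoint (R : realType) (N : nat) (b : nat -> R) (a : nat) : \bar R :=
  if a == 0%N then -oo%E else if (a <= N)%N then (b a)%:E else +oo%E.

Definition edge_length (R : realType) (N : nat) (b : nat -> R) (a : nat)
  : \bar R := (epoint N b a.+1 - epoint N b a)%E.

Definition increasing_points (R : realType) (N : nat) (b : nat -> R) : Prop :=
  forall a, (1 <= a)%N -> (a < N)%N -> b a < b a.+1.

Definition Hminus (R : realType) (H : R -> R) (p0 p : R) : R :=
  if p < p0 then H p else H p0.

Definition Hplus (R : realType) (H : R -> R) (p0 p : R) : R :=
  if p <= p0 then H p0 else H p.

Definition quasi_convex (R : realType) (f : R -> R) : Prop :=
  forall c : R, convex_set ([set p | f p <= c] : set R^o).

Definition coercive (R : realType) (f : R -> R) : Prop :=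
  (f p @[p --> +oo] --> +oo) /\ (f p @[p --> -oo] --> +oo).

Definition admissible_hams (R : realType) (N : nat) (H : nat -> R -> R)
    (p0 : nat -> R) : Prop :=
  forall a, (a <= N)%N ->
    [/\ continuous (H a), coercive (H a), quasi_convex (H a) &
        forall p, H a (p0 a) <= H a p].

Definition time_grid (R : realType) (K : nat) (tau : nat -> R) : Prop :=
  [/\ tau 0%N = 0, tau K.+1 = 1 &
      forall i, (i <= K)%N -> tau i < tau i.+1].

(* [A k i] is the value of the periodic limiter [a k] on [tau_i, tau_{i+1}[; it
   is bounded below by the minima of the two neighbouring Hamiltonians. *)
Definition admissible_limiters (R : realType) (N : nat) (H : nat -> R -> R)
    (p0 : nat -> R) (K : nat) (tau : nat -> R) (A : nat -> nat -> R)
    (a : nat -> R -> R) : Prop :=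
  forall k, (1 <= k)%N -> (k <= N)%N ->
    (forall s, a k (s + 1) = a k s) /\
    (forall i, (i <= K)%N ->
       (forall s, tau i <= s < tau i.+1 -> a k s = A k i) /\
       Num.max (H k.-1 (p0 k.-1)) (H k (p0 k)) <= A k i).

Definition slab (R : realType) (T0 : R) (T1 : \bar R) : set (R * R) :=
  [set z | T0 <= z.1 /\ (z.1%:E < T1)%E].

Definition open_slab (R : realType) (T0 : R) (T1 : \bar R) : set (R * R) :=
  [set z | T0 < z.1 /\ (z.1%:E < T1)%E].

(* Semi-continuous envelopes of u restricted to D. *)
Definition usc_env (R : realType) (D : set (R * R)) (u : R * R -> R)
    (z : R * R) : \bar R :=
  limf_esup (EFin \o u) (within D (nbhs z)).

Definition lsc_env (R : realType) (D : set (R * R)) (u : R * R -> R)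
    (z : R * R) : \bar R :=
  limf_einf (EFin \o u) (within D (nbhs z)).

Definition closed_edge (R : realType) (h : hamiltonian R) (a : nat) : set R :=
  [set x | (epoint (njct h) (jpoint h) a <= x%:E)%E /\
           (x%:E <= epoint (njct h) (jpoint h) a.+1)%E].

(* phi is C^1 in the times of ]T0, T1[ and the points of the closed
   interval J; the x-derivative is one-sided at the endpoints of J. *)
Definition C1_up_to_boundary (R : realType) (T0 : R) (T1 : \bar R) (J : set R)
    (phi : R * R -> R) : Prop :=
  let D := open_slab T0 T1 `&` [set z | J z.2] in
  exists phit phix : R * R -> R,
    [/\ {within D, continuous phit}, {within D, continuous phix} &
        forall z, D z ->
          is_derive z.1 1 (fun s => phi (s, z.2)) (phit z) /\
          (d^-1 * (phi (z.1, z.2 + d) - phi z)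
             @[d --> within [set d | J (z.2 + d)] 0^'] --> phix z)].

Definition test_function (R : realType) (h : hamiltonian R) (T0 : R)
    (T1 : \bar R) (phi : R * R -> R) : Prop :=
  {within open_slab T0 T1, continuous phi} /\
  forall a, (a <= njct h)%N -> C1_up_to_boundary T0 T1 (closed_edge h a) phi.

Definition dt (R : realType) (phi : R * R -> R) (z : R * R) : R :=
  derive1 (fun s : R => phi (s, z.2)) z.1.

Definition dx (R : realType) (phi : R * R -> R) (z : R * R) : R :=
  derive1 (fun y : R => phi (z.1, y)) z.2.

Definition dx_left (R : realType) (phi : R * R -> R) (z : R * R) : R :=
  lim (d^-1 * (phi (z.1, z.2 + d) - phi z) @[d --> 0^'-]).

Definition dx_right (R : realType) (phi : R * R -> R) (z : R * R) : R :=
  lim (d^-1 * (phi (z.1, z.2 + d) - phi z) @[d --> 0^'+]).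

(* The value at z of phi_t + H(t, x, phi_x) satisfies P. *)
Definition equation_at (R : realType) (h : hamiltonian R) (P : R -> Prop)
    (phi : R * R -> R) (z : R * R) : Prop :=
  (forall a, (a <= njct h)%N ->
     (epoint (njct h) (jpoint h) a < z.2%:E)%E ->
     (z.2%:E < epoint (njct h) (jpoint h) a.+1)%E ->
     P (dt phi z + ham h a (dx phi z))) /\
  (forall a, (1 <= a)%N -> (a <= njct h)%N -> z.2 = jpoint h a ->
     P (dt phi z +
        Num.max (Hplus (ham h a.-1) (pmin h a.-1) (dx_left phi z))
          (Num.max (Hminus (ham h a) (pmin h a) (dx_right phi z))
             (limiter h a z.1)))).

(* Sub- and super-solutions of u_t + H(t, x, u_x) = lam on ]T0, T1[ x R. *)
Definition is_subsolution (R : realType) (h : hamiltonian R) (lam T0 : R)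
    (T1 : \bar R) (u : R * R -> R) : Prop :=
  forall phi z, test_function h T0 T1 phi -> open_slab T0 T1 z ->
    usc_env (slab T0 T1) u z = (phi z)%:E ->
    (\forall y \near z, (usc_env (slab T0 T1) u y <= (phi y)%:E)%E) ->
    equation_at h (fun v => v <= lam) phi z.

Definition is_supersolution (R : realType) (h : hamiltonian R) (lam T0 : R)
    (T1 : \bar R) (u : R * R -> R) : Prop :=
  forall phi z, test_function h T0 T1 phi -> open_slab T0 T1 z ->
    lsc_env (slab T0 T1) u z = (phi z)%:E ->
    (\forall y \near z, ((phi y)%:E <= lsc_env (slab T0 T1) u y)%E) ->
    equation_at h (fun v => lam <= v) phi z.

(* Solutions of the Cauchy problem on [T0, T1[ x R with initial datum g. *)
Definition cauchy_solution (R : realType) (h : hamiltonian R) (T0 : R)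
    (T1 : \bar R) (g : R -> R) (u : R * R -> R) : Prop :=
  [/\ is_subsolution h 0 T0 T1 u, is_supersolution h 0 T0 T1 u,
      (forall x, (usc_env (slab T0 T1) u (T0, x) <= (g x)%:E)%E) &
      (forall x, ((g x)%:E <= lsc_env (slab T0 T1) u (T0, x))%E)].

(* Solutions for epsilon = 1.  "Successively": on each time interval the
   initial datum is the value already reached by u. *)
Definition unit_solution (R : realType) (h : hamiltonian R) (K : nat)
    (tau : nat -> R) (g : R -> R) (u : R * R -> R) : Prop :=
  [/\ exists L : R, L.-lipschitz_(slab 0 +oo%E) u,
      (forall x, u (0, x) = g x) &
      forall k i : nat, (i <= K)%N ->
        cauchy_solution h (tau i + k%:R) (tau i.+1 + k%:R)%:E
          (fun x => u (tau i + k%:R, x)) u].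

(* The rescaling also turns u(0, x) = g(x) into the initial condition below. *)
Definition eps_solution (R : realType) (h : hamiltonian R) (K : nat)
    (tau : nat -> R) (eps : R) (g : R -> R) (u : R * R -> R) : Prop :=
  unit_solution h K tau (fun x => eps^-1 * g (eps * x))
    (fun z => eps^-1 * u (eps * z.1, eps * z.2)).

Definition subcorrector_levels (R : realType) (h : hamiltonian R) (K : nat)
    (tau : nat -> R) : set R :=
  [set lam | exists w : R * R -> R,
    [/\ exists L : R, L.-lipschitz w,
        (forall t x, w (t + 1, x) = w (t, x)) &
        forall (k : int) (i : nat), (i <= K)%N ->
          is_subsolution h lam (tau i + k%:~R) (tau i.+1 + k%:~R)%:E w]].

(* [inf] is the genuine infimum only when [has_inf] holds. *)
Definition effective_limiter (R : realType) (h : hamiltonian R) (K : nat)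
    (tau : nat -> R) : R :=
  inf (subcorrector_levels h K tau).

(* One junction at the origin, H_L on the left, H_R on the right, and the
   constant limiter A. *)
Definition limit_hamiltonian (R : realType) (h : hamiltonian R) (A : R)
  : hamiltonian R :=
  {| njct := 1;
     jpoint := fun=> 0;
     ham := fun a => if a == 0%N then ham h 0 else ham h (njct h);
     pmin := fun a => if a == 0%N then pmin h 0 else pmin h (njct h);
     limiter := fun _ _ => A |}.

Definition linear_growth (R : realType) (u : R * R -> R) : Prop :=
  forall T : R, exists C : R, forall t x : R,
    0 <= t <= T -> `|u (t, x)| <= C * (1 + `|x|).

Definition limit_solution (R : realType) (h : hamiltonian R) (A : R)
    (u0 : R -> R) (u : R * R -> R) : Prop :=
  cauchy_solution (limit_hamiltonian h A) 0 +oo%E u0 u /\ linear_growth u.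

Definition homogenizes_to (R : realType) (h : hamiltonian R) (K : nat)
    (tau : nat -> R) (A : R) : Prop :=
  forall (U : R -> R -> R) (u0 : R -> R) (u : R -> R * R -> R),
    (exists L : R, forall eps : R, 0 < eps -> L.-lipschitz (U eps)) ->
    {family compact, U eps @[eps --> 0^'+] --> u0} ->
    (forall eps : R, 0 < eps -> eps_solution h K tau eps (U eps) (u eps)) ->
    exists ulim : R * R -> R,
      [/\ limit_solution h A u0 ulim,
          (forall v, limit_solution h A u0 v ->
             forall t x : R, 0 <= t -> v (t, x) = ulim (t, x)) &
          {family (fun C => compact C /\ C `<=` slab 0 +oo%E),
             u eps @[eps --> 0^'+] --> ulim}].

Definition mean (R : realType) (f : R -> R) : R :=
  \int[lebesgue_measure]_(s in `[0, 1]) f s.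

Definition sup_norm (R : realType) (f : R -> R) : R :=
  sup (range (fun s => `|f s|)).

(* Maximum of f over {1, ..., N}, for N >= 1. *)
Definition max_over (R : realType) (N : nat) (f : nat -> R) : R :=
  \big[Num.max/f 1%N]_(1 <= k < N.+1) f k.

Definition min_edge_length (R : realType) (N : nat) (b : nat -> R) : \bar R :=
  \big[Order.min/+oo%E]_(0 <= k < N.+1) edge_length N b k.

(* Main.v *)
(* Everything rests on a comparison principle between a Lipschitz sub-solution and a
   lower semi-continuous super-solution: a regularization in time of the sub-solution
   is semi-differentiable enough to touch the super-solution from below at the junction
   by a function with a kink, and the flux-limited conditions of both sides at the kink
   contradict each other.
   Bounds on the effective limiter.  Along a junction a sub-corrector decreases at
   least at the rate given by the limiter, so its level is at least the mean of each
   limiter; explicit correctors (one profile in time plus a steep profile in space) give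
   upper bounds.  For long edges the junctions are decoupled by profiles that descend
   from one junction below the level of the next.  For short edges the running maximum
   in time of a corrector has slopes bounded independently of the corrector, hence the
   junctions move together.  A longer edge is filled by inserting a flat band.
   Homogenization.  The solution has finite speed and is Lipschitz up to an error of
   order epsilon, so its half-relaxed limits are Lipschitz.  At the origin, by a slope
   improvement on each side only kinks whose slopes are critical matter.  If the upper
   limit violated the junction condition, the supremum of the integer time translates
   of a localized sub-solution would be a sub-corrector below the effective level; if
   the lower limit did, a corrector glued to the solution would contradict comparison.
   Comparison for the limit problem identifies the two limits. *)
Require Import Defs.
From HB Require Import structures.
From mathcomp Require Import all_boot all_order all_algebra.
From mathcomp Require Import all_classical all_reals all_analysis.
From mathcomp Require Import ring lra.
Set Implicit Arguments.
Unset Strict Implicit.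
Unset Printing Implicit Defensive.
Import Order.TTheory GRing.Theory Num.Theory.
Import numFieldNormedType.Exports.
Local Open Scope classical_set_scope.
Local Open Scope ring_scope.

(* [lra] is very slow in large contexts. *)
Ltac lin := clear; lra.

(** * One-variable and two-variable calculus *)
Section Calculus.
Context {R : realType}.
Implicit Types (f g : R -> R) (u phi : R -> R -> R).

(** Doubling the space variable is ruled out, because the Hamiltonian is discontinuous across
    junctions. Comparison therefore regularizes in time only and asks the sub-solution to be
    Lipschitz in exchange. This asymmetry shapes what follows: a super-solution may be merely lower
    semi-continuous, whereas a semi-continuous sub-solution must first be replaced by a Lipschitz
    one above it. No equation holds at the grid times, where the limiters jump. Contact points are
    therefore pushed strictly backwards in time into a cell, after which the time slope is known
    only up to a bound from below; this is the direction that the arguments need. Both halves of the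
    junction condition at the origin work with sub-solutions of the cell problem only: no profile
    solving it with equality is ever built. *)

Definition cont1 f := forall x e, 0 < e ->
  exists2 r, 0 < r & forall y, `|y - x| < r -> `|f y - f x| < e.
Definition cont2 u := forall t x e, 0 < e -> exists2 r, 0 < r &
  forall s y, `|s - t| < r -> `|y - x| < r -> `|u s y - u t x| < e.
Definition der f x l := forall e, 0 < e -> exists2 r, 0 < r &
  forall y, `|y - x| < r -> `|f y - f x - l * (y - x)| <= e * `|y - x|.

Lemma cont1P f : cont1 f <-> continuous f.
Proof.
split=> h x.
  apply/cvgrPdist_lt => e e0; have [r r0 hr] := h x e e0.
  exists r => //= y /=; rewrite distrC => yx; rewrite distrC; exact: hr.
move=> e e0; have /cvgrPdist_lt/(_ e e0) [r /= r0 hr] := h x.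
by exists r => // y yx; rewrite distrC; apply: hr; rewrite /= distrC.
Qed.

Lemma near2P (P : R * R -> Prop) t x : (\forall z \near (t, x), P z) <->
  exists2 r, 0 < r & forall s y, `|s - t| < r -> `|y - x| < r -> P (s, y).
Proof.
split.
  move=> /nbhs_ballP [r /= r0 hr]; exists r => // s y h1 h2.
  by apply: hr; split => /=; rewrite /ball /= distrC.
move=> [r r0 hr]; apply/nbhs_ballP; exists r => //= -[s y] [/= h1 h2].
by apply: hr; rewrite distrC.
Qed.

Lemma cont2P u : cont2 u <-> continuous (fun z : R * R => u z.1 z.2).
Proof.
split=> h.
  move=> [t x]; apply/cvgrPdist_lt => e e0; apply/near2P.
  have [r r0 hr] := h t x e e0; exists r => // s y h1 h2 /=.
  by rewrite distrC; apply: hr.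
move=> t x e e0; have /cvgrPdist_lt/(_ e e0)/near2P [r r0 hr] := h (t, x).
by exists r => // s y h1 h2; rewrite distrC; exact: (hr s y).
Qed.

Lemma derP f x l : der f x l <-> is_derive x 1 f l.
Proof.
have E m : (h^-1 *: ((f \o shift x) (h *: 1) - f x) @[h --> 0^'] --> m) <-> der f x m.
  split.
    move=> /cvgrPdist_le H e e0; have [r /= r0 hr] := H e e0.
    exists r => // y yx; have [->|yNx] := eqVneq y x.
      by rewrite !subrr mulr0 subr0 normr0 mulr0.
    have yx0 : y - x != 0 by rewrite subr_eq0.
    have := hr (y - x); rewrite /= sub0r normrN => /(_ yx yx0).
    rewrite /= /GRing.scale /= mulr1 subrK => h.
    have -> : f y - f x - m * (y - x) =
      - ((m - (y - x)^-1 * (f y - f x)) * (y - x)) by field.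
    by rewrite normrN normrM ler_wpM2r.
  move=> H; apply/cvgrPdist_le => e e0; have [r r0 hr] := H e e0.
  exists r => //= h /=; rewrite sub0r normrN => hr' h0.
  have := hr (h + x); rewrite addrK => /(_ hr') {}hr.
  rewrite /= /GRing.scale /= mulr1.
  have -> : m - h^-1 * (f (h + x) - f x) = - (h^-1 * (f (h + x) - f x - m * h)) by field.
  rewrite normrN normrM normfV mulrC ler_pdivrMr ?normr_gt0//.
split.
  move=> /(E l) H; apply: DeriveDef; first by apply/cvg_ex; exists l.
  by apply: cvg_lim.
move=> [H <-]; apply: (E _).1; exact: H.
Qed.

Lemma der_cont f x l : der f x l -> forall e, 0 < e ->
  exists2 r, 0 < r & forall y, `|y - x| < r -> `|f y - f x| < e.
Proof.
move=> /derP [/derivable1_diffP/differentiable_continuous h _] e e0.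
have /cvgrPdist_lt/(_ e e0) [r /= r0 hr] := h.
by exists r => // y yx; rewrite distrC; apply: hr; rewrite /= distrC.
Qed.

Lemma der_cst c x : der (fun=> c) x 0.
Proof. by apply/derP; exact: is_derive_cst. Qed.
Lemma der_id x : der id x 1.
Proof. by apply/derP; exact: is_derive_id. Qed.
Lemma derD f g x l m : der f x l -> der g x m -> der (fun y => f y + g y) x (l + m).
Proof. by move=> /derP h1 /derP h2; apply/derP; exact: is_deriveD. Qed.
Lemma derZ c f x l : der f x l -> der (fun y => c * f y) x (c * l).
Proof. by move=> /derP h1; apply/derP; exact: is_deriveZ. Qed.
Lemma der_comp f g x l m : der f (g x) l -> der g x m ->
  der (fun y => f (g y)) x (l * m).
Proof. by move=> /derP h1 /derP h2; apply/derP; exact: is_derive1_comp. Qed.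
Lemma der_eq f x l m : der f x l -> l = m -> der f x m. Proof. by move=> ? <-. Qed.
Lemma der_ext f g x l : (forall y, f y = g y) -> der f x l -> der g x l.
Proof. by move=> /funext ->. Qed.

(** Derivatives travel as explicit functions, so that closure under sums and compositions computes
    the derivatives of the test functions built below. *)
Definition C1 f f' := cont1 f' /\ forall x, der f x (f' x).
Definition C1xy phi phit phix := [/\ cont2 phi, cont2 phit, cont2 phix,
  forall t x, der (fun s => phi s x) t (phit t x) &
  forall t x, der (phi t) x (phix t x)].

Lemma C1_cont f f' : C1 f f' -> cont1 f.
Proof. by move=> [_ h] x; exact: der_cont. Qed.

Lemma cont1D f g : cont1 f -> cont1 g -> cont1 (fun x => f x + g x).
Proof. by move=> /cont1P hf /cont1P hg; apply/cont1P => x; apply: cvgD; [exact: hf|exact: hg]. Qed.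
Lemma cont1M f g : cont1 f -> cont1 g -> cont1 (fun x => f x * g x).
Proof. by move=> /cont1P hf /cont1P hg; apply/cont1P => x; apply: cvgM; [exact: hf|exact: hg]. Qed.
Lemma cont1_cst c : cont1 (fun=> c).
Proof. by apply/cont1P => x; exact: cvg_cst. Qed.
Lemma cont1_id : cont1 id.
Proof. by apply/cont1P => x; exact: cvg_id. Qed.
Lemma cont1_comp f g : cont1 f -> cont1 g -> cont1 (fun x => f (g x)).
Proof.
move=> hf hg x e e0; have [r r0 hr] := hf (g x) e e0; have [q q0 hq] := hg x r r0.
by exists q => // y yx; apply: hr; apply: hq.
Qed.
Lemma cont2D u v : cont2 u -> cont2 v -> cont2 (fun t x => u t x + v t x).
Proof. by move=> /cont2P hf /cont2P hg; apply/cont2P => z; apply: cvgD; [exact: hf|exact: hg]. Qed.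
Lemma cont2M u v : cont2 u -> cont2 v -> cont2 (fun t x => u t x * v t x).
Proof. by move=> /cont2P hf /cont2P hg; apply/cont2P => z; apply: cvgM; [exact: hf|exact: hg]. Qed.
Lemma cont2_t f : cont1 f -> cont2 (fun t x => f t).
Proof. by move=> hf t x e e0; have [r r0 hr] := hf t e e0; exists r => // s y h _; exact: hr. Qed.
Lemma cont2_x f : cont1 f -> cont2 (fun t x => f x).
Proof. by move=> hf t x e e0; have [r r0 hr] := hf x e e0; exists r => // s y _ h; exact: hr. Qed.
Lemma cont2_comp u f g : cont2 u -> cont1 f -> cont1 g -> cont2 (fun t x => u (f t) (g x)).
Proof.
move=> hu hf hg t x e e0; have [r r0 hr] := hu (f t) (g x) e e0.
have [q q0 hq] := hf t r r0; have [p p0 hp] := hg x r r0.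
exists (Num.min p q); first by rewrite lt_min p0 q0.
by move=> s y; rewrite !lt_min => /andP[h1 h2] /andP[h3 h4]; apply: hr; [exact: hq|exact: hp].
Qed.

Lemma C1D f f' g g' : C1 f f' -> C1 g g' -> C1 (fun x => f x + g x) (fun x => f' x + g' x).
Proof. by move=> [h1 h2] [h3 h4]; split; [exact: cont1D|move=> x; exact: derD]. Qed.
Lemma C1Z c f f' : C1 f f' -> C1 (fun x => c * f x) (fun x => c * f' x).
Proof. by move=> [h1 h2]; split; [apply: cont1M => //; exact: cont1_cst|move=> x; exact: derZ]. Qed.
Lemma C1_cst c : C1 (fun=> c) (fun=> 0).
Proof. by split; [exact: cont1_cst|move=> x; exact: der_cst]. Qed.
Lemma C1_id : C1 id (fun=> 1).
Proof. by split; [exact: cont1_cst|move=> x; exact: der_id]. Qed.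
Lemma C1_comp f f' g g' : C1 f f' -> C1 g g' -> C1 (fun x => f (g x)) (fun x => f' (g x) * g' x).
Proof.
move=> hf hg; split; last by move=> x; apply: der_comp; [exact: hf.2|exact: hg.2].
apply: cont1M hg.1; apply: cont1_comp (C1_cont hg); exact: hf.1.
Qed.
Lemma C1_aff a b : C1 (fun x => a * x + b) (fun=> a).
Proof.
have := C1D (C1Z a C1_id) (C1_cst b) => /=.
by have -> : (fun=> a * 1 + 0) = (fun=> a) :> (R -> R) by apply/funext => x; ring.
Qed.
Lemma C1_eq f f' g g' : C1 f f' -> (forall x, f x = g x) -> (forall x, f' x = g' x) -> C1 g g'.
Proof. by move=> h /funext <- /funext <-. Qed.

Lemma C1xyD phi phit phix psi psit psix : C1xy phi phit phix -> C1xy psi psit psix ->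
  C1xy (fun t x => phi t x + psi t x) (fun t x => phit t x + psit t x)
       (fun t x => phix t x + psix t x).
Proof.
move=> [a1 a2 a3 a4 a5] [b1 b2 b3 b4 b5].
by split; [exact: cont2D..|move=> t x; exact: derD|move=> t x; exact: derD].
Qed.
Lemma C1xyZ c phi phit phix : C1xy phi phit phix ->
  C1xy (fun t x => c * phi t x) (fun t x => c * phit t x) (fun t x => c * phix t x).
Proof.
have cc : cont2 (fun _ _ => c) by apply: cont2_t; exact: cont1_cst.
move=> [a1 a2 a3 a4 a5].
by split; [exact: cont2M..|move=> t x; exact: derZ|move=> t x; exact: derZ].
Qed.
Lemma C1xy_t f f' : C1 f f' -> C1xy (fun t _ => f t) (fun t _ => f' t) (fun _ _ => 0).
Proof.
move=> h; split; [exact/cont2_t/(C1_cont h)|exact/cont2_t/h.1|exact/cont2_t/cont1_cst| |].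
  by move=> t x; exact: h.2.
by move=> t x; exact: der_cst.
Qed.
Lemma C1xy_x f f' : C1 f f' -> C1xy (fun _ x => f x) (fun _ _ => 0) (fun _ x => f' x).
Proof.
move=> h; split; [exact/cont2_x/(C1_cont h)|exact/cont2_t/cont1_cst|exact/cont2_x/h.1| |].
  by move=> t x; exact: der_cst.
by move=> t x; exact: h.2.
Qed.
Lemma C1xy_comp phi phit phix f f' g g' : C1xy phi phit phix -> C1 f f' -> C1 g g' ->
  C1xy (fun t x => phi (f t) (g x)) (fun t x => phit (f t) (g x) * f' t)
    (fun t x => phix (f t) (g x) * g' x).
Proof.
move=> [a1 a2 a3 a4 a5] hf hg; have cf := C1_cont hf; have cg := C1_cont hg.
split.
- exact: cont2_comp.
- by apply: cont2M; [exact: cont2_comp|apply: cont2_t; exact: hf.1].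
- by apply: cont2M; [exact: cont2_comp|apply: cont2_x; exact: hg.1].
- by move=> t x; exact: (der_comp (a4 (f t) (g x)) (hf.2 t)).
- by move=> t x; exact: (der_comp (a5 (f t) (g x)) (hg.2 x)).
Qed.
Lemma C1xy_eq phi phit phix psi psit psix : C1xy phi phit phix ->
  (forall t x, phi t x = psi t x) -> (forall t x, phit t x = psit t x) ->
  (forall t x, phix t x = psix t x) -> C1xy psi psit psix.
Proof.
move=> h e1 e2 e3.
have -> : psi = phi by apply/funext => t; apply/funext => x.
have -> : psit = phit by apply/funext => t; apply/funext => x.
by have -> : psix = phix by apply/funext => t; apply/funext => x.
Qed.
Lemma cont2_ridge f c : cont1 f -> cont2 (fun t x => f (x + c * t)).
Proof.
move=> hf t x e e0; have [r r0 hr] := hf (x + c * t) e e0.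
have k0 : 0 < 1 + `|c| by rewrite ltr_pwDl.
exists (r / (1 + `|c|)); first exact: divr_gt0.
move=> s y h1 h2; apply: hr.
have -> : y + c * s - (x + c * t) = (y - x) + c * (s - t) by ring.
apply: le_lt_trans (ler_normD _ _) _; rewrite normrM.
have {1}-> : r = r / (1 + `|c|) + `|c| * (r / (1 + `|c|)) by field; lra.
by apply: ltr_leD => //; rewrite ler_wpM2l// ltW.
Qed.
Lemma C1xy_ridge f f' c : C1 f f' ->
  C1xy (fun t x => f (x + c * t)) (fun t x => c * f' (x + c * t)) (fun t x => f' (x + c * t)).
Proof.
move=> h; split.
- exact/cont2_ridge/(C1_cont h).
- by apply: cont2M; [exact/cont2_t/cont1_cst|exact/cont2_ridge/h.1].
- exact/cont2_ridge/h.1.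
- move=> t x; rewrite mulrC; apply: (der_comp (g := fun s => x + c * s)); first exact: h.2.
  by have [_ /(_ t)] := C1_aff c x; apply: der_ext => y; rewrite addrC.
- move=> t x; rewrite -[f' _]mulr1.
  apply: (der_comp (g := fun y => y + c * t)); first exact: h.2.
  have [_ /(_ x)] := C1_aff 1 (c * t); apply: der_ext => y; by rewrite mul1r.
Qed.

Definition pos (y : R) : R := Num.max y 0.
Definition psq (y : R) : R := pos y ^+ 2.
Lemma pos_ge0 y : 0 <= pos y. Proof. by rewrite /pos le_max lexx orbT. Qed.
Lemma pos_ge y : y <= pos y. Proof. by rewrite /pos le_max lexx. Qed.
Lemma pos_id y : 0 <= y -> pos y = y. Proof. by move=> h; rewrite /pos; apply/max_idPl. Qed.
Lemma pos_le0 y : y <= 0 -> pos y = 0. Proof. by move=> h; rewrite /pos; apply/max_idPr. Qed.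
Lemma posP y : (0 <= y /\ pos y = y) \/ (y <= 0 /\ pos y = 0).
Proof.
case: (leP 0 y) => h; first by left; split => //; exact: pos_id.
by right; split; [exact: ltW|exact/pos_le0/ltW].
Qed.
Lemma pos_lip x y : `|pos x - pos y| <= `|x - y|.
Proof.
apply/ler_normlP; have /ler_normlP[h1 h2] := lexx `|x - y|.
by case: (posP x) => -[? ->]; case: (posP y) => -[? ->]; split; lra.
Qed.
Lemma cont1_lip f K : (forall x y, `|f x - f y| <= K * `|x - y|) -> cont1 f.
Proof.
move=> h x e e0; have k0 : 0 < 1 + `|K| by rewrite ltr_pwDl.
exists (e / (1 + `|K|)); first exact: divr_gt0.
move=> y yx; apply: le_lt_trans (h _ _) _.
have : `|y - x| * (1 + `|K|) < e by rewrite -ltr_pdivlMr.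
have := ler_norm K; have := normr_ge0 (y - x); have := normr_ge0 K; nra.
Qed.
Lemma cont1_pos : cont1 pos.
Proof. by apply: (@cont1_lip _ 1) => x y; rewrite mul1r; exact: pos_lip. Qed.
Lemma psq_quad x y : `|psq y - psq x - 2 * pos x * (y - x)| <= `|y - x| ^+ 2.
Proof.
rewrite real_normK ?num_real// /psq; apply/ler_normlP.
have h := sqr_ge0 (y - x); have h1 := sqr_ge0 x; have h2 := sqr_ge0 y.
by case: (posP x) => -[? ->]; case: (posP y) => -[? ->]; split; nra.
Qed.
Lemma C1_psq : C1 psq (fun y => 2 * pos y).
Proof.
split; first by apply: cont1M cont1_pos; exact: cont1_cst.
move=> x e e0; exists e => // y yx.
have := psq_quad x y.
by have := normr_ge0 (y - x); nra.
Qed.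

Lemma C1_sqr : C1 (fun y : R => y ^+ 2) (fun y => 2 * y).
Proof.
split; first by apply: cont1M; [exact: cont1_cst|exact: cont1_id].
move=> x; apply/derP; apply: is_derive_eq; rewrite /GRing.scale /=; ring.
Qed.
Lemma C1_quad k s : C1 (fun y : R => k * (y - s) ^+ 2) (fun y => 2 * k * (y - s)).
Proof.
have := C1Z k (C1_comp C1_sqr (C1_aff 1 (- s))) => h.
by apply: (C1_eq h) => y; rewrite mul1r//; ring.
Qed.

(* Huber's function: [y^2 / (2 d)] for [|y| <= d], [|y| - d / 2] beyond. *)
Definition hub d y := (y ^+ 2 - psq (y - d) - psq (- y - d)) / (2 * d).
Definition hub' d y := (y - pos (y - d) + pos (- y - d)) / d.
Lemma C1_hub d : 0 < d -> C1 (hub d) (hub' d).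
Proof.
move=> d0.
have a1 := C1_comp C1_psq (C1_aff 1 (- d)); have a2 := C1_comp C1_psq (C1_aff (- 1) (- d)).
have := C1Z ((2 * d)^-1) (C1D (C1D C1_sqr (C1Z (- 1) a1)) (C1Z (- 1) a2)).
move=> h; apply: (C1_eq h) => x; rewrite /hub /hub' ?mul1r ?mulN1r; first by ring.
by field; lra.
Qed.
Lemma hub_bnd d y : 0 < d -> 0 <= hub d y /\ `|y| - d / 2 <= hub d y <= `|y|.
Proof.
move=> d0; have d2 : 0 < 2 * d by lra.
rewrite /hub; set X := y ^+ 2 - _ - _.
have [X0 X1 X2] : [/\ 0 <= X, `|y| * (2 * d) - d ^+ 2 <= X & X <= `|y| * (2 * d)].
  rewrite /X /psq; have [y0|y0] := leP 0 y; rewrite ?(ger0_norm y0) ?(ltr0_norm y0);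
  case: (posP (y - d)) => -[? ->]; case: (posP (- y - d)) => -[? ->]; split; nra.
split; first by apply: divr_ge0 => //; lra.
rewrite ler_pdivlMr// ler_pdivrMr//; apply/andP; split => //.
by have -> : (`|y| - d / 2) * (2 * d) = `|y| * (2 * d) - d ^+ 2 by field.
Qed.
Lemma hub0 d : 0 < d -> hub d 0 = 0.
Proof. by move=> d0; have [h1] := hub_bnd 0 d0; rewrite normr0 => /andP[_ h2]; lra. Qed.
Lemma hub'_bnd d y : 0 < d -> - 1 <= hub' d y <= 1.
Proof.
move=> d0; rewrite /hub' ler_pdivlMr// ler_pdivrMr//.
by case: (posP (y - d)) => -[? ->]; case: (posP (- y - d)) => -[? ->]; apply/andP; split; lra.
Qed.

(* A C1 cut-off of the identity: equal to it on [-r, r], with values in [-2r, 2r]. *)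
Definition clip r y := y - (psq (y - r) - psq (y - 2 * r)) / (2 * r)
  + (psq (- y - r) - psq (- y - 2 * r)) / (2 * r).
Lemma C1_clip r : 0 < r -> exists2 k, C1 (clip r) k & forall y, `|y| <= r -> k y = 1.
Proof.
move=> r0; exists (fun y => 1 - (2 * pos (y - r) - 2 * pos (y - 2 * r)) / (2 * r)
  - (2 * pos (- y - r) - 2 * pos (- y - 2 * r)) / (2 * r)).
  have a1 := C1_comp C1_psq (C1_aff 1 (- r)); have a2 := C1_comp C1_psq (C1_aff (- 1) (- r)).
  have a3 := C1_comp C1_psq (C1_aff 1 (- (2 * r))); have a4 := C1_comp C1_psq (C1_aff (- 1) (- (2 * r))).
  have := C1D C1_id (C1Z ((2 * r)^-1) (C1D (C1D (C1Z (- 1) a1) a3) (C1D a2 (C1Z (- 1) a4)))).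
  by move=> h; apply: (C1_eq h) => x; rewrite /clip ?mul1r ?mulN1r /=; field; lra.
by move=> y /ler_normlP[h1 h2]; rewrite !pos_le0; [field|..]; lra.
Qed.
Lemma clipE r y : 0 < r -> `|y| <= r -> clip r y = y.
Proof. by move=> r0 /ler_normlP[h1 h2]; rewrite /clip /psq !pos_le0; [field|..]; lra. Qed.
Lemma clip_bnd r y : 0 < r -> `|clip r y| <= 2 * r.
Proof.
move=> r0; have r2 : 0 < 2 * r by lra.
have -> : clip r y = (y * (2 * r) - (psq (y - r) - psq (y - 2 * r)) + (psq (- y - r) - psq (- y - 2 * r))) / (2 * r).
  by rewrite /clip; field; lra.
rewrite normrM normfV (gtr0_norm r2) ler_pdivrMr// /psq; apply/ler_normlP.
case: (posP (y - r)) => -[? ->]; case: (posP (- y - r)) => -[? ->];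
case: (posP (y - 2 * r)) => -[? ->]; case: (posP (- y - 2 * r)) => -[? ->];
split; nra.
Qed.

(** Compactness enters twice as a covering property: first large constants bound [f] from above;
    then, if the supremum were not attained, [f] would stay below it by a uniform margin. *)
Lemma usc_max {T : topologicalType} (A : set T) (f : T -> R) : compact A -> A !=set0 ->
  (forall z, A z -> forall e, 0 < e -> \forall y \near z, A y -> f y < f z + e) ->
  exists2 z, A z & forall y, A y -> f y <= f z.
Proof.
move=> cA [a0 Aa0] usc.
have ncA : near_covering_within A by apply/near_covering_withinP/compact_near_coveringP.
have bd : has_ubound (f @` A).
  have /= := ncA R (+oo%R : set_system R) (fun c z => f z <= c) _.
  case.
    move=> z Az; have h := usc z Az 1 ltr01.
    exists ([set y | A y -> f y < f z + 1], [set c | f z + 1 <= c]) => /=.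
      by split => //; apply: nbhs_pinfty_ge; exact: num_real.
    by move=> [y c] /= [h1 h2] /h1 h3; exact: le_trans (ltW h3) h2.
  move=> M [_ hM]; exists (M + 1) => _ [y Ay <-].
  by apply: (hM (M + 1)) => //; rewrite ltrDl.
pose M := sup (f @` A).
have sM : has_sup (f @` A) by split => //; exists (f a0), a0.
apply: contrapT => nomax.
have lt : forall z, A z -> f z < M.
  move=> z Az; rewrite ltNge; apply/negP => Mz; apply: nomax; exists z => // y Ay.
  by apply: le_trans Mz; apply: ub_le_sup => //; exists y.
have /= := ncA R (0^'+ : set_system R) (fun c z => f z <= M - c) _.
case.
  move=> z Az; have e0 : 0 < (M - f z) / 2 by have := lt z Az; lra.
  have h := usc z Az _ e0.
  exists ([set y | A y -> f y < f z + (M - f z) / 2], [set c | c <= (M - f z) / 2]) => /=.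
    by split => //; exact: nbhs_right_le.
  by move=> [y c] /= [h1 h2] /h1 h3; lra.
move=> r /= r0 hr.
have r2 : 0 < r / 2 by lra.
have hr2 : A `<=` (fun z => f z <= M - r / 2).
  apply: hr => //.
  by rewrite /= sub0r normrN gtr0_norm//; lra.
have [_ [y Ay <-]] := sup_adherent r2 sM.
have := hr2 y Ay; rewrite /M; lra.
Qed.

Lemma max2 (u : R -> R -> R) a b c d : a <= b -> c <= d ->
  (forall t x, a <= t <= b -> c <= x <= d -> forall e, 0 < e -> exists2 r, 0 < r &
    forall s y, a <= s <= b -> c <= y <= d -> `|s - t| < r -> `|y - x| < r -> u s y < u t x + e) ->
  exists t x, [/\ a <= t <= b, c <= x <= d &
    forall s y, a <= s <= b -> c <= y <= d -> u s y <= u t x].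
Proof.
move=> ab cd usc.
have [||z|[t x] /= [ht hx] hm] := @usc_max _ ([set` `[a, b]] `*` [set` `[c, d]]) (fun z => u z.1 z.2).
- by apply: compact_setX; exact: segment_compact.
- by exists (a, c); split; rewrite /= in_itv /= ?lexx.
- case: z => t x [/= ht hx] e e0; apply/near2P.
  rewrite !in_itv /= in ht hx.
  have [r r0 hr] := usc t x ht hx e e0; exists r => // s y hs hy [/= h1 h2].
  by apply: hr.
- exists t, x; split; [by move: ht; rewrite in_itv|by move: hx; rewrite in_itv|].
  by move=> s y hs hy; apply: (hm (s, y)); split; rewrite /= in_itv.
Qed.

Lemma max1 f a b : a <= b ->
  (forall x, a <= x <= b -> forall e, 0 < e -> exists2 r, 0 < r &
    forall y, a <= y <= b -> `|y - x| < r -> f y < f x + e) ->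
  exists2 x, a <= x <= b & forall y, a <= y <= b -> f y <= f x.
Proof.
move=> ab usc; have [//|//|t x _ hx e e0|t [x [_ hx hm]]] := @max2 (fun _ => f) a b a b.
  by have [r r0 hr] := usc x hx e e0; exists r => // s y _ ? _; exact: hr.
by exists x => // y hy; apply: (hm x y).
Qed.

End Calculus.

(** * Quasi-convex Hamiltonians *)
Section Hams.
Context {R : realType}.
Implicit Types (H : R -> R) (p q c : R).

(** Compactness in the form used below: local thresholds on the parameter give a uniform one. *)
Lemma cover1 (a b : R) (P : R -> R -> Prop) :
  (forall x, a <= x <= b -> exists2 r, 0 < r &
     forall y d, `|y - x| < r -> 0 < d -> d < r -> P d y) ->
  exists2 d0, 0 < d0 & forall y d, a <= y <= b -> 0 < d -> d < d0 -> P d y.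
Proof.
move=> h; have := @segment_compact R a b.
move=> /compact_near_coveringP/near_covering_withinP/(_ R 0^'+ P _) [].
  move=> x; rewrite /= in_itv /= => /h [r r0 hr].
  exists ([set y | `|y - x| < r], [set d | 0 < d < r]) => /=.
    split; first by apply/nbhs_ballP; exists r => //= y; rewrite /ball /= distrC.
    by exists r => //= y /=; rewrite sub0r normrN => + y0; rewrite gtr0_norm// y0.
  by move=> [y d] /= [h1 /andP[h2 h3]] _; exact: hr.
move=> r /= r0 hr; exists r => // y d hy d0 dr.
by apply: (hr d); rewrite //= ?in_itv//= sub0r normrN gtr0_norm.
Qed.

Lemma cover2 (a b c d : R) (P : R -> R -> R -> Prop) :
  (forall t x, a <= t <= b -> c <= x <= d -> exists2 r, 0 < r &
     forall s y e, `|s - t| < r -> `|y - x| < r -> 0 < e -> e < r -> P e s y) ->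
  exists2 e0, 0 < e0 & forall s y e, a <= s <= b -> c <= y <= d -> 0 < e -> e < e0 -> P e s y.
Proof.
move=> h; have := compact_setX (@segment_compact R a b) (@segment_compact R c d).
move=> /compact_near_coveringP/near_covering_withinP/(_ R 0^'+ (fun e z => P e z.1 z.2) _) [].
  move=> [t x] [/= ]; rewrite !in_itv /= => ht hx; have [r r0 hr] := h t x ht hx.
  exists ([set z | `|z.1 - t| < r /\ `|z.2 - x| < r], [set d | 0 < d < r]) => /=.
    split; first by apply/near2P; exists r.
    by exists r => //= y /=; rewrite sub0r normrN => + y0; rewrite gtr0_norm// y0.
  by move=> [[s y] e] /= [[h1 h1'] /andP[h2 h3]] _; exact: hr.
move=> r /= r0 hr; exists r => // s y e hs hy e0 er.
by apply: (hr e _ _ (s, y)); rewrite //= ?in_itv//= sub0r normrN gtr0_norm.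
Qed.

Lemma cont1_bounded (f : R -> R) (a b : R) : cont1 f ->
  exists2 M, 0 < M & forall x, a <= x <= b -> `|f x| <= M.
Proof.
move=> cf; have [|d d0 hd] := @cover1 a b (fun d x => `|f x| <= d^-1).
  move=> x _; have [r r0 hr] := cf x 1 ltr01.
  exists (Num.min r (1 + `|f x|)^-1).
    by rewrite lt_min r0 invr_gt0 ltr_pwDl.
  move=> y d; rewrite !lt_min => /andP[yx _] d0 /andP[dr].
  rewrite -[X in X < _]invrK ltf_pV2 ?posrE ?invr_gt0 ?ltr_pwDl// => dd.
  apply: ltW (le_lt_trans _ dd); have := hr y yx.
  have := ler_normD (f y - f x) (f x); rewrite subrK; lra.
exists (d / 2)^-1; first by rewrite invr_gt0; lra.
by move=> x hx; apply: hd => //; lra.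
Qed.

(** Stands in for a Lipschitz constant, which a continuous Hamiltonian need not have: pairs at
    distance at most [d / 2] differ by at most [e], and for the others the bound [2 * M] on the
    difference is absorbed by a large [c]. *)
Lemma cont1_modulus (f : R -> R) (B e : R) : cont1 f -> 0 < e ->
  exists2 c, 0 < c & forall p q, `|p| <= B -> `|q| <= B -> `|f p - f q| <= e + c * `|p - q|.
Proof.
move=> cf e0.
have [|d d0 hd] := @cover1 (- B) B (fun d x => forall y, `|y - x| <= d -> `|f x - f y| <= e).
  move=> x _; have [//|r r0 hr] := cf x (e / 2); first by lra.
  exists (r / 2); first lra.
  move=> y d yx d0 dr z zy; have h1 := hr y; have h2 := hr z.
  have := ler_normD (z - y) (y - x); rewrite addrA subrK => h3.
  have := ler_distD (f x) (f y) (f z); rewrite (distrC (f x) (f z)).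
  have : `|y - x| < r by lra.
  move=> /h1; have : `|z - x| < r by lra.
  by move=> /h2; lra.
have [M M0 hM] := cont1_bounded (- B) B cf.
exists (2 * M / (d / 2)); first by apply: divr_gt0; lra.
move=> p q pB qB; have bp : - B <= p <= B by rewrite -ler_norml.
have bq : - B <= q <= B by rewrite -ler_norml.
have [h|h] := leP `|q - p| (d / 2).
  have := hd p (d / 2) bp; rewrite distrC in h.
  have : 0 <= 2 * M / (d / 2) * `|p - q| by rewrite mulr_ge0// divr_ge0; lra.
  move=> h1 h2; have : `|f p - f q| <= e by apply: h2; rewrite ?(distrC q p)//; lra.
  lra.
have h1 := hM p bp; have h2 := hM q bq; have := ler_normB (f p) (f q).
have : 2 * M <= 2 * M / (d / 2) * `|p - q|.
  rewrite mulrAC ler_pdivlMr; last lra.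
  by rewrite ler_pM2l ?(distrC p q); lra.
lra.
Qed.

Lemma cont1_ivt (f : R -> R) (a b v : R) : cont1 f -> a <= b ->
  (f a <= v <= f b) || (f b <= v <= f a) -> exists2 c, a <= c <= b & f c = v.
Proof.
move=> /cont1P cf ab hv.
have [||c] := @IVT R f a b v ab; last by rewrite in_itv => ? ?; exists c.
  by apply: continuous_subspaceT => x; exact: cf.
case/orP: hv => /andP[h1 h2]; first by rewrite ge_min h1/= le_max h2 orbT.
by rewrite ge_min h1 orbT /= le_max h2.
Qed.

Definition goodH H p0 := [/\ continuous H, coercive H, quasi_convex H & forall p, H p0 <= H p].

Lemma goodH_cont H p0 : goodH H p0 -> cont1 H.
Proof. by case=> h _ _ _; apply/cont1P. Qed.

Lemma goodH_qc H p0 p q c y : goodH H p0 -> H p <= c -> H q <= c -> p <= y <= q -> H y <= c.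
Proof.
move=> [_ _ qc _] hp hq /andP[py yq].
have [pq|pq] := eqVneq p q.
  by have -> : y = p by apply/eqP; rewrite eq_le py pq yq.
have dpq : 0 < q - p by rewrite subr_gt0 lt_neqAle pq (le_trans py yq).
have l0 : 0 <= (q - y) / (q - p) by apply: divr_ge0; lra.
have l1 : (q - y) / (q - p) <= 1 by rewrite ler_pdivrMr//; lra.
have := qc c p q (Itv01 l0 l1); rewrite !inE /= => /(_ hp hq).
set z := conv _ _ _; suff -> : z = y by [].
have -> : z = ((q - y) / (q - p)) * p + (1 - (q - y) / (q - p)) * q by [].
by field; rewrite subr_eq0 eq_sym.
Qed.

Lemma goodH_min H p0 p : goodH H p0 -> H p0 <= H p. Proof. by case. Qed.
Lemma goodH_ninc H p0 p q : goodH H p0 -> p <= q -> q <= p0 -> H q <= H p.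
Proof.
move=> h pq qp; apply: (@goodH_qc H p0 p p0 _ q h) => //; first exact: goodH_min.
by rewrite pq.
Qed.
Lemma goodH_ndec H p0 p q : goodH H p0 -> p0 <= p -> p <= q -> H p <= H q.
Proof.
move=> h pq qp; apply: (@goodH_qc H p0 p0 q _ p h) => //; first exact: goodH_min.
by rewrite pq.
Qed.

Lemma goodH_refl H p0 : goodH H p0 -> goodH (fun p => H (- p)) (- p0).
Proof.
move=> h; split.
- apply/cont1P; apply: cont1_comp; first exact: goodH_cont h.
  by apply: (@cont1_lip _ _ 1) => x y; rewrite mul1r -opprD normrN.
- case: h => _ [h1 h2] _ _; split; apply/cvgryPgt => c.
    have /cvgryPgt/(_ c) [b [_ hb]] := h2; exists (- b); split; first exact: num_real.
    by move=> p bp /=; apply: hb; lra.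
  have /cvgryPgt/(_ c) [b [_ hb]] := h1; exists (- b); split; first exact: num_real.
  by move=> p bp /=; apply: hb; lra.
- move=> c; case: (h) => _ _ qc _ p q l; rewrite !inE /= => hp hq.
  have := qc c (- p) (- q) l; rewrite !inE /= => /(_ hp hq).
  set a := conv _ _ _; set b := conv _ _ _.
  have -> : a = l%:num *: - p + (1 - l%:num) *: - q by [].
  have -> : b = l%:num *: p + (1 - l%:num) *: q by [].
  by rewrite /GRing.scale /= opprD !mulrN.
- by move=> p; rewrite opprK; case: h.
Qed.

Lemma HminusE H p0 p : Hminus H p0 p = H (Num.min p p0).
Proof. by rewrite /Hminus; case: ltP => // h. Qed.
Lemma HplusE H p0 p : Hplus H p0 p = H (Num.max p p0).
Proof. by rewrite /Hplus; case: leP. Qed.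
Lemma Hplus_refl H p0 p : Hplus H p0 p = Hminus (fun q => H (- q)) (- p0) (- p).
Proof. by rewrite HplusE HminusE -oppr_max opprK. Qed.

Lemma cont1_Hminus H p0 : goodH H p0 -> cont1 (Hminus H p0).
Proof.
move=> h; have -> : Hminus H p0 = fun p => H (Num.min p p0) by apply/funext => p; exact: HminusE.
apply: cont1_comp; first exact: goodH_cont h.
apply: (@cont1_lip _ _ 1) => x y; rewrite mul1r.
apply/ler_normlP; have /ler_normlP[h1 h2] := lexx `|x - y|.
by case: (leP x p0); case: (leP y p0); split; lra.
Qed.
Lemma cont1_Hplus H p0 : goodH H p0 -> cont1 (Hplus H p0).
Proof.
move=> h; have -> : Hplus H p0 = fun p => H (Num.max p p0) by apply/funext => p; exact: HplusE.
apply: cont1_comp; first exact: goodH_cont h.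
apply: (@cont1_lip _ _ 1) => x y; rewrite mul1r.
apply/ler_normlP; have /ler_normlP[h1 h2] := lexx `|x - y|.
by case: (leP x p0); case: (leP y p0); split; lra.
Qed.
Lemma Hminus_ninc H p0 p q : goodH H p0 -> p <= q -> Hminus H p0 q <= Hminus H p0 p.
Proof.
move=> h pq; rewrite !HminusE; apply: (goodH_ninc h); last by rewrite ge_min lexx orbT.
by rewrite le_min !ge_min pq lexx orbT.
Qed.
Lemma Hplus_ndec H p0 p q : goodH H p0 -> p <= q -> Hplus H p0 p <= Hplus H p0 q.
Proof.
move=> h pq; rewrite !HplusE; apply: (goodH_ndec h); first by rewrite le_max lexx orbT.
by rewrite ge_max !le_max pq lexx orbT.
Qed.
Lemma Hminus_ge H p0 p : goodH H p0 -> H p0 <= Hminus H p0 p.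
Proof. by rewrite HminusE; case. Qed.
Lemma Hminus_le H p0 p : goodH H p0 -> Hminus H p0 p <= H p.
Proof. by rewrite HminusE => h; case: (leP p p0) => // _; case: h. Qed.
Lemma Hplus_le H p0 p : goodH H p0 -> Hplus H p0 p <= H p.
Proof. by rewrite HplusE => h; case: (leP p p0) => // _; case: h. Qed.
Lemma Hminus_l H p0 p : p <= p0 -> Hminus H p0 p = H p.
Proof. by rewrite HminusE => /min_idPl ->. Qed.
Lemma Hplus_r H p0 p : p0 <= p -> Hplus H p0 p = H p.
Proof. by rewrite HplusE => /max_idPl ->. Qed.
Lemma Hminus_r H p0 p : p0 <= p -> Hminus H p0 p = H p0.
Proof. by rewrite HminusE => /min_idPr ->. Qed.

Lemma goodH_coer H p0 c : goodH H p0 -> exists2 B, 0 < B & forall p, B <= `|p| -> c < H p.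
Proof.
move=> [_ [h1 h2] _ _].
have /cvgryPgt/(_ c) [a [_ ha]] := h1; have /cvgryPgt/(_ c) [b [_ hb]] := h2.
exists (1 + `|a| + `|b|); first by have := normr_ge0 a; have := normr_ge0 b; lra.
move=> p; have := ler_norm a; have := ler_norm (- b); rewrite normrN.
have := normr_ge0 a; have := normr_ge0 b.
have [p0'|p0'] := leP 0 p; rewrite ?(ger0_norm p0') ?(ltr0_norm p0') => *.
  by apply: ha; lra.
by apply: hb; lra.
Qed.

Lemma goodH_root_lt H p0 c : goodH H p0 -> H p0 < c ->
  exists p, [/\ p < p0, H p = c & forall q, q <= p -> c <= H q].
Proof.
move=> h hc; have [B B0 hB] := goodH_coer c h.
have lB : - (B + `|p0|) <= p0 by have := ler_norm (- p0); rewrite normrN; lra.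
have [|p /andP[p1 p2] hp] := cont1_ivt (v := c) (goodH_cont h) lB.
  apply/orP; right; rewrite (ltW hc) /=; apply/ltW/hB; rewrite normrN ger0_norm; by have := normr_ge0 p0; lra.
exists p; split => //.
  rewrite lt_neqAle p2 andbT; apply: contraTneq hc => <-; by rewrite hp ltxx.
by move=> q qp; rewrite -hp; apply: (goodH_ninc h).
Qed.

(** Below the minimum there is no root and the minimizer is returned instead; hence the maximum in
    the bound, which at a junction is dominated by the limiter. *)
Lemma goodH_root H p0 c : goodH H p0 -> exists p, [/\ p <= p0,
  Hminus H p0 p <= Num.max c (H p0) & forall q, q <= p -> c <= H q].
Proof.
move=> h; have [hc|hc] := leP c (H p0).
  exists p0; split; rewrite ?Hminus_l//.
  by move=> q _; apply: le_trans hc _; case: h.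
have [p [p1 p2 p3]] := goodH_root_lt h hc; exists p; split => //; first exact: ltW.
by rewrite Hminus_l ?p2// ltW.
Qed.
Lemma goodH_root_lt_r H p0 c : goodH H p0 -> H p0 < c ->
  exists p, [/\ p0 < p, H p = c & forall q, p <= q -> c <= H q].
Proof.
move=> /goodH_refl h hc; have [|p [p1 p2 p3]] := goodH_root_lt (c := c) h; first by rewrite opprK.
exists (- p); split; rewrite // 1?ltrNr// => q pq.
by have := p3 (- q); rewrite opprK; apply; rewrite lerNl.
Qed.
Lemma goodH_root_r H p0 c : goodH H p0 -> exists p, [/\ p0 <= p,
  Hplus H p0 p <= Num.max c (H p0) & forall q, p <= q -> c <= H q].
Proof.
move=> /goodH_refl h; have [p [p1 p2 p3]] := goodH_root c h.
exists (- p); split; first by rewrite lerNr.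
  by move: p2; rewrite Hplus_refl !opprK.
by move=> q pq; have := p3 (- q); rewrite opprK; apply; rewrite lerNl.
Qed.

(** The profile [z] has slope [p] except on a layer of width [d] next to [a], where it drops with
    slope down to [p - L]. As [L] exceeds the Lipschitz constant, the maximum of [f - z] is not at
    [a]; the drop costs at most [L * d / 2 = g / 2], half of the deficit [g], so the maximum is not
    at [b] either. An interior one remains, and [z' <= p] everywhere. *)
Lemma slope_touch (f : R -> R) (K a b p : R) : a < b ->
  (forall x y, a <= x <= b -> a <= y <= b -> `|f x - f y| <= K * `|x - y|) ->
  f b - f a < p * (b - a) ->
  exists z z' x, [/\ C1 z z', a < x < b, z' x <= p &
    forall y, a <= y <= b -> f y - z y <= f x - z x].
Proof.
move=> ab lip h.
pose L := 2 * (1 + `|K| + `|p|).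
have L0 : 0 < L by rewrite /L; have := normr_ge0 K; have := normr_ge0 p; lra.
pose g := p * (b - a) - (f b - f a).
have g0 : 0 < g by rewrite /g; lra.
pose d := g / L; have d0 : 0 < d by exact: divr_gt0.
pose z y := p * (y - a) - L * (y - a - hub d (y - a)).
pose z' y := p - L * (1 - hub' d (y - a)).
have cz : C1 z z'.
  have h1 := C1_comp (C1_hub d0) (C1_aff 1 (- a)).
  have := C1D (C1_aff (p - L) (- (p - L) * a)) (C1Z L h1).
  by move=> hh; apply: (C1_eq hh) => y; rewrite /z /z' mul1r; ring.
have cont : forall x, a <= x <= b -> forall e, 0 < e -> exists2 r, 0 < r &
    forall y, a <= y <= b -> `|y - x| < r -> f y - z y < f x - z x + e.
  move=> x hx e e0; have e2 : 0 < e / 2 by lra.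
  have [r r0 hr] := C1_cont cz x e2.
  exists (Num.min r (e / 2 / L)); first by rewrite lt_min r0 divr_gt0//; lra.
  move=> y hy; rewrite lt_min => /andP[/hr/ltr_normlP[h1 h2]].
  rewrite ltr_pdivlMr// => h3; have := lip y x hy hx.
  have : K * `|y - x| <= L * `|y - x|.
    by rewrite ler_wpM2r// /L; have := ler_norm K; have := normr_ge0 p; have := normr_ge0 K; lra.
  move=> h4 /ler_normlP[h5 h6]; lra.
have [x hx hm] := max1 (ltW ab) cont.
have z0 : z a = 0 by rewrite /z subrr hub0//; ring.
have zb : f b - z b < f a - z a.
  have [_ /andP[h1 h2]] := hub_bnd (b - a) d0.
  have hL : L * (b - a - hub d (b - a)) <= L * (d / 2).
    by rewrite ler_wpM2l ?(ltW L0)//; move: h1; rewrite ger0_norm; lra.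
  have dL : L * (d / 2) = g / 2 by rewrite /d; field; lra.
  by rewrite z0 /z; rewrite /g in dL g0; lra.
pose y := a + Num.min d (b - a).
have [y1 y2 y3] : [/\ a < y, y <= b & y - a <= d].
  by rewrite /y; case: (leP d (b - a)) => ?; split; lra.
have za : f a - z a < f y - z y.
  have hk : hub d (y - a) <= (y - a) / 2.
    rewrite /hub ler_pdivrMr; last lra.
    by rewrite /psq !pos_le0; [nra|lra|lra].
  have hL : L * ((y - a) / 2) <= L * (y - a - hub d (y - a)).
    by rewrite ler_wpM2l ?(ltW L0)//; lra.
  have E : `|a - y| = y - a by rewrite distrC ger0_norm//; lra.
  rewrite z0 /z; have := ler_norm K; have := ler_norm p => hp hK.
  have hKy : K * (y - a) <= `|K| * (y - a) by rewrite ler_wpM2r//; lra.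
  have hpy : p * (y - a) <= `|p| * (y - a) by rewrite ler_wpM2r//; lra.
  have : L * ((y - a) / 2) = (1 + `|K| + `|p|) * (y - a) by rewrite /L; field.
  have := lip a y; rewrite lexx (ltW ab) (ltW y1) y2 E => /(_ isT isT).
  by move=> /ler_normlP[h5 h6]; lra.
have xa : x != a.
  by apply/negP => /eqP xa; have := hm y; rewrite (ltW y1) y2 xa => /(_ isT); lra.
have xb : x != b.
  by apply/negP => /eqP xb; have := hm a; rewrite lexx (ltW ab) xb => /(_ isT); lra.
exists z, z', x; split => //.
  by case/andP: hx => h1 h2; rewrite !lt_neqAle h1 h2 xb eq_sym xa.
rewrite /z'; have /andP[_ h1] := hub'_bnd (x - a) d0.
have h2 : 0 <= L * (1 - hub' d (x - a)) by rewrite mulr_ge0 ?(ltW L0)//; lra.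
lra.
Qed.

Lemma slope_touch_r (f : R -> R) (K a b p : R) : a < b ->
  (forall x y, a <= x <= b -> a <= y <= b -> `|f x - f y| <= K * `|x - y|) ->
  p * (b - a) < f b - f a ->
  exists z z' x, [/\ C1 z z', a < x < b, p <= z' x &
    forall y, a <= y <= b -> f y - z y <= f x - z x].
Proof.
move=> ab lip h.
have [|x y hx hy||z [z' [x [cz hx hz hm]]]] := @slope_touch (fun x => f (- x)) K (- b) (- a) (- p).
- by rewrite ltrN2.
- have -> : `|x - y| = `|- x - - y| by rewrite -opprD normrN.
  by apply: lip; apply/andP; lra.
- by rewrite !opprK; lra.
exists (fun y => z (- y)), (fun y => - z' (- y)), (- x); split.
- have := C1_comp cz (C1_aff (- 1) 0) => hh; apply: (C1_eq hh) => y; rewrite addr0 mulN1r//; by rewrite mulrN1.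
- by apply/andP; lra.
- by rewrite opprK; lra.
- by move=> y hy; rewrite opprK; have := hm (- y); rewrite opprK; apply; apply/andP; lra.
Qed.
End Hams.

(** * Test functions with kinks *)
Section Visc.
Context {R : realType}.
Implicit Types (h : hamiltonian R) (phi U : R -> R -> R).

Definition in_edge h a x :=
  ((1 <= a)%N -> jpoint h a < x) /\ ((a < njct h)%N -> x < jpoint h a.+1).

Definition wf h := [/\ (1 <= njct h)%N, increasing_points (njct h) (jpoint h) &
  admissible_hams (njct h) (ham h) (pmin h)].

Definition kink (pl pr b y : R) := pr * pos (y - b) - pl * pos (b - y).

Definition junction_ham h a t pl pr :=
  Num.max (Hplus (ham h a.-1) (pmin h a.-1) pl)
    (Num.max (Hminus (ham h a) (pmin h a) pr) (limiter h a t)).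

Definition locmax (f : R -> R -> R) t x := exists2 r, 0 < r &
  forall s y, `|s - t| < r -> `|y - x| < r -> f s y <= f t x.

Definition in_time (T0 : R) (T1 : \bar R) t := T0 < t /\ (t%:E < T1)%E.

Definition visc_int (sg : R) h lam T0 T1 U := forall a phi phit phix t x,
  (a <= njct h)%N -> C1xy phi phit phix -> in_time T0 T1 t -> in_edge h a x ->
  locmax (fun s y => sg * (U s y - phi s y)) t x ->
  sg * (phit t x + ham h a (phix t x)) <= sg * lam.

(* Sub-solutions correspond to [sg = 1] and super-solutions to [sg = -1]; all the
   test functions are C1 on the plane, up to an additional kink at a junction. *)
Definition visc (sg : R) h lam T0 T1 U := visc_int sg h lam T0 T1 U /\
  forall a phi phit phix pl pr t, (1 <= a)%N -> (a <= njct h)%N ->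
  C1xy phi phit phix -> in_time T0 T1 t ->
  locmax (fun s y => sg * (U s y - phi s y - kink pl pr (jpoint h a) y)) t (jpoint h a) ->
  sg * (phit t (jpoint h a) + junction_ham h a t (phix t (jpoint h a) + pl)
    (phix t (jpoint h a) + pr)) <= sg * lam.

(** At a junction only a function of time plus a kink is tested. This weaker requirement suffices,
    because every test function is dominated near the contact point, in the direction of [sg], by
    such a function with slightly opened slopes. *)
Definition visc_sep (sg : R) h lam T0 T1 U := visc_int sg h lam T0 T1 U /\
  forall a psi psi' pl pr t, (1 <= a)%N -> (a <= njct h)%N ->
  C1 psi psi' -> in_time T0 T1 t ->
  locmax (fun s y => sg * (U s y - psi s - kink pl pr (jpoint h a) y)) t (jpoint h a) ->
  sg * (psi' t + junction_ham h a t pl pr) <= sg * lam.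

Lemma visc_visc_sep sg h lam T0 T1 U : visc sg h lam T0 T1 U -> visc_sep sg h lam T0 T1 U.
Proof.
move=> [v1 v2]; split => // a psi psi' pl pr t a1 aN cpsi tT lm.
by have := v2 a _ _ _ pl pr t a1 aN (C1xy_t cpsi) tT lm; rewrite !add0r.
Qed.

Lemma epoint_lt N (b : nat -> R) a x : (a <= N)%N ->
  ((epoint N b a < x%:E)%E <-> ((1 <= a)%N -> b a < x)) /\
  ((x%:E < epoint N b a.+1)%E <-> ((a < N)%N -> x < b a.+1)).
Proof.
move=> aN; rewrite /epoint /=; split.
  case: a aN => [|a] aN /=; first by split => // _; rewrite ltNyr.
  by rewrite aN lte_fin; split=> // /(_ isT).
case: ifP => h; first by rewrite lte_fin; split => // /(_ isT).
by split => // _; rewrite ltry.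
Qed.
Lemma epoint_le N (b : nat -> R) a x : (a <= N)%N ->
  ((epoint N b a <= x%:E)%E <-> ((1 <= a)%N -> b a <= x)) /\
  ((x%:E <= epoint N b a.+1)%E <-> ((a < N)%N -> x <= b a.+1)).
Proof.
move=> aN; rewrite /epoint /=; split.
  case: a aN => [|a] aN /=; first by split => // _; rewrite leNye.
  by rewrite aN lee_fin; split=> // /(_ isT).
case: ifP => h; first by rewrite lee_fin; split => // /(_ isT).
by split => // _; rewrite leey.
Qed.

Lemma jpoint_le h a c : wf h -> (1 <= a)%N -> (a <= c)%N -> (c <= njct h)%N ->
  jpoint h a <= jpoint h c.
Proof.
move=> [_ inc _] a1; elim: c => [|c IH]; first by rewrite leqn0 => /eqP ->.
rewrite leq_eqVlt => /orP[/eqP -> //|ac cN].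
apply: le_trans (IH _ (ltnW cN)) (ltW _) => //; apply: inc => //.
exact: leq_trans a1 ac.
Qed.
Lemma jpoint_lt h a c : wf h -> (1 <= a)%N -> (a < c)%N -> (c <= njct h)%N ->
  jpoint h a < jpoint h c.
Proof.
move=> w a1 ac cN; apply: lt_le_trans (jpoint_le w _ ac cN) => //.
by case: (w) => _ inc _; apply: inc => //; exact: leq_trans ac cN.
Qed.

Lemma closed_edgeP h a x : (a <= njct h)%N -> closed_edge h a x <->
  ((1 <= a)%N -> jpoint h a <= x) /\ ((a < njct h)%N -> x <= jpoint h a.+1).
Proof.
move=> aN; have [e1 e2] := epoint_le (jpoint h) x aN; rewrite /closed_edge /=.
by split => -[/e1 ? /e2 ?].
Qed.

Lemma in_edge_cases h x : wf h -> (exists2 a, (a <= njct h)%N & in_edge h a x) \/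
  (exists a, [/\ (1 <= a)%N, (a <= njct h)%N & x = jpoint h a]).
Proof.
move=> w; have [N1 _ _] := w.
suff : forall n, (n <= njct h)%N -> ((1 <= n)%N -> jpoint h n < x) ->
    (exists2 a, (a <= njct h)%N & in_edge h a x) \/
    (exists a, [/\ (1 <= a)%N, (a <= njct h)%N & x = jpoint h a]).
  by move=> /(_ 0%N); apply.
move=> n nN; move: {2}(njct h - n)%N (leqnn (njct h - n)) => m.
elim: m n nN => [|m IH] n nN hm hn.
  have nE : n = njct h by apply/eqP; rewrite eqn_leq nN -subn_eq0 -leqn0 hm.
  by left; exists n => //; split => //; rewrite nE ltnn.
have [nN'|] := ltnP n (njct h); last first.
  move=> h1; have nE : n = njct h by apply/eqP; rewrite eqn_leq nN.
  by left; exists n => //; split => //; rewrite nE ltnn.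
have [xb|bx|xb] := ltgtP x (jpoint h n.+1).
- by left; exists n => //; split.
- by apply: (IH n.+1) => //; rewrite subnS; case: (njct h - n)%N hm.
- by right; exists n.+1; split.
Qed.

Lemma in_edge_nbhs h a x : in_edge h a x -> exists2 r, 0 < r &
  forall y, `|y - x| < r -> in_edge h a y.
Proof.
move=> [h1 h2].
pose r1 := if (1 <= a)%N then x - jpoint h a else 1.
pose r2 := if (a < njct h)%N then jpoint h a.+1 - x else 1.
exists (Num.min r1 r2).
  by rewrite lt_min /r1 /r2; case: ifP h1 => [_ /(_ isT)|]; case: ifP h2 => [_ /(_ isT)|] => *; apply/andP; lra.
move=> y; rewrite lt_min /r1 /r2 => /andP[/ltr_normlP[a1 a2] /ltr_normlP[a3 a4]].
by split=> e; move: a1 a2 a3 a4; rewrite e => *; lra.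
Qed.

Lemma in_timeP T0 T1 t : in_time T0 T1 t -> exists2 r, 0 < r &
  forall s, `|s - t| < r -> in_time T0 T1 s.
Proof.
move=> [h1 h2]; case: T1 h2 => [T1||] //; rewrite ?lte_fin.
  move=> h2; exists (Num.min (t - T0) (T1 - t)); first by rewrite lt_min; apply/andP; lra.
  move=> s; rewrite lt_min => /andP[/ltr_normlP[a1 a2] /ltr_normlP[a3 a4]].
  by split; rewrite ?lte_fin; lra.
move=> _; exists (t - T0); first lra.
by move=> s /ltr_normlP[a1 a2]; split; rewrite ?ltry//; lra.
Qed.

Lemma junction_ham_cont h a t pl pr e : wf h -> (1 <= a)%N -> (a <= njct h)%N -> 0 < e ->
  exists2 r, 0 < r & forall ql qr, `|ql - pl| < r -> `|qr - pr| < r ->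
    `|junction_ham h a t ql qr - junction_ham h a t pl pr| <= e.
Proof.
move=> [_ _ ah] a1 aN e0.
have [r1 r10 hr1] := cont1_Hplus (ah a.-1 (leq_trans (leq_pred _) aN)) pl e0.
have [r2 r20 hr2] := cont1_Hminus (ah a aN) pr e0.
exists (Num.min r1 r2); first by rewrite lt_min r10 r20.
move=> ql qr; rewrite !lt_min => /andP[/hr1/ltr_normlP[k1 k2] _] /andP[_ /hr2/ltr_normlP[k3 k4]].
rewrite /junction_ham; set L := limiter h a t; apply/ler_normlP.
move: k1 k2 k3 k4; set A := Hplus _ _ ql; set B := Hplus _ _ pl; set C := Hminus _ _ qr; set D := Hminus _ _ pr.
move=> k1 k2 k3 k4.
by case: (leP C L) => ?; case: (leP D L) => ?; (case: (leP A _) => ?; case: (leP B _) => ?); split; lra.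
Qed.

Lemma sg_cancel (sg x y : R) : sg = 1 \/ sg = -1 ->
  (forall e, 0 < e -> sg * x <= sg * y + e) -> sg * x <= sg * y.
Proof. by move=> _ h; apply/ler_addgt0Pr. Qed.

End Visc.

(** * From the definition to smooth test functions with a kink *)

Section Bridge.
Context {R : realType}.
Implicit Types (h : hamiltonian R) (U phi : R -> R -> R) (u : R * R -> R).

Lemma quotP (f : R -> R) (x l : R) (A : set R) :
  (d^-1 * (f (x + d) - f x) @[d --> within A 0^'] --> l) <->
  forall e, 0 < e -> exists2 r, 0 < r & forall d, `|d| < r -> A d ->
    `|f (x + d) - f x - l * d| <= e * `|d|.
Proof.
split.
  move=> /cvgrPdist_le H e e0; have [r /= r0 hr] := H e e0.
  exists r => // d dr Ad; have [->|d0] := eqVneq d 0.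
    by rewrite addr0 mulr0 !subrr normr0 mulr0.
  have := hr d; rewrite /= sub0r normrN => /(_ dr d0 Ad) {}hr.
  have -> : f (x + d) - f x - l * d = - ((l - d^-1 * (f (x + d) - f x)) * d) by field.
  by rewrite normrN normrM ler_wpM2r.
move=> H; apply/cvgrPdist_le => e e0; have [r r0 hr] := H e e0.
exists r => //= d /=; rewrite sub0r normrN => dr d0 Ad.
have -> : l - d^-1 * (f (x + d) - f x) = - (d^-1 * (f (x + d) - f x - l * d)) by field.
by rewrite normrN normrM normfV mulrC ler_pdivrMr ?normr_gt0// hr.
Qed.

Lemma der_quot (f : R -> R) (x l : R) (A : set R) : der f x l ->
  d^-1 * (f (x + d) - f x) @[d --> within A 0^'] --> l.
Proof.
move=> df; apply/quotP => e e0; have [r r0 hr] := df e e0.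
by exists r => // d dr _; have := hr (x + d); rewrite addrAC subrr add0r; apply.
Qed.

Lemma lim_left (f : R -> R) (x l : R) : (forall e, 0 < e -> exists2 r, 0 < r &
    forall d, `|d| < r -> d < 0 -> `|f (x + d) - f x - l * d| <= e * `|d|) ->
  lim (d^-1 * (f (x + d) - f x) @[d --> 0^'-]) = l.
Proof.
move=> H; apply: cvg_lim => //; apply/cvgrPdist_le => e e0; have [r r0 hr] := H e e0.
exists r => //= d /=; rewrite sub0r normrN => dr d0.
have dn : d != 0 by rewrite lt_eqF.
have -> : l - d^-1 * (f (x + d) - f x) = - (d^-1 * (f (x + d) - f x - l * d)) by field.
by rewrite normrN normrM normfV mulrC ler_pdivrMr ?normr_gt0// hr.
Qed.
Lemma lim_right (f : R -> R) (x l : R) : (forall e, 0 < e -> exists2 r, 0 < r &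
    forall d, `|d| < r -> 0 < d -> `|f (x + d) - f x - l * d| <= e * `|d|) ->
  lim (d^-1 * (f (x + d) - f x) @[d --> 0^'+]) = l.
Proof.
move=> H; apply: cvg_lim => //; apply/cvgrPdist_le => e e0; have [r r0 hr] := H e e0.
exists r => //= d /=; rewrite sub0r normrN => dr d0.
have dn : d != 0 by rewrite gt_eqF.
have -> : l - d^-1 * (f (x + d) - f x) = - (d^-1 * (f (x + d) - f x - l * d)) by field.
by rewrite normrN normrM normfV mulrC ler_pdivrMr ?normr_gt0// hr.
Qed.

Lemma derive1_der (f : R -> R) x l : der f x l -> derive1 f x = l.
Proof. by move=> /derP d; rewrite derive1E derive_val. Qed.

Lemma kink_edge h a c pl pr y : wf h -> (1 <= a)%N -> (a <= njct h)%N -> (c <= njct h)%N ->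
  closed_edge h c y -> kink pl pr (jpoint h a) y =
    (if (a <= c)%N then pr else pl) * (y - jpoint h a).
Proof.
move=> w a1 aN cN /(closed_edgeP y cN) [h1 h2]; rewrite /kink; case: leqP => ac.
  have ya : jpoint h a <= y.
    by apply: le_trans (h1 (leq_trans a1 ac)); exact: jpoint_le.
  by rewrite pos_id ?pos_le0; [ring|lra|lra].
have ya : y <= jpoint h a.
  apply: le_trans (h2 (leq_trans ac aN)) _; exact: jpoint_le.
by rewrite pos_le0 ?pos_id; [ring|lra|lra].
Qed.

Lemma cont2_kink (pl pr b : R) : cont2 (fun _ x => kink pl pr b x).
Proof.
have c1 : cont1 (fun x => pos (x - b)).
  apply: (@cont1_lip _ _ 1) => x y; rewrite mul1r (le_trans (pos_lip _ _))//.
  by have -> : x - b - (y - b) = x - y by ring.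
have c2 : cont1 (fun x => pos (b - x)).
  apply: (@cont1_lip _ _ 1) => x y; rewrite mul1r (le_trans (pos_lip _ _))//.
  have E : b - x - (b - y) = - (x - y) by ring.
  by rewrite E normrN.
apply: cont2_x; rewrite /kink.
have := cont1D (cont1M (cont1_cst pr) c1) (cont1M (cont1_cst (- pl)) c2).
by under eq_fun do rewrite mulNr.
Qed.

Lemma test_function_kink h T0 T1 a phi phit phix pl pr c : wf h ->
  (1 <= a)%N -> (a <= njct h)%N -> C1xy phi phit phix ->
  test_function h T0 T1 (fun z => phi z.1 z.2 + kink pl pr (jpoint h a) z.2 + c).
Proof.
move=> w a1 aN [c0 ct cx dt dx]; split.
  apply: continuous_subspaceT.
  have := cont2D (cont2D c0 (cont2_kink pl pr (jpoint h a))) (cont2_t (cont1_cst c)).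
  by move/cont2P.
move=> e eN; exists (fun z => phit z.1 z.2), (fun z => phix z.1 z.2 + (if (a <= e)%N then pr else pl)).
set s := if _ then _ else _; split.
- by apply: continuous_subspaceT; exact/cont2P.
- apply: continuous_subspaceT; have := cont2D cx (cont2_t (cont1_cst s)); by move/cont2P.
move=> -[t x] [/= tT Jx]; split.
  apply/derP; apply: der_eq; last exact: addr0.
  apply: derD; last exact: der_cst.
  apply: der_eq; last exact: addr0.
  by apply: derD; [exact: dt|exact: der_cst].
pose g y := phi t y + s * (y - jpoint h a) + c.
have dg : der g x (phix t x + s).
  apply: der_eq; last exact: addr0.
  apply: derD; last exact: der_cst.
  apply: derD; first exact: dx.
  have [_ /(_ x)] := C1_aff s (- (s * jpoint h a)).
  by apply: der_ext => y; ring.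
have gE y : closed_edge h e y -> phi t y + kink pl pr (jpoint h a) y + c = g y.
  by move=> Jy; rewrite (kink_edge _ _ w a1 aN eN Jy).
apply: cvg_trans (der_quot [set d | closed_edge h e (x + d)] dg).
apply: near_eq_cvg; apply: (filterS (P := [set d | closed_edge h e (x + d)])).
  by move=> d /= Jd; rewrite -!gE.
exact: withinT.
Qed.

Lemma dt_kink phi phit phix pl pr c t x b : C1xy phi phit phix ->
  dt (fun z => phi z.1 z.2 + kink pl pr b z.2 + c) (t, x) = phit t x.
Proof.
move=> [_ _ _ d _]; apply: derive1_der => /=.
apply: der_eq; last exact: addr0.
apply: derD; last exact: der_cst.
apply: der_eq; last exact: addr0.
by apply: derD; [exact: d|exact: der_cst].
Qed.

Lemma kink00 (b y : R) : kink 0 0 b y = 0.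
Proof. by rewrite /kink !mul0r subr0. Qed.

Lemma dx_kink0 phi phit phix c t x b : C1xy phi phit phix ->
  dx (fun z => phi z.1 z.2 + kink 0 0 b z.2 + c) (t, x) = phix t x.
Proof.
move=> [_ _ _ _ d]; apply: derive1_der => /=.
apply: der_eq; last exact: addr0.
apply: derD; last exact: der_cst.
by apply: der_ext (d t x) => y; rewrite kink00 addr0.
Qed.

Lemma dx_left_kink phi phit phix pl pr c t b : C1xy phi phit phix ->
  dx_left (fun z => phi z.1 z.2 + kink pl pr b z.2 + c) (t, b) = phix t b + pl.
Proof.
move=> [_ _ _ _ d]; rewrite /dx_left /=.
apply: (lim_left (f := fun y => phi t y + kink pl pr b y + c)) => e e0.
have [r r0 hr] := d t b e e0; exists r => // y yr y0.
have := hr (b + y); rewrite addrAC subrr add0r => /(_ yr).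
have -> : kink pl pr b (b + y) = pl * y.
  by rewrite /kink pos_le0 ?pos_id; [ring|lra|lra].
have -> : kink pl pr b b = 0 by rewrite /kink subrr pos_le0//; ring.
by have -> : forall A B D E F : R, A + pl * y + D - (B + 0 + D) - (E + pl) * y = A - B - E * y by move=> *; ring.
Qed.
Lemma dx_right_kink phi phit phix pl pr c t b : C1xy phi phit phix ->
  dx_right (fun z => phi z.1 z.2 + kink pl pr b z.2 + c) (t, b) = phix t b + pr.
Proof.
move=> [_ _ _ _ d]; rewrite /dx_right /=.
apply: (lim_right (f := fun y => phi t y + kink pl pr b y + c)) => e e0.
have [r r0 hr] := d t b e e0; exists r => // y yr y0.
have := hr (b + y); rewrite addrAC subrr add0r => /(_ yr).
have -> : kink pl pr b (b + y) = pr * y.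
  by rewrite /kink pos_id ?pos_le0; [ring|lra|lra].
have -> : kink pl pr b b = 0 by rewrite /kink subrr pos_le0//; ring.
by have -> : forall A B D E F : R, A + pr * y + D - (B + 0 + D) - (E + pr) * y = A - B - E * y by move=> *; ring.
Qed.

(* Both notions at once: [env] stands for the relevant semicontinuous envelope. *)
Definition is_visc_def (sg : R) h lam T0 T1 (U : R * R -> \bar R) :=
  forall (phi : R * R -> R) z, test_function h T0 T1 phi -> open_slab T0 T1 z ->
    U z = (phi z)%:E ->
    (\forall y \near z, (sg%:E * U y <= (sg * phi y)%:E)%E) ->
    equation_at h (fun v => sg * v <= sg * lam) phi z.

Lemma equation_at_ext h (P Q : R -> Prop) (phi : R * R -> R) z : (forall v, P v -> Q v) ->
  equation_at h P phi z -> equation_at h Q phi z.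
Proof.
by move=> PQ [e1 e2]; split=> [a aN x1 x2|a a1 aN zE]; apply: PQ; [exact: e1|exact: e2].
Qed.
Lemma is_visc_sub h lam T0 T1 u : is_subsolution h lam T0 T1 u <->
  is_visc_def 1 h lam T0 T1 (usc_env (slab T0 T1) u).
Proof.
split=> H f z tf zT Uz lm.
  apply: (equation_at_ext (P := fun v => v <= lam)) => [v|]; first by rewrite !mul1r.
  by apply: H => //; apply: filterS lm => y; rewrite mul1e mul1r.
apply: (equation_at_ext (P := fun v => 1 * v <= 1 * lam)) => [v|]; first by rewrite !mul1r.
by apply: H => //; apply: filterS lm => y; rewrite mul1e mul1r.
Qed.
Lemma is_visc_super h lam T0 T1 u : is_supersolution h lam T0 T1 u <->
  is_visc_def (-1) h lam T0 T1 (lsc_env (slab T0 T1) u).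
Proof.
split=> H f z tf zT Uz lm.
  apply: (equation_at_ext (P := fun v => lam <= v)) => [v|]; first by rewrite !mulN1r lerN2.
  by apply: H => //; apply: filterS lm => y; rewrite EFinN mulN1e mulN1r EFinN leeN2.
apply: (equation_at_ext (P := fun v => -1 * v <= -1 * lam)) => [v|]; first by rewrite !mulN1r lerN2.
by apply: H => //; apply: filterS lm => y; rewrite EFinN mulN1e mulN1r EFinN leeN2.
Qed.

Lemma visc_of_def sg h lam T0 T1 U V : wf h ->
  (forall t x, in_time T0 T1 t -> V (t, x) = (U t x)%:E) ->
  is_visc_def sg h lam T0 T1 V -> visc sg h lam T0 T1 U.
Proof.
move=> w VU H.
have key a phi phit phix pl pr t x : (1 <= a)%N -> (a <= njct h)%N ->
    C1xy phi phit phix -> in_time T0 T1 t ->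
    locmax (fun s y => sg * (U s y - phi s y - kink pl pr (jpoint h a) y)) t x ->
    equation_at h (fun v => sg * v <= sg * lam)
      (fun z => phi z.1 z.2 + kink pl pr (jpoint h a) z.2 + (U t x - phi t x - kink pl pr (jpoint h a) x)) (t, x).
  move=> a1 aN cphi tT [r r0 hr]; apply: H => //.
  - exact: (test_function_kink _ _ _ _ _ w a1 aN cphi).
  - by rewrite /= VU//; congr (_%:E); ring.
  - have [q q0 hq] := in_timeP tT.
    apply/near2P; exists (Num.min r q); first by rewrite lt_min r0 q0.
    move=> s y; rewrite !lt_min => /andP[s1 s2] /andP[y1 _].
    rewrite VU; last exact: hq.
    by rewrite -EFinM lee_fin /=; have := hr s y s1 y1; lra.
have [N1 _ _] := w; split.
  move=> a phi phit phix t x aN cphi tT xe lm.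
  (* Inside an edge the kink is taken with zero slopes, so any junction serves; the first one always
     exists. *)
  have := key 1%N phi phit phix 0 0 t x isT N1 cphi tT.
  case.
    by case: lm => r r0 hr; exists r => // s y hs hy; rewrite !kink00 !subr0; exact: hr.
  move=> /(_ a aN) + _; rewrite (dx_kink0 _ _ _ _ cphi).
  have [e1 e2] := epoint_lt (jpoint h) x aN; have [x1 x2] := xe.
  move=> /(_ (e1.2 x1) (e2.2 x2)).
  by rewrite (dt_kink _ _ _ _ _ _ cphi).
move=> a phi phit phix pl pr t a1 aN cphi tT lm.
have [_ /(_ a a1 aN erefl)] := key a phi phit phix pl pr t _ a1 aN cphi tT lm.
rewrite /= (dx_left_kink _ _ _ _ _ cphi) (dx_right_kink _ _ _ _ _ cphi).
by rewrite (dt_kink _ _ _ _ _ _ cphi).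
Qed.

End Bridge.

(** * From kinked test functions back to the definition *)

Section Bridge2.
Context {R : realType}.
Implicit Types (h : hamiltonian R) (U phi : R -> R -> R) (u : R * R -> R).

Definition cont2_at (u : R -> R -> R) t x := forall e, 0 < e -> exists2 r, 0 < r &
  forall s y, `|s - t| < r -> `|y - x| < r -> `|u s y - u t x| < e.

(** Test functions in [visc] are C1 on the whole plane, those of the definition only near the
    contact point. Precomposition with [clip] extends them: it is the identity up to [r], with
    values up to [2 * r], strictly inside the neighbourhood of size [3 * r]. *)
Lemma C1xy_local (phi phit phix : R -> R -> R) t0 x0 r : 0 < r ->
  (forall t x, `|t - t0| < 3 * r -> `|x - x0| < 3 * r ->
    [/\ cont2_at phi t x, cont2_at phit t x, cont2_at phix t x,
        der (phi^~ x) t (phit t x) & der (phi t) x (phix t x)]) ->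
  exists psi psit psix, C1xy psi psit psix /\ forall t x, `|t - t0| <= r -> `|x - x0| <= r ->
    [/\ psi t x = phi t x, psit t x = phit t x & psix t x = phix t x].
Proof.
move=> r0 H; have [k ck k1] := C1_clip r0.
have cl c : C1 (fun t => c + clip r (t - c)) (fun t => k (t - c)).
  have h1 := C1_comp ck (C1_aff 1 (- c)).
  have := C1D (C1_cst c) h1 => hh; apply: (C1_eq hh) => y; rewrite mul1r//; ring.
pose F c t := c + clip r (t - c).
have FB c t : `|F c t - c| < 3 * r.
  by rewrite /F addrAC subrr add0r; apply: le_lt_trans (clip_bnd _ r0) _; lra.
have FE c t : `|t - c| <= r -> F c t = t by move=> tr; rewrite /F clipE//; ring.
have cF c : cont1 (F c) by exact: C1_cont (cl c).
have comp : forall g, (forall t x, `|t - t0| < 3 * r -> `|x - x0| < 3 * r -> cont2_at g t x) ->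
    cont2 (fun t x => g (F t0 t) (F x0 x)).
  move=> g cg t x e e0; have [q q0 hq] := cg _ _ (FB t0 t) (FB x0 x) e e0.
  have [q1 q10 h1] := cF t0 t q q0; have [q2 q20 h2] := cF x0 x q q0.
  exists (Num.min q1 q2); first by rewrite lt_min q10 q20.
  by move=> s y; rewrite !lt_min => /andP[/h1 a1 _] /andP[_ /h2 a2]; exact: hq.
exists (fun t x => phi (F t0 t) (F x0 x)), (fun t x => phit (F t0 t) (F x0 x) * k (t - t0)),
  (fun t x => phix (F t0 t) (F x0 x) * k (x - x0)); split.
  split.
  - by apply: comp => t x h1 h2; have [] := H t x h1 h2.
  - apply: cont2M; first by apply: comp => t x h1 h2; have [] := H t x h1 h2.
    exact/cont2_t/(cl t0).1.
  - apply: cont2M; first by apply: comp => t x h1 h2; have [] := H t x h1 h2.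
    exact/cont2_x/(cl x0).1.
  - move=> t x; have [_ _ _ d _] := H _ _ (FB t0 t) (FB x0 x).
    exact: (der_comp (f := phi^~ (F x0 x)) d ((cl t0).2 t)).
  - move=> t x; have [_ _ _ _ d] := H _ _ (FB t0 t) (FB x0 x).
    exact: (der_comp (f := phi (F t0 t)) d ((cl x0).2 x)).
by move=> t x ht hx; rewrite !FE// !k1// !mulr1.
Qed.

Lemma within_cont_at (D : set (R * R)) (g : R * R -> R) t x r : {within D, continuous g} ->
  0 < r -> (forall s y, `|s - t| < r -> `|y - x| < r -> D (s, y)) ->
  cont2_at (fun s y => g (s, y)) t x.
Proof.
move=> /subspace_continuousP H r0 hD e e0.
have Dz : D (t, x) by apply: hD; rewrite subrr normr0.
have /cvgrPdist_lt/(_ e e0) := H _ Dz; rewrite near_withinE => /near2P [q q0 hq].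
exists (Num.min r q); first by rewrite lt_min r0 q0.
move=> s y; rewrite !lt_min => /andP[s1 s2] /andP[y1 y2].
by rewrite distrC; apply: hq => //; exact: hD.
Qed.

Lemma within_cont (D : set (R * R)) (g : R * R -> R) t x e : {within D, continuous g} ->
  D (t, x) -> 0 < e -> exists2 r, 0 < r & forall s y, `|s - t| < r -> `|y - x| < r ->
    D (s, y) -> `|g (s, y) - g (t, x)| < e.
Proof.
move=> /subspace_continuousP H Dz e0.
have /cvgrPdist_lt/(_ e e0) := H _ Dz; rewrite near_withinE => /near2P [q q0 hq].
by exists q => // s y s1 y1 Dy; rewrite distrC; apply: hq.
Qed.

Lemma mvt_bound (f f' : R -> R) (a b p eta : R) : a <= b ->
  (forall x, a < x < b -> der f x (f' x)) ->
  (forall x, a <= x <= b -> forall e, 0 < e -> exists2 r, 0 < r &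
    forall y, `|y - x| < r -> `|f y - f x| < e) ->
  (forall x, a < x < b -> `|f' x - p| <= eta) ->
  `|f b - f a - p * (b - a)| <= eta * (b - a).
Proof.
move=> ab df cf bf; have [->|aNb] := eqVneq a b.
  by rewrite !subrr !mulr0 subr0 normr0.
have ltab : a < b by rewrite lt_neqAle aNb.
have [x||c] := @MVT R f f' a b ltab.
- by rewrite in_itv /= => hx; apply/derP; exact: df.
- apply/subspace_continuousP => x; rewrite /= in_itv /= => hx.
  apply/cvgrPdist_lt => e e0; rewrite near_withinE.
  have [r r0 hr] := cf x hx e e0; exists r => //= y yx _; rewrite distrC; apply: hr.
  by rewrite distrC.
rewrite in_itv /= => hc ->.
by rewrite -mulrBl normrM (gtr0_norm (_ : 0 < b - a)) ?subr_gt0// ler_wpM2r ?subr_ge0// bf.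
Qed.

Lemma quot2 (f : R * R -> R) t x (p : R) (A : set R) :
  (d^-1 * (f (t, x + d) - f (t, x)) @[d --> within A 0^'] --> p) ->
  forall e, 0 < e -> exists2 r, 0 < r & forall d, `|d| < r -> A d ->
    `|f (t, x + d) - f (t, x) - p * d| <= e * `|d|.
Proof. exact: (quotP (fun y => f (t, y)) x p A).1. Qed.

Lemma in_edge_closed h a x : (a <= njct h)%N -> in_edge h a x -> closed_edge h a x.
Proof. by move=> aN [h1 h2]; apply/closed_edgeP => //; split=> e; apply: ltW; [exact: h1|exact: h2]. Qed.

Lemma in_edge_right h a : wf h -> (1 <= a)%N -> (a <= njct h)%N -> exists2 r, 0 < r &
  forall y, jpoint h a < y -> y < jpoint h a + r -> in_edge h a y.
Proof.
move=> [_ inc _] a1 aN; exists (if (a < njct h)%N then jpoint h a.+1 - jpoint h a else 1).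
  by case: ifP => // aN'; rewrite subr_gt0; exact: inc.
by move=> y y1 y2; split=> // aN'; move: y2; rewrite aN'; lra.
Qed.
Lemma in_edge_left h a : wf h -> (1 <= a)%N -> (a <= njct h)%N -> exists2 r, 0 < r &
  forall y, y < jpoint h a -> jpoint h a - r < y -> in_edge h a.-1 y.
Proof.
move=> [_ inc _]; case: a => // a _ aN /=.
exists (if (1 <= a)%N then jpoint h a.+1 - jpoint h a else 1).
  by case: ifP => // aN'; rewrite subr_gt0; exact: inc.
by move=> y y1 y2; split=> // aN'; move: y2; rewrite aN'; lra.
Qed.

Lemma sgP (sg : R) : sg = 1 \/ sg = -1 -> sg * sg = 1 /\ `|sg| = 1.
Proof. by move=> [->|->]; rewrite ?mulr1 ?mulrNN ?mulr1 ?normrN normr1. Qed.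

(** What a test function looks like at an endpoint of an edge: a one-sided slope [p]; an expansion
    in space that is uniform over nearby times, by the mean value theorem on each time slice, as the
    space derivative is continuous up to the endpoint; and a trace in time that extends to a C1
    function of one variable. *)
Lemma edge_slope h T0 T1 c (f : R * R -> R) (b : R) (right : bool) t0 : wf h -> (c <= njct h)%N ->
  {within open_slab T0 T1, continuous f} -> in_time T0 T1 t0 ->
  (exists2 r, 0 < r & forall y, `|y - b| < r -> (if right then b < y else y < b) -> in_edge h c y) ->
  closed_edge h c b ->
  C1_up_to_boundary T0 T1 (closed_edge h c) f ->
  exists p, [/\ (if right then dx_right f (t0, b) else dx_left f (t0, b)) = p,
   (forall e, 0 < e -> exists2 r, 0 < r & forall s y, `|s - t0| < r -> `|y - b| < r ->
      (if right then b <= y else y <= b) -> `|f (s, y) - f (s, b) - p * (y - b)| <= e * `|y - b|),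
   dt f (t0, b) = dt f (t0, b) &
   exists psi psi', [/\ C1 psi psi', psi' t0 = dt f (t0, b) &
     exists2 r, 0 < r & forall s, `|s - t0| < r -> psi s = f (s, b)]].
Proof.
move=> w cN cf tT [r r0 hr] Jb [ft [fx [cft cfx df]]].
have [q q0 hq] := in_timeP tT.
exists (fx (t0, b)); split => //.
- have H := quot2 (df (t0, b) (conj tT Jb)).2.
  case: right hr => hr; [apply: (lim_right (f := fun y => f (t0, y)))|apply: (lim_left (f := fun y => f (t0, y)))] => e e0.
    have [q1 q10 h1] := H e e0; exists (Num.min q1 r); first by rewrite lt_min q10 r0.
    move=> d; rewrite lt_min => /andP[d1 d2] d0; apply: h1 => //=.
    by apply: (in_edge_closed cN); apply: hr; [by rewrite addrAC subrr add0r|lra].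
  have [q1 q10 h1] := H e e0; exists (Num.min q1 r); first by rewrite lt_min q10 r0.
  move=> d; rewrite lt_min => /andP[d1 d2] d0; apply: h1 => //=.
  by apply: (in_edge_closed cN); apply: hr; [by rewrite addrAC subrr add0r|lra].
- move=> e e0; have [q1 q10 h1] := within_cont (t := t0) (x := b) cfx (conj tT Jb) e0.
  pose m := Num.min q (Num.min q1 r).
  have m0 : 0 < m by rewrite /m !lt_min q0 q10 r0.
  exists m => // s y; rewrite !lt_min => /and3P[s1 s2 s3] /and3P[y1 y2 y3] yb.
  have contf x : forall e, 0 < e -> exists2 r, 0 < r &
      forall y, `|y - x| < r -> `|f (s, y) - f (s, x)| < e.
    move=> e' e'0; have [p p0 hp] := in_timeP (hq s s1).
    have hD : forall s' y', `|s' - s| < p -> `|y' - x| < p -> open_slab T0 T1 (s', y').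
      by move=> s' y' h2 _; exact: hp.
    have hc := within_cont_at cf p0 hD.
    have [p' p'0 hp'] := hc e' e'0.
    by exists p' => // y' hy'; apply: hp' => //; rewrite subrr normr0.
  have dx x : (if right then b < x else x < b) -> `|x - b| < r -> der (fun y => f (s, y)) x (fx (s, x)).
    move=> bx xr; have xe := hr x xr bx.
    have H := quot2 (df (s, x) (conj (hq s s1) (in_edge_closed cN xe))).2.
    have [p p0 hp] := in_edge_nbhs xe.
    move=> e' e'0; have [p' p'0 hp'] := H e' e'0.
    exists (Num.min p p'); first by rewrite lt_min p0 p'0.
    move=> y'; rewrite lt_min => /andP[h2 h3].
    have := hp' (y' - x) h3; rewrite /= addrC subrK; apply.
    exact: (in_edge_closed cN (hp y' h2)).
  case: right hr dx yb => hr dx yb; move: y2 y3.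
    rewrite (ger0_norm (_ : 0 <= y - b)) ?subr_ge0// => y2 y3.
    apply: (@mvt_bound (fun x => f (s, x)) (fun x => fx (s, x))) => [//|x|x _|x]; [|exact: contf|]; move=> /andP[x1 x2].
      by apply: dx => //; move: x1 x2 y3; clear=> *; rewrite ger0_norm; lra.
    have xr : `|x - b| < r by move: x1 x2 y2 y3; clear=> *; rewrite ger0_norm; lra.
    have xq : `|x - b| < q1 by move: x1 x2 y2 y3; clear=> *; rewrite ger0_norm; lra.
    apply/ltW/h1 => //; split; first exact: hq.
    exact: (in_edge_closed cN (hr x xr x1)).
  rewrite (ler0_norm (_ : y - b <= 0)) ?subr_le0// => y2 y3.
  have -> : f (s, y) - f (s, b) - fx (t0, b) * (y - b) = - (f (s, b) - f (s, y) - fx (t0, b) * (b - y)) by ring.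
  rewrite normrN opprB; apply: (@mvt_bound (fun x => f (s, x)) (fun x => fx (s, x))) => [//|x|x _|x]; [|exact: contf|]; move=> /andP[x1 x2].
    by apply: dx => //; move: x1 x2 y3; clear=> *; rewrite ltr0_norm; lra.
  have xr : `|x - b| < r by move: x1 x2 y2 y3; clear=> *; rewrite ltr0_norm; lra.
  have xq : `|x - b| < q1 by move: x1 x2 y2 y3; clear=> *; rewrite ltr0_norm; lra.
  apply/ltW/h1 => //; split; first exact: hq.
  exact: (in_edge_closed cN (hr x xr x2)).
- have qq : 0 < q / 3 by lra.
  have dtE : forall s, in_time T0 T1 s -> der (fun s => f (s, b)) s (ft (s, b)).
    by move=> s sT; have [/derP] := df (s, b) (conj sT Jb).
  have [|F [Ft [Fx [cF FE]]]] := @C1xy_local (fun s _ => f (s, b)) (fun s _ => ft (s, b)) (fun _ _ => 0) t0 b (q / 3) qq.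
    move=> t x; rewrite mulrC divfK// => tq xq; have tT' := hq t tq.
    split.
    - move=> e e0; have [p p0 hp] := der_cont (dtE t tT') e0.
      by exists p => // s y s1 _; exact: hp.
    - move=> e e0; have [p p0 hp] := within_cont (t := t) (x := b) cft (conj tT' Jb) e0.
      have [p' p'0 hp'] := in_timeP tT'.
      exists (Num.min p p'); first by rewrite lt_min p0 p'0.
      move=> s y; rewrite !lt_min => /andP[s1 s2] _; apply: hp => //; first by rewrite subrr normr0.
      by split; [exact: hp'|].
    - by move=> e e0; exists 1 => // s y _ _; rewrite subrr normr0.
    - exact: dtE.
    - exact: der_cst.
  have [_ cFt _ dFt _] := cF.
  have bb : `|b - b| <= q / 3 by rewrite subrr normr0 ltW.
  exists (fun s => F s b), (fun s => Ft s b); split.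
  - split; last by move=> s; exact: dFt.
    move=> s e e0; have [p p0 hp] := cFt s b e e0.
    by exists p => // y h1; apply: hp => //; rewrite subrr normr0.
  - rewrite /dt (derive1_der (dtE t0 tT)).
    by have [|_ -> _] := FE t0 b _ bb => //; rewrite subrr normr0 ltW.
  - exists (q / 3) => // s /ltW hs; by have [-> _ _] := FE s b hs bb.
Qed.

Lemma def_of_visc (sg : R) h lam T0 T1 U V : wf h -> sg = 1 \/ sg = -1 ->
  (forall t x, in_time T0 T1 t -> V (t, x) = (U t x)%:E) ->
  visc_sep sg h lam T0 T1 U -> is_visc_def sg h lam T0 T1 V.
Proof.
move=> w hsg VU [H1 H2] f [t0 x0] [cf tf] /= tT Vz /near2P [r0 r00 lm].
have [ss sn] := sgP hsg.
have [q q0 hq] := in_timeP tT.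
have Uz : U t0 x0 = f (t0, x0) by move: Vz; rewrite VU// => -[].
have lm' : exists2 r, 0 < r & forall s y, `|s - t0| < r -> `|y - x0| < r -> sg * U s y <= sg * f (s, y).
  exists (Num.min r0 q); first by rewrite lt_min r00 q0.
  move=> s y; rewrite !lt_min => /andP[s1 s2] /andP[y1 _].
  by have := lm s y s1 y1; rewrite VU ?lee_fin//; exact: hq.
move: lm' => {lm r0 r00} [r0 r00 lm]; split => /=.
  move=> a aN /(epoint_lt (jpoint h) x0 aN).1 x1 /(epoint_lt (jpoint h) x0 aN).2 x2.
  have xe : in_edge h a x0 by split.
  have [ft [fx [cft cfx df]]] := tf a aN.
  have [p p0 hp] := in_edge_nbhs xe.
  pose r := Num.min r0 (Num.min q p) / 3.
  have r0' : 0 < r by rewrite /r divr_gt0// !lt_min r00 q0 p0.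
  have r3 (s : R) : `|s| < 3 * r -> [/\ `|s| < r0, `|s| < q & `|s| < p].
    by rewrite /r mulrC divfK// !lt_min => /and3P[].
  have hD s y : `|s - t0| < 3 * r -> `|y - x0| < 3 * r ->
      (open_slab T0 T1 `&` [set z | closed_edge h a z.2]) (s, y).
    move=> /r3 [_ s2 _] /r3 [_ _ y3]; split; first exact: hq.
    exact: (in_edge_closed aN (hp y y3)).
  have box t x : `|t - t0| < 3 * r -> `|x - x0| < 3 * r -> exists2 m, 0 < m &
      forall s y, `|s - t| < m -> `|y - x| < m -> `|s - t0| < 3 * r /\ `|y - x0| < 3 * r.
    move=> ht hx; exists (Num.min (3 * r - `|t - t0|) (3 * r - `|x - x0|)).
      by rewrite lt_min; apply/andP; lra.
    move=> s y; rewrite !lt_min => /andP[s1 _] /andP[_ y2].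
    have := ler_normD (s - t) (t - t0); have := ler_normD (y - x) (x - x0).
    by rewrite !addrA !subrK; lra.
  have [|F [Ft [Fx [cF FE]]]] := @C1xy_local (fun s y => f (s, y)) (fun s y => ft (s, y)) (fun s y => fx (s, y)) t0 x0 r r0'.
    move=> t x ht hx; have [m m0 hm] := box t x ht hx.
    have hDm : forall s y, `|s - t| < m -> `|y - x| < m -> (open_slab T0 T1 `&` [set z | closed_edge h a z.2]) (s, y).
      by move=> s y s1 y1; have [? ?] := hm s y s1 y1; exact: hD.
    have [d1 /quot2 d2] := df (t, x) (hD t x ht hx).
    split.
    - by apply: (within_cont_at cf m0) => s y s1 y1; case: (hDm s y s1 y1).
    - exact: (within_cont_at cft m0).
    - exact: (within_cont_at cfx m0).
    - exact/derP.
    - move=> e e0; have [m' m'0 hm'] := d2 e e0.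
      exists (Num.min m m'); first by rewrite lt_min m0 m'0.
      move=> y; rewrite lt_min => /andP[y1 y2].
      have := hm' (y - x) y2; rewrite /= addrC subrK; apply.
      by have [|//] := hDm t y _ y1; rewrite subrr normr0.
  have tt : `|t0 - t0| <= r by rewrite subrr normr0 ltW.
  have xx : `|x0 - x0| <= r by rewrite subrr normr0 ltW.
  have [E1 E2 E3] := FE t0 x0 tt xx.
  have := H1 a F Ft Fx t0 x0 aN cF tT xe; rewrite E2 E3.
  have lt0 : 0 < 3 * r by rewrite mulr_gt0.
  have tt3 : `|t0 - t0| < 3 * r by rewrite subrr normr0.
  have xx3 : `|x0 - x0| < 3 * r by rewrite subrr normr0.
  have [/derP d1 /quot2 d2] := df (t0, x0) (hD t0 x0 tt3 xx3).
  rewrite /dt /dx /= (derive1_der d1).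
  have dd : der (fun y => f (t0, y)) x0 (fx (t0, x0)).
    move=> e e0; have [m' m'0 hm'] := d2 e e0.
    exists (Num.min (3 * r) m'); first by rewrite lt_min lt0 m'0.
    move=> y; rewrite lt_min => /andP[y1 y2].
    have := hm' (y - x0) y2; rewrite /= addrC subrK; apply.
    by have [|//] := hD t0 y _ y1; rewrite subrr normr0.
  rewrite (derive1_der dd); apply.
  exists r => // s y /ltW s1 /ltW y1.
  have [-> _ _] := FE s y s1 y1; rewrite E1 Uz subrr mulr0.
  have s3 : `|s - t0| < 3 * r by move: s1 r0'; lin.
  have y3 : `|y - x0| < 3 * r by move: y1 r0'; lin.
  have [s2 _ _] := r3 _ s3; have [y2 _ _] := r3 _ y3.
  by move: (lm s y s2 y2); lin.
move=> a a1 aN xb; rewrite xb in lm Vz Uz *.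
set b := jpoint h a in lm Vz Uz *.
have aN' : (a.-1 <= njct h)%N by apply: leq_trans aN; exact: leq_pred.
have JR : closed_edge h a b.
  by apply/closed_edgeP => //; split => // aN''; apply: jpoint_le.
have JL : closed_edge h a.-1 b.
  apply/closed_edgeP => //; rewrite prednK//; split => // a1'; apply: jpoint_le => //; exact: leq_pred.
have [|pr [-> hR _ [psi [psi' [cpsi psiE psif]]]]] := @edge_slope h T0 T1 a f b true t0 w aN cf tT _ JR (tf a aN).
  have [r r0' hr] := in_edge_right w a1 aN; exists r => // y /ltr_normlP[y1 y2] yb.
  by apply: hr => //; rewrite -/b; lra.
have [|pl [-> hL _ _]] := @edge_slope h T0 T1 a.-1 f b false t0 w aN' cf tT _ JL (tf a.-1 aN').
  have [r r0' hr] := in_edge_left w a1 aN; exists r => // y /ltr_normlP[y1 y2] yb.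
  by apply: hr => //; rewrite -/b; lra.
rewrite -psiE -/(junction_ham h a t0 pl pr); apply: sg_cancel => // e e0.
have [r r0' hr] := junction_ham_cont t0 pl pr w a1 aN e0.
have r2 : 0 < r / 2 by lra.
have [rR rR0 {}hR] := hR _ r2; have [rL rL0 {}hL] := hL _ r2.
move: psif => [rp rp0 psif].
have hs x : sg * (x + sg * (r / 2)) = sg * x + r / 2 by rewrite mulrDr mulrA ss mul1r.
(* The kink is opened by [r / 2] on each side in the direction of [sg]: this absorbs the first-order
   error of the two expansions, and the continuity of [junction_ham] limits the loss to [e]. *)
have := H2 a psi psi' (pl - sg * (r / 2)) (pr + sg * (r / 2)) t0 a1 aN cpsi tT.
have nr : `|sg * (r / 2)| < r by rewrite normrM sn mul1r gtr0_norm//; lra.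
have := hr (pl - sg * (r / 2)) (pr + sg * (r / 2)).
have E1 : pl - sg * (r / 2) - pl = - (sg * (r / 2)) by ring.
have E2 : pr + sg * (r / 2) - pr = sg * (r / 2) by ring.
rewrite E1 E2 normrN => /(_ nr nr); rewrite -/b.
move: (junction_ham h a t0 (pl - _) _) => J1; move: (junction_ham h a t0 _ _) => J2.
move=> hJ H3; have {}H3 : sg * (psi' t0 + J1) <= sg * lam.
  apply: H3; exists (Num.min r0 (Num.min rR (Num.min rL rp))).
    by rewrite !lt_min r00 rR0 rL0 rp0.
  move=> s y; rewrite !lt_min => /and4P[s1 s2 s3 s4] /and4P[y1 y2 y3 y4].
  rewrite !psif ?subrr ?normr0// Uz.
  have := lm s y s1 y1; rewrite /kink !subrr (pos_le0 (lexx 0)) => h1.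
  case: (leP b y) => yb.
    have yb1 : 0 <= y - b by rewrite subr_ge0.
    have yb2 : b - y <= 0 by rewrite subr_le0.
    have := hR s y s2 y2 yb; rewrite (pos_id yb1) (pos_le0 yb2) (ger0_norm yb1) ler_norml => /andP[h2 h3].
    case: hsg h1 => ->; rewrite ?mul1r ?mulN1r; move: h2 h3; clear; nra.
  have yb1 : y - b < 0 by rewrite subr_lt0.
  have yb2 : 0 <= b - y by rewrite subr_ge0 ltW.
  have := hL s y s3 y3 (ltW yb); rewrite (pos_le0 (ltW yb1)) (pos_id yb2) (ltr0_norm yb1) ler_norml => /andP[h2 h3].
  case: hsg h1 => ->; rewrite ?mul1r ?mulN1r; move: h2 h3; clear; nra.
move: hJ => /ler_normlP[h1 h2].
move: h1 h2 H3; case: hsg => ->; lin.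
Qed.
End Bridge2.

(** * Semi-continuous envelopes of Lipschitz functions *)
Section Env.
Context {R : realType}.
Implicit Types (h : hamiltonian R) (U : R -> R -> R) (u : R * R -> R).

Lemma usc_envE (D : set (R * R)) u z : D z ->
  (forall e, 0 < e -> \forall y \near z, D y -> u y <= u z + e) ->
  usc_env D u z = (u z)%:E.
Proof.
move=> Dz H; rewrite /usc_env limf_esupE; apply/eqP; rewrite eq_le; apply/andP; split.
  apply/lee_addgt0Pr => e e0; apply: ereal_inf_le.
  exists (ereal_sup ((EFin \o u) @` [set y | D y /\ u y <= u z + e])).
    exists [set y | D y /\ u y <= u z + e] => //.
    by apply: filterS (H e e0) => y h Dy; split=> //; exact: h.
  by apply: ge_ereal_sup => _ [y [_ h] <-]; rewrite /= -EFinD lee_fin.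
apply: le_ereal_inf_tmp => _ [V zV <-]; apply: ereal_sup_ubound.
by exists z => //; apply: nbhs_singleton zV _.
Qed.

Lemma lsc_usc_env (D : set (R * R)) u z :
  lsc_env D u z = (- usc_env D (fun y => (- u y)%R) z)%E.
Proof. by []. Qed.

Lemma lsc_envE (D : set (R * R)) u z : D z ->
  (forall e, 0 < e -> \forall y \near z, D y -> u z - e <= u y) ->
  lsc_env D u z = (u z)%:E.
Proof.
move=> Dz H; rewrite lsc_usc_env usc_envE ?oppeK ?EFinN ?oppeK// => e e0.
by apply: filterS (H e e0) => y h /h; lra.
Qed.

Definition lipon (I : R -> Prop) (K : R) U := forall s t x y, I s -> I t ->
  `|U s x - U t y| <= K * (`|s - t| + `|x - y|).
Definition in_slab (T0 : R) (T1 : \bar R) t := T0 <= t /\ (t%:E < T1)%E.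

Lemma lipon_sub (I J : R -> Prop) K U : (forall t, I t -> J t) -> lipon J K U -> lipon I K U.
Proof. by move=> IJ l s t x y /IJ ? /IJ ?; exact: l. Qed.

Lemma lipon_le (I : R -> Prop) K K' U : K <= K' -> lipon I K U -> lipon I K' U.
Proof.
move=> KK l s t x y Is It; apply: le_trans (l _ _ _ _ Is It) _.
by rewrite ler_wpM2r// addr_ge0.
Qed.

Lemma lipon_near (I : R -> Prop) K U t x e : lipon I K U -> I t -> 0 < e ->
  exists2 r, 0 < r & forall s y, I s -> `|s - t| < r -> `|y - x| < r -> `|U s y - U t x| < e.
Proof.
move=> l It e0; have k0 : 0 < 1 + `|K| by rewrite ltr_pwDl.
exists (e / (2 * (1 + `|K|))); first by rewrite divr_gt0// mulr_gt0.
move=> s y Is h1 h2; apply: le_lt_trans (l _ _ _ _ Is It) _.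
have h3 : (`|s - t| + `|y - x|) * (1 + `|K|) < e.
  have : `|s - t| + `|y - x| < e / (1 + `|K|).
    have -> : e / (1 + `|K|) = e / (2 * (1 + `|K|)) + e / (2 * (1 + `|K|)) by field; lra.
    exact: ltrD.
  by rewrite ltr_pdivlMr.
apply: le_lt_trans h3; rewrite mulrC ler_wpM2l ?addr_ge0//.
by have := ler_norm K; lra.
Qed.

Lemma prod_norm_le (z : R * R) : `|z| <= `|z.1| + `|z.2|.
Proof. by rewrite /Num.norm /= ge_max lerDl lerDr !normr_ge0. Qed.
Lemma prod_norm_ge (z : R * R) : `|z.1| + `|z.2| <= 2 * `|z|.
Proof.
have : `|z.1| <= `|z| by rewrite [`|z|]/Num.norm /= le_max lexx.
have : `|z.2| <= `|z| by rewrite [`|z|]/Num.norm /= le_max lexx orbT.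
lra.
Qed.

Lemma lipon_def (D : set R) L u : L.-lipschitz_([set z : R * R | D z.1]) u ->
  lipon D `|L| (fun t x => u (t, x)).
Proof.
move=> H s t x y Ds Dt; have /= := H ((s, x), (t, y)) (conj Ds Dt).
move=> h; apply: le_trans h _.
apply: le_trans (ler_wpM2r _ (ler_norm L)) _ => //.
by rewrite ler_wpM2l//; exact: prod_norm_le.
Qed.
Lemma def_lipon (D : set R) K U : 0 <= K -> lipon D K U ->
  (2 * K).-lipschitz_([set z : R * R | D z.1]) (fun z => U z.1 z.2).
Proof.
move=> K0 H [[s x] [t y]] [/= Ds Dt]; apply: le_trans (H _ _ _ _ Ds Dt) _.
have h := prod_norm_ge ((s, x) - (t, y)).
by apply: le_trans (ler_wpM2l K0 h) _; rewrite mulrCA mulrA.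
Qed.

(** For a Lipschitz function the envelope is the function itself at the times concerned, so
    envelopes disappear from the rest of the argument. *)
Lemma sub_viscP h lam T0 T1 K u : wf h -> lipon (in_slab T0 T1) K (fun t x => u (t, x)) ->
  is_subsolution h lam T0 T1 u <-> visc 1 h lam T0 T1 (fun t x => u (t, x)).
Proof.
move=> w l.
have E t x : in_time T0 T1 t -> usc_env (slab T0 T1) u (t, x) = (u (t, x))%:E.
  move=> [t0 t1]; have tT : in_slab T0 T1 t by split => //; exact: ltW.
  apply: usc_envE => // e e0; apply/near2P.
  have [r r0 hr] := lipon_near x l tT e0; exists r => // s y h1 h2 sT.
  by have /ltr_normlP[_] := hr s y sT h1 h2; lra.
split=> [/is_visc_sub|v]; first exact: visc_of_def.
apply/is_visc_sub; apply: (def_of_visc w _ E); first by left.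
exact: visc_visc_sep.
Qed.
Lemma super_viscP h lam T0 T1 K u : wf h -> lipon (in_slab T0 T1) K (fun t x => u (t, x)) ->
  is_supersolution h lam T0 T1 u <-> visc (-1) h lam T0 T1 (fun t x => u (t, x)).
Proof.
move=> w l.
have E t x : in_time T0 T1 t -> lsc_env (slab T0 T1) u (t, x) = (u (t, x))%:E.
  move=> [t0 t1]; have tT : in_slab T0 T1 t by split => //; exact: ltW.
  apply: lsc_envE => // e e0; apply/near2P.
  have [r r0 hr] := lipon_near x l tT e0; exists r => // s y h1 h2 sT.
  by have /ltr_normlP[] := hr s y sT h1 h2; lra.
split=> [/is_visc_super|v]; first exact: visc_of_def.
apply/is_visc_super; apply: (def_of_visc w _ E); first by right.
exact: visc_visc_sep.
Qed.
(** A detour through the definition: separated tests control all its test functions, and these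
    include every C1 function plus a kink. *)
Lemma visc_sep_visc (sg : R) h lam T0 T1 K U : wf h -> sg = 1 \/ sg = -1 ->
  lipon (in_slab T0 T1) K U -> visc_sep sg h lam T0 T1 U -> visc sg h lam T0 T1 U.
Proof.
move=> w hsg l v.
pose V z := (U z.1 z.2)%:E.
have E t x : in_time T0 T1 t -> V (t, x) = (U t x)%:E by [].
by apply: (visc_of_def w E); exact: (def_of_visc w hsg E).
Qed.

Lemma locmax_ext (f g : R -> R -> R) t x r : 0 < r ->
  (forall s y, `|s - t| < r -> `|y - x| < r -> f s y <= g s y) -> f t x = g t x ->
  locmax g t x -> locmax f t x.
Proof.
move=> r0 fg e [q q0 hq]; exists (Num.min r q); first by rewrite lt_min r0.
move=> s y; rewrite !lt_min => /andP[s1 s2] /andP[y1 y2].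
by rewrite e; apply: le_trans (fg s y s1 y1) _; exact: hq.
Qed.

Lemma visc_time_sub sg h lam T0 T1 T0' T1' U : (forall t, in_time T0' T1' t -> in_time T0 T1 t) ->
  visc sg h lam T0 T1 U -> visc sg h lam T0' T1' U.
Proof.
move=> TT [v1 v2]; split.
  by move=> a phi phit phix t x aN cphi /TT tT; exact: v1.
by move=> a phi phit phix pl pr t a1 aN cphi /TT tT; exact: v2.
Qed.

End Env.

(** * Comparison principle *)
Section FirstMax.
Context {R : realType}.
Implicit Types (f : R -> R).

(** The infimum of the set of maximum points is again one, by upper semi-continuity. Strictness
    before it is what later keeps the maximizing times of nearby problems from falling far below
    it. *)
Lemma first_max f a b : a <= b ->
  (forall x, a <= x <= b -> forall e, 0 < e -> exists2 r, 0 < r &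
    forall y, a <= y <= b -> `|y - x| < r -> f y < f x + e) ->
  exists t, [/\ a <= t <= b, forall y, a <= y <= b -> f y <= f t &
    forall y, a <= y <= b -> y < t -> f y < f t].
Proof.
move=> ab usc; have [t0 t0ab t0m] := max1 ab usc.
pose S := [set t | a <= t <= b /\ f t = f t0].
have S0 : S t0 by [].
have iS : has_inf S by split; [exists t0|exists a => t [/andP[]]].
pose t := inf S.
have ta : a <= t by apply: lb_le_inf; [exists t0|move=> s [/andP[]]].
have tt0 : t <= t0 by apply: ge_inf => //; exact: iS.2.
have tab : a <= t <= b by rewrite ta; case/andP: t0ab => _; exact: le_trans.
have fE : f t = f t0.
  apply/eqP; rewrite eq_le t0m//=; rewrite leNgt; apply/negP => ft.
  have e0 : 0 < (f t0 - f t) / 2 by lra.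
  have [r r0 hr] := usc t tab _ e0.
  have [s [sab fs] st] := inf_adherent r0 iS.
  have ts : t <= s by apply: ge_inf; [exact: iS.2|].
  have := hr s sab; rewrite ger0_norm ?subr_ge0// fs.
  by move: st; rewrite -/t; lra.
exists t; split => //; first by move=> y; rewrite fE; exact: t0m.
move=> y yab yt; rewrite lt_neqAle fE t0m// andbT; apply/negP => /eqP fy.
by move: yt; rewrite ltNge => /negP; apply; apply: ge_inf; [exact: iS.2|].
Qed.

Lemma locmax_slope (I : R -> Prop) K (u phi : R -> R -> R) t x l r : lipon I K u ->
  0 < r -> I t -> (forall y, `|y - x| < r -> u t y - phi t y <= u t x - phi t x) ->
  der (phi t) x l -> `|l| <= K.
Proof.
move=> lu r0 It lm dl; apply/ler_addgt0Pr => e e0.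
have [q q0 hq] := dl e e0.
pose d := Num.min r q / 2.
have d0 : 0 < d by rewrite divr_gt0// lt_min r0.
have [dr dq] : d < r /\ d < q.
  by rewrite /d; case: (leP r q) => *; split; lra.
have := lm (x + d); have := lm (x - d); have := hq (x + d); have := hq (x - d).
have := lu t t (x + d) x It It; have := lu t t (x - d) x It It.
have -> : x - d - x = - d by ring.
have -> : x + d - x = d by ring.
rewrite !normrN !subrr normr0 !add0r !(gtr0_norm d0) => /ler_normlP[k1 k2] /ler_normlP[k3 k4].
move=> /(_ dq)/ler_normlP[k5 k6] /(_ dq)/ler_normlP[k7 k8] /(_ dr) k9 /(_ dr) k10.
apply/ler_normlP; split; rewrite -(ler_pM2r d0); nra.
Qed.
End FirstMax.

(** * Sup-convolution in time and its contact points *)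

Section Core.
Context {R : realType}.
Implicit Types (h : hamiltonian R) (u v P Pt Px : R -> R -> R).

Lemma C1xy_lip_x P Pt Px Bp t x y : C1xy P Pt Px -> (forall x, `|Px t x| <= Bp) ->
  `|P t x - P t y| <= Bp * `|x - y|.
Proof.
move=> cP PxB.
have cf : forall z e, 0 < e -> exists2 r, 0 < r & forall y, `|y - z| < r -> `|P t y - P t z| < e.
  by move=> z e e0; have [_ _ _ _ d] := cP; exact: der_cont (d t z) e e0.
have main : forall x y, x <= y -> `|P t y - P t x| <= Bp * (y - x).
  move=> {}x {}y xy; have := @mvt_bound R (P t) (Px t) x y 0 Bp xy _ _ _.
  rewrite mul0r subr0; apply.
  - by move=> z _; have [_ _ _ _] := cP; exact.
  - by move=> z _; exact: cf.
  - by move=> z _; rewrite subr0.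
case: (leP x y) => xy.
  by rewrite distrC (distrC x) (ger0_norm (_ : 0 <= y - x)) ?subr_ge0// main.
by rewrite (gtr0_norm (_ : 0 < x - y)) ?subr_gt0// main// ltW.
Qed.

(* [u - P], penalized quadratically in time: its maximum over [t] is the
   sup-convolution of [u - P]. *)
Definition penal (nu : R) u P t s x := u t x - P t x - (t - s) ^+ 2 / (2 * nu).

Lemma penal_lip (nu T0 T' K Bp : R) u P Pt Px t s s' x y : 0 < nu ->
  lipon (fun t => T0 <= t <= T') K u -> C1xy P Pt Px -> (forall t x, `|Px t x| <= Bp) ->
  T0 <= t <= T' -> T0 <= s <= T' -> T0 <= s' <= T' ->
  `|penal nu u P t s x - penal nu u P t s' y| <= (T' - T0) / nu * `|s - s'| + (K + Bp) * `|x - y|.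
Proof.
move=> nu0 lu cP PxB ht hs hs'.
have h1 := lu t t x y ht ht; rewrite subrr normr0 add0r in h1.
have h2 := C1xy_lip_x x y cP (PxB t).
have E : penal nu u P t s x - penal nu u P t s' y = (u t x - u t y) - (P t x - P t y)
    + (s - s') * ((2 * t - s - s') / (2 * nu)).
  by rewrite /penal; field; rewrite gt_eqF.
rewrite E; apply: le_trans (ler_normD _ _) _; rewrite addrC lerD//.
  rewrite normrM mulrC ler_wpM2r// normrM normfV (gtr0_norm (_ : 0 < 2 * nu)) ?mulr_gt0//.
  rewrite ler_pdivrMr ?mulr_gt0//.
  have -> : (T' - T0) / nu * (2 * nu) = 2 * (T' - T0) by field; rewrite gt_eqF.
  by move: ht hs hs'; clear => /andP[? ?] /andP[? ?] /andP[? ?]; apply/ler_normlP; split; lra.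
apply: le_trans (ler_normB _ _) _.
by rewrite mulrDl lerD.
Qed.

Lemma penal_cont (nu T0 T' K : R) u P Pt Px s x :
  lipon (fun t => T0 <= t <= T') K u -> C1xy P Pt Px ->
  forall t, T0 <= t <= T' -> forall e, 0 < e ->
  exists2 r, 0 < r & forall y, T0 <= y <= T' -> `|y - t| < r -> penal nu u P y s x < penal nu u P t s x + e.
Proof.
move=> lu cP t ht e e0; have e3 : 0 < e / 3 by lra.
have [r1 r10 h1] := lipon_near x lu ht e3.
have [cPP _ _ _ _] := cP.
have [r2 r20 h2] := cPP t x _ e3.
have sq := C1_quad (2 * nu)^-1 s.
have [r3 r30 h3] := C1_cont sq t e3.
exists (Num.min r1 (Num.min r2 r3)); first by rewrite !lt_min r10 r20 r30.
move=> y hy; rewrite !lt_min => /and3P[y1 y2 y3].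
have xx (r : R) : 0 < r -> `|x - x| < r by rewrite subrr normr0.
have /ltr_normlP[_ k1] := h1 y x hy y1 (xx _ r10).
have /ltr_normlP[k2 _] := h2 y x y2 (xx _ r20).
have /ltr_normlP[k3 _] := h3 y y3.
by rewrite /penal ![_ / (2 * nu)]mulrC; move: k1 k2 k3; lin.
Qed.

Lemma usc_below (f : R -> R) a b M : a <= b ->
  (forall x, a <= x <= b -> forall e, 0 < e -> exists2 r, 0 < r &
    forall y, a <= y <= b -> `|y - x| < r -> f y < f x + e) ->
  (forall x, a <= x <= b -> f x < M) -> exists2 g, 0 < g & forall x, a <= x <= b -> f x <= M - g.
Proof.
move=> ab usc fM; have [t ht tm] := max1 ab usc.
exists (M - f t); first by rewrite subr_gt0 fM.
by move=> x hx; have := tm x hx; lra.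
Qed.
End Core.

Section CorePoint.
Context {R : realType}.
Implicit Types (h : hamiltonian R) (u v P Pt Px ut : R -> R -> R).

(** [c] is the slope of the modulus of the Hamiltonians, so that subtracting [P] from [u] leaves a
    strict sub-solution: the margin is [eta], of which the modulus consumes [eta / 4]. *)
Definition cp_hyp h T0 T' u P Pt Px (K Bp c eta : R) :=
  [/\ lipon (fun t => T0 <= t <= T') K u, visc 1 h 0 T0 T'%:E u & C1xy P Pt Px] /\
  [/\ (forall t x, T0 < t -> eta + c * `|Px t x| <= Pt t x), (forall t x, `|Px t x| <= Bp),
      0 <= c & forall a p q, (a <= njct h)%N -> `|p| <= K + Bp -> `|q| <= K + Bp ->
  `|ham h a p - ham h a q| <= eta / 4 + c * `|p - q|].

(** The slope seen by [u] is [Px + z'], bounded by [K]; replacing it by [z'] in the Hamiltonian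
    costs [eta / 4 + c * |Px|], and the growth of [P] in time repays [eta + c * |Px|]. The quadratic
    penalty contributes the time slope [(t1 - s1) / nu]. *)
Lemma core_touch h T0 T' u P Pt Px K Bp c eta nu s1 t1 a x x1 x2 z z' :
  cp_hyp h T0 T' u P Pt Px K Bp c eta -> 0 < nu -> (a <= njct h)%N ->
  T0 < t1 < T' -> x1 < x < x2 -> (forall y, x1 < y < x2 -> in_edge h a y) -> C1 z z' ->
  (forall t y, T0 <= t <= T' -> x1 <= y <= x2 ->
     penal nu u P t s1 y - z y <= penal nu u P t1 s1 x - z x) ->
  ham h a (z' x) <= - ((t1 - s1) / nu) - eta + eta / 4.
Proof.
move=> [[lu vu cP] [PtPx PxB c0 modH]] nu0 aN /andP[t1a t1b] /andP[xa xb] edge cz lm.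
have cphi := C1xyD (C1xyD cP (C1xy_t (C1_quad (2 * nu)^-1 s1))) (C1xy_x cz).
have lm' : exists2 r, 0 < r & forall t y, `|t - t1| < r -> `|y - x| < r ->
    T0 <= t <= T' /\ x1 <= y <= x2.
  exists (Num.min (Num.min (t1 - T0) (T' - t1)) (Num.min (x - x1) (x2 - x))).
    by rewrite !lt_min; apply/andP; split; apply/andP; split; lra.
  move=> t y; rewrite !lt_min => /andP[/andP[/ltr_normlP[a1 a2] /ltr_normlP[a3 a4]] _].
  move=> /andP[_ /andP[/ltr_normlP[a5 a6] /ltr_normlP[a7 a8]]].
  by split; apply/andP; split; lra.
have {lm'}[r r0 hr] := lm'.
have lmx t y : `|t - t1| < r -> `|y - x| < r ->
    u t y - (P t y + (2 * nu)^-1 * (t - s1) ^+ 2 + z y) <= u t1 x - (P t1 x + (2 * nu)^-1 * (t1 - s1) ^+ 2 + z x).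
  move=> h1 h2; have [h3 h4] := hr t y h1 h2.
  have := lm t y h3 h4; rewrite /penal ![_ / (2 * nu)]mulrC.
  by lin.
have tT : in_time T0 T'%:E t1 by split; rewrite ?lte_fin.
have xe : in_edge h a x by apply: edge; rewrite xa.
have := vu.1 a _ _ _ t1 x aN cphi tT xe; rewrite !mul1r => H.
have {}H : Pt t1 x + 2 * (2 * nu)^-1 * (t1 - s1) + 0 + ham h a (Px t1 x + 0 + z' x) <= 0.
  by apply: H; exists r => // t y h1 h2; rewrite !mul1r; exact: lmx.
have [_ _ _ _ dx] := cphi.
have t1T : T0 <= t1 <= T' by rewrite !ltW.
have sl : `|Px t1 x + 0 + z' x| <= K.
  apply: (@locmax_slope _ _ K u (fun t y => P t y + (2 * nu)^-1 * (t - s1) ^+ 2 + z y) t1 x _ r lu r0 t1T _ (dx t1 x)) => y yx; apply: lmx => //.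
  by rewrite subrr normr0.
have PB := PxB t1 x; have Bp0 : 0 <= Bp by exact: le_trans PB.
have zB : `|z' x| <= K + Bp.
  have E : z' x = (Px t1 x + 0 + z' x) - Px t1 x by ring.
  by rewrite E; apply: le_trans (ler_normB _ _) _; exact: lerD.
have := modH a (z' x) (Px t1 x + 0 + z' x) aN zB.
have -> : z' x - (Px t1 x + 0 + z' x) = - Px t1 x by ring.
rewrite normrN => /(_ (le_trans sl _)); rewrite lerDl => /(_ Bp0) /ler_normlP[_ h1].
have h2 := PtPx t1 x t1a.
have E : 2 * (2 * nu)^-1 * (t1 - s1) = (t1 - s1) / nu by field; rewrite gt_eqF.
rewrite E in H; move: H h1 h2; lin.
Qed.

(** One-sided semi-differentiability of the sup-convolution. If [ut s] fell below the line of slope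
    [p] on one side of [xb], [slope_touch] or its mirror image would produce a contact with a slope
    beyond [p], where the Hamiltonian is at least [c'], more than [core_touch] allows. *)
Lemma core_slope (right : bool) h T0 T' u P Pt Px K Bp c eta nu ut sb xb tb (p c' : R) a :
  cp_hyp h T0 T' u P Pt Px K Bp c eta -> 0 < nu -> 0 < eta -> (a <= njct h)%N ->
  T0 < sb < T' -> T0 < tb ->
  (forall s x, T0 <= s <= T' -> exists t, [/\ T0 <= t <= T', ut s x = penal nu u P t s x &
     forall t', T0 <= t' <= T' -> penal nu u P t' s x <= ut s x]) ->
  (forall om, 0 < om -> exists2 r, 0 < r & forall s x t, `|s - sb| < r -> `|x - xb| < r ->
     T0 <= s <= T' -> T0 <= t <= T' -> penal nu u P t s x = ut s x -> tb - om < t /\ t < T') ->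
  (exists2 r, 0 < r & forall y, `|y - xb| < r -> (if right then xb < y else y < xb) -> in_edge h a y) ->
  - ((tb - sb) / nu) - eta / 2 < c' ->
  (forall q, (if right then q <= p else p <= q) -> c' <= ham h a q) ->
  exists2 r, 0 < r & forall s x, `|s - sb| < r -> `|x - xb| < r ->
    (if right then xb <= x else x <= xb) -> ut s xb + p * (x - xb) <= ut s x.
Proof.
move=> cp nu0 eta0 aN /andP[sb0 sb1] tb0 hut near [r1 r10 edge] hc hp.
have [[lu vu cP] [PtPx PxB _ _]] := cp.
(* Near [(sb, xb)], [s] moves by less than [om] and the optimal time decreases by less than [om], so
   [(t - s) / nu] decreases by at most [2 * om / nu <= eta / 4]. The bound [(tb - T0) / 2] keeps the
   optimal time after [T0]. *)
have [om [om0 om1 om2]] : exists om, [/\ 0 < om, om <= eta * nu / 8 & om <= (tb - T0) / 2].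
  exists (Num.min (eta * nu / 8) ((tb - T0) / 2)); rewrite !ge_min !lexx orbT; split => //.
  by rewrite lt_min; apply/andP; split; [by rewrite divr_gt0// mulr_gt0|lra].
have [r2 r20 hr2] := near om om0.
pose r := Num.min (Num.min r1 r2) (Num.min om (Num.min (sb - T0) (T' - sb))).
have r0 : 0 < r by rewrite !lt_min r10 r20 om0 /=; apply/andP; lra.
have rP d : d < r -> [/\ d < r1, d < r2, d < om, d < sb - T0 & d < T' - sb].
  by rewrite !lt_min => /andP[/andP[-> ->] /and3P[-> -> ->]].
have lip s : T0 <= s <= T' -> forall x y, `|ut s x - ut s y| <= (K + Bp) * `|x - y|.
  have half : forall x y, T0 <= s <= T' -> ut s x - ut s y <= (K + Bp) * `|x - y|.
    move=> x y hs; have [t [ht tE tm]] := hut s x hs; have [t' [ht' tE' tm']] := hut s y hs.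
    have := penal_lip x y nu0 lu cP PxB ht hs hs; rewrite subrr normr0 mulr0 add0r.
    move=> /ler_normlP[_]; have := tm' t ht; rewrite tE; lin.
  move=> hs x y; apply/ler_normlP; have := half x y hs; have := half y x hs.
  by rewrite (distrC y x); clear => *; split; lra.
have touch s x x1 x2 z z' : `|s - sb| < r -> x1 < x < x2 ->
    (forall y, x1 <= y <= x2 -> `|y - xb| < r) ->
    (forall y, x1 < y < x2 -> if right then xb < y else y < xb) -> C1 z z' ->
    (forall y, x1 <= y <= x2 -> ut s y - z y <= ut s x - z x) -> ham h a (z' x) < c'.
  move=> ss xx hx12 side cz zm.
  have [_ s2 s3 s4 s5] := rP _ ss.
  have hs : T0 <= s <= T' by move: s4 s5; clear => /ltr_normlP[? ?] /ltr_normlP[? ?]; apply/andP; lra.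
  have [t [ht tE tm]] := hut s x hs.
  have xI : x1 <= x <= x2 by case/andP: xx => ? ?; rewrite !ltW.
  have [_ x2' _ _ _] := rP _ (hx12 x xI).
  have [t1 t2] := hr2 s x t s2 x2' hs ht (esym tE).
  have tI : T0 < t < T' by rewrite t2 andbT; move: t1 om2 tb0; lin.
  have edge' y : x1 < y < x2 -> in_edge h a y.
    move=> yy; have yI : x1 <= y <= x2 by case/andP: yy => ? ?; rewrite !ltW.
    by have [y1 _ _ _ _] := rP _ (hx12 y yI); apply: edge => //; exact: side.
  have lm t' y : T0 <= t' <= T' -> x1 <= y <= x2 ->
      penal nu u P t' s y - z y <= penal nu u P t s x - z x.
    move=> ht' hy; rewrite -tE; apply: le_trans (zm y hy).
    by rewrite lerD2r; have [t'' [ht'' _ tm'']] := hut s y hs; exact: tm''.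
  have := core_touch cp nu0 aN tI xx edge' cz lm.
  have : - ((t - s) / nu) <= - ((tb - sb) / nu) + eta / 4.
    rewrite -lerBlDl opprK addrC -mulrBl ler_pdivrMr//.
    move: s3 t1 om1; clear => /ltr_normlP[? ?] *; lra.
  move: hc; lin.
exists r => // s x ss xr side.
have [->|xNb] := eqVneq x xb; first by rewrite subrr mulr0 addr0.
have hs : T0 <= s <= T'.
  by have [_ _ _ s4 s5] := rP _ ss; move: s4 s5; clear => /ltr_normlP[? ?] /ltr_normlP[? ?]; apply/andP; lra.
rewrite leNgt; apply/negP => lt.
case: right edge hp touch side => edge hp touch side.
  have xbx : xb < x by rewrite lt_neqAle eq_sym xNb.
  have [||z [z' [y [cz hy hz ym]]]] := @slope_touch R (ut s) (K + Bp) xb x p xbx.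
  - by move=> *; exact: lip.
  - by move: lt; lin.
  have Hc y' : xb <= y' <= x -> `|y' - xb| < r.
    move: xr xbx; clear => xr ? /andP[? ?]; move: xr; rewrite ger0_norm; last lra.
    by rewrite ger0_norm; lra.
  have Hs y' : xb < y' < x -> xb < y' by case/andP.
  by have := touch s y xb x z z' ss hy Hc Hs cz ym; rewrite ltNge hp.
have xbx : x < xb by rewrite lt_neqAle xNb.
have [||z [z' [y [cz hy hz ym]]]] := @slope_touch_r R (ut s) (K + Bp) x xb p xbx.
- by move=> *; exact: lip.
- by move: lt; lin.
have Hc y' : x <= y' <= xb -> `|y' - xb| < r.
  move: xr xbx; clear => xr ? /andP[? ?]; move: xr; rewrite ler0_norm; last lra.
  by rewrite ler0_norm; lra.
have Hs y' : x < y' < xb -> y' < xb by case/andP.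
by have := touch s y x xb z z' ss hy Hc Hs cz ym; rewrite ltNge hp.
Qed.

End CorePoint.

Section CorePoint2.
Context {R : realType}.
Implicit Types (h : hamiltonian R) (u v P Pt Px ut : R -> R -> R).

(* Smoothing the concave kink uses all the slopes in between, and the quasi-convexity
   of the Hamiltonian handles them at once. *)
Lemma super_kink h a T0 T' v (th k sb xb pr pl pr2 pl2 c2 : R) :
  visc_int (-1) h 0 T0 T'%:E v -> (a <= njct h)%N -> in_edge h a xb -> T0 < sb < T' ->
  (forall t x e, T0 <= t <= T' -> 0 < e -> exists2 r, 0 < r &
    forall s y, T0 <= s <= T' -> `|s - t| < r -> `|y - x| < r -> v t x - e < v s y) ->
  0 < k -> pr2 < pr -> pl < pl2 -> pr <= pl -> (forall q, pr2 <= q <= pl2 -> ham h a q <= c2) ->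
  (exists2 r, 0 < r & forall s x, `|s - sb| < r -> `|x - xb| < r ->
    v sb xb + th * (s - sb) - k * (s - sb) ^+ 2 + (if xb <= x then pr else pl) * (x - xb) <= v s x) ->
  - th <= c2.
Proof.
move=> vv aN xe /andP[sb0 sb1] lsc k0 prr pll prl Hc [r0 r00 low].
rewrite leNgt; apply/negP => thc.
have [r1 r10 edge] := in_edge_nbhs xe.
pose e := - th - c2; have e0 : 0 < e by rewrite /e; lra.
have [rho [rho0 rr0 rr1 rr2 [rr3 rre]]] : exists rho, [/\ 0 < rho, rho < r0, rho < r1,
    rho < sb - T0 & rho < T' - sb /\ 4 * k * rho < e].
  pose m := Num.min (Num.min r0 r1) (Num.min (Num.min (sb - T0) (T' - sb)) (e / (4 * k))).
  have m0 : 0 < m.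
    by rewrite !lt_min r00 r10 /= divr_gt0 ?mulr_gt0// andbT; apply/andP; split; lra.
  have : m <= r0 /\ m <= r1 /\ m <= sb - T0 /\ m <= T' - sb /\ m <= e / (4 * k).
    by rewrite /m !ge_min !lexx !orbT.
  rewrite ler_pdivlMr ?mulr_gt0// => -[m1 [m2 [m3 [m4 m5]]]].
  exists (m / 2); split; [by move: m0; lin|by move: m1 m2 m3 m4 m0; lin..|].
  by split; [move: m4 m0; lin|move: m5 m0 k0; clear; nra].
pose D := (pl2 - pr2) / 2; have D0 : 0 < D by rewrite /D; lra.
pose g := Num.min (k * rho ^+ 2) (Num.min ((pr - pr2) * rho) ((pl2 - pl) * rho)).
have g0 : 0 < g.
  have a1 : 0 < k * rho ^+ 2 by rewrite mulr_gt0 ?exprn_gt0.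
  have a2 : 0 < (pr - pr2) * rho by rewrite mulr_gt0 ?subr_gt0.
  have a3 : 0 < (pl2 - pl) * rho by rewrite mulr_gt0 ?subr_gt0.
  by rewrite !lt_min a1 a2 a3.
have [g1 [g2 g3]] : g <= k * rho ^+ 2 /\ g <= (pr - pr2) * rho /\ g <= (pl2 - pl) * rho.
  by rewrite /g !ge_min !lexx !orbT.
(* Rounding the kink of half-opening [D] at scale [d] costs at most [D * d / 2 = g / 2], less than
   the gain [g] available on the boundary of the box; the minimum is therefore interior. *)
pose d := g / D; have d0 : 0 < d by exact: divr_gt0.
have Dd : D * d = g by rewrite /d mulrC divfK// gt_eqF.
pose z y := (pr2 + pl2) / 2 * y + (- D) * hub d y.
pose z' y := (pr2 + pl2) / 2 + (- D) * hub' d y.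
have cz : C1 (fun x => z (x - xb)) (fun x => z' (x - xb)).
  have := C1_comp (C1D (C1_aff ((pr2 + pl2) / 2) 0) (C1Z (- D) (C1_hub d0))) (C1_aff 1 (- xb)) => hh.
  by apply: (C1_eq hh) => y; rewrite /z /z' ?addr0 mul1r ?mulr1.
have z'B y : pr2 <= z' y <= pl2.
  have /andP[h1 h2] := hub'_bnd y d0.
  have h3 : D * hub' d y <= D * 1 by rewrite ler_pM2l.
  have h4 : D * (-1) <= D * hub' d y by rewrite ler_pM2l.
  by rewrite /z'; move: h3 h4; rewrite /D; clear=> *; apply/andP; split; lra.
have zR y : 0 <= y -> z y <= pr2 * y + g / 2.
  move=> y0; have [_ /andP[h1 _]] := hub_bnd y d0; rewrite ger0_norm// in h1.
  have h2 : D * (y - d / 2) <= D * hub d y by rewrite ler_pM2l.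
  by rewrite /z; move: h2 Dd; rewrite /D; lin.
have zL y : y <= 0 -> z y <= pl2 * y + g / 2.
  move=> y0; have [_ /andP[h1 _]] := hub_bnd y d0; rewrite ler0_norm// in h1.
  have h2 : D * (- y - d / 2) <= D * hub d y by rewrite ler_pM2l.
  by rewrite /z; move: h2 Dd; rewrite /D; lin.
have z0 : z 0 = 0 by rewrite /z hub0// !mulr0 addr0.
have cphi := C1xyD (C1xyD (C1xy_t (C1_aff th (- (th * sb)))) (C1xy_t (C1_quad (- (2 * k)) sb))) (C1xy_x cz).
pose phi s x := th * s + - (th * sb) + - (2 * k) * (s - sb) ^+ 2 + z (x - xb).
have inT s : sb - rho <= s <= sb + rho -> T0 <= s <= T'.
  by move: rr2 rr3; clear => ? ? /andP[? ?]; apply/andP; lra.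
have [|||s1 [x1 [hs1 hx1 sm]]] := @max2 R (fun s x => - (v s x - phi s x)) (sb - rho) (sb + rho) (xb - rho) (xb + rho).
- by move: rho0; lin.
- by move: rho0; lin.
- move=> t x ht hx e1 e10; have e2 : 0 < e1 / 2 by rewrite divr_gt0.
  have [q q0 hq] := lsc t x _ (inT _ ht) e2.
  have [cp _ _ _ _] := cphi; have [q' q'0 hq'] := cp t x _ e2.
  exists (Num.min q q'); first by rewrite lt_min q0.
  move=> s y hs hy; rewrite !lt_min => /andP[h1 h2] /andP[h3 h4].
  have := hq s y (inT _ hs) h1 h3; have := hq' s y h2 h4.
  by rewrite -/(phi s y) -/(phi t x) => /ltr_normlP[_]; lin.
have h1 := sm sb xb; have {h1} : v s1 x1 - phi s1 x1 <= v sb xb.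
  have h2 : phi sb xb = 0 by rewrite /phi !subrr z0; ring.
  have := h1 _ _; rewrite h2 => h3; rewrite -lerN2 -[v sb xb]subr0; apply: h3; move: rho0; clear => ?; apply/andP; split; lra.
move=> hmin.
have lows : v sb xb + th * (s1 - sb) - k * (s1 - sb) ^+ 2 + (if xb <= x1 then pr else pl) * (x1 - xb) <= v s1 x1.
  apply: low; apply/ltr_normlP; move: hs1 hx1 rr0; clear => /andP[? ?] /andP[? ?] ?; split; lra.
have gk : k * (s1 - sb) ^+ 2 + (if xb <= x1 then pr - pr2 else pl - pl2) * (x1 - xb) <= g / 2.
  move: lows hmin; rewrite /phi; case: (leP xb x1) => hx.
    by have := zR (x1 - xb); rewrite subr_ge0 => /(_ hx); lin.
  by have := zL (x1 - xb); rewrite subr_le0 => /(_ (ltW hx)); lin.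
have sqk : 0 <= k * (s1 - sb) ^+ 2 by rewrite mulr_ge0 ?sqr_ge0 ?ltW.
have xk : 0 <= (if xb <= x1 then pr - pr2 else pl - pl2) * (x1 - xb).
  case: (leP xb x1) => hx; first by rewrite mulr_ge0// subr_ge0// ltW.
  by rewrite mulr_le0// subr_le0 ltW.
have s1i : sb - rho < s1 < sb + rho.
  move: hs1 => /andP[h1 h2]; rewrite !lt_neqAle h1 h2 !andbT; apply/andP; split; apply/negP => /eqP E.
    have : (s1 - sb) ^+ 2 = rho ^+ 2 by rewrite -E; ring.
    by move=> E2; move: gk xk g1 g0; rewrite E2; lin.
  have : (s1 - sb) ^+ 2 = rho ^+ 2 by rewrite E; ring.
  by move=> E2; move: gk xk g1 g0; rewrite E2; lin.
have x1i : xb - rho < x1 < xb + rho.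
  move: hx1 => /andP[h1 h2]; rewrite !lt_neqAle h1 h2 !andbT; apply/andP; split; apply/negP => /eqP E.
    have E2 : x1 - xb = - rho by rewrite -E; ring.
    have lt : (xb <= x1) = false by apply/negbTE; rewrite -ltNge; move: E2 rho0; lin.
    by move: gk sqk g3 g0; rewrite E2 lt; lin.
  have E2 : x1 - xb = rho by rewrite E; ring.
  have lt : xb <= x1 by move: E2 rho0; lin.
  by move: gk sqk g2 g0; rewrite E2 lt; lin.
have s1T : in_time T0 T'%:E s1.
  by move: s1i rr2 rr3; clear => /andP[? ?] *; split; rewrite ?lte_fin; lra.
have x1e : in_edge h a x1.
  by apply: edge; apply/ltr_normlP; move: x1i rr1; clear => /andP[? ?] *; split; lra.
have := vv a _ _ _ s1 x1 aN cphi s1T x1e; rewrite mulr0.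
have lm : locmax (fun s y => -1 * (v s y - phi s y)) s1 x1.
  exists (Num.min (Num.min (s1 - (sb - rho)) (sb + rho - s1)) (Num.min (x1 - (xb - rho)) (xb + rho - x1))).
    by rewrite !lt_min; move: s1i x1i; clear => /andP[? ?] /andP[? ?]; apply/andP; split; apply/andP; split; lra.
  move=> s y; rewrite !lt_min => /andP[/andP[/ltr_normlP[a1 a2] /ltr_normlP[a3 a4]] _].
  move=> /andP[_ /andP[/ltr_normlP[a5 a6] /ltr_normlP[a7 a8]]]; rewrite !mulN1r; apply: sm; apply/andP.
    by move: a1 a2 a3 a4; lin.
  by move: a5 a6 a7 a8; lin.
move=> /(_ lm); rewrite !addr0 !add0r mulN1r oppr_le0 => H.
have := Hc _ (z'B (x1 - xb)).
have : - (4 * k * rho) <= 2 * - (2 * k) * (s1 - sb) <= 4 * k * rho.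
  by move: s1i k0; clear => /andP[? ?] ?; apply/andP; split; nra.
move: H rre; rewrite /e; clear => H rre /andP[? ?]; lra.
Qed.
End CorePoint2.

Section CorePoint3.
Context {R : realType}.
Implicit Types (h : hamiltonian R) (u v P Pt Px ut : R -> R -> R).

(** Comparison is run on time intervals where the limiters are constant; the bound by the
    neighbouring minima lets the limiter dominate the minimal Hamiltonians at a kink. *)
Definition adm_lim h (A : nat -> R) T0 T1 :=
  (forall a t, (1 <= a)%N -> (a <= njct h)%N -> in_time T0 T1 t -> limiter h a t = A a) /\
  (forall a, (1 <= a)%N -> (a <= njct h)%N ->
     ham h a.-1 (pmin h a.-1) <= A a /\ ham h a (pmin h a) <= A a).

(** Let [th] be the time slope at the contact and [c' = - th - eta / 4]. By [core_slope] the
    sup-convolution lies above a kink whose slopes come from level [c'] of the Hamiltonians, hence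
    so does [v] after a shift. Inside an edge, [super_kink] then forces [- th <= c' + eta / 8]. At a
    junction, [u] gives [A a <= - th - eta] while [v] gives [- th <= max(c', A a)]. Both are
    absurd. *)
Lemma core_point h A T0 T' u v P Pt Px ut K Bp c eta nu M tb sb xb :
  wf h -> adm_lim h A T0 T'%:E -> cp_hyp h T0 T' u P Pt Px K Bp c eta ->
  0 <= K -> 0 <= Bp -> 0 < nu -> 0 < eta ->
  visc (-1) h 0 T0 T'%:E v ->
  (forall t x e, T0 <= t <= T' -> 0 < e -> exists2 r, 0 < r &
    forall s y, T0 <= s <= T' -> `|s - t| < r -> `|y - x| < r -> v t x - e < v s y) ->
  T0 < sb < T' -> T0 < tb < T' ->
  (forall s x, T0 <= s <= T' -> exists t, [/\ T0 <= t <= T', ut s x = penal nu u P t s x &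
     forall t', T0 <= t' <= T' -> penal nu u P t' s x <= ut s x]) ->
  (forall om, 0 < om -> exists2 r, 0 < r & forall s x t, `|s - sb| < r -> `|x - xb| < r ->
     T0 <= s <= T' -> T0 <= t <= T' -> penal nu u P t s x = ut s x -> tb - om < t /\ t < T') ->
  ut sb xb = penal nu u P tb sb xb -> v sb xb = ut sb xb - M ->
  (exists2 r, 0 < r & forall s x, `|s - sb| < r -> `|x - xb| < r -> ut s x - M <= v s x) -> False.
Proof.
move=> w [limA admA] cp K0 Bp0 nu0 eta0 vv lsc sbT /andP[tb0 tb1] hut near utb vb [r0 r00 vge].
have [[lu vu cP] [PtPx PxB c0 modH]] := cp.
have [sb0 sb1] := andP sbT.
have sbT' : T0 <= sb <= T' by rewrite !ltW.
have tbT' : T0 <= tb <= T' by rewrite !ltW.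
pose th := (tb - sb) / nu.
pose c' := - th - eta / 4.
have hc : - ((tb - sb) / nu) - eta / 2 < c' by rewrite /c' -/th; lra.
have [_ _ ah] := w.
have lip_sb x y : ut sb x - ut sb y <= (K + Bp) * `|x - y|.
  have [t [ht tE tm]] := hut sb x sbT'; have [t' [ht' tE' tm']] := hut sb y sbT'.
  have := penal_lip x y nu0 lu cP PxB ht sbT' sbT'; rewrite subrr normr0 mulr0 add0r.
  by move=> /ler_normlP[_]; have := tm' t ht; rewrite tE; lin.
have time s : T0 <= s <= T' -> ut sb xb + th * (s - sb) - (2 * nu)^-1 * (s - sb) ^+ 2 <= ut s xb.
  move=> hs; have [t [ht tE tm]] := hut s xb hs; have := tm tb tbT'.
  apply: le_trans; rewrite utb /penal /th le_eqVlt; apply/orP; left; apply/eqP.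
  by field; rewrite gt_eqF.
have k0 : 0 < (2 * nu)^-1 by rewrite invr_gt0 mulr_gt0.
have inr r1 : 0 < r1 -> exists2 r, 0 < r & forall s x : R, `|s - sb| < r -> `|x - xb| < r ->
    [/\ `|s - sb| < r0, `|s - sb| < r1, `|x - xb| < r0, `|x - xb| < r1 & T0 <= s <= T'].
  move=> r10; exists (Num.min (Num.min r0 r1) (Num.min (sb - T0) (T' - sb))).
    by rewrite !lt_min r00 r10 /=; apply/andP; split; rewrite subr_gt0.
  move=> s x; rewrite !lt_min => /andP[/andP[-> ->] /andP[/ltr_normlP[h1 h2] /ltr_normlP[h3 h4]]].
  move=> /andP[/andP[-> ->] _]; split => //.
  by move: h1 h2 h3 h4; clear => *; apply/andP; split; lra.
have [[a aN xe]|[a [a1 aN xE]]] := in_edge_cases xb w.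
- have ga := ah a aN; have [re re0 edge] := in_edge_nbhs xe.
  have edgeS (right : bool) : exists2 r, 0 < r & forall y, `|y - xb| < r -> (if right then xb < y else y < xb) -> in_edge h a y.
    by exists re => // y hy _; exact: edge.
  have slope right p := @core_slope R right h T0 T' u P Pt Px K Bp c eta nu ut sb xb tb p c' a cp nu0 eta0 aN sbT tb0 hut near (edgeS right) hc.
  (* Otherwise every slope would be admissible in [core_slope], including [K + Bp + 1], which
     exceeds the Lipschitz constant of [ut sb]. *)
  have minc : ham h a (pmin h a) < c'.
    rewrite ltNge; apply/negP => mc.
    have [|r r0' hr] := slope true (K + Bp + 1).
      by move=> q _; apply: le_trans mc _; exact: goodH_min.
    have := hr sb (xb + r / 2); rewrite subrr normr0 => /(_ r0').
    have -> : xb + r / 2 - xb = r / 2 by ring.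
    have r2 : 0 < r / 2 by move: r0'; lin.
    rewrite gtr0_norm// lerDl (ltW r2) => /(_ _ isT) h1.
    have : r / 2 < r by move: r0'; lin.
    move=> /h1; have := lip_sb (xb + r / 2) xb.
    have -> : xb + r / 2 - xb = r / 2 by ring.
    by rewrite gtr0_norm//; move: r2; clear; nra.
  have [pr [pr0 prE prq]] := goodH_root_lt ga minc.
  have [pl [pl0 plE plq]] := goodH_root_lt_r ga minc.
  have cc : c' < c' + eta / 8 by move: eta0; lin.
  have [pr2 [pr20 pr2E pr2q]] := goodH_root_lt ga (lt_trans minc cc).
  have [pl2 [pl20 pl2E pl2q]] := goodH_root_lt_r ga (lt_trans minc cc).
  have prr : pr2 < pr.
    rewrite ltNge; apply/negP => le; have := goodH_ninc ga le (ltW pr20).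
    by rewrite prE pr2E leNgt cc.
  have pll : pl < pl2.
    rewrite ltNge; apply/negP => le; have := goodH_ndec ga (ltW pl20) le.
    by rewrite plE pl2E leNgt cc.
  have [rR rR0 slR] := slope true pr prq.
  have [rL rL0 slL] := slope false pl plq.
  have : - th <= c' + eta / 8.
    apply: (super_kink vv.1 aN xe sbT lsc k0 prr pll) => //.
    - exact: ltW (lt_trans pr0 pl0).
    - by move=> q hq; apply: (goodH_qc ga _ _ hq); rewrite ?pr2E ?pl2E.
    have m0 : 0 < Num.min rR rL by rewrite lt_min rR0 rL0.
    have [r r0' hr] := inr _ m0; exists r => // s x hs hx.
    have [s1 s2 x1 x2 sT] := hr s x hs hx.
    rewrite !lt_min in s2 x2; case/andP: s2 => s2 s3; case/andP: x2 => x2 x3.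
    have h1 := vge s x s1 x1; have h2 := time s sT.
    apply: le_trans h1; rewrite vb.
    case: (leP xb x) => xx.
      by have := slR s x s2 x2 xx; move: h2; lin.
    by have := slL s x s3 x3 (ltW xx); move: h2; lin.
  by rewrite /c'; move: eta0; lin.
- have aN' : (a.-1 <= njct h)%N by apply: leq_trans aN; exact: leq_pred.
  have gl := ah _ aN'; have gr := ah _ aN.
  have [admL admR] := admA a a1 aN.
  have [pr [pr0 prm prq]] := goodH_root c' gr.
  have [pl [pl0 plm plq]] := goodH_root_r c' gl.
  have edgeR : exists2 r, 0 < r & forall y, `|y - xb| < r -> (if true then xb < y else y < xb) -> in_edge h a y.
    have [r r0' hr] := in_edge_right w a1 aN; exists r => // y /ltr_normlP[_ y2] yx.
    by apply: hr; rewrite -xE//; move: y2; lin.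
  have edgeL : exists2 r, 0 < r & forall y, `|y - xb| < r -> (if false then xb < y else y < xb) -> in_edge h a.-1 y.
    have [r r0' hr] := in_edge_left w a1 aN; exists r => // y /ltr_normlP[y2 _] yx.
    by apply: hr; rewrite -xE//; move: y2; lin.
  have [rR rR0 slR] := @core_slope R true h T0 T' u P Pt Px K Bp c eta nu ut sb xb tb pr c' a cp nu0 eta0 aN sbT tb0 hut near edgeR hc prq.
  have [rL rL0 slL] := @core_slope R false h T0 T' u P Pt Px K Bp c eta nu ut sb xb tb pl c' a.-1 cp nu0 eta0 aN' sbT tb0 hut near edgeL hc plq.
  have tT : in_time T0 T'%:E tb by split; rewrite ?lte_fin.
  have sT : in_time T0 T'%:E sb by split; rewrite ?lte_fin.
  (* A kink of slope [K + Bp] on both sides stays above [u - P], whatever its shape; the junction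
     inequality for [u] then retains the limiter. *)
  have subA : A a <= - th - eta.
    have cphi := C1xyD cP (C1xy_t (C1_quad (2 * nu)^-1 sb)).
    have := vu.2 a _ _ _ (- (K + Bp)) (K + Bp) tb a1 aN cphi tT; rewrite -xE !mul1r.
    have lm : locmax (fun s y => 1 * (u s y - (P s y + (2 * nu)^-1 * (s - sb) ^+ 2) - kink (- (K + Bp)) (K + Bp) xb y)) tb xb.
      exists (Num.min (tb - T0) (T' - tb)); first by rewrite lt_min !subr_gt0 tb0.
      move=> s y; rewrite lt_min => /andP[/ltr_normlP[h1 h2] /ltr_normlP[h3 h4]] _.
      have hs : T0 <= s <= T' by move: h1 h2 h3 h4; clear => *; apply/andP; split; lra.
      have := penal_lip y xb nu0 lu cP PxB hs sbT' sbT'; rewrite subrr normr0 mulr0 add0r.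
      have [t [ht tE tm]] := hut sb xb sbT'; have := tm s hs; rewrite utb /penal.
      have kE : kink (- (K + Bp)) (K + Bp) xb y = (K + Bp) * `|y - xb|.
        rewrite /kink; case: (leP xb y) => yx.
          by rewrite pos_id ?subr_ge0// pos_le0 ?subr_le0// ger0_norm ?subr_ge0//; ring.
        have [p1 p2] : y - xb <= 0 /\ 0 <= xb - y by move: yx; clear; split; lra.
        by rewrite (pos_le0 p1) (pos_id p2) ler0_norm//; ring.
      have k00 : kink (- (K + Bp)) (K + Bp) xb xb = 0 by rewrite /kink subrr pos_le0//; ring.
      rewrite kE k00 ![_ / (2 * nu)]mulrC => h5 /ler_normlP[_ h6]; move: h5 h6; lin.
    move=> /(_ lm); set J := junction_ham _ _ _ _ _ => H.
    have JA : A a <= J by rewrite /J /junction_ham limA// !le_max lexx !orbT.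
    have h1 := PtPx tb xb tb0; have h2 : 0 <= c * `|Px tb xb| by rewrite mulr_ge0.
    have E : 2 * (2 * nu)^-1 * (tb - sb) = th by rewrite /th; field; rewrite gt_eqF.
    by rewrite E in H; move: H JA h1 h2; lin.
  have cphi := C1xyD (C1xy_t (C1_aff th (- (th * sb)))) (C1xy_t (C1_quad (- (2 * nu)^-1) sb)).
  have := vv.2 a _ _ _ pl pr sb a1 aN cphi sT; rewrite -xE.
  have lm : locmax (fun s y => -1 * (v s y - (th * s + - (th * sb) + - (2 * nu)^-1 * (s - sb) ^+ 2) - kink pl pr xb y)) sb xb.
    have m0 : 0 < Num.min rR rL by rewrite lt_min rR0 rL0.
    have [r r0' hr] := inr _ m0; exists r => // s x hs hx.
    have [s1 s2 x1 x2 sT'] := hr s x hs hx.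
    rewrite !lt_min in s2 x2; case/andP: s2 => s2 s3; case/andP: x2 => x2 x3.
    have h1 := vge s x s1 x1; have h2 := time s sT'.
    have k00 : kink pl pr xb xb = 0 by rewrite /kink subrr pos_le0//; ring.
    rewrite k00 vb /kink; case: (leP xb x) => xx.
      rewrite (pos_id (y := x - xb)) ?subr_ge0// (pos_le0 (y := xb - x)) ?subr_le0//.
      by have := slR s x s2 x2 xx; move: h1 h2; lin.
    have [p1 p2] : x - xb <= 0 /\ 0 <= xb - x by move: xx; clear; split; lra.
    rewrite (pos_le0 p1) (pos_id p2).
    by have := slL s x s3 x3 (ltW xx); move: h1 h2; lin.
  move=> /(_ lm); rewrite mulr0 mulN1r oppr_le0 subrr mulr0 !addr0 !add0r.
  set J := junction_ham _ _ _ _ _ => H.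
  have JA : J <= Num.max c' (A a).
    have mx (m : R) : m <= A a -> Num.max c' m <= Num.max c' (A a).
      by move=> mA; rewrite ge_max !le_max lexx mA orbT.
    have h1 := le_trans plm (mx _ admL); have h2 := le_trans prm (mx _ admR).
    by rewrite /J /junction_ham limA// !ge_max h1 h2 le_max lexx orbT.
  move: JA subA H eta0; rewrite /c' le_max; clear => /orP[] *; lra.
Qed.
End CorePoint3.

(** * Localization of the maximum *)

Section CpCore.
Context {R : realType}.
Implicit Types (h : hamiltonian R) (u v P Pt Px ut : R -> R -> R).

Definition lsc_on (I : R -> Prop) v := forall t x e, I t -> 0 < e -> exists2 r, 0 < r &
    forall s y, I s -> `|s - t| < r -> `|y - x| < r -> v t x - e < v s y.

(** The maximum of the sup-convolution minus [v] is at least [gam]. The hypotheses on [P] exclude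
    large [x] and late times from it, and a small [nu] keeps [t] and [s] so close that the initial
    ordering excludes times near [T0]. *)
Lemma cp_core h A T0 T' Tm u v P Pt Px K Bp c eta gam X ts xs :
  wf h -> adm_lim h A T0 T'%:E -> cp_hyp h T0 T' u P Pt Px K Bp c eta ->
  0 <= K -> 0 <= Bp -> 0 < eta -> 0 < gam -> 0 <= X -> T0 < Tm < T' ->
  visc (-1) h 0 T0 T'%:E v -> lsc_on (fun t => T0 <= t <= T') v ->
  (forall x, u T0 x <= v T0 x) -> (forall t x, T0 <= t -> 0 <= P t x) ->
  (forall t s x, T0 <= t <= T' -> T0 <= s <= T' -> X <= `|x| -> u t x - P t x - v s x < 0) ->
  (forall t s x, Tm <= t <= T' -> T0 <= s <= T' -> u t x - P t x - v s x < 0) ->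
  T0 <= ts <= T' -> gam <= u ts xs - P ts xs - v ts xs -> False.
Proof.
move=> w adm cp K0 Bp0 eta0 gam0 X0 /andP[T0m TmT] vv lsc init P0 far late tsI hgam.
have [[lu vu cP] [PtPx PxB c0 modH]] := cp.
have T0T : T0 < T' by exact: lt_trans TmT.
have T0I : T0 <= T0 <= T' by rewrite lexx ltW.
have XX : - X <= X by move: X0; lin.
have [tv [xv [tvI xvI vmin]]] : exists t x, [/\ T0 <= t <= T', - X <= x <= X &
    forall s y, T0 <= s <= T' -> - X <= y <= X -> - v s y <= - v t x].
  apply: (max2 (ltW T0T) XX) => t x tI _ e e0.
  have [r r0 hr] := lsc t x e tI e0; exists r => // s y sI _ h1 h2.
  by have := hr s y sI h1 h2; lin.
pose Bd := `|u T0 0 + K * (T' - T0 + X) - v tv xv|.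
have Bd0 : 0 <= Bd by exact: normr_ge0.
have hBd t s x : T0 <= t <= T' -> T0 <= s <= T' -> `|x| <= X -> u t x - P t x - v s x <= Bd.
  move=> tI sI xX; have := lu t T0 x 0 tI T0I; rewrite subr0 => /ler_normlP[_ h1].
  have h2 : K * (`|t - T0| + `|x|) <= K * (T' - T0 + X).
    rewrite ler_wpM2l// lerD//; case/andP: tI; clear => *; rewrite ger0_norm; lra.
  have h3 := vmin s x sI; rewrite -ler_norml in h3; have {}h3 := h3 xX.
  have h4 : 0 <= P t x by apply: P0; case/andP: tI.
  have := ler_norm (u T0 0 + K * (T' - T0 + X) - v tv xv); rewrite -/Bd.
  by move: h1 h2 h3 h4; lin.
have K1 : 0 < 8 * (K + 1) by move: K0; lin.
(* Over a duration [kap], [u] varies by at most [gam / 8]; together with the loss [gam / 4] on [v],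
   the initial layer spends at most [gam / 2]. *)
pose kap := gam / (8 * (K + 1)); have kap0 : 0 < kap by rewrite divr_gt0.
have kapK : K * kap <= gam / 8.
  by rewrite /kap mulrA ler_pdivrMr//; move: K0 gam0; clear; nra.
have [|d0 d00 hd] := @cover1 R (- X) X (fun d x => forall s, T0 <= s <= T' -> s < T0 + d -> u T0 x - gam / 4 <= v s x).
  move=> x _; have g8 : 0 < gam / 8 by rewrite divr_gt0.
  have [r r0 hr] := lsc T0 x _ T0I g8; exists (Num.min r kap); first by rewrite lt_min r0.
  move=> y d; rewrite !lt_min => /andP[y1 y2] dd /andP[d1 d2] s sI sd.
  have h1 : `|s - T0| < r by case/andP: sI; move: d1 sd; clear => *; rewrite ger0_norm; lra.
  have := hr s y sI h1 y1; have := lu T0 T0 y x T0I T0I; rewrite subrr normr0 add0r => /ler_normlP[_ h2].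
  have h3 : K * `|y - x| <= K * kap by rewrite ler_wpM2l// ltW.
  by have := init x; move: h2 h3 kapK; lin.
have [tau [tau0 taud tauk]] : exists tau, [/\ 0 < tau, tau < d0 & tau <= kap].
  exists (Num.min (d0 / 2) kap); rewrite ge_min lexx orbT lt_min kap0 divr_gt0//; split => //.
  by rewrite gt_min; apply/orP; left; move: d00; lin.
have hinit s x : T0 <= s <= T' -> s < T0 + tau -> `|x| <= X -> u T0 x - gam / 4 <= v s x.
  by move=> sI st; rewrite ler_norml => xX; exact: (hd x tau xX tau0 taud s sI st).
have [rho [rho0 rhot rhoT]] : exists rho, [/\ 0 < rho, rho < tau & rho < T' - Tm].
  exists (Num.min tau (T' - Tm) / 2).
  have m0 : 0 < Num.min tau (T' - Tm) by rewrite lt_min tau0 subr_gt0.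
  have [m1 m2] : Num.min tau (T' - Tm) <= tau /\ Num.min tau (T' - Tm) <= T' - Tm by rewrite !ge_min !lexx orbT.
  by move: m0 m1 m2; clear => *; split; lra.
(* At a maximum point the penalty [(t - s) ^ 2 / (2 * nu)] is at most [Bd], which with this [nu]
   gives [|t - s| < rho]. *)
pose nu := rho ^+ 2 / (2 * (Bd + 1)).
have Bd2 : 0 < 2 * (Bd + 1) by move: Bd0; lin.
have nu0 : 0 < nu by apply: divr_gt0 => //; exact: exprn_gt0.
have nuE : nu * (2 * (Bd + 1)) = rho ^+ 2 by rewrite /nu divfK// gt_eqF.
have nu2 : 0 < 2 * nu by rewrite mulr_gt0.
have nuP (d : R) : d ^+ 2 / (2 * nu) <= Bd -> `|d| < rho.
  rewrite (ler_pdivrMr _ _ nu2) => h1.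
  rewrite -(@ltr_pXn2r R 2)// ?nnegrE ?(ltW rho0)// real_normK ?num_real// -nuE.
  by move: h1 nu0; lin.
have ex (z : R * R) : exists t, T0 <= z.1 <= T' -> [/\ T0 <= t <= T' &
    forall t', T0 <= t' <= T' -> penal nu u P t' z.1 z.2 <= penal nu u P t z.1 z.2].
  have [zI|zI] := boolP (T0 <= z.1 <= T'); last by exists 0.
  have [t tI tm] := max1 (ltW T0T) (penal_cont nu z.1 z.2 lu cP).
  by exists t.
have [tm htm] := choice ex.
pose ut s x := penal nu u P (tm (s, x)) s x.
have hut s x : T0 <= s <= T' -> exists t, [/\ T0 <= t <= T', ut s x = penal nu u P t s x &
     forall t', T0 <= t' <= T' -> penal nu u P t' s x <= ut s x].
  by move=> sI; have [h1 h2] := htm (s, x) sI; exists (tm (s, x)).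
pose Ls := (T' - T0) / nu; pose Lx := K + Bp.
have Ls0 : 0 <= Ls by rewrite divr_ge0 ?subr_ge0 ?(ltW T0T) ?(ltW nu0).
have Lx0 : 0 <= Lx by rewrite addr_ge0.
have half s s' x y : T0 <= s <= T' -> T0 <= s' <= T' -> ut s x - ut s' y <= Ls * `|s - s'| + Lx * `|x - y|.
  move=> sI sI'; have [t [tI tE tmx]] := hut s x sI; have [t' [tI' tE' tmx']] := hut s' y sI'.
  have /ler_normlP[_] := penal_lip x y nu0 lu cP PxB tI sI sI'.
  by have := tmx' t tI; rewrite tE /Ls /Lx; lin.
have small e : 0 < e -> exists2 r, 0 < r & forall a b, a < r -> b < r -> Ls * a + Lx * b < e.
  move=> e0; have L1 : 0 < Ls + Lx + 1 by move: Ls0 Lx0; lin.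
  exists (e / (Ls + Lx + 1)); first exact: divr_gt0.
  move=> a b ha hb; have h1 : Ls * a <= Ls * (e / (Ls + Lx + 1)) by rewrite ler_wpM2l// ltW.
  have h2 : Lx * b <= Lx * (e / (Ls + Lx + 1)) by rewrite ler_wpM2l// ltW.
  have h3 : (Ls + Lx + 1) * (e / (Ls + Lx + 1)) = e by rewrite mulrC divfK// gt_eqF.
  have : 0 < e / (Ls + Lx + 1) by exact: divr_gt0.
  by move: h1 h2 h3; lin.
have [sb [xb [sbI xbI smax]]] : exists s x, [/\ T0 <= s <= T', - X <= x <= X &
    forall s' y, T0 <= s' <= T' -> - X <= y <= X -> ut s' y - v s' y <= ut s x - v s x].
  apply: (@max2 R (fun s x => ut s x - v s x) _ _ _ _ (ltW T0T) XX) => t x tI xI e e0.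
  have e2 : 0 < e / 2 by rewrite divr_gt0.
  have [r r0 hr] := lsc t x _ tI e2; have [q q0 hq] := small _ e2.
  exists (Num.min r q); first by rewrite lt_min r0.
  move=> s y sI _; rewrite !lt_min => /andP[s1 s2] /andP[y1 y2].
  have := hr s y sI s1 y1; have := half s t y x sI tI; have := hq _ _ s2 y2.
  by lin.
pose M := ut sb xb - v sb xb.
have Mg : gam <= M.
  have xsX : `|xs| <= X.
    rewrite leNgt; apply/negP => xX; have := far ts ts xs tsI tsI (ltW xX).
    by move: hgam gam0; lin.
  have [t [tI tE tmx]] := hut ts xs tsI; have := tmx ts tsI.
  rewrite /penal subrr expr0n /= mul0r subr0.
  have := smax ts xs tsI; rewrite -ler_norml -/M => /(_ xsX).
  by move: hgam; lin.
have xbX : `|xb| <= X by rewrite ler_norml.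
have key t : T0 <= t <= T' -> ut sb xb = penal nu u P t sb xb ->
    [/\ t < Tm, T0 < sb < T' & T0 < t < T'] /\ `|xb| < X.
  move=> tI tE; have E : u t xb - P t xb - v sb xb - (t - sb) ^+ 2 / (2 * nu) = M.
    by rewrite /M tE /penal; clear; ring.
  have sq0 : 0 <= (t - sb) ^+ 2 / (2 * nu) by apply: divr_ge0; [exact: sqr_ge0|exact: ltW nu2].
  have tTm : t < Tm.
    rewrite ltNge; apply/negP => tTm; have tT : Tm <= t <= T' by case/andP: tI => _ ->; rewrite tTm.
    by have := late t sb xb tT sbI; move: E Mg gam0 sq0; lin.
  have tsb : `|t - sb| < rho.
    by apply: nuP; have := hBd t sb xb tI sbI xbX; move: E Mg gam0; lin.
  have sbt : T0 + tau <= sb.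
    rewrite leNgt; apply/negP => lt; have h1 := hinit sb xb sbI lt xbX.
    have := lu t T0 xb xb tI T0I; rewrite subrr normr0 addr0 => /ler_normlP[_ h2].
    have h3 : K * `|t - T0| <= K * (kap + kap).
      rewrite ler_wpM2l//; case/andP: tI => ? ?; rewrite ger0_norm ?subr_ge0//.
      by move: tsb lt rhot tauk; clear => /ltr_normlP[]; lra.
    have h4 : 0 <= P t xb by apply: P0; case/andP: tI.
    by move: E Mg h1 h2 h3 h4 sq0 kapK gam0; lin.
  split; last first.
    rewrite ltNge; apply/negP => xX; have := far t sb xb tI sbI xX.
    by move: E Mg gam0 sq0; lin.
  move/ltr_normlP: tsb => [a1 a2]; split => //; first by move: a1 a2 sbt tau0 tTm rhoT; clear=> *; apply/andP; lra.
  by move: a1 a2 sbt rhot tTm TmT; clear=> *; apply/andP; lra.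
(* The earliest optimal time is chosen: optimal times of nearby points then exceed [tb - om], the
   lower bound that [core_slope] asks for. *)
have [tb [tbI tbm tbf]] := first_max (ltW T0T) (penal_cont nu sb xb lu cP).
have utb : ut sb xb = penal nu u P tb sb xb.
  have [t [tI tE tmx]] := hut sb xb sbI.
  by apply/eqP; rewrite eq_le tmx// andbT tE tbm.
have [[tbTm sbT tbT] xbXX] := key tb tbI utb.
have near om : 0 < om -> exists2 r, 0 < r & forall s x t, `|s - sb| < r -> `|x - xb| < r ->
     T0 <= s <= T' -> T0 <= t <= T' -> penal nu u P t s x = ut s x -> tb - om < t /\ t < T'.
  move=> om0; have [g1 g10 hg1] : exists2 g, 0 < g & forall t, T0 <= t <= tb - om -> penal nu u P t sb xb <= ut sb xb - g.
    have [le|lt] := leP T0 (tb - om); last by exists 1 => // t /andP[]; move: lt; lin.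
    have sub t : T0 <= t <= tb - om -> T0 <= t <= T'.
      by move: tbT om0; clear => /andP[? ?] ? /andP[? ?]; apply/andP; lra.
    apply: usc_below => //.
      move=> t tI e e0; have [r r0 hr] := penal_cont nu sb xb lu cP (sub t tI) e0.
      by exists r => // y yI; apply: hr; exact: sub.
    by move=> t tI; rewrite utb; apply: tbf; [exact: sub|case/andP: tI om0; lin].
  have hg2 t : Tm <= t <= T' -> penal nu u P t sb xb <= ut sb xb - gam.
    move=> tI; have := late t sb xb tI sbI.
    have sq0 : 0 <= (t - sb) ^+ 2 / (2 * nu) by apply: divr_ge0; [exact: sqr_ge0|exact: ltW nu2].
    by move: Mg sq0; rewrite /M /penal; lin.
  have g0 : 0 < Num.min g1 gam / 2 by rewrite divr_gt0// lt_min g10.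
  have [m1 m2] : Num.min g1 gam <= g1 /\ Num.min g1 gam <= gam by rewrite !ge_min !lexx orbT.
  have [r r0 hr] := small _ g0; exists r => // s x t sr xr sI tI tE.
  have h1 := hr _ _ sr xr.
  have h2 := half sb s xb x sbI sI; rewrite (distrC sb) (distrC xb) in h2.
  have /ler_normlP[_ h3] := penal_lip x xb nu0 lu cP PxB tI sI sbI; rewrite -/Ls -/Lx in h3.
  split.
    rewrite ltNge; apply/negP => tom; have := hg1 t; case/andP: (tI) => -> _; rewrite tom => /(_ isT).
    by move: h1 h2 h3 tE m1; lin.
  case/andP: (tI) => _ tT'; have := hg2 t; rewrite tT' andbT => h4.
  rewrite ltNge; apply/negP => tom; have := h4 (le_trans (ltW TmT) tom).
  by move: h1 h2 h3 tE m2; lin.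
have vb : v sb xb = ut sb xb - M by rewrite /M; clear; ring.
have rr : 0 < X - `|xb| by rewrite subr_gt0.
case/andP: (sbT) => sb0 sb1.
have vge : exists2 r, 0 < r & forall s x, `|s - sb| < r -> `|x - xb| < r -> ut s x - M <= v s x.
  exists (Num.min (X - `|xb|) (Num.min (sb - T0) (T' - sb))); first by rewrite !lt_min rr !subr_gt0 sb0.
  move=> s x; rewrite !lt_min => /and3P[_ /ltr_normlP[h1 h2] /ltr_normlP[h3 h4]] /andP[h5 _].
  have sI : T0 <= s <= T' by move: h1 h2 h3 h4; clear => *; apply/andP; lra.
  have xX : `|x| <= X.
    by have := ler_normD (x - xb) xb; rewrite subrK; move: h5; lin.
  by have := smax s x sI; rewrite -ler_norml => /(_ xX); rewrite -/M; lin.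
exact: (@core_point R h A T0 T' u v P Pt Px ut K Bp c eta nu M tb sb xb w adm cp K0 Bp0 nu0 eta0 vv lsc sbT tbT hut near utb vb vge).
Qed.
End CpCore.

(** * Penalization and the comparison principle *)

Section Comparison.
Context {R : realType}.
Implicit Types (h : hamiltonian R) (u v : R -> R -> R).

Lemma wf_modulus h (B e : R) : wf h -> 0 < e -> exists2 c, 0 <= c &
  forall a p q, (a <= njct h)%N -> `|p| <= B -> `|q| <= B ->
    `|ham h a p - ham h a q| <= e + c * `|p - q|.
Proof.
move=> [_ _ ah] e0.
suff : forall n, (n <= njct h)%N -> exists2 c, 0 <= c & forall a p q, (a <= n)%N ->
    `|p| <= B -> `|q| <= B -> `|ham h a p - ham h a q| <= e + c * `|p - q|.
  exact.
have one a : (a <= njct h)%N -> exists2 c, 0 < c & forall p q, `|p| <= B -> `|q| <= B ->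
    `|ham h a p - ham h a q| <= e + c * `|p - q|.
  by move=> aN; apply: cont1_modulus => //; apply: goodH_cont; exact: ah.
elim=> [|n IH] nN.
  have [c c0 hc] := one 0%N isT; exists c; first exact: ltW.
  by move=> a p q; rewrite leqn0 => /eqP ->; exact: hc.
have [c c0 hc] := IH (ltnW nN); have [d d0 hd] := one n.+1 nN.
exists (c + d); first by rewrite addr_ge0 ?(ltW d0).
move=> a p q; rewrite leq_eqVlt ltnS => /orP[/eqP ->|an] pB qB.
  apply: le_trans (hd p q pB qB) _; rewrite lerD2l ler_wpM2r//; move: c0; lin.
apply: le_trans (hc a p q an pB qB) _; rewrite lerD2l ler_wpM2r//; move: d0; lin.
Qed.

(** A C1 majorant of [2 * max(y, 0)] that vanishes for [y <= -1]. *)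
Definition ramp (y : R) := y + hub 1 y + 1 / 2.
Definition ramp' (y : R) := 1 + hub' 1 y.
Lemma C1_ramp : C1 ramp ramp'.
Proof.
have := C1D (C1D (@C1_id R) (C1_hub ltr01)) (C1_cst (1 / 2)) => hh.
refine (C1_eq hh _ _) => y; rewrite /ramp /ramp' ?addr0//.
Qed.
Lemma ramp_ge y : 0 <= ramp y /\ 2 * y <= ramp y.
Proof.
have [_ /andP[h1 _]] := hub_bnd y (@ltr01 R).
have := ler_norm y; have := ler_norm (- y); rewrite normrN /ramp.
by move: h1; clear=> *; split; lra.
Qed.
Lemma ramp0 y : y <= -1 -> ramp y = 0.
Proof.
move=> y1; rewrite /ramp /hub /psq pos_le0; last by move: y1; lin.
by rewrite pos_id; [field|move: y1; lin].
Qed.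
Lemma ramp'_bnd y : 0 <= ramp' y <= 2.
Proof.
have /andP[h1 h2] := hub'_bnd y (@ltr01 R).
by rewrite /ramp'; move: h1 h2; clear => *; apply/andP; lra.
Qed.

(** The penalty [P] has three parts: two ramps in [x], whose fronts travel inwards at speed [c], so
    that [Pt >= c * |Px|] by construction; the drift [eta * (t - T0)], with [eta] such that it costs
    a quarter of the gap [D] at [ts]; and a steep term after [ts] that rules out times beyond [Tm].
    [Rr] is such that both ramps vanish at [(ts, xs)], and their slope [2 * kap] beats the linear
    growth [C1'] of [u - v]. *)
Lemma comparison h A T0 T1 u v K : wf h -> adm_lim h A T0 T1 ->
  lipon (in_slab T0 T1) K u -> visc 1 h 0 T0 T1 u -> visc (-1) h 0 T0 T1 v ->
  lsc_on (in_slab T0 T1) v ->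
  (forall T', in_slab T0 T1 T' -> exists C, forall t x, T0 <= t <= T' -> - (C * (1 + `|x|)) <= v t x) ->
  (forall x, u T0 x <= v T0 x) -> forall t x, in_slab T0 T1 t -> u t x <= v t x.
Proof.
move=> w [limA admA] lu0 vu vv lsc growth init ts xs [tsT0 tsT1].
rewrite leNgt; apply/negP => lt.
have ts0 : T0 < ts.
  rewrite lt_neqAle tsT0 andbT; apply/negP => /eqP E.
  by have := init xs; rewrite E leNgt lt.
have [r r0 hr] := @in_timeP R T0 T1 ts (conj ts0 tsT1).
pose T' := ts + r / 2; pose Tm := ts + r / 4.
have [TmT tsTm TsT] : [/\ Tm < T', ts < Tm & ts < T'] by rewrite /T' /Tm; move: r0; clear => ?; split; lra.
have T'1 : (T'%:E < T1)%E.
  have [] := hr T'; last by [].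
  by rewrite /T' [ts + _]addrC addrK gtr0_norm; move: r0; lin.
have T'S : in_slab T0 T1 T' by split=> //; exact: ltW (lt_trans ts0 TsT).
have sI t : T0 <= t <= T' -> in_slab T0 T1 t.
  by move=> /andP[h1 h2]; split => //; apply: le_lt_trans T'1; rewrite lee_fin.
have sT t : in_time T0 T'%:E t -> in_time T0 T1 t.
  by move=> [h1 h2]; split => //; apply: lt_trans h2 T'1.
have [C hC] := growth T' T'S.
have lu : lipon (fun t => T0 <= t <= T') `|K| u.
  exact: lipon_sub sI (lipon_le (ler_norm K) lu0).
pose D := u ts xs - v ts xs; have D0 : 0 < D by rewrite subr_gt0.
pose eta := D / (4 * (ts - T0)).
have eta4 : 0 < 4 * (ts - T0) by move: ts0; lin.
have eta0 : 0 < eta by exact: divr_gt0.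
pose C1' := `|u T0 0| + `|K| * (T' - T0) + `|K| + `|C|.
have T0T' : T0 <= T' by case: T'S.
have C10 : 0 <= C1' by rewrite /C1' !addr_ge0// mulr_ge0// subr_ge0.
have uv t s x : T0 <= t <= T' -> T0 <= s <= T' -> u t x - v s x <= C1' * (1 + `|x|).
  move=> tI sI'; have T0I : T0 <= T0 <= T' by rewrite lexx.
  have := lu t T0 x 0 tI T0I; rewrite subr0 => /ler_normlP[_ h1].
  have h2 : `|K| * `|t - T0| <= `|K| * (T' - T0).
    by rewrite ler_wpM2l//; case/andP: tI; clear => *; rewrite ger0_norm; lra.
  have h3 := hC s x sI'; have h4 : C * (1 + `|x|) <= `|C| * (1 + `|x|) by rewrite ler_wpM2r ?addr_ge0 ?ler_norm.
  have h5 := ler_norm (u T0 0); have h6 := normr_ge0 x.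
  have h7 : 0 <= `|u T0 0| * `|x| by rewrite mulr_ge0.
  have h8 : 0 <= `|K| * (T' - T0) * `|x| by rewrite !mulr_ge0 ?subr_ge0.
  have h9 : 0 <= `|K| by [].
  by rewrite /C1'; move: h1 h2 h3 h4 h5 h6 h7 h8 h9; lin.
pose kap := C1' + 1; have kap0 : 0 < kap by rewrite /kap; move: C10; lin.
have e4 : 0 < eta / 4 by rewrite divr_gt0.
have [c c0 hc] := wf_modulus (`|K| + 4 * kap) w e4.
pose Rr := `|xs| + c * (ts - T0) + 1.
pose m := C1' + 2 * kap * Rr + 1.
have cts : 0 <= c * (ts - T0) by rewrite mulr_ge0// subr_ge0.
have Rr0 : 0 <= Rr by rewrite /Rr; have := normr_ge0 xs; move: cts; lin.
have m0 : 0 < m.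
  have kR : 0 <= kap * Rr by rewrite mulr_ge0// ltW.
  by rewrite /m; move: C10 kR; lin.
pose Kp := m / (r / 4) ^+ 2.
have Kp0 : 0 < Kp by rewrite divr_gt0// exprn_gt0// divr_gt0.
have KpE : Kp * (r / 4) ^+ 2 = m by rewrite divfK// gt_eqF// exprn_gt0// divr_gt0.
pose f1 y := kap * ramp (y - (Rr + c * T0)).
pose f1' y := kap * ramp' (y - (Rr + c * T0)).
pose f2 y := kap * ramp (- y - (Rr + c * T0)).
pose f2' y := - (kap * ramp' (- y - (Rr + c * T0))).
have cf1 : C1 f1 f1'.
  have := C1Z kap (C1_comp C1_ramp (C1_aff 1 (- (Rr + c * T0)))) => hh.
  by apply: (C1_eq hh) => y; rewrite mul1r// mulr1.
have cf2 : C1 f2 f2'.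
  have := C1Z kap (C1_comp C1_ramp (C1_aff (-1) (- (Rr + c * T0)))) => hh.
  by apply: (C1_eq hh) => y; rewrite mulN1r// mulrN1 mulrN.
pose f3 t := eta * t + - (eta * T0) + Kp * psq (t - ts).
pose f3' t := eta + Kp * (2 * pos (t - ts)).
have cf3 : C1 f3 f3'.
  have := C1D (C1_aff eta (- (eta * T0))) (C1Z Kp (C1_comp C1_psq (C1_aff 1 (- ts)))) => hh.
  by apply: (C1_eq hh) => y; rewrite mul1r// mulr1.
pose P t x := f1 (x + c * t) + f2 (x + - c * t) + f3 t.
pose Pt t x := c * f1' (x + c * t) + - c * f2' (x + - c * t) + f3' t.
pose Px t x := f1' (x + c * t) + f2' (x + - c * t) + 0.
have cP : C1xy P Pt Px := C1xyD (C1xyD (C1xy_ridge c cf1) (C1xy_ridge (- c) cf2)) (C1xy_t cf3).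
have f1B y : 0 <= f1' y <= 2 * kap.
  have /andP[h1 h2] := ramp'_bnd (y - (Rr + c * T0)).
  by rewrite /f1'; move: h1 h2 kap0; clear => *; apply/andP; split; nra.
have f2B y : - (2 * kap) <= f2' y <= 0.
  have /andP[h1 h2] := ramp'_bnd (- y - (Rr + c * T0)).
  by rewrite /f2'; move: h1 h2 kap0; clear => *; apply/andP; split; nra.
have f3ge t : T0 <= t -> 0 <= f3 t.
  move=> tT; have : 0 <= Kp * psq (t - ts) by rewrite mulr_ge0 ?(ltW Kp0)// /psq sqr_ge0.
  by rewrite /f3; move: eta0 tT; clear; nra.
have f12 t x : 0 <= f1 (x + c * t) + f2 (x + - c * t) /\ (T0 <= t -> 2 * kap * (`|x| - Rr) <= f1 (x + c * t) + f2 (x + - c * t)).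
  have [h1 h2] := ramp_ge (x + c * t - (Rr + c * T0)).
  have [h3 h4] := ramp_ge (- (x + - c * t) - (Rr + c * T0)).
  rewrite /f1 /f2; split; first by rewrite addr_ge0// mulr_ge0// ltW.
  move=> tT; have ct : 0 <= c * (t - T0) by rewrite mulr_ge0// subr_ge0.
  have [x0|x0] := leP 0 x.
    rewrite ger0_norm//; have : 2 * (x - Rr) <= ramp (x + c * t - (Rr + c * T0)) by move: h2 ct; lin.
    by move: h3 kap0; clear; nra.
  rewrite ltr0_norm//; have : 2 * (- x - Rr) <= ramp (- (x + - c * t) - (Rr + c * T0)) by move: h4 ct; lin.
  by move: h1 kap0; clear; nra.
have gam0 : 0 < 3 / 4 * D by move: D0; lin.
have mk : m = C1' + 2 * kap * Rr + 1 by [].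
have kE : kap = C1' + 1 by [].
apply: (@cp_core R h A T0 T' Tm u v P Pt Px `|K| (4 * kap) c eta (3 / 4 * D) m ts xs w _ _ _ _ eta0 gam0 (ltW m0)) => //.
- by split=> // a t a1 aN tT; apply: limA => //; exact: sT.
- split; first by split; [exact: lu|exact: visc_time_sub sT vu|exact: cP].
  split => //.
    move=> t x tT; rewrite /Px /Pt addr0.
    have := f1B (x + c * t); have := f2B (x + - c * t).
    have : 0 <= Kp * (2 * pos (t - ts)) by rewrite mulr_ge0 ?(ltW Kp0)// mulr_ge0// pos_ge0.
    rewrite /f3'; move: (f1' _) (f2' _) => a b k3 /andP[b1 b2] /andP[a1 a2].
    have : `|a + b| <= a - b by apply/ler_normlP; move: b2 a1; clear=> *; split; lra.
    move=> ab; have : c * `|a + b| <= c * (a - b) by rewrite ler_wpM2l.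
    by move: k3; lin.
  move=> t x; rewrite /Px addr0; have := f1B (x + c * t); have := f2B (x + - c * t).
  move: (f1' _) (f2' _) => a b /andP[b1 b2] /andP[a1 a2].
  by apply/ler_normlP; move: b1 b2 a1 a2; clear=> *; split; lra.
- by rewrite mulr_ge0// ltW.
- by rewrite (lt_trans ts0).
- exact: visc_time_sub sT vv.
- move=> t x e tI e0; have [q q0 hq] := lsc t x e (sI t tI) e0.
  by exists q => // s y /sI; exact: hq.
- by move=> t x tT /=; apply: addr_ge0; [case: (f12 t x)|exact: f3ge].
- move=> t s x tI sI' xm; have h1 := uv t s x tI sI'.
  have tT : T0 <= t by case/andP: tI.
  have [_ /(_ tT) h2] := f12 t x; have h3 := f3ge t tT.
  have h4 : 0 <= C1' * `|x| by rewrite mulr_ge0.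
  by rewrite /P; move: h1 h2 h3 h4 xm (normr_ge0 x); rewrite mk kE; lin.
- move=> t s x /andP[t1 t2] sI'; have tT : T0 <= t by exact: le_trans (ltW (lt_trans ts0 tsTm)) t1.
  have tI : T0 <= t <= T' by rewrite tT.
  have h1 := uv t s x tI sI'.
  have [_ /(_ tT) h2] := f12 t x.
  have h4 : 0 <= C1' * `|x| by rewrite mulr_ge0.
  have h5 : m <= Kp * psq (t - ts).
    rewrite -KpE ler_pM2l// /psq pos_id; last by move: t1 tsTm; lin.
    rewrite ler_pXn2r// ?nnegrE; first by move: t1; rewrite /Tm; lin.
      by rewrite divr_ge0// ltW.
    by move: t1 tsTm; lin.
  have h6 : 0 <= eta * t + - (eta * T0) by move: eta0 tT; clear; nra.
  by rewrite /P /f3; move: h1 h2 h4 h5 h6 (normr_ge0 x); rewrite mk kE; lin.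
- by rewrite tsT0 ltW.
- have E1 : f1 (xs + c * ts) = 0.
    rewrite /f1 ramp0 ?mulr0// /Rr; have := ler_norm xs; lin.
  have E2 : f2 (xs + - c * ts) = 0.
    rewrite /f2 ramp0 ?mulr0// /Rr; have := ler_norm (- xs); rewrite normrN; lin.
  have E3 : f3 ts = D / 4.
    rewrite /f3 subrr /psq pos_le0// expr0n /= mulr0 addr0 /eta; field.
    by move: ts0; lin.
  by rewrite /P E1 E2 E3 /D; lin.
Qed.
End Comparison.

(** * Touching and barriers *)
Section Touch.
Context {R : realType}.
Implicit Types (h : hamiltonian R) (u v w U phi : R -> R -> R).

Lemma der_ge_r (f : R -> R) x l m r : 0 < r -> der f x l ->
  (forall y, x < y -> y < x + r -> m * (y - x) <= f y - f x) -> m <= l.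
Proof.
move=> r0 df hm; apply/ler_addgt0Pr => e e0; have [q q0 hq] := df e e0.
pose d := Num.min r q / 2.
have [d0 dr dq] : [/\ 0 < d, d < r & d < q].
  have m0 : 0 < Num.min r q by rewrite lt_min r0.
  have [m1 m2] : Num.min r q <= r /\ Num.min r q <= q by rewrite !ge_min !lexx orbT.
  by rewrite /d; move: m0 m1 m2; clear => *; split; lra.
have := hq (x + d); have := hm (x + d); have -> : x + d - x = d by ring.
rewrite gtr0_norm// ltrDl d0 ltrD2l dr => /(_ isT isT) h1 /(_ dq)/ler_normlP[_ h2].
by rewrite -(ler_pM2r d0); move: h1 h2; lin.
Qed.
Lemma der_ge_l (f : R -> R) x l m r : 0 < r -> der f x l ->
  (forall y, y < x -> x - r < y -> m * (y - x) <= f y - f x) -> l <= m.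
Proof.
move=> r0 df hm; rewrite -lerN2; apply: (@der_ge_r (fun y => f (- y)) (- x) (- l) (- m) r r0).
  have := @der_comp R f (fun y => - y) (- x) l (-1); rewrite opprK mulrN1; apply => //.
  by have := (C1_aff (-1) (0 : R)).2 (- x); apply: der_ext => y; rewrite mulN1r addr0.
move=> y y1 y2; have h1 : - y < x by lra.
have h2 : x - r < - y by lra.
by have := hm (- y) h1 h2; rewrite !opprK; lra.
Qed.

Lemma C1xy_bounded phi phit phix a b c d : C1xy phi phit phix ->
  exists2 M, 0 < M & forall t x, a <= t <= b -> c <= x <= d -> `|phit t x| <= M.
Proof.
move=> [_ ct _ _ _]; have [|e e0 he] := @cover2 R a b c d (fun e t x => `|phit t x| <= e^-1).
  move=> t x _ _; have [r r0 hr] := ct t x 1 ltr01.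
  have f0 : 0 < 1 + `|phit t x| by rewrite ltr_pwDl.
  exists (Num.min r (1 + `|phit t x|)^-1); first by rewrite lt_min r0 invr_gt0.
  move=> s y e; rewrite !lt_min => /andP[s1 _] /andP[y1 _] e0 /andP[_].
  rewrite -[X in X < _]invrK ltf_pV2 ?posrE ?invr_gt0// => dd.
  apply: ltW (le_lt_trans _ dd); have := hr s y s1 y1.
  by have := ler_normD (phit s y - phit t x) (phit t x); rewrite subrK; lin.
exists (e / 2)^-1; first by rewrite invr_gt0 divr_gt0.
by move=> t x tI xI; apply: he => //; move: e0; lin.
Qed.

Lemma C1xy_lip_t phi phit phix a b c d M s t x : C1xy phi phit phix ->
  (forall t x, a <= t <= b -> c <= x <= d -> `|phit t x| <= M) ->
  a <= s -> s <= t -> t <= b -> c <= x <= d -> `|phi t x - phi s x| <= M * (t - s).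
Proof.
move=> [_ _ _ dt _] hM as_ st tb xI.
have := @mvt_bound R (fun s => phi s x) (fun s => phit s x) s t 0 M st _ _ _.
rewrite mul0r subr0; apply.
- by move=> z _; exact: dt.
- by move=> z _ e e0; exact: der_cont (dt z x) e e0.
- by move=> z /andP[z1 z2]; rewrite subr0; apply: hM => //; move: z1 z2 as_ tb; clear=> *; apply/andP; lra.
Qed.

(* Penalizing the times close to [t] steeply moves the touching point before [t], at the
   price of a time slope that decreases by at most [eta]. *)
Lemma terminal_touch (I : R -> Prop) K w phi phit phix t x eta r0 :
  lipon I K w -> C1xy phi phit phix -> 0 < r0 -> (forall s, t - r0 < s -> s <= t -> I s) ->
  (forall s y, t - r0 < s -> s <= t -> `|y - x| < r0 -> w s y - phi s y <= w t x - phi t x) ->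
  0 < eta -> exists s y psi psit psix, [/\ t - eta < s, s < t, `|y - x| < eta, C1xy psi psit psix &
    [/\ locmax (fun s y => w s y - psi s y) s y, phit t x - eta <= psit s y &
        `|psix s y - phix t x| <= eta]].
Proof.
move=> lw cphi r00 hI lm eta0.
have [c0 ct cx dt dx] := cphi.
have e2 : 0 < eta / 2 by rewrite divr_gt0.
have [r1 r10 h1] := ct t x _ e2; have [r2 r20 h2] := cx t x _ e2.
have [r [rp rr0 rr1 rr2 rre]] : exists r, [/\ 0 < r, r < r0, r < r1, r < r2 & r <= eta / 4].
  pose m := Num.min (Num.min r0 r1) (Num.min r2 (eta / 4)).
  have m0 : 0 < m by rewrite !lt_min r00 r10 r20 divr_gt0.
  have [m1 [m2 [m3 m4]]] : m <= r0 /\ m <= r1 /\ m <= r2 /\ m <= eta / 4 by rewrite !ge_min !lexx !orbT.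
  by exists (m / 2); move: m0 m1 m2 m3 m4; clear => *; split; lra.
have [M M0 hM] := C1xy_bounded (t - r) t (x - r) (x + r) cphi.
(* The bonus [L * k] for leaving [t] grows at rate at least [L / 2] over the layer [d], more than
   [w] and [phi] can lose together, so no maximum sits at [t]. With [d <= r ^ 2 / L] the bonus stays
   below [r ^ 2], and the quadratic terms keep the maximum inside the box. *)
pose L := 2 * (`|K| + M + r + 1).
have L0 : 0 < L by rewrite /L; have := normr_ge0 K; move: M0 rp; lin.
pose d := Num.min r (r ^+ 2 / L).
have d0 : 0 < d by rewrite lt_min rp divr_gt0// exprn_gt0.
have dr : d <= r by rewrite ge_min lexx.
have dL : L * (d / 2) < r ^+ 2.
  have : d <= r ^+ 2 / L by rewrite ge_min lexx orbT.
  by rewrite ler_pdivlMr// => h; have := exprn_gt0 2 rp; move: h; lin.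
pose k s := t - s - hub d (t - s).
have kB s : s <= t -> 0 <= k s /\ k s <= d / 2.
  move=> st; have [_ /andP[a1 a2]] := hub_bnd (t - s) d0.
  by move: a1 a2; rewrite ger0_norm ?subr_ge0// /k; clear => *; split; lra.
have ck : C1 k (fun s => - (1 - hub' d (t - s))).
  have := C1D (C1_aff (-1) t) (C1Z (-1) (C1_comp (C1_hub d0) (C1_aff (-1) t))) => hh.
  apply: (C1_eq hh) => s; rewrite /k (_ : -1 * s + t = t - s); try ring.
pose psi s y := phi s y + (1 * (s - t) ^+ 2 + - L * k s) + 1 * (y - x) ^+ 2.
pose psit s y := phit s y + (2 * 1 * (s - t) + - L * - (1 - hub' d (t - s))) + 0.
pose psix s y := phix s y + 0 + 2 * 1 * (y - x).
have cpsi : C1xy psi psit psix :=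
  C1xyD (C1xyD cphi (C1xy_t (C1D (C1_quad 1 t) (C1Z (- L) ck)))) (C1xy_x (C1_quad 1 x)).
have psiE : psi t x = phi t x.
  by rewrite /psi /k !subrr hub0//; ring.
have tI s : t - r <= s <= t -> I s by move=> /andP[a1 a2]; apply: hI => //; move: a1 rr0; lin.
have [s1 [x1 [sI xI sm]]] : exists s y, [/\ t - r <= s <= t, x - r <= y <= x + r &
    forall s' y', t - r <= s' <= t -> x - r <= y' <= x + r -> w s' y' - psi s' y' <= w s y - psi s y].
  apply: (@max2 R (fun s y => w s y - psi s y)); [by move: rp; lin|by move: rp; lin|].
  move=> s y sI yI e e0; have e2' : 0 < e / 2 by rewrite divr_gt0.
  have [q1 q10 hq1] := lipon_near y lw (tI s sI) e2'.
  have [cp _ _ _ _] := cpsi; have [q2 q20 hq2] := cp s y _ e2'.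
  exists (Num.min q1 q2); first by rewrite lt_min q10.
  move=> s' y' sI' _; rewrite !lt_min => /andP[a1 a2] /andP[a3 a4].
  have /ltr_normlP[_] := hq1 s' y' (tI s' sI') a1 a3.
  have := hq2 s' y' a2 a4; rewrite -/(psi s' y') -/(psi s y) => /ltr_normlP[+ _].
  by lin.
have base : w t x - phi t x <= w s1 x1 - psi s1 x1.
  by rewrite -psiE; apply: sm; move: rp; clear => *; apply/andP; lra.
have lm1 : w s1 x1 - phi s1 x1 <= w t x - phi t x.
  apply: lm; [by move: sI rr0; clear => /andP[]; lra|by case/andP: sI|].
  by move: xI rr0; clear => /andP[? ?] ?; apply/ltr_normlP; split; lra.
have [s1a s1b] := andP sI; have [x1a x1b] := andP xI.
have [k0 kd] := kB s1 s1b.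
have kL : L * k s1 <= L * (d / 2) by rewrite ler_pM2l.
have sqb : (s1 - t) ^+ 2 + (x1 - x) ^+ 2 < r ^+ 2.
  by move: base lm1 kL dL; rewrite /psi; lin.
have sq1 := sqr_ge0 (s1 - t); have sq2 := sqr_ge0 (x1 - x).
have s1r : t - r < s1.
  rewrite ltNge; apply/negP => le; have E : s1 = t - r by apply/eqP; rewrite eq_le le.
  by move: sqb sq2; rewrite E; clear; nra.
have x1r : `|x1 - x| < r.
  rewrite -(@ltr_pXn2r R 2)// ?nnegrE ?(ltW rp)// real_normK ?num_real//.
  by move: sqb sq1; lin.
have s1t : s1 < t.
  rewrite lt_neqAle s1b andbT; apply/negP => /eqP E.
  pose q := d / 2.
  have [q0 qd] : 0 < q /\ q <= d by rewrite /q; move: d0; clear=> *; split; lra.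
  have qr : q <= r by exact: le_trans dr.
  have qI : t - r <= t - q <= t by move: q0 qr; clear=> *; apply/andP; lra.
  have := sm (t - q) x1 qI xI.
  have tt : t - r <= t <= t by move: rp; clear=> *; apply/andP; lra.
  have := lw t (t - q) x1 x1 (tI _ tt) (tI _ qI); rewrite subrr normr0 addr0.
  have -> : t - (t - q) = q by ring.
  rewrite (gtr0_norm q0) => /ler_normlP[_ a1].
  have := C1xy_lip_t cphi hM (_ : t - r <= t - q) (_ : t - q <= t) (lexx t) xI.
  have [-> tq] := andP qI; rewrite tq => /(_ isT isT).
  have -> : t - (t - q) = q by ring.
  move=> /ler_normlP[a2 _].
  have hk : k (t - q) >= q / 2.
    rewrite /k; have -> : t - (t - q) = q by ring.
    have : hub d q <= q / 2.
      rewrite /hub ler_pdivrMr ?mulr_gt0//.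
      rewrite /psq !pos_le0; [|by move: q0 d0; lin|by move: qd; lin].
      by move: q0 qd d0; clear; nra.
    by lin.
  have kt : k t = 0 by rewrite /k subrr hub0// subrr.
  have hL : L * (q / 2) <= L * k (t - q) by rewrite ler_pM2l.
  have hK : K * q <= `|K| * q by rewrite ler_pM2r// ler_norm.
  have hq2 : q ^+ 2 <= r * q by rewrite expr2 ler_pM2r.
  have hLq : L * (q / 2) = (`|K| + M + r + 1) * q by rewrite /L; field.
  rewrite E /psi kt subrr; have -> : t - q - t = - q by ring.
  by move: a1 a2 hL hK hq2 hLq q0; clear; nra.
exists s1, x1, psi, psit, psix; split; last first.
- split.
  + exists (Num.min (Num.min (s1 - (t - r)) (t - s1)) (r - `|x1 - x|)).
      by rewrite !lt_min !subr_gt0 s1r s1t x1r.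
    move=> s y; rewrite !lt_min => /andP[/andP[/ltr_normlP[a1 a2] /ltr_normlP[a3 a4]] _] /andP[_ a5].
    have a6 := ler_normD (y - x1) (x1 - x); rewrite addrA subrK in a6.
    apply: sm; first by move: a1 a2 a3 a4; clear=> *; apply/andP; lra.
    by move: a5 a6; clear=> a5 a6; have : `|y - x| <= r by [lra]; move=> /ler_normlP[? ?]; apply/andP; lra.
  + have sr1 : `|s1 - t| < r1 by move: s1r s1t rr1; clear=> *; apply/ltr_normlP; split; lra.
    have /ltr_normlP[a1 _] := h1 s1 x1 sr1 (lt_trans x1r rr1).
    have : 0 <= L * (1 - hub' d (t - s1)).
      by rewrite mulr_ge0 ?(ltW L0)// subr_ge0; case/andP: (hub'_bnd (t - s1) d0).
    by rewrite /psit; move: a1 s1r rre; lin.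
  + have sr2 : `|s1 - t| < r2 by move: s1r s1t rr2; clear=> *; apply/ltr_normlP; split; lra.
    have /ltr_normlP[a1 a2] := h2 s1 x1 sr2 (lt_trans x1r rr2).
    by move/ltr_normlP: x1r => [a3 a4]; rewrite /psix; apply/ler_normlP; move: a1 a2 a3 a4 rre; clear => *; split; lra.
- exact: cpsi.
- by move: x1r rre eta0; lin.
- exact: s1t.
- by move: s1r rre eta0; lin.
Qed.
End Touch.

(** * Sub-solutions point by point, and barriers *)

Section Pointwise.
Context {R : realType}.
Implicit Types (h : hamiltonian R) (u v w U V phi : R -> R -> R).

Lemma edge_junction h a c x : wf h -> (a <= njct h)%N -> in_edge h a x ->
  (1 <= c)%N -> (c <= njct h)%N -> x <> jpoint h c.
Proof.
move=> w aN [e1 e2] c1 cN xc; have [ac|ca] := ltnP a c.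
  have aN' : (a < njct h)%N by exact: leq_trans ac cN.
  by have := e2 aN'; have := jpoint_le w (ltn0Sn a) ac cN; rewrite -xc; lra.
have a1 : (1 <= a)%N by exact: leq_trans c1 ca.
by have := e1 a1; have := jpoint_le w c1 ca aN; rewrite -xc; lra.
Qed.
Lemma edge_uniq h a c x : wf h -> (a <= njct h)%N -> (c <= njct h)%N ->
  in_edge h a x -> in_edge h c x -> a = c.
Proof.
move=> w; wlog ac : a c / (a < c)%N => [H aN cN xa xc|].
  by have [ac|ca|//] := ltngtP a c; [exact: H|apply/esym; exact: H].
move=> aN cN [_ e2] [e3 _].
have aN' : (a < njct h)%N by exact: leq_trans ac cN.
have c1 : (0 < c)%N by exact: leq_ltn_trans ac.
by exfalso; move: (e2 aN') (e3 c1) (jpoint_le w (ltn0Sn a) ac cN); lin.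
Qed.
Lemma jpoint_inj h a c : wf h -> (1 <= a)%N -> (a <= njct h)%N -> (1 <= c)%N -> (c <= njct h)%N ->
  jpoint h a = jpoint h c -> a = c.
Proof.
move=> w; wlog ac : a c / (a < c)%N => [H a1 aN c1 cN e|].
  by have [ac|ca|//] := ltngtP a c; [exact: H|apply/esym; apply: H].
by move=> a1 aN c1 cN e; have := jpoint_lt w a1 ac cN; rewrite e ltxx.
Qed.

(** Localizing the inequality at one point allows maxima of several pieces to be verified pointwise,
    each point being handled by a piece that realizes the maximum there ([subpt_touch]). *)
Definition subpt h lam U t x :=
  (forall a phi phit phix, (a <= njct h)%N -> C1xy phi phit phix -> in_edge h a x ->
    locmax (fun s y => U s y - phi s y) t x -> phit t x + ham h a (phix t x) <= lam) /\
  (forall a phi phit phix pl pr, (1 <= a)%N -> (a <= njct h)%N -> C1xy phi phit phix ->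
    x = jpoint h a -> locmax (fun s y => U s y - phi s y - kink pl pr x y) t x ->
    phit t x + junction_ham h a t (phix t x + pl) (phix t x + pr) <= lam).

Lemma visc_subpt h lam T0 T1 U : visc 1 h lam T0 T1 U <->
  forall t x, in_time T0 T1 t -> subpt h lam U t x.
Proof.
split=> [[v1 v2] t x tT|H].
  split.
    move=> a phi phit phix aN cphi xe [r r0 hr].
    have H := v1 a phi phit phix t x aN cphi tT xe; rewrite !mul1r in H; apply: H.
    by exists r => // s y h1 h2; rewrite !mul1r; exact: hr.
  move=> a phi phit phix pl pr a1 aN cphi xb [r r0 hr]; rewrite xb in hr *.
  have H := v2 a phi phit phix pl pr t a1 aN cphi tT; rewrite !mul1r in H; apply: H.
  by exists r => // s y h1 h2; rewrite !mul1r; exact: hr.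
split.
  move=> a phi phit phix t x aN cphi tT xe [r r0 hr]; rewrite !mul1r.
  have [H1 _] := H t x tT; apply: (H1 a phi phit phix aN cphi xe); exists r => // s y h1 h2.
  by have := hr s y h1 h2; rewrite !mul1r.
move=> a phi phit phix pl pr t a1 aN cphi tT [r r0 hr]; rewrite !mul1r.
have [_ H2] := H t (jpoint h a) tT; apply: (H2 a phi phit phix pl pr a1 aN cphi erefl); exists r => // s y h1 h2.
by have := hr s y h1 h2; rewrite !mul1r.
Qed.

Lemma subpt_touch h lam U V t x : (exists2 r, 0 < r & forall s y, `|s - t| < r -> `|y - x| < r ->
    V s y <= U s y) -> V t x = U t x -> subpt h lam V t x -> subpt h lam U t x.
Proof.
move=> [r r0 VU] e [s1 s2]; split.
  move=> a phi phit phix aN cphi xe lm; apply: (s1 a _ _ _ aN cphi xe).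
  apply: (locmax_ext r0 _ _ lm); last by rewrite e.
  by move=> s y h1 h2; rewrite lerD2r VU.
move=> a phi phit phix pl pr a1 aN cphi xb lm; apply: (s2 a _ _ _ pl pr a1 aN cphi xb).
apply: (locmax_ext r0 _ _ lm); last by rewrite e.
by move=> s y h1 h2; rewrite !lerD2r VU.
Qed.

Lemma subpt_tilt h lam m U psi psi' t x : C1 psi psi' -> psi' t <= m ->
  subpt h lam U t x -> subpt h (lam + m) (fun s y => U s y + psi s) t x.
Proof.
move=> cpsi pm [s1 s2]; have cN := C1xyZ (-1) (C1xy_t cpsi); split.
  move=> a phi phit phix aN cphi xe [r r0 hr].
  have := s1 a _ _ _ aN (C1xyD cphi cN) xe.
  rewrite mulr0 addr0 => H.
  have : phit t x + -1 * psi' t + ham h a (phix t x) <= lam.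
    by apply: H; exists r => // s y h1 h2; have := hr s y h1 h2; lin.
  by move: pm; lin.
move=> a phi phit phix pl pr a1 aN cphi xe [r r0 hr].
have := s2 a _ _ _ pl pr a1 aN (C1xyD cphi cN) xe.
rewrite mulr0 addr0 => H; move: (junction_ham _ _ _ _ _) H => J H.
have : phit t x + -1 * psi' t + J <= lam.
  by apply: H; exists r => // s y h1 h2; have := hr s y h1 h2; lin.
by move: pm; lin.
Qed.

Lemma locmax_time U phi phit phix (th t x : R) g : C1xy phi phit phix ->
  locmax (fun s y => U s y - phi s y - g y) t x ->
  (exists2 r, 0 < r & forall s, `|s - t| < r -> U t x + th * (s - t) <= U s x) -> phit t x = th.
Proof.
move=> [_ _ _ d _] [r r0 hr] [q q0 hq].
have m0 : 0 < Num.min r q by rewrite lt_min r0.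
have key s : `|s - t| < Num.min r q -> th * (s - t) <= phi s x - phi t x.
  rewrite lt_min => /andP[h1 h2]; have := hr s x h1; rewrite subrr normr0 => /(_ r0).
  by have := hq s h2; lra.
apply/eqP; rewrite eq_le; apply/andP; split.
  apply: (der_ge_l m0 (d t x)) => y y1 y2; apply: key; rewrite ltr0_norm; lra.
by apply: (der_ge_r m0 (d t x)) => y y1 y2; apply: key; rewrite gtr0_norm; lra.
Qed.

Lemma locmax_right U phi phit phix (p pl pr t x : R) : C1xy phi phit phix ->
  locmax (fun s y => U s y - phi s y - kink pl pr x y) t x ->
  (exists2 r, 0 < r & forall y, x < y -> y < x + r -> U t x + p * (y - x) <= U t y) ->
  p <= phix t x + pr.
Proof.
move=> [_ _ _ _ d] [r r0 hr] [q q0 hq].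
have m0 : 0 < Num.min r q by rewrite lt_min r0.
rewrite -lerBlDr; apply: (der_ge_r m0 (d t x)) => y y1.
rewrite -ltrBlDl lt_min => /andP[y2 y3].
have := hr t y; rewrite subrr normr0 gtr0_norm; last by move: y1; lin.
move=> /(_ r0 y2); rewrite /kink subrr (pos_le0 (lexx 0)).
rewrite pos_id; last by move: y1; lin.
rewrite pos_le0; last by move: y1; lin.
by have := hq y y1; rewrite -ltrBlDl => /(_ y3); lin.
Qed.
Lemma locmax_left U phi phit phix (p pl pr t x : R) : C1xy phi phit phix ->
  locmax (fun s y => U s y - phi s y - kink pl pr x y) t x ->
  (exists2 r, 0 < r & forall y, y < x -> x - r < y -> U t x + p * (y - x) <= U t y) ->
  phix t x + pl <= p.
Proof.
move=> [_ _ _ _ d] [r r0 hr] [q q0 hq].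
have m0 : 0 < Num.min r q by rewrite lt_min r0.
rewrite -lerBrDr; apply: (der_ge_l m0 (d t x)) => y y1 y4.
have y5 : x - y < Num.min r q by move: y4; lin.
move: y5; rewrite lt_min => /andP[y2 y3].
have := hr t y; rewrite subrr normr0 ltr0_norm; last by move: y1; lin.
rewrite opprB => /(_ r0 y2); rewrite /kink subrr (pos_le0 (lexx 0)).
rewrite pos_le0; last by move: y1; lin.
rewrite pos_id; last by move: y1; lin.
have y6 : x - q < y by move: y3; lin.
by have := hq y y1 y6; lin.
Qed.

(** Supporting lines from below pin down every contact from above: its time slope is [th] and its
    space slope lies between [pr] and [pl]. Explicit piecewise linear profiles are checked in this
    way. *)
Lemma subpt_edge h lam U a t x th pl pr : wf h -> (a <= njct h)%N -> in_edge h a x ->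
  (exists2 r, 0 < r & forall s, `|s - t| < r -> U t x + th * (s - t) <= U s x) ->
  (exists2 r, 0 < r & forall y, x < y -> y < x + r -> U t x + pr * (y - x) <= U t y) ->
  (exists2 r, 0 < r & forall y, y < x -> x - r < y -> U t x + pl * (y - x) <= U t y) ->
  (forall q, pr <= q <= pl -> th + ham h a q <= lam) -> subpt h lam U t x.
Proof.
move=> w aN xe hth hr hl hq; split; last first.
  by move=> c phi phit phix ql qr c1 cN _ xc; case: (edge_junction w aN xe c1 cN xc).
move=> c phi phit phix cN cphi xc lm.
have E := edge_uniq w cN aN xc xe; rewrite E.
have lm0 : locmax (fun s y => U s y - phi s y - kink 0 0 x y) t x.
  by case: lm => r r0 hr'; exists r => // s y h1 h2; rewrite !kink00 !subr0; exact: hr'.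
rewrite (locmax_time cphi lm0 hth); apply: hq; apply/andP; split.
  by rewrite -[phix t x]addr0; exact: locmax_right cphi lm0 hr.
by rewrite -[phix t x]addr0; exact: locmax_left cphi lm0 hl.
Qed.
Lemma subpt_junction h lam U a t x th pl pr : wf h -> (1 <= a)%N -> (a <= njct h)%N -> x = jpoint h a ->
  (exists2 r, 0 < r & forall s, `|s - t| < r -> U t x + th * (s - t) <= U s x) ->
  (exists2 r, 0 < r & forall y, x < y -> y < x + r -> U t x + pr * (y - x) <= U t y) ->
  (exists2 r, 0 < r & forall y, y < x -> x - r < y -> U t x + pl * (y - x) <= U t y) ->
  th + junction_ham h a t pl pr <= lam -> subpt h lam U t x.
Proof.
move=> w a1 aN xb hth hr hl hq; split.
  by move=> c phi phit phix cN _ xc; case: (edge_junction w cN xc a1 aN xb).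
move=> c phi phit phix ql qr c1 cN cphi xc lm.
have E : c = a by apply: (jpoint_inj w) => //; rewrite -xc.
rewrite E (locmax_time cphi lm hth); apply: le_trans hq; rewrite lerD2l.
have h1 := locmax_right cphi lm hr; have h2 := locmax_left cphi lm hl.
have [_ _ ah] := w.
have h3 := Hplus_ndec (ah a.-1 (leq_trans (leq_pred _) aN)) h2.
have h4 := Hminus_ninc (ah a aN) h1.
by rewrite /junction_ham !ge_max !le_max h3 h4 lexx !orbT.
Qed.

Lemma visc_shift sg h lam T0 T1 k c U :
  (forall a t, (1 <= a)%N -> (a <= njct h)%N -> limiter h a (t + k) = limiter h a t) ->
  visc sg h lam (T0 + k) (T1 + k)%:E U -> visc sg h lam T0 T1%:E (fun t x => U (t + k) x + c).
Proof.
move=> lk [v1 v2].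
have cs phi phit phix : C1xy phi phit phix ->
    C1xy (fun t x => phi (t - k) x) (fun t x => phit (t - k) x) (fun t x => phix (t - k) x).
  move=> cphi; have := C1xy_comp cphi (C1_aff 1 (- k)) (@C1_id R) => hh.
  by apply: (C1xy_eq hh) => t x; rewrite mul1r// mulr1.
have tk t : in_time T0 T1%:E t -> in_time (T0 + k) (T1 + k)%:E (t + k).
  by move=> [h1]; rewrite lte_fin => h2; split; rewrite ?lte_fin ltrD2r.
split.
  move=> a phi phit phix t x aN cphi tT xe [r r0 hr].
  have := v1 a _ _ _ (t + k) x aN (cs _ _ _ cphi) (tk t tT) xe; rewrite addrK; apply.
  exists r => // s y h1 h2; have := hr (s - k) y; rewrite subrK addrK.
  have -> : s - k - t = s - (t + k) by ring.
  by move=> /(_ h1 h2); rewrite !mulrDr; lra.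
move=> a phi phit phix pl pr t a1 aN cphi tT [r r0 hr].
have := v2 a _ _ _ pl pr (t + k) a1 aN (cs _ _ _ cphi) (tk t tT).
rewrite addrK /junction_ham lk//; apply.
exists r => // s y h1 h2; have := hr (s - k) y; rewrite subrK addrK.
have -> : s - k - t = s - (t + k) by ring.
by move=> /(_ h1 h2); rewrite !mulrDr; lra.
Qed.

Lemma finite_bound (f : nat -> R) n : exists2 C, 0 <= C & forall a, (a <= n)%N -> f a <= C.
Proof.
elim: n => [|n [C C0 hC]].
  exists `|f 0%N| => // a; rewrite leqn0 => /eqP ->; exact: ler_norm.
exists (C + `|f n.+1|); first by rewrite addr_ge0.
move=> a; rewrite leq_eqVlt ltnS => /orP[/eqP ->|/hC].
  by have := ler_norm (f n.+1); move: C0; lin.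
by have := normr_ge0 (f n.+1); lin.
Qed.

Lemma wf_bounds h L : wf h -> exists2 C, 0 <= C & forall a, (a <= njct h)%N ->
  (forall p, `|p| <= L -> ham h a p <= C) /\ - C <= ham h a (pmin h a).
Proof.
move=> [_ _ ah].
have ex a : exists C, (a <= njct h)%N -> (forall p, `|p| <= L -> ham h a p <= C) /\ - C <= ham h a (pmin h a).
  have [aN|aN] := boolP (a <= njct h)%N; last by exists 0.
  have [M M0 hM] := cont1_bounded (- L) L (goodH_cont (ah a aN)).
  exists (M + `|ham h a (pmin h a)|) => _; split.
    move=> p pL; rewrite ler_norml in pL; have := hM p pL.
    by have := ler_norm (ham h a p); have := normr_ge0 (ham h a (pmin h a)); lin.
  by have := ler_norm (- ham h a (pmin h a)); rewrite normrN; move: M0; lin.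
have [f hf] := choice ex; have [C C0 hC] := finite_bound f (njct h).
exists C => // a aN; have [h1 h2] := hf a aN; have := hC a aN.
by move=> h3; split=> [p /h1|]; lra.
Qed.

Lemma barrier_sub h T0 T1 A L C g : wf h -> adm_lim h A T0 T1 ->
  (forall x y, `|g x - g y| <= L * `|x - y|) -> 0 <= L ->
  (forall a, (a <= njct h)%N -> forall p, `|p| <= L -> ham h a p <= C) ->
  (forall a, (1 <= a)%N -> (a <= njct h)%N -> A a <= C) ->
  visc 1 h 0 T0 T1 (fun t x => g x - C * t).
Proof.
move=> w [limA admA] lg L0 hH hA; apply/visc_subpt => t x tT.
have hth : exists2 r, 0 < r & forall s, `|s - t| < r -> g x - C * t + - C * (s - t) <= g x - C * s.
  by exists 1 => // s _; lra.
have hr : exists2 r, 0 < r & forall y, x < y -> y < x + r -> g x - C * t + - L * (y - x) <= g y - C * t.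
  exists 1 => // y xy _; have := lg y x; rewrite (gtr0_norm (x := y - x)); last by move: xy; lin.
  by move=> /ler_normlP[]; lin.
have hl : exists2 r, 0 < r & forall y, y < x -> x - r < y -> g x - C * t + L * (y - x) <= g y - C * t.
  exists 1 => // y xy _; have := lg y x; rewrite (ltr0_norm (x := y - x)); last by move: xy; lin.
  by move=> /ler_normlP[]; lin.
have [_ _ ah] := w.
have [[a aN xe]|[a [a1 aN xE]]] := in_edge_cases x w.
  apply: (subpt_edge w aN xe hth hr hl) => q; rewrite -ler_norml => /(hH a aN); lin.
apply: (subpt_junction w a1 aN xE hth hr hl).
have aN' : (a.-1 <= njct h)%N by apply: leq_trans aN; exact: leq_pred.
have h1 : `|L| <= L by rewrite ger0_norm.
have h2 : `|- L| <= L by rewrite normrN ger0_norm.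
have h3 := le_trans (Hplus_le L (ah _ aN')) (hH _ aN' _ h1).
have h4 := le_trans (Hminus_le (- L) (ah _ aN)) (hH _ aN _ h2).
by rewrite addrC subr_le0 /junction_ham limA// !ge_max h3 h4 hA.
Qed.

(** [g] is arbitrary: only the time slope [C] matters, as every Hamiltonian stays above [- C]. *)
Lemma barrier_super h T0 T1 C (g : R -> R) : wf h ->
  (forall a, (a <= njct h)%N -> - C <= ham h a (pmin h a)) ->
  visc (-1) h 0 T0 T1 (fun t x => g x + C * t).
Proof.
move=> w hC; have [_ _ ah] := w.
have time phi phit phix f t x : C1xy phi phit phix ->
    locmax (fun s y => -1 * (g y + C * s - phi s y - f y)) t x -> phit t x = C.
  move=> cphi [r r0 hr]; have cN := C1xyZ (-1) cphi.
  have : -1 * phit t x = - C.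
    apply: (@locmax_time (fun s y => - (g y + C * s)) _ _ _ (- C) t x (fun y => - f y) cN).
      by exists r => // s y h1 h2; have := hr s y h1 h2; lra.
    by exists 1 => // s _; lra.
  by lra.
split.
  move=> a phi phit phix t x aN cphi tT xe lm.
  have lm' : locmax (fun s y => -1 * (g y + C * s - phi s y - 0)) t x.
    by case: lm => r r0 hr; exists r => // s y h1 h2; rewrite !subr0; exact: hr.
  rewrite (time _ _ _ (fun=> 0) t x cphi lm') mulr0.
  by have := hC a aN; have := goodH_min (phix t x) (ah a aN); lin.
move=> a phi phit phix pl pr t a1 aN cphi tT lm.
rewrite (time _ _ _ _ t _ cphi lm) mulr0 /junction_ham.
set m := Num.max _ _; have : ham h a (pmin h a) <= m.
  by rewrite /m !le_max (Hminus_ge _ (ah a aN)) orbT.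
by have := hC a aN; lin.
Qed.
End Pointwise.

(** * Correctors and bounds on the effective limiter *)
Section Grid.
Context {R : realType}.
Implicit Types (tau A : nat -> R) (P : R -> R -> Prop).

Lemma grid_le K tau i j : time_grid K tau -> (i <= j)%N -> (j <= K.+1)%N -> tau i <= tau j.
Proof.
move=> [_ _ h]; elim: j => [|j IH]; first by rewrite leqn0 => /eqP ->.
rewrite leq_eqVlt => /orP[/eqP -> //|ij jK]; apply: le_trans (IH ij (ltnW jK)) _.
by apply: ltW; exact: h.
Qed.

Lemma grid_bounds K tau i : time_grid K tau -> (i <= K.+1)%N -> 0 <= tau i <= 1.
Proof.
move=> tg iK; have [t0 t1 _] := tg.
by rewrite -[X in X <= _ <= _]t0 -[X in _ <= _ <= X]t1 !(grid_le tg).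
Qed.

(** Transitivity is what crosses the grid times, where no equation holds. The chain of closed cells
    is a double induction, over periods and over the cells of a period. *)
Lemma grid_ind K tau P : time_grid K tau -> (forall t, P t t) ->
  (forall r s t, r <= s -> s <= t -> P r s -> P s t -> P r t) ->
  (forall (k : int) i s t, (i <= K)%N -> tau i + k%:~R <= s -> s <= t -> t <= tau i.+1 + k%:~R -> P s t) ->
  forall s t, s <= t -> P s t.
Proof.
move=> tg Pr Pt Pb s t0; have [tau0 tau1 lt] := tg.
set k := Num.floor s; have ks : k%:~R <= s by exact: Num.Theory.floor_le.
have key m i t : (i <= K.+1)%N -> s <= t -> t <= tau i + (k + m%:Z)%:~R -> P s t.
  elim: m i t => [|m IHm]; elim=> [|i IHi] t iK st ti.
  - have -> : t = s by apply/eqP; rewrite eq_le st andbT; move: ti ks; rewrite tau0 addr0; lin.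
    exact: Pr.
  - have [lt1|le1] := leP t (tau i + (k + 0%:Z)%:~R); first exact: IHi (ltnW iK) st lt1.
    have [sl|ls] := leP s (tau i + (k + 0%:Z)%:~R); last first.
      by apply: (Pb (k + 0%:Z) i) => //; exact: ltW.
    apply: (Pt _ (tau i + (k + 0%:Z)%:~R)) => //; first exact: ltW.
      by apply: IHi => //; exact: ltnW.
    by apply: (Pb (k + 0%:Z) i) => //; exact: ltW.
  - apply: (IHm K.+1) => //; rewrite tau1; apply: le_trans ti _.
    by rewrite tau0 intS !intrD; lin.
  - have [lt1|le1] := leP t (tau i + (k + m.+1%:Z)%:~R); first exact: IHi (ltnW iK) st lt1.
    have [sl|ls] := leP s (tau i + (k + m.+1%:Z)%:~R); last first.
      by apply: (Pb (k + m.+1%:Z) i) => //; exact: ltW.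
    apply: (Pt _ (tau i + (k + m.+1%:Z)%:~R)) => //; first exact: ltW.
      by apply: IHi => //; exact: ltnW.
    by apply: (Pb (k + m.+1%:Z) i) => //; exact: ltW.
move=> st; have kt : 0 <= Num.floor t0 - k by rewrite subr_ge0 Num.Theory.le_floor.
apply: (key `|Num.floor t0 - k|%N K.+1) => //.
rewrite gez0_abs// [k + _]addrC subrK tau1.
by have /andP[_] := Num.Theory.floor_itv t0; rewrite intrD1; lra.
Qed.

(** Cells are open on the left because contact points are moved strictly before [t]: a grid time
    must count as the end of a cell. Hence the ceiling minus one. *)
Lemma grid_left K tau t : time_grid K tau -> exists (k : int) i, (i <= K)%N /\
  tau i + k%:~R < t <= tau i.+1 + k%:~R.
Proof.
move=> tg; have [tau0 tau1 lt] := tg.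
pose k := Num.ceil t - 1; have /andP[k1 k2] := Num.Theory.ceil_itv t.
have key i : (i <= K)%N -> t <= tau i.+1 + k%:~R ->
    exists i, (i <= K)%N /\ tau i + k%:~R < t <= tau i.+1 + k%:~R.
  elim: i => [|i IH] iK ti; first by exists 0%N; rewrite tau0 add0r k1.
  have [h|h] := leP t (tau i.+1 + k%:~R); first exact: IH (ltnW iK) h.
  by exists i.+1; rewrite h.
have [|i hi] := key K (leqnn _); last by exists k, i.
by rewrite tau1 /k intrD rmorphN1 /=; move: k2; lin.
Qed.

Lemma periodic_int (f : R -> R) (k : int) s : (forall s, f (s + 1) = f s) -> f (s + k%:~R) = f s.
Proof.
move=> fp; have key n r : f (r + n%:R) = f r.
  by elim: n r => [|n IH] r; rewrite ?addr0// -natr1 addrA fp IH.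
have [k0|k0] := leP 0 k; first by rewrite -(gez0_abs k0) key.
have := key `|k|%N (s + k%:~R); rewrite pmulrn lez0_abs; last exact: ltW.
by rewrite rmorphN addrK => ->.
Qed.

Definition step_on K tau A (f' : R -> R) := (forall s : R, f' (s + 1) = f' s :> R) /\
  forall i, (i <= K)%N -> forall s, tau i <= s < tau i.+1 -> f' s = A i.

Lemma step_onE K tau A f' (k : int) i s : step_on K tau A f' -> (i <= K)%N ->
  tau i + k%:~R <= s < tau i.+1 + k%:~R -> f' s = A i.
Proof.
move=> [fp fA] iK h; rewrite -[s](subrK k%:~R) periodic_int//; apply: fA => //.
by rewrite lerBrDr ltrBlDr.
Qed.

Lemma mean_step K tau A f' : time_grid K tau -> step_on K tau A f' ->
  mean f' = \sum_(i < K.+1) A i * (tau i.+1 - tau i).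
Proof.
move=> tg [_ fA]; have [tau0 tau1 lt] := tg; rewrite /mean.
pose mu := @lebesgue_measure R.
pose J i := [set` `[tau i, tau i.+1[%R]%classic : set R.
have key j : (j <= K.+1)%N ->
    mu.-integrable [set` `[0, tau j[%R] (EFin \o f') /\
    \int[mu]_(s in [set` `[0, tau j[%R]) f' s = \sum_(i < j) A i * (tau i.+1 - tau i).
  elim: j => [|j IH] jK.
    rewrite tau0 set_itv_ge ?bnd_simp ?ltxx// big_ord0; split; first exact: integrable_set0.
    by rewrite Rintegral_set0.
  have [I1 I2] := IH (ltnW jK).
  have tj : 0 <= tau j by have /andP[] := grid_bounds tg (ltnW jK).
  have tj1 : tau j < tau j.+1 by exact: lt.
  have -> : [set` `[0, tau j.+1[%R] = [set` `[0, tau j[%R] `|` J j.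
    by rewrite /J -itv_bndbnd_setU ?bnd_simp//; exact: ltW.
  have cstE : {in J j, f' =1 cst (A j)}.
    by move=> s /set_mem; rewrite /J /= in_itv /=; exact: fA.
  have mJ : measurable (J j) by exact: measurable_itv.
  have IJ : mu.-integrable (J j) (EFin \o f').
    have cI : mu.-integrable [set` `[tau j, tau j.+1]%R] (EFin \o cst (A j)).
      apply: continuous_compact_integrable; first exact: segment_compact.
      by apply: continuous_subspaceT => ?; exact: cvg_cst.
    have cJ : mu.-integrable (J j) (EFin \o cst (A j)).
      apply: (integrableS _ _ _ cI); [exact: measurable_itv|exact: measurable_itv|].
      by rewrite /J; apply: subset_itvl; rewrite bnd_simp.
    by apply: eq_integrable cJ => // s sJ /=; rewrite cstE.
  have disj : [disjoint [set` `[0, tau j[%R] & J j]%classic.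
    apply/disj_setPS => s [] /=; rewrite !in_itv /= => /andP[_ h1] /andP[h2 _].
    by have := lt_le_trans h1 h2; rewrite ltxx.
  have I3 : mu.-integrable ([set` `[0, tau j[%R] `|` J j) (EFin \o f').
    apply/integrable_mkcond; first exact: measurableU.
    have /integrable_mkcond K1 := I1; have /integrable_mkcond K2 := IJ.
    apply: eq_integrable (integrableD measurableT (K1 _) (K2 _)) => // s _ /=.
    rewrite !patchE in_setU; case: ifPn => s1; case: ifPn => s2; rewrite /= ?addr0 ?add0r ?adde0 ?add0e//.
    by move/disj_setPS: disj => /(_ s) []; split; exact: set_mem.
  split => //; rewrite Rintegral_setU//.
  rewrite I2 big_ord_recr /=; congr (_ + _).
  transitivity (\int[mu]_(s in J j) cst (A j) s); first by apply: eq_Rintegral => s sJ; rewrite cstE.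
  rewrite Rintegral_cst//; congr (_ * _).
  have mE : mu (J j) = (tau j.+1 - tau j)%:E.
    by rewrite /mu /J lebesgue_measure_itv /= lte_fin tj1 EFinB.
  exact: (congr1 fine mE).
have [I1 I2] := key K.+1 (leqnn _); rewrite -I2 tau1 Rintegral_itv_bndo_bndc//.
by rewrite -tau1.
Qed.

(** [G] weighs the covered part of each cell by [c - A i], and vanishes at [0] and at [1] because
    [c] is the mean; composing with the fractional part makes it periodic. The value at the right
    end of a period agrees with the one at its left end, so closed cells are allowed. *)
Lemma step_primitive K tau A c : time_grid K tau ->
  c = \sum_(i < K.+1) A i * (tau i.+1 - tau i) -> exists g : R -> R,
  (forall t, g (t + 1) = g t) /\
  forall (k : int) i s t, (i <= K)%N -> tau i + k%:~R <= s -> s <= tau i.+1 + k%:~R ->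
    tau i + k%:~R <= t -> t <= tau i.+1 + k%:~R -> g t - g s = (c - A i) * (t - s).
Proof.
move=> tg cE; have [tau0 tau1 lt] := tg.
pose len (i : nat) t := Num.max 0 (Num.min t (tau i.+1) - tau i).
pose G t := \sum_(i < K.+1) (c - A i) * len i t.
have len_lo i t : t <= tau i -> len i t = 0.
  by move=> h; rewrite /len max_l// subr_le0 ge_min h.
have len_hi i t : (i <= K)%N -> tau i.+1 <= t -> len i t = tau i.+1 - tau i.
  by move=> iK h; rewrite /len min_r// max_r// subr_ge0 ltW// lt.
have len_in i t : tau i <= t <= tau i.+1 -> len i t = t - tau i.
  by move=> /andP[h1 h2]; rewrite /len min_l// max_r// subr_ge0.
have G0 : G 0 = 0.
  apply: big1 => i _; rewrite len_lo ?mulr0//.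
  by have /andP[] := @grid_bounds K tau i tg (ltnW (ltn_ord i)).
have G1 : G 1 = 0.
  rewrite /G (eq_bigr (fun i : 'I_K.+1 => c * (tau i.+1 - tau i) - A i * (tau i.+1 - tau i))).
    rewrite sumrB -cE -mulr_sumr -(big_mkord xpredT (fun i => tau i.+1 - tau i)) telescope_sumr//.
    by rewrite tau0 tau1 subr0 mulr1 subrr.
  move=> i _; rewrite len_hi ?mulrBl//; first by rewrite -ltnS.
  by have /andP[] := @grid_bounds K tau i.+1 tg (ltn_ord i).
have Gd i s t : (i <= K)%N -> tau i <= s <= tau i.+1 -> tau i <= t <= tau i.+1 ->
    G t - G s = (c - A i) * (t - s).
  move=> iK si ti; rewrite /G -sumrB (bigD1 (Ordinal (iK : (i < K.+1)%N)))//= big1 ?addr0.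
    by rewrite !len_in// -mulrBr; congr (_ * _); ring.
  move=> j ji; have {ji} ji : (j : nat) != i by apply: contra ji => /eqP e; apply/eqP/val_inj.
  have /andP[s1 s2] := si; have /andP[t1 t2] := ti.
  have [h|h|h] := ltngtP (j : nat) i; last by rewrite h eqxx in ji.
    have h' : tau j.+1 <= tau i by apply: (grid_le tg) => //; exact: leqW.
    have jK : (j <= K)%N by rewrite -ltnS.
    by rewrite !len_hi// ?subrr//; apply: le_trans h' _.
  have h' : tau i.+1 <= tau j by apply: (grid_le tg) => //; exact: ltnW.
  by rewrite !len_lo ?subrr//; apply: le_trans h'.
exists (fun t => G (t - (Num.floor t)%:~R)); split.
  move=> t; rewrite -[1]/(1%:~R) floorDrz ?intr_int// intrKfloor intrD; congr G; ring.
move=> k i s t iK s1 s2 t1 t2.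
have E r : tau i + k%:~R <= r -> r <= tau i.+1 + k%:~R -> G (r - (Num.floor r)%:~R) = G (r - k%:~R).
  move=> r1 r2; have /andP[b1 b2] := @grid_bounds K tau i tg (leqW iK).
  have /andP[b3 b4] := @grid_bounds K tau i.+1 tg iK.
  have [rk|kr] := ltP r (k%:~R + 1).
    have -> : Num.floor r = k; last by [].
    by apply/Num.Theory.floor_def; rewrite intrD1 rk andbT; move: b1 r1; lin.
  have -> : r = (k + 1)%:~R.
    by rewrite intrD1; apply/eqP; rewrite eq_le kr andbT; move: b4 r2; lin.
  by rewrite intrKfloor subrr intrD1 addrC addKr G0 G1.
rewrite !E// (Gd i)//; first by congr (_ * _); ring.
  by rewrite lerBrDr lerBlDr s1.
by rewrite lerBrDr lerBlDr t1.
Qed.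

Lemma grid_lip K tau (g : R -> R) M : time_grid K tau ->
  (forall (k : int) i s t, (i <= K)%N -> tau i + k%:~R <= s -> s <= t -> t <= tau i.+1 + k%:~R ->
    `|g t - g s| <= M * (t - s)) -> forall s t, `|g t - g s| <= M * `|t - s|.
Proof.
move=> tg H; have key s t : s <= t -> `|g t - g s| <= M * (t - s).
  apply: (grid_ind tg (P := fun s t => `|g t - g s| <= M * (t - s))) => {s t}.
  - by move=> t; rewrite !subrr normr0 mulr0.
  - move=> r s t rs st h1 h2; have := ler_normD (g t - g s) (g s - g r).
    by rewrite addrA subrK; lra.
  - by move=> k i s t iK h1 h2 h3; exact: (H k i).
move=> s t; have [st|ts] := leP s t.
  by rewrite [`|t - s|]ger0_norm ?subr_ge0//; exact: key.
rewrite distrC [`|t - s|]distrC [`|s - t|]ger0_norm ?subr_ge0; last exact: ltW.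
by apply: key; exact: ltW.
Qed.

Lemma periodic_bound (g : R -> R) M : (forall t, g (t + 1) = g t) -> 0 <= M ->
  (forall s t, `|g t - g s| <= M * `|t - s|) -> forall s t, `|g t - g s| <= M.
Proof.
move=> gp M0 gl s t.
have E r : g r = g (r - (Num.floor r)%:~R).
  by rewrite -[r in LHS](subrK (Num.floor r)%:~R) periodic_int.
rewrite (E t) (E s); apply: le_trans (gl _ _) _; rewrite -[leRHS]mulr1 ler_wpM2l//.
have /andP[a1 a2] := Num.Theory.floor_itv t; have /andP[b1 b2] := Num.Theory.floor_itv s.
rewrite !intrD1 in a2 b2; rewrite ler_norml; lra.
Qed.
End Grid.

(** * Levels of sub-correctors and their lower bound *)

Section Levels.
Context {R : realType}.
Implicit Types (h : hamiltonian R) (w : R -> R -> R) (K : nat) (tau : nat -> R) (A : nat -> nat -> R).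

Definition everywhere (t : R) := True.

Definition regular K tau (t : R) := exists (k : int) i, (i <= K)%N /\
  tau i + k%:~R < t /\ t < tau i.+1 + k%:~R.

Definition corrector h lam K tau w := forall t x, regular K tau t -> subpt h lam w t x.

Definition grid_adm h K tau A := [/\ wf h, time_grid K tau &
  admissible_limiters (njct h) (ham h) (pmin h) K tau A (limiter h)].

Lemma grid_adm_step h K tau A a : grid_adm h K tau A -> (1 <= a)%N -> (a <= njct h)%N ->
  step_on K tau (A a) (limiter h a).
Proof. by move=> [_ _ adm] a1 aN; have [p q] := adm a a1 aN; split=> // i iK; have [] := q i iK. Qed.

Lemma grid_adm_ge h K tau A a i : grid_adm h K tau A -> (1 <= a)%N -> (a <= njct h)%N -> (i <= K)%N ->
  ham h a.-1 (pmin h a.-1) <= A a i /\ ham h a (pmin h a) <= A a i.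
Proof.
move=> [_ _ adm] a1 aN iK; have [_ q] := adm a a1 aN; have [_] := q i iK.
by rewrite ge_max => /andP[].
Qed.

Lemma grid_adm_lim h K tau A (k : int) i : grid_adm h K tau A -> (i <= K)%N ->
  adm_lim h (A^~ i) (tau i + k%:~R) (tau i.+1 + k%:~R)%:E.
Proof.
move=> ga iK; split=> [a t a1 aN [t1 t2]|a a1 aN]; last exact: (grid_adm_ge ga).
by apply: (@step_onE _ K tau _ _ k _ t (grid_adm_step ga a1 aN)) => //; rewrite ltW//= -lte_fin.
Qed.

Lemma corrector_visc h lam K tau w : corrector h lam K tau w <->
  forall (k : int) i, (i <= K)%N -> visc 1 h lam (tau i + k%:~R) (tau i.+1 + k%:~R)%:E w.
Proof.
split=> [H k i iK|H t x [k [i [iK [t1 t2]]]]].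
  by apply/visc_subpt => t x [t1]; rewrite lte_fin => t2; apply: H; exists k, i.
by have /visc_subpt := H k i iK; apply; split; rewrite ?lte_fin.
Qed.

Lemma level_intro h lam K tau w M : wf h -> 0 <= M -> lipon everywhere M w ->
  (forall t x, w (t + 1) x = w t x) -> corrector h lam K tau w -> subcorrector_levels h K tau lam.
Proof.
move=> wh M0 lw wp /corrector_visc cw; exists (fun z => w z.1 z.2); split => //.
  exists (2 * M); have := def_lipon (D := everywhere) M0 lw.
  by rewrite (_ : [set z | everywhere z.1] = setT)//; apply/seteqP; split.
move=> k i iK; apply/(sub_viscP lam (K := M) wh); last exact: cw.
by move=> s t x y _ _; exact: lw.
Qed.

Lemma level_elim h lam K tau : wf h -> subcorrector_levels h K tau lam ->
  exists M w, [/\ 0 <= M, lipon everywhere M w, forall t x, w (t + 1) x = w t x &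
    corrector h lam K tau w].
Proof.
move=> wh [w [[L lw] wp sw]]; exists `|L|, (fun t x => w (t, x)).
have l : lipon everywhere `|L| (fun t x => w (t, x)).
  by apply: lipon_def; rewrite (_ : [set z | everywhere z.1] = setT)//; apply/seteqP; split.
split => //; apply/corrector_visc => k i iK.
apply/(sub_viscP lam (K := `|L|) wh); last exact: sw.
by move=> s t x y _ _; exact: l.
Qed.

Lemma kink_abs L b y : kink (- L) L b y = L * `|y - b| :> R.
Proof.
rewrite /kink; have [by'|yb] := leP b y.
  rewrite ger0_norm ?subr_ge0// pos_id ?subr_ge0// pos_le0 ?subr_le0//; ring.
rewrite ltr0_norm ?subr_lt0// pos_le0 ?subr_le0 ?ltW// pos_id ?subr_ge0 ?ltW//; ring.
Qed.

(** A kink of slopes [- M] and [M] never obstructs a contact with an [M]-Lipschitz function, so the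
    junction inequality can be tested with any function of time, and it retains the limiter. A
    faster increase of the trace would give such a contact by [slope_touch_r]. *)
Lemma corrector_time_slope h lam K tau A M w a i (k : int) s t : grid_adm h K tau A -> lipon everywhere M w ->
  corrector h lam K tau w -> (1 <= a)%N -> (a <= njct h)%N -> (i <= K)%N ->
  tau i + k%:~R <= s -> s <= t -> t <= tau i.+1 + k%:~R ->
  w t (jpoint h a) - w s (jpoint h a) <= (lam - A a i) * (t - s).
Proof.
move=> ga lw cw a1 aN iK s1 st t1; rewrite leNgt; apply/negP => lt.
have [ts|lts] := leP t s.
  by have E : t = s by [apply/eqP; rewrite eq_le ts st]; move: lt; rewrite E !subrr mulr0 ltxx.
set b := jpoint h a in lt *; set p := lam - A a i in lt.
have d0 : 0 < t - s by rewrite subr_gt0.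
pose q := (w t b - w s b) / (t - s).
have qE : q * (t - s) = w t b - w s b by rewrite /q divfK// gt_eqF.
have pq : p < q by rewrite /q ltr_pdivlMr.
have lf x y : s <= x <= t -> s <= y <= t -> `|w x b - w y b| <= M * `|x - y|.
  by move=> _ _; have := lw x y b b I I; rewrite subrr normr0 addr0.
have h1 : (p + q) / 2 * (t - s) < w t b - w s b by rewrite -qE ltr_pM2r//; move: pq; lin.
have [z [z' [r [cz /andP[sr rt] pz hz]]]] := slope_touch_r lts lf h1.
have rr : regular K tau r.
  by exists k, i; split => //; split; [exact: le_lt_trans s1 sr|exact: lt_le_trans rt t1].
have [_ S] := cw r b rr.
have := S a _ _ _ (- M) M a1 aN (C1xy_t cz) erefl.
rewrite !add0r => H.
have lm : locmax (fun s0 y => w s0 y - z s0 - kink (- M) M b y) r b.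
  exists (Num.min (r - s) (t - r)); first by rewrite lt_min !subr_gt0 sr.
  move=> s0 y; rewrite lt_min => /andP[]; rewrite !ltr_norml => /andP[g1 _] /andP[_ g2] _.
  have := hz s0; have -> : s <= s0 <= t by move: g1 g2; lin.
  move=> /(_ isT); rewrite !kink_abs subrr normr0 mulr0 subr0.
  have := lw s0 s0 y b I I; rewrite subrr normr0 add0r => /ler_normlP[_].
  lin.
have := H lm; have : A a i <= junction_ham h a r (- M) M.
  have -> : A a i = limiter h a r.
    symmetry; apply: (@step_onE _ K tau _ _ k _ r (grid_adm_step ga a1 aN)) => //.
    by rewrite (le_trans s1 (ltW sr)) (lt_le_trans rt t1).
  by rewrite /junction_ham !le_max lexx !orbT.
by move: pz pq; rewrite /p; lin.
Qed.

Lemma mean_le_level h lam K tau A a : grid_adm h K tau A -> (1 <= a)%N -> (a <= njct h)%N ->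
  subcorrector_levels h K tau lam -> mean (limiter h a) <= lam.
Proof.
move=> ga a1 aN Hl; have [wh tg _] := ga.
have [M [w [M0 lw wp cw]]] := level_elim wh Hl.
set c := mean _.
have [g [gp gs]] := step_primitive tg (mean_step tg (grid_adm_step ga a1 aN)).
pose f t := w t (jpoint h a) - g t.
have key s t : s <= t -> f t - f s <= (lam - c) * (t - s).
  apply: (grid_ind tg (P := fun s t => f t - f s <= (lam - c) * (t - s))) => {s t}.
  - by move=> t; rewrite !subrr mulr0.
  - by move=> r s t _ _; lin.
  - move=> k i s t iK s1 st t1.
    have := corrector_time_slope ga lw cw a1 aN iK s1 st t1.
    have := gs k i s t iK s1 (le_trans st t1) (le_trans s1 st) t1.
    by rewrite /f -/c; lin.
have := key 0 1 ler01; rewrite /f -[in w 1 _](add0r 1) wp -[in g 1](add0r 1) gp.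
by lin.
Qed.

(** Piecewise linear with slope [s a] on edge [a], written with hinges so that continuity is
    automatic. *)
Definition pwl h (s : nat -> R) x := s 0%N * x + \sum_(1 <= c < (njct h).+1) (s c - s c.-1) * pos (x - jpoint h c).

Lemma pwlE h s a x y : wf h -> (a <= njct h)%N ->
  ((1 <= a)%N -> jpoint h a <= x /\ jpoint h a <= y) ->
  ((a < njct h)%N -> x <= jpoint h a.+1 /\ y <= jpoint h a.+1) ->
  pwl h s y - pwl h s x = s a * (y - x).
Proof.
move=> wh aN h1 h2; rewrite /pwl.
have -> u v u' v' : (u + v) - (u' + v') = (u - u') + (v - v') :> R by ring.
rewrite -sumrB (big_cat_nat (n := a.+1))//= [X in _ + (_ + X)]big_nat [X in _ + (_ + X)]big1 ?addr0.
  have -> : \sum_(1 <= c < a.+1) ((s c - s c.-1) * pos (y - jpoint h c) - (s c - s c.-1) * pos (x - jpoint h c))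
     = \sum_(1 <= c < a.+1) ((s c - s c.-1) * (y - x)).
    apply: eq_big_nat => c /andP[c1]; rewrite ltnS => ca.
    have [hx hy] := h1 (leq_trans c1 ca).
    have hca := jpoint_le wh c1 ca aN.
    rewrite !pos_id ?subr_ge0; [ring|exact: le_trans hca hx|exact: le_trans hca hy].
  rewrite -mulr_suml big_add1 /= telescope_sumr//=; ring.
move=> c /andP[ac cN].
have [hx hy] := h2 (leq_trans ac cN).
have hca := jpoint_le wh (ltn0Sn a) ac cN.
rewrite !pos_le0 ?mulr0 ?subr0// subr_le0; [exact: le_trans hx hca|exact: le_trans hy hca].
Qed.

Lemma pwl_lip h s : exists2 M, 0 <= M & forall x y, `|pwl h s x - pwl h s y| <= M * `|x - y|.
Proof.
exists (`|s 0%N| + \sum_(1 <= c < (njct h).+1) `|s c - s c.-1|).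
  by rewrite addr_ge0// sumr_ge0.
move=> x y; rewrite /pwl.
have -> u v u' v' : (u + v) - (u' + v') = (u - u') + (v - v') :> R by ring.
rewrite mulrDl; apply: le_trans (ler_normD _ _) _; rewrite -mulrBr normrM lerD2l.
rewrite -sumrB mulr_suml; apply: le_trans (ler_norm_sum _ _ _) _; apply: ler_sum => c _.
rewrite -mulrBr normrM ler_wpM2l//; apply: le_trans (pos_lip _ _) _.
by rewrite opprB addrA subrK.
Qed.
End Levels.

(** * The level of the mean of the largest limiter *)

Section MeanBounds.
Context {R : realType}.
Implicit Types (h : hamiltonian R) (w : R -> R -> R) (K : nat) (tau : nat -> R) (A : nat -> nat -> R).

Lemma max_over1 (f : nat -> R) : max_over 1 f = f 1%N.
Proof. by rewrite /max_over /index_iota big_cons big_nil maxxx. Qed.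
Lemma max_over_ge N (f : nat -> R) k : (1 <= k)%N -> (k <= N)%N -> f k <= max_over N f.
Proof.
by move=> k1 kN; apply: (@le_bigmax_seq _ _ _ _ _ k) => //; rewrite mem_index_iota k1 ltnS.
Qed.
Lemma max_over_ex N (f : nat -> R) : (1 <= N)%N -> exists2 k, (1 <= k <= N)%N & max_over N f = f k.
Proof.
move=> N1; rewrite /max_over big_nat; elim/big_ind: _ => //.
- by exists 1%N.
- move=> x y [k kN ->] [l lN ->]; case: leP => _; [by exists l|by exists k].
- by move=> k kN; exists k.
Qed.
Lemma max_over_le N (f : nat -> R) C : (1 <= N)%N -> (forall k, (1 <= k)%N -> (k <= N)%N -> f k <= C) ->
  max_over N f <= C.
Proof. by move=> N1 H; have [k /andP[k1 kN] ->] := max_over_ex f N1; exact: H. Qed.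
Lemma max_over_eq N (f g : nat -> R) : (1 <= N)%N -> (forall k, (1 <= k)%N -> (k <= N)%N -> f k = g k) ->
  max_over N f = max_over N g.
Proof.
move=> N1 H; apply/eqP; rewrite eq_le; apply/andP; split; apply: max_over_le => // k k1 kN.
  by rewrite H// max_over_ge.
by rewrite -H// max_over_ge.
Qed.

Lemma step_on_max h K tau A : grid_adm h K tau A ->
  step_on K tau (fun i => max_over (njct h) (fun k => A k i)) (fun s => max_over (njct h) (fun k => limiter h k s)).
Proof.
move=> ga; have [[N1 _ _] _ _] := ga; split.
  by move=> s; apply: max_over_eq => // k k1 kN; have [p _] := grid_adm_step ga k1 kN; exact: p.
by move=> i iK s si; apply: max_over_eq => // k k1 kN; have [_ p] := grid_adm_step ga k1 kN; exact: p.
Qed.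

Lemma step_primitive_lip K tau (A : nat -> R) (f : R -> R) : time_grid K tau -> step_on K tau A f ->
  exists g M, [/\ 0 <= M, forall t, g (t + 1) = g t, forall s t, `|g t - g s| <= M * `|t - s| &
  forall (k : int) i s t, (i <= K)%N -> tau i + k%:~R <= s -> s <= tau i.+1 + k%:~R ->
    tau i + k%:~R <= t -> t <= tau i.+1 + k%:~R -> g t - g s = (mean f - A i) * (t - s)].
Proof.
move=> tg st; have [g [gp gs]] := step_primitive tg (mean_step tg st).
have [M M0 hM] := finite_bound (fun i => `|mean f - A i|) K.
exists g, M; split => //; apply: (grid_lip tg) => k i s t iK s1 st' t1.
rewrite (gs k i)//; last 2 first; [exact: le_trans st' t1|exact: le_trans s1 st'|].
by rewrite normrM [`|t - s|]ger0_norm ?subr_ge0// ler_wpM2r ?subr_ge0// hM.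
Qed.

Lemma pwl_edge h s a x : wf h -> (a <= njct h)%N -> in_edge h a x -> exists2 r, 0 < r &
  forall y, `|y - x| < r -> pwl h s y = pwl h s x + s a * (y - x).
Proof.
move=> wh aN xe; have [r r0 hr] := in_edge_nbhs xe; exists r => // y /hr [y1 y2].
have [x1 x2] := xe.
rewrite -(@pwlE _ h s a x y wh aN); first by ring.
  by move=> a1; rewrite !ltW ?x1 ?y1.
by move=> a1; rewrite !ltW ?x2 ?y2.
Qed.

Lemma pwl_right h s a : wf h -> (1 <= a)%N -> (a <= njct h)%N -> exists2 r, 0 < r &
  forall y, jpoint h a < y -> y < jpoint h a + r -> pwl h s y = pwl h s (jpoint h a) + s a * (y - jpoint h a).
Proof.
move=> wh a1 aN; have [r r0 hr] := in_edge_right wh a1 aN; exists r => // y y1 y2.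
have [e1 e2] := hr y y1 y2.
rewrite -(@pwlE _ h s a _ y wh aN); first by ring.
  by move=> _; split; [exact: lexx|exact: ltW].
by move=> aN'; split; [apply: ltW; exact: lt_trans y1 (e2 aN')|apply: ltW; exact: e2].
Qed.

Lemma pwl_left h s a : wf h -> (1 <= a)%N -> (a <= njct h)%N -> exists2 r, 0 < r &
  forall y, y < jpoint h a -> jpoint h a - r < y -> pwl h s y = pwl h s (jpoint h a) + s a.-1 * (y - jpoint h a).
Proof.
move=> wh a1 aN; have [r r0 hr] := in_edge_left wh a1 aN; exists r => // y y1 y2.
have [e1 e2] := hr y y1 y2; have aN' : (a.-1 <= njct h)%N by apply: leq_trans aN; exact: leq_pred.
rewrite -(@pwlE _ h s a.-1 _ y wh aN'); first by ring.
  by move=> a2; split; [apply: ltW; exact: lt_trans (e1 a2) y1|apply: ltW; exact: e1].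
by rewrite prednK// => _; split; [exact: lexx|exact: ltW].
Qed.

Lemma grid_adm_ham_le h K tau A a i : grid_adm h K tau A -> (a <= njct h)%N -> (i <= K)%N ->
  ham h a (pmin h a) <= max_over (njct h) (fun k => A k i).
Proof.
move=> ga aN iK; have [[N1 _ _] _ _] := ga.
case: a aN => [|a] aN.
  have [h1 _] := grid_adm_ge ga (leqnn 1) N1 iK; apply: le_trans h1 _.
  exact: (max_over_ge (fun k => A k i) (leqnn 1) N1).
have [_ h1] := grid_adm_ge ga (ltn0Sn a) aN iK; apply: le_trans h1 _.
exact: (max_over_ge (fun k => A k i) (ltn0Sn a) aN).
Qed.

(** With slope [pmin h a] on every edge all Hamiltonians sit at their minima, below the limiters,
    and one time profile absorbs the largest limiter on each cell. *)
Lemma mean_max_level h K tau A : grid_adm h K tau A ->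
  subcorrector_levels h K tau (mean (fun s => max_over (njct h) (fun k => limiter h k s))).
Proof.
move=> ga; have [wh tg _] := ga; set c := mean _.
have [g [M [M0 gp gl gs]]] := step_primitive_lip tg (step_on_max ga).
have [M' M'0 Bl] := pwl_lip h (pmin h); pose w t x := g t + pwl h (pmin h) x.
have lw : lipon everywhere (M + M') w.
  move=> s t x y _ _; rewrite /w.
  have := gl t s; have := Bl x y; have := ler_normD (g s - g t) (pwl h (pmin h) x - pwl h (pmin h) y).
  have -> : g s - g t + (pwl h (pmin h) x - pwl h (pmin h) y) = g s + pwl h (pmin h) x - (g t + pwl h (pmin h) y) by ring.
  have := mulr_ge0 M0 (normr_ge0 (x - y)); have := mulr_ge0 M'0 (normr_ge0 (s - t)).
  by lin.
apply: (level_intro wh (addr_ge0 M0 M'0) lw); first by move=> t x; rewrite /w gp.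
move=> t x [k [i [iK [t1 t2]]]]; set Am := max_over (njct h) (fun k => A k i).
have hth : exists2 r, 0 < r & forall s, `|s - t| < r -> w t x + (c - Am) * (s - t) <= w s x.
  exists (Num.min (t - (tau i + k%:~R)) (tau i.+1 + k%:~R - t)); first by rewrite lt_min !subr_gt0 t1.
  move=> s; rewrite lt_min => /andP[]; rewrite !ltr_norml => /andP[g1 _] /andP[_ g2].
  rewrite /w -(gs k i t s)//; [lin| | | |]; move: t1 t2 g1 g2; lin.
have [[a aN xe]|[a [a1 aN xE]]] := in_edge_cases x wh.
  have [r r0 hr] := pwl_edge (pmin h) wh aN xe.
  apply: (subpt_edge (pl := pmin h a) (pr := pmin h a) wh aN xe hth).
  - exists r => // y y1 y2.
    have yr : `|y - x| < r by rewrite gtr0_norm ?subr_gt0//; move: y2; lin.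
    by rewrite /w (hr y yr) -addrA.
  - exists r => // y y1 y2.
    have yr : `|y - x| < r by rewrite ltr0_norm ?subr_lt0//; move: y2; lin.
    by rewrite /w (hr y yr) -addrA.
  - move=> q /andP[q1 q2]; have -> : q = pmin h a by apply/eqP; rewrite eq_le q1 q2.
    by have := grid_adm_ham_le ga aN iK; rewrite -/Am; lin.
have [r r0 hr] := pwl_right (pmin h) wh a1 aN; have [r' r'0 hr'] := pwl_left (pmin h) wh a1 aN.
apply: (subpt_junction (pl := pmin h a.-1) (pr := pmin h a) wh a1 aN xE hth).
- by exists r => // y; rewrite xE => y1 y2; rewrite /w (hr y y1 y2) -addrA.
- by exists r' => // y; rewrite xE => y1 y2; rewrite /w (hr' y y1 y2) -addrA.
suff : junction_ham h a t (pmin h a.-1) (pmin h a) <= Am by lin.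
have aN' : (a.-1 <= njct h)%N by apply: leq_trans aN; exact: leq_pred.
rewrite /junction_ham Hplus_r// Hminus_r// !ge_max !(grid_adm_ham_le ga)//=.
rewrite (@step_onE _ K tau _ _ k i t (grid_adm_step ga a1 aN))// ?(ltW t1)//.
exact: (max_over_ge (fun k => A k i) a1 aN).
Qed.

Lemma has_inf_levels h K tau A : grid_adm h K tau A -> has_inf (subcorrector_levels h K tau).
Proof.
move=> ga; have [[N1 _ _] _ _] := ga; split; first by exists (mean (fun s => max_over (njct h) (fun k => limiter h k s))); exact: mean_max_level ga.
by exists (mean (limiter h 1%N)) => lam; exact: (mean_le_level ga (leqnn 1) N1).
Qed.

Lemma mean_le_eff h K tau A a : grid_adm h K tau A -> (1 <= a)%N -> (a <= njct h)%N ->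
  mean (limiter h a) <= effective_limiter h K tau.
Proof.
move=> ga a1 aN; apply: lb_le_inf; first by case: (has_inf_levels ga).
by move=> lam; exact: (mean_le_level ga).
Qed.

Lemma eff_le h K tau A lam : grid_adm h K tau A -> subcorrector_levels h K tau lam ->
  effective_limiter h K tau <= lam.
Proof. by move=> ga Hl; apply: ge_inf => //; case: (has_inf_levels ga). Qed.

Lemma max_mean_le_eff h K tau A : grid_adm h K tau A ->
  max_over (njct h) (fun k => mean (limiter h k)) <= effective_limiter h K tau.
Proof.
move=> ga; have [[N1 _ _] _ _] := ga; apply: max_over_le => // k k1 kN; exact: mean_le_eff ga k1 kN.
Qed.

Lemma eff_one_junction h K tau A : grid_adm h K tau A -> njct h = 1%N ->
  effective_limiter h K tau = mean (limiter h 1%N).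
Proof.
move=> ga N1; apply/eqP; rewrite eq_le (mean_le_eff ga) ?N1// andbT.
apply: (eff_le ga); have := mean_max_level ga; rewrite N1.
by congr (subcorrector_levels h K tau (mean _)); apply/funext => s; rewrite max_over1.
Qed.
End MeanBounds.

(** * Monotonicity in the edge lengths *)
Section Monotone.
Context {R : realType}.
Implicit Types (h : hamiltonian R) (w U V phi : R -> R -> R) (K : nat) (tau : nat -> R) (A : nat -> nat -> R).

Lemma C1xy_lip_loc phi phit phix (t x : R) : C1xy phi phit phix -> exists r B, [/\ 0 < r, 0 <= B &
  forall s y z, `|s - t| < r -> `|y - x| < r -> `|z - x| < r -> `|phi s y - phi s z| <= B * `|y - z|].
Proof.
move=> [_ _ cx _ dx]; have [r r0 hr] := cx t x 1 ltr01.
exists r, (1 + `|phix t x|); split => //.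
move=> s y z st; wlog yz : y z / y <= z => [H|] hy hz.
  have [yz|zy] := leP y z; first exact: H.
  by rewrite distrC [`|y - z|]distrC H// ltW.
rewrite distrC [`|y - z|]distrC (ger0_norm (_ : 0 <= z - y)) ?subr_ge0//.
have := @mvt_bound R (phi s) (phix s) y z 0 (1 + `|phix t x|) yz _ _ _.
rewrite mul0r subr0; apply.
- by move=> v _; exact: dx.
- by move=> v _ e e0; exact: der_cont (dx s v) e e0.
- move=> v /andP[v1 v2]; rewrite subr0.
  have vx : `|v - x| < r.
    by move: hy hz; rewrite !ltr_norml => /andP[a1 a2] /andP[b1 b2]; move: v1 v2 a1 b2; lin.
  by have := hr s v st vx; have := ler_normD (phix s v - phix t x) (phix t x); rewrite subrK; lin.
Qed.

Definition move_pts h b := Hamiltonian (njct h) b (ham h) (pmin h) (limiter h).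

Lemma subpt_move h b c k lam U V t x :
  (exists2 r, 0 < r & forall s y, `|s - t| < r -> `|y - x| < r -> V s y = U s (y - c) + k) ->
  (forall a, (a <= njct h)%N -> in_edge (move_pts h b) a x -> in_edge h a (x - c)) ->
  (forall a, (1 <= a)%N -> (a <= njct h)%N -> x = b a -> x - c = jpoint h a) ->
  subpt h lam U t (x - c) -> subpt (move_pts h b) lam V t x.
Proof.
move=> [r r0 VU] he hj [s1 s2].
have tr phi phit phix : C1xy phi phit phix ->
    C1xy (fun t x => phi t (x + c)) (fun t x => phit t (x + c)) (fun t x => phix t (x + c)).
  move=> cphi; have := C1xy_comp cphi (@C1_id R) (C1_aff 1 c) => hh.
  by apply: (C1xy_eq hh) => s y; rewrite mul1r// mulr1.
split.
  move=> a phi phit phix aN cphi xe [q q0 hq].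
  have := s1 a _ _ _ aN (tr _ _ _ cphi) (he a aN xe); rewrite subrK; apply.
  exists (Num.min r q); first by rewrite lt_min r0.
  move=> s y; rewrite !lt_min => /andP[s3 s4] /andP[].
  have E : y - (x - c) = y + c - x by ring.
  rewrite E => y1 y2; have := hq s (y + c) s4 y2; rewrite !VU ?subrr ?normr0// addrK.
  by rewrite subrK; lin.
move=> a phi phit phix pl pr a1 aN cphi xb [q q0 hq].
have := s2 a _ _ _ pl pr a1 aN (tr _ _ _ cphi) (hj a a1 aN xb); rewrite subrK; apply.
exists (Num.min r q); first by rewrite lt_min r0.
move=> s y; rewrite !lt_min => /andP[s3 s4] /andP[].
have E : y - (x - c) = y + c - x by ring.
rewrite E => y1 y2; have := hq s (y + c) s4 y2; rewrite !VU ?subrr ?normr0// addrK subrK.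
have -> : kink pl pr (x - c) y = kink pl pr x (y + c) by rewrite /kink; congr (_ * pos _ - _ * pos _); ring.
have -> : kink pl pr (x - c) (x - c) = kink pl pr x x by rewrite /kink; congr (_ * pos _ - _ * pos _); ring.
lin.
Qed.

Lemma in_edge_move h b a x : in_edge (move_pts h b) a x =
  (((1 <= a)%N -> b a < x) /\ ((a < njct h)%N -> x < b a.+1)).
Proof. by []. Qed.

Lemma level_translate h b c K tau lam : wf h -> increasing_points (njct h) b ->
  (forall j, (1 <= j)%N -> (j <= njct h)%N -> b j = jpoint h j + c) ->
  subcorrector_levels h K tau lam -> subcorrector_levels (move_pts h b) K tau lam.
Proof.
move=> wh ib hb Hl; have [M [w [M0 lw wp cw]]] := level_elim wh Hl.
have [N1 _ ah] := wh; have wh' : wf (move_pts h b) by [].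
apply: (level_intro (w := fun t x => w t (x - c)) (M := M) wh' M0).
- by move=> s t x y _ _; apply: le_trans (lw s t _ _ I I) _; rewrite opprB addrA subrK.
- by move=> t x; exact: wp.
move=> t x rt; apply: (subpt_move (c := c) (k := 0)); last exact: cw.
- by exists 1 => // s y _ _; rewrite addr0.
- move=> a aN; rewrite in_edge_move => -[e1 e2]; split=> a1.
    by rewrite ltrBrDr -hb//; exact: e1.
  by rewrite ltrBlDr -hb//; exact: e2.
- by move=> a a1 aN ->; rewrite hb// addrK.
Qed.

(* A band of slope [pmin h k] is inserted to the right of the [k]-th junction. *)
Lemma level_insert h b k D K tau lam : wf h -> increasing_points (njct h) b -> 0 < D ->
  (1 <= k)%N -> (k <= njct h)%N ->
  (forall j, (1 <= j)%N -> (j <= njct h)%N -> b j = jpoint h j + (if (k < j)%N then D else 0)) ->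
  subcorrector_levels h K tau lam -> subcorrector_levels (move_pts h b) K tau lam.
Proof.
move=> wh ib D0 k1 kN hb Hl; have [M [w [M0 lw wp cw]]] := level_elim wh Hl.
have [N1 _ ah] := wh; have wh' : wf (move_pts h b) by [].
set bk := jpoint h k; set p := pmin h k.
have bkE : b k = bk by rewrite hb// ltnn addr0.
(* [y - psi y] collapses the band [[bk, bk + D]] onto the junction and shifts back what lies to its
   right; [p * psi] gives the band its slope. *)
pose psi y := pos (y - bk) - pos (y - (bk + D)).
pose V t y := w t (y - psi y) + p * psi y.
have psi0 y : y <= bk -> psi y = 0.
  by move=> yb; rewrite /psi !pos_le0 ?subrr// subr_le0//; move: yb D0; lin.
have psi1 y : bk <= y -> y <= bk + D -> psi y = y - bk.
  by move=> y1 y2; rewrite /psi pos_id ?subr_ge0// pos_le0 ?subr0// subr_le0.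
have psi2 y : bk + D <= y -> psi y = D.
  move=> y1; rewrite /psi !pos_id ?subr_ge0//; first by ring.
  by move: y1 D0; lin.
have psil x y : `|psi x - psi y| <= 2 * `|x - y|.
  rewrite /psi; have h1 := pos_lip (x - bk) (y - bk); have h2 := pos_lip (x - (bk + D)) (y - (bk + D)).
  have e c : x - c - (y - c) = x - y by ring.
  rewrite !e in h1 h2.
  have := ler_normB (pos (x - bk) - pos (y - bk)) (pos (x - (bk + D)) - pos (y - (bk + D))).
  have -> : pos (x - bk) - pos (y - bk) - (pos (x - (bk + D)) - pos (y - (bk + D))) =
    pos (x - bk) - pos (x - (bk + D)) - (pos (y - bk) - pos (y - (bk + D))) by ring.
  by move: h1 h2; lin.
have V0 s y : y <= bk -> V s y = w s y by move=> yb; rewrite /V psi0// subr0 mulr0 addr0.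
have V1 s y : bk <= y -> y <= bk + D -> V s y = w s bk + p * (y - bk).
  by move=> y1 y2; rewrite /V psi1// (_ : y - (y - bk) = bk)//; ring.
have V2 s y : bk + D <= y -> V s y = w s (y - D) + p * D.
  by move=> y1; rewrite /V psi2.
have wk s y : w s y <= w s bk + M * `|y - bk|.
  by have := lw s s y bk I I; rewrite subrr normr0 add0r => /ler_normlP[_]; lin.
have lV : lipon everywhere (3 * M + 2 * `|p|) V.
  move=> s t x y _ _; rewrite /V.
  have h1 := lw s t (x - psi x) (y - psi y) I I; have h2 := psil x y.
  have h3 := ler_normB (x - y) (psi x - psi y).
  have e : x - y - (psi x - psi y) = x - psi x - (y - psi y) by ring.
  rewrite e in h3.
  have h4 : `|x - psi x - (y - psi y)| <= 3 * `|x - y| by move: h2 h3; lin.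
  have h5 := ler_wpM2l M0 h4.
  have h6 := ler_normD (w s (x - psi x) - w t (y - psi y)) (p * (psi x - psi y)).
  have e' : w s (x - psi x) - w t (y - psi y) + p * (psi x - psi y) =
    w s (x - psi x) + p * psi x - (w t (y - psi y) + p * psi y) by ring.
  rewrite e' normrM in h6.
  have h7 := ler_wpM2l (normr_ge0 p) h2.
  have h8 := mulr_ge0 M0 (normr_ge0 (s - t)); have h9 := mulr_ge0 (normr_ge0 p) (normr_ge0 (s - t)).
  by move: h1 h5 h6 h7 h8 h9; lin.
have M'0 : 0 <= 3 * M + 2 * `|p| by have := normr_ge0 p; move: M0; lin.
apply: (level_intro wh' M'0 lV); first by move=> t x; rewrite /V wp.
have aN' : (k.-1 <= njct h)%N by apply: leq_trans kN; exact: leq_pred.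
have minJ t pl pr : ham h k p <= junction_ham h k t pl pr.
  by rewrite /junction_ham !le_max (Hminus_ge _ (ah k kN)) orbT.
have edge a x : (a <= njct h)%N -> in_edge (move_pts h b) a x -> bk < x -> x < bk + D -> a = k.
  move=> aN; rewrite in_edge_move => -[e1 e2] x1 x2; have [ak|ka|//] := ltngtP a k.
    have aN1 : (a < njct h)%N by exact: leq_trans ak kN.
    have := e2 aN1; rewrite hb// ltnNge ak /= addr0; have := jpoint_le wh (ltn0Sn a) ak kN.
    by move: x1; rewrite /bk; clear=> *; exfalso; lra.
  have a1 : (1 <= a)%N by exact: leq_trans ka.
  have := e1 a1; rewrite hb// ka; have := jpoint_lt wh k1 ka aN.
  by move: x2; rewrite /bk; clear=> *; exfalso; lra.
have nojct a x : (1 <= a)%N -> (a <= njct h)%N -> bk < x -> x <= bk + D -> x <> b a.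
  move=> a1 aN x1 x2 xa; rewrite hb// in xa; move: xa; case: ifP => ak xa.
    by have := jpoint_lt wh k1 ak aN; move: x2; rewrite xa /bk; clear=> *; lra.
  have ak' : (a <= k)%N by rewrite leqNgt ak.
  by have := jpoint_le wh a1 ak' kN; move: x1; rewrite xa /bk; clear=> *; lra.
move=> t x rt; have [xk|kx|xE] := ltgtP x bk.
- apply: (subpt_move (c := 0) (k := 0)); last by rewrite subr0; exact: cw.
  + exists (bk - x); first by rewrite subr_gt0.
    move=> s y _; rewrite subr0 addr0 => yx; apply: V0; apply: ltW; move: yx; rewrite ltr_norml; lin.
  + move=> a aN; rewrite in_edge_move subr0 => -[e1 e2]; split=> a1.
      by have := e1 a1; rewrite hb//; case: ifP => _; move: D0; lin.
    have := e2 a1; rewrite hb//; case: ifP => //; last by rewrite addr0.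
    move=> ka _; apply: lt_le_trans xk _; apply: (jpoint_le wh k1 _ a1).
    exact: ltnW.
  + move=> a a1 aN; rewrite hb// subr0; case: ifP => ka xa; last by rewrite xa addr0.
    by exfalso; have := jpoint_lt wh k1 ka aN; move: xk; rewrite xa /bk; move: D0; clear=> *; lra.
- have [xD|Dx|xE] := ltgtP x (bk + D).
  + split; last by move=> a phi phit phix pl pr a1 aN _ xa; case: (nojct a x a1 aN kx (ltW xD) xa).
    move=> a phi phit phix aN cphi xe lm; have E := edge a x aN xe kx xD.
    have lm0 : locmax (fun s y => V s y - phi s y - kink 0 0 x y) t x.
      by case: lm => r r0 hr; exists r => // s y h1 h2; rewrite !kink00 !subr0; exact: hr.
    have px : phix t x = p.
      apply/eqP; rewrite eq_le; apply/andP; split.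
        rewrite -[X in X <= _]addr0; apply: (locmax_left cphi lm0).
        exists (x - bk); first by rewrite subr_gt0.
        by move=> y y1 y2; rewrite !V1; [lin|..]; move: y1 y2 kx xD; lin.
      rewrite -[X in _ <= X]addr0; apply: (locmax_right cphi lm0).
      exists (bk + D - x); first by rewrite subr_gt0.
      by move=> y y1 y2; rewrite !V1; [lin|..]; move: y1 y2 kx xD; lin.
    (* In the band the contact has slope exactly [p], a minimizer. The time trace of [phi] at [x],
       tested against [w] at the junction with a steep kink, gives the bound with the minimal
       Hamiltonian. *)
    rewrite px E; have [_ S] := cw t bk rt.
    have cpsi := C1xy_comp cphi (@C1_id R) (C1_cst x).
    have := S k _ _ _ (- M) M k1 kN cpsi erefl; rewrite mulr1 => H.
    have : locmax (fun s y => w s y - phi s x - kink (- M) M bk y) t bk.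
      case: lm => r r0 hr; exists r => // s y s1 _.
      have := hr s x s1; rewrite subrr normr0 => /(_ r0).
      rewrite !V1 ?(ltW kx) ?(ltW xD)// !kink_abs subrr normr0 mulr0; have := wk s y; lin.
    by move=> /H; have := minJ t (phix t x * 0 + - M) (phix t x * 0 + M); rewrite /p; lin.
  + apply: (subpt_move (c := D) (k := p * D)); last exact: cw.
    * exists (x - (bk + D)); first by rewrite subr_gt0.
      move=> s y _ yx; apply: V2; apply: ltW; move: yx; rewrite ltr_norml; lin.
    * move=> a aN; rewrite in_edge_move => -[e1 e2]; split=> a1.
        rewrite ltrBrDr; have := e1 a1; rewrite hb//; case: ifP => [//|ka].
        have ak' : (a <= k)%N by rewrite leqNgt ka.
        by have := jpoint_le wh a1 ak' kN; move: Dx; rewrite /bk; lin.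
      by rewrite ltrBlDr; have := e2 a1; rewrite hb//; case: ifP => // _; move: D0; lin.
    * move=> a a1 aN; rewrite hb//; case: ifP => ka xa; first by rewrite xa addrK.
      have ak' : (a <= k)%N by rewrite leqNgt ka.
      by exfalso; have := jpoint_le wh a1 ak' kN; move: Dx; rewrite xa /bk; move: D0; clear=> *; lra.
  + split; last by move=> a phi phit phix pl pr a1 aN _ xa; case: (nojct a x a1 aN kx _ xa); rewrite xE.
    move=> a phi phit phix aN cphi xe lm.
    have E : a = k.
      have [r r0 hr] := in_edge_nbhs xe.
      pose y := x - Num.min (D / 2) (r / 2).
      have m0 : 0 < Num.min (D / 2) (r / 2) by rewrite lt_min !divr_gt0.
      have m1 : Num.min (D / 2) (r / 2) <= D / 2 /\ Num.min (D / 2) (r / 2) <= r / 2.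
        by rewrite !ge_min !lexx orbT.
      apply: (edge a y aN); rewrite /y.
      - apply: hr; rewrite ltr_norml; move: m0 m1 r0; clear => *; lra.
      - by rewrite xE; move: m0 m1 D0; clear => *; lra.
      - by rewrite xE; move: m0; lin.
    have lm0 : locmax (fun s y => V s y - phi s y - kink 0 0 x y) t x.
      by case: lm => r r0 hr; exists r => // s y h1 h2; rewrite !kink00 !subr0; exact: hr.
    have px : phix t x <= p.
      rewrite -[X in X <= _]addr0; apply: (locmax_left cphi lm0).
      exists D => // y y1 y2; rewrite !V1; [lin|..]; move: y1 y2 kx xE; clear => *; lra.
    have [r [B [r0 B0 hB]]] := C1xy_lip_loc t x cphi.
    (* At the right end of the band the contact slope is at most [p], so the Hamiltonian coincides
       with its decreasing part. The junction inequality for [w] bounds that part, tested with the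
       translate of [phi] on the right and a steep slope on the left. *)
    have cpsi := C1xy_comp cphi (@C1_id R) (C1_aff 1 D).
    have [_ S] := cw t bk rt.
    have := S k _ _ _ (- (M + B)) 0 k1 kN cpsi erefl.
    rewrite mul1r -xE !mulr1 addr0 => H.
    have : locmax (fun s y => w s y - phi s (1 * y + D) - kink (- (M + B)) 0 bk y) t bk.
      case: lm => q q0 hq; exists (Num.min r q); first by rewrite lt_min r0.
      move=> s y; rewrite !lt_min => /andP[s1 s2] /andP[y1 y2]; rewrite !mul1r -xE.
      rewrite {2}/kink subrr (pos_le0 (lexx 0)) !mulr0 !subr0.
      have Ex : y + D - x = y - bk by rewrite xE; ring.
      have [yb|by_] := leP bk y.
        have := hq s (y + D) s2; rewrite Ex => /(_ y2).
        rewrite !V2 ?xE ?lerD2r// !addrK /kink mul0r.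
        rewrite (pos_le0 (y := bk - y)) ?subr_le0// mulr0 subr0; lin.
      have := hq s x s2; rewrite subrr normr0 => /(_ q0); rewrite !V2 ?xE// !addrK -xE.
      have := hB s (y + D) x s1; rewrite Ex subrr normr0 => /(_ y1 r0) /ler_normlP[h1 _].
      have := wk s y; rewrite /kink mul0r pos_id ?subr_ge0 ?(ltW by_)//.
      move: h1; rewrite (ltr0_norm (x := y - bk)) ?subr_lt0//; lin.
    move=> /H; rewrite E; apply: le_trans; rewrite lerD2l /junction_ham.
    by rewrite -(Hminus_l (ham h k) px) !le_max lexx orbT.
- split.
    move=> a phi phit phix aN _ xe; have kx' := edge_junction wh' aN xe k1 kN.
    by case: kx'; rewrite xE -bkE.
  move=> a phi phit phix pl pr a1 aN cphi xa lm.
  have E : a = k by apply: (jpoint_inj wh') => //; change (b a = b k); rewrite bkE -xE xa.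
  have px : p <= phix t x + pr.
    apply: (locmax_right cphi lm); exists D => // y y1 y2.
    by rewrite xE !V1 -?xE; [lin|..]; move: y1 y2 D0 xE; clear => *; lra.
  (* At the left end the right slope is at least [p], so the decreasing part takes its minimal value
     and does not exceed the one at the steep slope [M + B], for which [w] has a contact. *)
  have [r [B [r0 B0 hB]]] := C1xy_lip_loc t x cphi.
  have [_ S] := cw t x rt.
  have := S k _ _ _ pl (M + B) k1 kN cphi xE.
  move=> H; have : locmax (fun s y => w s y - phi s y - kink pl (M + B) x y) t x.
    case: lm => q q0 hq; exists (Num.min r q); first by rewrite lt_min r0.
    move=> s y; rewrite !lt_min => /andP[s1 s2] /andP[y1 y2].
    have kk : kink pl (M + B) x x = 0 by rewrite /kink subrr (pos_le0 (lexx 0)) !mulr0 subr0.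
    have kk' : kink pl pr x x = 0 by rewrite /kink subrr (pos_le0 (lexx 0)) !mulr0 subr0.
    have [yb|by_] := leP y x.
      have := hq s y s2 y2; rewrite !V0 -?xE// kk kk' {1}/kink.
      rewrite /kink (pos_le0 (y := y - x)) ?subr_le0// !mulr0; lin.
    have := hq s x s2; rewrite subrr normr0 => /(_ q0); rewrite !V0 -?xE// kk kk'.
    have := hB s y x s1 y1; rewrite subrr normr0 => /(_ r0) /ler_normlP[h1 _].
    have := wk s y; rewrite -xE /kink (pos_id (y := y - x)) ?subr_ge0 ?(ltW by_)//.
    rewrite (pos_le0 (y := x - y)) ?subr_le0 ?(ltW by_)// mulr0 subr0.
    move: h1; rewrite (gtr0_norm (x := y - x)) ?subr_gt0//; lin.
  move=> /H; apply: le_trans; rewrite E lerD2l.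
  suff : Hminus (ham h k) p (phix t x + pr) <= Hminus (ham h k) p (phix t x + (M + B)).
    rewrite /junction_ham /= => h1; rewrite !ge_max !le_max lexx h1 lexx !orbT.
    by [].
  by rewrite (Hminus_r _ px); exact: (Hminus_ge _ (ah k kN)).
Qed.

Lemma edge_length_mid N (b : nat -> R) j : (1 <= j)%N -> (j < N)%N -> edge_length N b j = (b j.+1 - b j)%:E.
Proof. by case: j => // j _ jN; rewrite /edge_length /epoint /= jN ltnW. Qed.

(** Edge lengths determine the points up to a translation; lengthening edge [k] by [D] shifts the
    points beyond it, and for an unbounded edge only the translation is left. *)
Lemma level_monotone h b k K tau lam : wf h -> increasing_points (njct h) b -> (k <= njct h)%N ->
  (forall j, (j <= njct h)%N -> j != k -> edge_length (njct h) b j = edge_length (njct h) (jpoint h) j) ->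
  (edge_length (njct h) (jpoint h) k <= edge_length (njct h) b k)%E ->
  subcorrector_levels h K tau lam -> subcorrector_levels (move_pts h b) K tau lam.
Proof.
move=> wh ib kN hj hk Hl; have [N1 inc ah] := wh.
pose c := b 1%N - jpoint h 1%N.
pose D := if (1 <= k)%N && (k < njct h)%N then (b k.+1 - b k) - (jpoint h k.+1 - jpoint h k) else 0.
have D0 : 0 <= D.
  rewrite /D; case: ifP => // /andP[k1 kN']; move: hk; rewrite !edge_length_mid// lee_fin.
  by rewrite subr_ge0.
have bE j : (1 <= j)%N -> (j <= njct h)%N -> b j = jpoint h j + c + (if (1 <= k)%N && (k < j)%N then D else 0).
  elim: j => // j IH _ jN; case: j IH jN => [|j] IH jN.
    by rewrite /c [X in if X then _ else _](_ : _ = false) ?addr0; [ring|by case: (k) => [|[|m]]].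
  have := IH isT (ltnW jN); have [E|jk] := eqVneq j.+1 k.
    rewrite /D -E jN ltnn ltnSn /=; lra.
  have := hj j.+1 (ltnW jN) jk; rewrite !edge_length_mid// => -[h1].
  have -> : (k < j.+2)%N = (k < j.+1)%N by rewrite ltnS leq_eqVlt eq_sym (negbTE jk).
  by move=> h2; lra.
have h1 := level_translate (b := fun j => jpoint h j + c) (c := c) wh.
have i1 : increasing_points (njct h) (fun j => jpoint h j + c) by move=> j j1 jN; rewrite ltrD2r inc.
have {}h1 := h1 _ _ _ i1 (fun _ _ _ => erefl) Hl.
have w1 : wf (move_pts h (fun j => jpoint h j + c)) by [].
have [D0'|D0'] := eqVneq D 0.
  apply: (level_translate (h := move_pts h (fun j => jpoint h j + c)) (c := 0) w1 ib _ h1).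
  by move=> j j1 jN; rewrite bE// D0'; case: ifP.
have Dp : 0 < D by rewrite lt_neqAle eq_sym D0' D0.
have k1 : (1 <= k)%N by move: D0'; rewrite /D; case: ifP => [/andP[]//|]; rewrite eqxx.
apply: (level_insert (h := move_pts h (fun j => jpoint h j + c)) (k := k) (D := D) w1 ib Dp k1 kN _ h1).
by move=> j j1 jN; rewrite bE// k1.
Qed.

Lemma grid_adm_move h K tau A b : increasing_points (njct h) b -> grid_adm h K tau A ->
  grid_adm (move_pts h b) K tau A.
Proof. by move=> ib [[N1 _ ah] tg adm]. Qed.

Lemma eff_monotone h K tau A b k : grid_adm h K tau A -> increasing_points (njct h) b -> (k <= njct h)%N ->
  (forall j, (j <= njct h)%N -> j != k -> edge_length (njct h) b j = edge_length (njct h) (jpoint h) j) ->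
  (edge_length (njct h) (jpoint h) k <= edge_length (njct h) b k)%E ->
  effective_limiter (move_pts h b) K tau <= effective_limiter h K tau.
Proof.
move=> ga ib kN hj hk; have [wh _ _] := ga.
apply: lb_le_inf; first by case: (has_inf_levels ga).
by move=> lam Hl; apply: (eff_le (grid_adm_move ib ga)); exact: (level_monotone wh ib kN hj hk Hl).
Qed.
End Monotone.

(** * Short and long edges *)
Section Slopes.
Context {R : realType}.
Implicit Types (h : hamiltonian R) (w : R -> R -> R) (F z : R -> R) (K : nat) (tau : nat -> R).

(** Maximum over the past of [w] with a drift. Where it is touched from above, [w] has a contact
    with time slope almost [- C] or more, which bounds the Hamiltonian from above; the slopes of [F]
    are thus controlled without reference to the Lipschitz constant of [w]. *)
Definition running_max w S0 t C F := forall x,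
  (exists s, [/\ S0 <= s, s <= t & F x = w s x + C * s]) /\
  forall s, S0 <= s -> s <= t -> w s x + C * s <= F x.

Lemma running_max_lip w S0 t C F M x y : lipon (fun s => S0 <= s) M w -> running_max w S0 t C F ->
  `|F x - F y| <= M * `|x - y|.
Proof.
move=> lw rF; have half u v : F u - F v <= M * `|u - v|.
  have [[s [s1 s2 ->]] _] := rF u; have [_ /(_ s s1 s2)] := rF v.
  by have := lw s s u v s1 s1; rewrite subrr normr0 add0r => /ler_normlP[_]; lin.
by apply/ler_normlP; rewrite opprB; split; [rewrite distrC|]; exact: half.
Qed.

Lemma running_max_ex w S0 t C M : S0 <= t -> lipon (fun s => S0 <= s) M w -> exists F, running_max w S0 t C F.
Proof.
move=> St lw; suff ex x : exists f, (exists s, [/\ S0 <= s, s <= t & f = w s x + C * s]) /\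
    forall s, S0 <= s -> s <= t -> w s x + C * s <= f.
  by have [F hF] := choice ex; exists F.
have [|s /andP[s1 s2] hs] := @max1 R (fun s => w s x + C * s) S0 t St.
  move=> s /andP[s1 _] e e0; pose q := 1 + `|M| + `|C|.
  have q0 : 0 < q by rewrite /q; have := normr_ge0 M; have := normr_ge0 C; lra.
  exists (e / q); first by rewrite divr_gt0.
  move=> r /andP[r1 _]; rewrite ltr_pdivlMr// => rs.
  have := lw r s x x r1 s1; rewrite subrr normr0 addr0 => /ler_normlP[_] h1.
  have h2 : M * `|r - s| <= `|M| * `|r - s| by rewrite ler_wpM2r// ler_norm.
  have h3 : C * (r - s) <= `|C| * `|r - s| by rewrite -normrM ler_norm.
  by have := normr_ge0 (r - s); move: h1 h2 h3 rs; rewrite /q; lin.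
exists (w s x + C * s); split; first by exists s.
by move=> r r1 r2; apply: hs; rewrite r1.
Qed.

(** At a late maximizing time [s], a contact of [F] becomes a contact of [w] over times up to [s],
    with time slope [- C]; [terminal_touch] then moves it to a regular time. *)
Lemma slope_core h lam K tau w M S0 t C F z z' (y0 y1 x s d : R) : wf h -> time_grid K tau ->
  lipon (fun s => S0 <= s) M w ->
  (forall s x, S0 < s -> regular K tau s -> subpt h lam w s x) ->
  running_max w S0 t C F -> C1 z z' -> y0 < x -> x < y1 ->
  (forall y, y0 <= y <= y1 -> F y - z y <= F x - z x) ->
  S0 < s -> s <= t -> F x = w s x + C * s -> 0 < d ->
  exists s' y psi psit psix, [/\ S0 < s', regular K tau s', `|y - x| < d, C1xy psi psit psix &
    [/\ locmax (fun s y => w s y - psi s y) s' y, - C - d <= psit s' y & `|psix s' y - z' x| <= d]].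
Proof.
move=> wh tg lw cw rF cz yx xy hF Ss st Fx d0.
have [k [i [iK /andP[t1 t2]]]] := grid_left s tg.
have cphi := C1xyD (C1xy_x cz) (C1xy_t (C1Z (- C) (@C1_id R))).
pose r0 := Num.min (Num.min (x - y0) (y1 - x)) (s - S0).
have r00 : 0 < r0 by rewrite !lt_min !subr_gt0 yx xy.
pose e := Num.min (Num.min d (s - (tau i + k%:~R))) (s - S0).
have e0 : 0 < e by rewrite !lt_min !subr_gt0 d0 t1.
have [||s' [y [psi [psit [psix [a1 a2 a3 a4 [a5 a6 a7]]]]]]] := @terminal_touch R (fun s => S0 <= s) M w _ _ _ s x e r0 lw cphi r00 _ _ e0.
- by move=> r; rewrite ltrBlDr -ltrBlDl !lt_min => /andP[_] hh _; move: hh; lin.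
- move=> r v; rewrite ltrBlDr -ltrBlDl !lt_min => /andP[_ h1] h2 /andP[].
  rewrite !ltr_norml => /andP[/andP[h3 _] /andP[_ h4]] _.
  have := hF v; have -> : y0 <= v <= y1 by move: h3 h4; lin.
  have [_ /(_ r)] := rF v => h5 /(_ isT) h6.
  have := h5 _ (le_trans h2 st); have -> : S0 <= r by move: h1; lin.
  by move=> /(_ isT); move: h6; rewrite Fx; lin.
move: a1 a3 a6 a7; rewrite /e; set E := Num.min _ _ => a1 a3 a6 a7.
have [E1 [E2 E3]] : E <= d /\ E <= s - (tau i + k%:~R) /\ E <= s - S0 by rewrite !ge_min !lexx !orbT.
exists s', y, psi, psit, psix; split => //.
- by move: a1 E3; lin.
- by exists k, i; split=> //; split; [move: a1 E2; lin|exact: lt_le_trans a2 t2].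
- exact: lt_le_trans a3 E1.
- split => //; first by move: a6 E1; lin.
  by apply: le_trans E1; move: a7; rewrite addr0.
Qed.

(** The maximum over the window must be reached after its initial time, where no equation is
    available; [P] selects the contact slopes for which this is required. *)
Definition late_max w S0 t C F (P : R -> Prop) (y0 y1 : R) := forall z z' x, C1 z z' -> y0 < x -> x < y1 ->
  P (z' x) -> (forall y, y0 <= y <= y1 -> F y - z y <= F x - z x) ->
  exists s, [/\ S0 < s, s <= t & F x = w s x + C * s].

Lemma slope_edge h lam K tau w M S0 t C F z z' (y0 y1 x s : R) a : wf h -> time_grid K tau ->
  lipon (fun s => S0 <= s) M w ->
  (forall s x, S0 < s -> regular K tau s -> subpt h lam w s x) ->
  running_max w S0 t C F -> C1 z z' -> y0 < x -> x < y1 ->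
  (forall y, y0 <= y <= y1 -> F y - z y <= F x - z x) ->
  S0 < s -> s <= t -> F x = w s x + C * s -> (a <= njct h)%N -> in_edge h a x ->
  ham h a (z' x) <= lam + C.
Proof.
move=> wh tg lw cw rF cz yx xy hF Ss st Fx aN xe; have [_ _ ah] := wh.
rewrite leNgt; apply/negP => lt; set q0 := z' x in lt.
pose e := (ham h a q0 - (lam + C)) / 2; have e0 : 0 < e by rewrite divr_gt0// subr_gt0.
have [r r0 hr] := goodH_cont (ah a aN) q0 e0.
have [r' r'0 hr'] := in_edge_nbhs xe.
pose d := Num.min (Num.min (r / 2) r') (e / 2).
have d0 : 0 < d by rewrite !lt_min r'0 (divr_gt0 r0)// (divr_gt0 e0).
have [s' [y [psi [psit [psix [b1 b2 b3 b4 [b5 b6 b7]]]]]]] :=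
  slope_core wh tg lw cw rF cz yx xy hF Ss st Fx d0.
move: b3 b6 b7; rewrite /d; set m := Num.min _ _ => b3 b6 b7.
have [m1 [m2 m3]] : m <= r / 2 /\ m <= r' /\ m <= e / 2 by rewrite !ge_min !lexx !orbT.
have [S _] := cw s' y b1 b2.
have h1 := S a _ _ _ aN b4 (hr' y (lt_le_trans b3 m2)) b5.
have : `|psix s' y - q0| < r by move: b7 m1 r0; rewrite -/q0; clear => *; lra.
move=> /hr /ltr_normlP[]; have : e = e by []; rewrite {1}/e.
by move: h1 b6 m3 e0; lin.
Qed.

Lemma slope_le_edge h lam K tau w M S0 t C F (y0 y1 p : R) a : wf h -> time_grid K tau ->
  lipon (fun s => S0 <= s) M w ->
  (forall s x, S0 < s -> regular K tau s -> subpt h lam w s x) ->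
  running_max w S0 t C F -> y0 <= y1 -> (a <= njct h)%N ->
  (forall x, y0 < x -> x < y1 -> in_edge h a x) ->
  (forall q, p <= q -> lam + C < ham h a q) ->
  late_max w S0 t C F (fun q => p <= q) y0 y1 -> F y1 - F y0 <= p * (y1 - y0).
Proof.
move=> wh tg lw cw rF; rewrite le_eqVlt => /orP[/eqP -> *|yy aN xe hp lm]; first by rewrite !subrr mulr0.
rewrite leNgt; apply/negP => lt.
have [z [z' [x [cz /andP[x0 x1] pz hz]]]] := slope_touch_r yy (fun x y _ _ => running_max_lip x y lw rF) lt.
have [s [s1 s2 s3]] := lm z z' x cz x0 x1 pz hz.
have := slope_edge wh tg lw cw rF cz x0 x1 hz s1 s2 s3 aN (xe x x0 x1).
by rewrite leNgt hp.
Qed.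

Lemma slope_ge_edge h lam K tau w M S0 t C F (y0 y1 p : R) a : wf h -> time_grid K tau ->
  lipon (fun s => S0 <= s) M w ->
  (forall s x, S0 < s -> regular K tau s -> subpt h lam w s x) ->
  running_max w S0 t C F -> y0 <= y1 -> (a <= njct h)%N ->
  (forall x, y0 < x -> x < y1 -> in_edge h a x) ->
  (forall q, q <= p -> lam + C < ham h a q) ->
  late_max w S0 t C F (fun q => q <= p) y0 y1 -> p * (y1 - y0) <= F y1 - F y0.
Proof.
move=> wh tg lw cw rF; rewrite le_eqVlt => /orP[/eqP -> *|yy aN xe hp lm]; first by rewrite !subrr mulr0.
rewrite leNgt; apply/negP => lt.
have [z [z' [x [cz /andP[x0 x1] pz hz]]]] := slope_touch yy (fun x y _ _ => running_max_lip x y lw rF) lt.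
have [s [s1 s2 s3]] := lm z z' x cz x0 x1 pz hz.
have := slope_edge wh tg lw cw rF cz x0 x1 hz s1 s2 s3 aN (xe x x0 x1).
by rewrite leNgt hp.
Qed.

Lemma steep_bound h c : wf h -> exists2 L, 0 < L & forall a q, (a <= njct h)%N -> L <= `|q| ->
  c < ham h a q /\ (0 <= q -> pmin h a <= q) /\ (q <= 0 -> q <= pmin h a).
Proof.
move=> [_ _ ah].
have ex a : exists L, (a <= njct h)%N -> 0 < L /\ forall q, L <= `|q| ->
    c < ham h a q /\ (0 <= q -> pmin h a <= q) /\ (q <= 0 -> q <= pmin h a).
  have [aN|aN] := boolP (a <= njct h)%N; last by exists 0.
  have [B B0 hB] := goodH_coer c (ah a aN); exists (B + `|pmin h a|) => _; split.
    by have := normr_ge0 (pmin h a); move: B0; lin.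
  move=> q qB; split; first by apply: hB; have := normr_ge0 (pmin h a); move: qB; lin.
  have h1 := ler_norm (pmin h a); have h2 := ler_norm (- pmin h a); rewrite normrN in h2.
  split=> q0; move: qB; [rewrite (ger0_norm q0)|rewrite (ler0_norm q0)]; move: B0 h1 h2; lin.
have [f hf] := choice ex; have [L L0 hL] := finite_bound f (njct h).
exists (L + 1) => [|a q aN qL]; first by move: L0; lin.
by have [_] := hf a aN; apply; have := hL a aN; move: qL; lin.
Qed.

(** At a junction a steep slope is, according to its sign, on the increasing branch of the left edge
    or on the decreasing branch of the right edge, so junctions do not escape the bound. *)
Lemma slope_global h lam K tau w M S0 t C F (y0 y1 L : R) : wf h -> time_grid K tau ->
  lipon (fun s => S0 <= s) M w ->
  (forall s x, S0 < s -> regular K tau s -> subpt h lam w s x) ->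
  running_max w S0 t C F ->
  (forall a q, (a <= njct h)%N -> L <= `|q| ->
    lam + C + 1 < ham h a q /\ (0 <= q -> pmin h a <= q) /\ (q <= 0 -> q <= pmin h a)) ->
  (forall y0 y1, late_max w S0 t C F (fun q => L + 1 <= `|q|) y0 y1) ->
  0 < L -> `|F y1 - F y0| <= (L + 1) * `|y1 - y0|.
Proof.
move=> wh tg lw cw rF hL lm L0; have [_ _ ah] := wh.
have no z z' x y0' y1' : C1 z z' -> y0' < x -> x < y1' -> L + 1 <= `|z' x| ->
    (forall y, y0' <= y <= y1' -> F y - z y <= F x - z x) -> False.
  move=> cz x0 x1 zL hz; have [s [s1 s2 s3]] := lm _ _ z z' x cz x0 x1 zL hz.
  have [s' [y [psi [psit [psix [b1 b2 b3 b4 [b5 b6 b7]]]]]]] :=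
    slope_core wh tg lw cw rF cz x0 x1 hz s1 s2 s3 ltr01.
  have [S1 S2] := cw s' y b1 b2; set q := psix s' y in b7.
  have qL : L <= `|q|.
    have := ler_normD q (z' x - q); rewrite addrC subrK distrC => h1.
    by move: h1 b7 zL; lin.
  have [[a aN ye]|[a [a1 aN yE]]] := in_edge_cases y wh.
    have := S1 a _ _ _ aN b4 ye b5; have [h1 _] := hL a q aN qL.
    by move: b6 h1; rewrite /q; lin.
  have lm0 : locmax (fun s y' => w s y' - psi s y' - kink 0 0 y y') s' y.
    by case: b5 => r r0 hr; exists r => // v v' h1 h2; rewrite !kink00 !subr0; exact: hr.
  have := S2 a _ _ _ 0 0 a1 aN b4 yE lm0; rewrite !addr0 -/q.
  have aN' : (a.-1 <= njct h)%N by apply: leq_trans aN; exact: leq_pred.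
  have [h1 [h2 h3]] := hL a q aN qL; have [g1 [g2 g3]] := hL _ q aN' qL.
  suff : lam + C + 1 < junction_ham h a s' q q by move: b6; lin.
  rewrite /junction_ham !lt_max; have [q0|q0] := leP 0 q; first by rewrite Hplus_r ?g1// g2.
  by rewrite Hminus_l ?h1 ?orbT// h3// ltW.
have half u v : u < v -> `|F v - F u| <= (L + 1) * (v - u).
  move=> uv; apply/ler_normlP; rewrite lerNl -mulNr; split; rewrite leNgt; apply/negP => lt.
    have [z [z' [x [cz /andP[x0 x1] pz hz]]]] := slope_touch uv (fun x y _ _ => running_max_lip x y lw rF) lt.
    apply: (no z z' x u v cz x0 x1 _ hz); rewrite -normrN; apply: le_trans (ler_norm _).
    by move: pz; lin.
  have [z [z' [x [cz /andP[x0 x1] pz hz]]]] := slope_touch_r uv (fun x y _ _ => running_max_lip x y lw rF) lt.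
  by apply: (no z z' x u v cz x0 x1 _ hz); apply: le_trans (ler_norm _).
have [uv|uv|->] := ltgtP y0 y1; last by rewrite !subrr normr0 mulr0.
  by rewrite [`|y1 - y0|]gtr0_norm ?subr_gt0//; exact: half.
by rewrite distrC [`|y1 - y0|]distrC [`|y0 - y1|]gtr0_norm ?subr_gt0//; exact: half.
Qed.
End Slopes.

(** * The limit of vanishing edges *)

Section ShortEdges.
Context {R : realType}.
Implicit Types (h : hamiltonian R) (w : R -> R -> R) (K : nat) (tau : nat -> R) (A : nat -> nat -> R).

Lemma limiter_bound h K tau A : grid_adm h K tau A -> exists2 C, 0 <= C & forall a i,
  (1 <= a)%N -> (a <= njct h)%N -> (i <= K)%N -> A a i <= C.
Proof.
move=> _; have [C C0 hC] := finite_bound (fun a => \sum_(i < K.+1) `|A a i|) (njct h).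
exists C => // a i _ aN iK; apply: le_trans (hC a aN).
rewrite (bigD1 (Ordinal (iK : (i < K.+1)%N)))//= -[leLHS]addr0; apply: lerD; first exact: ler_norm.
exact: sumr_ge0.
Qed.

Lemma short_edges h d a : wf h ->
  (forall k, (1 <= k)%N -> (k < njct h)%N -> (edge_length (njct h) (jpoint h) k < d%:E)%E) -> 0 < d ->
  (1 <= a)%N -> (a <= njct h)%N -> `|jpoint h a - jpoint h 1| <= (njct h)%:R * d.
Proof.
move=> wh hd d0 a1 aN; rewrite ger0_norm ?subr_ge0; last exact: jpoint_le wh (leqnn 1) a1 aN.
apply: le_trans (_ : a%:R * d <= _); last by rewrite ler_wpM2r ?ler_nat// ltW.
elim: a a1 aN => // a IH _ aN; case: a IH aN => [|a] IH aN; first by rewrite subrr mul1r ltW.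
have := IH isT (ltnW aN); have := hd a.+1 isT aN; rewrite edge_length_mid// lte_fin.
by rewrite -[in a.+2%:R]natr1 mulrDl mul1r; lin.
Qed.

(** The slopes of [F t] are at most [L + 1], so over edges shorter than [d] the junctions nearly
    agree. On each cell the increment is measured at the junction whose limiter is largest; moving
    there and back costs [kap], once per cell of the period, and periodicity closes the sum. *)
Lemma corrector_short h K tau A lam L d : grid_adm h K tau A -> subcorrector_levels h K tau lam ->
  let c := mean (fun s => max_over (njct h) (fun k => limiter h k s)) in
  forall Cb, (forall a i, (1 <= a)%N -> (a <= njct h)%N -> (i <= K)%N -> A a i <= Cb) ->
  forall C, 0 < C -> Cb - lam <= C -> 0 < L ->
  (forall a q, (a <= njct h)%N -> L <= `|q| ->
    lam + C + 1 < ham h a q /\ (0 <= q -> pmin h a <= q) /\ (q <= 0 -> q <= pmin h a)) ->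
  (forall k, (1 <= k)%N -> (k < njct h)%N -> (edge_length (njct h) (jpoint h) k < d%:E)%E) -> 0 < d ->
  c - lam <= K.+1%:R * (2 * (L + 1) * ((njct h)%:R * d)).
Proof.
move=> ga Hl c Cb hCb C C0 hC L0 hL hd d0; have [wh tg _] := ga; have [N1 _ _] := wh.
have [M [w [M0 lw wp cw]]] := level_elim wh Hl.
have lwS S : lipon (fun s => S <= s) M w by move=> s t x y _ _; exact: lw.
have exF t : exists F, running_max w (t - 2) t C F.
  by apply: (running_max_ex C _ (lwS (t - 2))); lin.
have [F rF] := choice exF.
have late t x : exists s, [/\ t - 2 < s, s <= t & F t x = w s x + C * s].
  have [[s [s1 s2 s3]] sup] := rF t x; exists s; split => //.
  (* A maximizer at the start of a window of length two is beaten by its translate by one period,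
     since the drift [C] is positive. *)
  rewrite lt_neqAle s1 andbT; apply/negP => /eqP sE.
  have := sup (s + 1); rewrite wp s3 -sE => H.
  have : w (t - 2) x + C * (t - 2 + 1) <= w (t - 2) x + C * (t - 2) by apply: H; lin.
  by move: C0; lin.
have Fx t x y : `|F t x - F t y| <= (L + 1) * `|x - y|.
  have cw' s z : t - 2 < s -> regular K tau s -> subpt h lam w s z by move=> _; exact: cw.
  have lm y0 y1 : late_max w (t - 2) t C (F t) (fun q => L + 1 <= `|q|) y0 y1.
    by move=> z z' u _ _ _ _ _; exact: late.
  exact: (slope_global y x wh tg (lwS (t - 2)) cw' (rF t) hL lm L0).
have Fp t x : F (t + 1) x = F t x + C.
  apply/eqP; rewrite eq_le; apply/andP; split.
    have [s [s1 s2 ->]] := late (t + 1) x; have [_ /(_ (s - 1))] := rF t x.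
    rewrite -[in w s x](subrK 1 s) wp => H.
    have : w (s - 1) x + C * (s - 1) <= F t x by apply: H; move: s1 s2; lin.
    by lin.
  have [s [s1 s2 ->]] := late t x; have [_ /(_ (s + 1))] := rF (t + 1) x.
  rewrite wp => H.
  have : w s x + C * (s + 1) <= F (t + 1) x by apply: H; move: s1 s2; lin.
  by lin.
have slope a i (k : int) s t : (1 <= a)%N -> (a <= njct h)%N -> (i <= K)%N ->
    tau i + k%:~R <= s -> s <= t -> t <= tau i.+1 + k%:~R ->
    F t (jpoint h a) - F s (jpoint h a) <= (lam - A a i + C) * (t - s).
  move=> a1 aN iK s1 st t1; have Ab := hCb a i a1 aN iK.
  have p0 : 0 <= lam - A a i + C by move: Ab hC; lin.
  have [r [r1 r2 ->]] := late t (jpoint h a); have [_ sup] := rF s (jpoint h a).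
  have [rs|sr] := leP r s.
    have h1 := sup r _ rs; have h2 := mulr_ge0 p0 (_ : 0 <= t - s).
    move: h1 h2; have -> : s - 2 <= r by move: r1 st; lin.
    by rewrite subr_ge0 => /(_ isT) h1 /(_ st); move: h1; lin.
  have h1 := corrector_time_slope ga lw cw a1 aN iK s1 (ltW sr) (le_trans r2 t1).
  have h2 : w s (jpoint h a) + C * s <= F s (jpoint h a) by apply: sup => //; lin.
  have h3 : (lam - A a i + C) * (r - s) <= (lam - A a i + C) * (t - s) by rewrite ler_wpM2l// lerD2r.
  by move: h1 h2 h3; lin.
have [g [gp gs]] := step_primitive tg (mean_step tg (step_on_max ga)); rewrite -/c in gs.
pose f t := F t (jpoint h 1) - C * t - g t.
set kap := 2 * (L + 1) * _.
have [tau0 tau1 _] := tg.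
have key j : (j <= K.+1)%N -> f (tau j) - f 0 <= (lam - c) * tau j + j%:R * kap.
  elim: j => [|j IH] jK; first by rewrite tau0 subrr mulr0 mul0r addr0.
  have tj : tau j <= tau j.+1 by apply: (grid_le tg).
  have [a /andP[a1 aN] aE] := max_over_ex (fun k => A k j) N1.
  have e0 (i : nat) : tau i + 0%:~R = tau i by rewrite addr0.
  have h1 := slope a j 0 (tau j) (tau j.+1) a1 aN jK; rewrite !e0 in h1.
  have {}h1 := h1 (lexx _) tj (lexx _).
  have h2 := gs 0 j (tau j) (tau j.+1) jK; rewrite !e0 in h2.
  have {}h2 := h2 (lexx _) tj tj (lexx _); rewrite aE in h2.
  have h3 := short_edges wh hd d0 a1 aN.
  have h4 := Fx (tau j.+1) (jpoint h a) (jpoint h 1); have h5 := Fx (tau j) (jpoint h a) (jpoint h 1).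
  have h6 : (L + 1) * `|jpoint h a - jpoint h 1| <= kap / 2.
    have -> : kap / 2 = (L + 1) * ((njct h)%:R * d) by rewrite /kap; field.
    by rewrite ler_wpM2l//; move: L0; lin.
  have {}h4 := le_trans h4 h6; have {}h5 := le_trans h5 h6.
  move: h4 h5 => /ler_normlP[h41 h42] /ler_normlP[h51 h52].
  have -> : j.+1%:R * kap = j%:R * kap + kap by rewrite -natr1 mulrDl mul1r.
  have := IH (ltnW jK); rewrite /f.
  by move: h1 h2 h41 h42 h51 h52; lin.
have := key K.+1 (leqnn _); rewrite tau1 mulr1 /f -[in F 1 _](add0r 1) Fp -[in g 1](add0r 1) gp.
by rewrite /kap; lin.
Qed.

(** Only levels below [c] need an estimate, which makes the steepness bound [L] independent of the
    level; levels are bounded below by [l0], which does the same for [C]. *)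
Lemma eff_short h K tau A e : grid_adm h K tau A -> 0 < e -> exists2 d : R, 0 < d &
  forall b, increasing_points (njct h) b ->
  (forall k, (1 <= k)%N -> (k < njct h)%N -> (edge_length (njct h) b k < d%:E)%E) ->
  `|effective_limiter (move_pts h b) K tau - mean (fun s => max_over (njct h) (fun k => limiter h k s))| < e.
Proof.
move=> ga e0; have [wh tg _] := ga; have [N1 _ _] := wh; set c := mean _.
have [Cb Cb0 hCb] := limiter_bound ga.
set l0 := mean (limiter h 1%N).
pose C := Cb + `|l0| + 1.
have C0 : 0 < C by rewrite /C; have := normr_ge0 l0; move: Cb0; lin.
have [L L0 hL] := steep_bound (c + C + 1) wh.
pose D := K.+1%:R * (2 * (L + 1) * (njct h)%:R) : R.
have D0 : 0 < D.
  by rewrite /D !mulr_gt0// ?ltr0n//; move: L0; lin.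
exists (e / (2 * D)); first by rewrite divr_gt0// mulr_gt0.
move=> b ib hb; have ga' := grid_adm_move ib ga; have [ex _] := has_inf_levels ga'.
have up : effective_limiter (move_pts h b) K tau <= c by exact: (eff_le ga' (mean_max_level ga')).
have lo : c - e / 2 <= effective_limiter (move_pts h b) K tau.
  apply: lb_le_inf => // lam Hl; have [cl|lc] := leP c lam; first by move: cl e0; lin.
  have l0l : l0 <= lam by exact: (mean_le_level ga' (leqnn 1) N1 Hl).
  have := corrector_short (h := move_pts h b) (L := L) (d := e / (2 * D)) (C := C) ga' Hl hCb C0 _ L0 _ hb.
  have -> : K.+1%:R * (2 * (L + 1) * ((njct (move_pts h b))%:R * (e / (2 * D)))) = e / 2.
    have -> : K.+1%:R * (2 * (L + 1) * ((njct (move_pts h b))%:R * (e / (2 * D)))) = D * (e / (2 * D)).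
      by rewrite /D /=; ring.
    by field; rewrite gt_eqF.
  have h1 : Cb - lam <= C.
    by rewrite /C; have := ler_norm (- l0); rewrite normrN; move: l0l; lin.
  move=> /(_ h1) H.
  have {H} := H _ _; rewrite -/c => H.
  have : c - lam <= e / 2.
    apply: H; last by rewrite divr_gt0// mulr_gt0.
    move=> a q aN qL; have [h2 h3] := hL a q aN qL; split=> //; apply: le_lt_trans h2.
    by move: lc; lin.
  by lin.
by apply/ltr_normlP; move: up lo e0; clear => *; split; lra.
Qed.
End ShortEdges.

(** * Decoupled junctions on long edges *)

Section LongEdges.
Context {R : realType}.
Implicit Types (h : hamiltonian R) (w : R -> R -> R) (K : nat) (tau : nat -> R) (A : nat -> nat -> R).

Lemma grid_right K tau t : time_grid K tau -> exists (k : int) i, (i <= K)%N /\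
  tau i + k%:~R <= t < tau i.+1 + k%:~R.
Proof.
move=> tg; have [tau0 tau1 lt] := tg.
pose k := Num.floor t; have /andP[k1 k2] := Num.Theory.floor_itv t; rewrite intrD1 in k2.
have key i : (i <= K)%N -> t < tau i.+1 + k%:~R ->
    exists i, (i <= K)%N /\ tau i + k%:~R <= t < tau i.+1 + k%:~R.
  elim: i => [|i IH] iK ti; first by exists 0%N; rewrite tau0 add0r k1.
  have [h|h] := ltP t (tau i.+1 + k%:~R); first exact: IH (ltnW iK) h.
  by exists i.+1; rewrite h.
have [|i hi] := key K (leqnn _); last by exists k, i.
by rewrite tau1 addrC.
Qed.

Lemma step_sup_norm K tau (A : nat -> R) f i : time_grid K tau -> step_on K tau A f -> (i <= K)%N ->
  `|A i| <= sup_norm f.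
Proof.
move=> tg st iK; have [C C0 hC] := finite_bound (fun i => `|A i|) K.
have [_ _ lt] := tg; have <- : f (tau i) = A i by apply: st.2 => //; rewrite lexx lt.
apply: ub_le_sup; last by exists (tau i).
exists C => _ [s _ <-]; have [k [j [jK sj]]] := grid_right s tg.
by rewrite (step_onE st jK sj) hC.
Qed.

Lemma grid_sum1 K tau : time_grid K tau -> \sum_(i < K.+1) (tau i.+1 - tau i) = 1 :> R.
Proof.
move=> [tau0 tau1 _]; rewrite -(big_mkord xpredT (fun i => tau i.+1 - tau i)) telescope_sumr//.
by rewrite tau0 tau1 subr0.
Qed.

Lemma mean_norm_le K tau (A : nat -> R) f C : time_grid K tau -> step_on K tau A f ->
  (forall i, (i <= K)%N -> `|A i| <= C) -> `|mean f| <= C.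
Proof.
move=> tg st hC; rewrite (mean_step tg st); have [_ _ lt] := tg.
rewrite -[leRHS]mulr1 -(grid_sum1 tg) mulr_sumr; apply: le_trans (ler_norm_sum _ _ _) _.
apply: ler_sum => i _; have iK : (i <= K)%N by rewrite -ltnS.
have d0 : 0 <= tau i.+1 - tau i by rewrite subr_ge0 ltW// lt.
by rewrite normrM (ger0_norm d0) ler_wpM2r// hC.
Qed.

Lemma mean_const K tau (A : nat -> R) f : time_grid K tau -> step_on K tau A f ->
  (forall i, (i <= K)%N -> mean f <= A i) -> forall i, (i <= K)%N -> A i = mean f.
Proof.
move=> tg st hA i iK; have [_ _ lt] := tg.
have S0 : \sum_(i < K.+1) (A i - mean f) * (tau i.+1 - tau i) = 0.
  under eq_bigr do rewrite mulrBl.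
  by rewrite sumrB -(mean_step tg st) -mulr_sumr (grid_sum1 tg) mulr1 subrr.
have pos' (j : 'I_K.+1) : true -> 0 <= (A j - mean f) * (tau j.+1 - tau j).
  move=> _; have jK : (j <= K)%N by rewrite -ltnS.
  by rewrite mulr_ge0// subr_ge0; [exact: hA|exact/ltW/lt].
have /eqP := psumr_eq0P pos' S0 (i := Ordinal (iK : (i < K.+1)%N)) isT.
rewrite mulf_eq0 !subr_eq0 /= => /orP[/eqP //|/eqP E].
by have := lt i iK; rewrite E ltxx.
Qed.

(** The bound [4 * C] involves the size of the limiter alone. A limiter that never falls below its
    mean is constant, and the profile is then zero: this covers the edges on which there is no room
    to descend. *)
Lemma bump_primitive K tau (A : nat -> R) f C : time_grid K tau -> step_on K tau A f -> 0 <= C ->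
  (forall i, (i <= K)%N -> `|A i| <= C) -> exists (g : R -> R) M, [/\ 0 <= M, forall t, g (t + 1) = g t,
  forall s t, `|g t - g s| <= M * `|t - s|, forall t, 0 <= g t <= 4 * C &
  ((forall i, (i <= K)%N -> mean f <= A i) -> forall t, g t = 0) /\
  forall (k : int) i s t, (i <= K)%N -> tau i + k%:~R <= s -> s <= tau i.+1 + k%:~R ->
    tau i + k%:~R <= t -> t <= tau i.+1 + k%:~R -> g t - g s = (mean f - A i) * (t - s)].
Proof.
move=> tg st C0 hC.
have [cst|ncst] := pselect (forall i, (i <= K)%N -> mean f <= A i).
  exists (fun=> 0), 0; split => // [s t|t|]; first by rewrite subrr normr0 mul0r.
    by rewrite lexx mulr_ge0.
  by split=> // k i s t iK _ _ _ _; rewrite (mean_const tg st cst)// !subrr mul0r.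
have [g [gp gs]] := step_primitive tg (mean_step tg st).
have gl s t : `|g t - g s| <= 2 * C * `|t - s|.
  apply: (grid_lip tg) => k i {}s {}t iK s1 st' t1.
  rewrite (gs k i)//; last 2 first; [exact: le_trans st' t1|exact: le_trans s1 st'|].
  rewrite normrM (ger0_norm (_ : 0 <= t - s)) ?subr_ge0// ler_wpM2r ?subr_ge0//.
  by have := ler_normB (mean f) (A i); have := mean_norm_le tg st hC; have := hC i iK; lin.
have gb := periodic_bound gp (_ : 0 <= 2 * C) gl.
exists (fun t => g t - g 0 + 2 * C), (2 * C); split => //.
- by rewrite mulr_ge0.
- by move=> t; rewrite gp.
- by move=> s t; have -> : g t - g 0 + 2 * C - (g s - g 0 + 2 * C) = g t - g s by ring.
- move=> t; have /ler_normlP[] := gb (mulr_ge0 (ler0n _ 2) C0) 0 t; lin.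
- split=> // k i s t iK s1 s2 t1 t2; rewrite -(gs k i s t)//; ring.
Qed.

Definition tent (a b x : R) := pos (Num.min (x - a) (b - x)).

Lemma minr_lip (a b a' b' : R) d : `|a - a'| <= d -> `|b - b'| <= d -> `|Num.min a b - Num.min a' b'| <= d.
Proof.
move=> /ler_normlP[h1 h2] /ler_normlP[h3 h4].
by apply/ler_normlP; split; case: (leP a b) => h5; case: (leP a' b') => h6; move: h1 h2 h3 h4 h5 h6; lin.
Qed.
Lemma maxr_lip (a b a' b' : R) d : `|a - a'| <= d -> `|b - b'| <= d -> `|Num.max a b - Num.max a' b'| <= d.
Proof.
move=> /ler_normlP[h1 h2] /ler_normlP[h3 h4].
by apply/ler_normlP; split; case: (leP a b) => h5; case: (leP a' b') => h6; move: h1 h2 h3 h4 h5 h6; lin.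
Qed.
Lemma max_over_lip N (f g : nat -> R) d : (1 <= N)%N ->
  (forall k, (1 <= k)%N -> (k <= N)%N -> `|f k - g k| <= d) -> `|max_over N f - max_over N g| <= d.
Proof.
move=> N1 H; have half u v : (forall k, (1 <= k)%N -> (k <= N)%N -> `|u k - v k| <= d) -> max_over N u - max_over N v <= d.
  move=> {}H; have [k /andP[k1 kN] ->] := max_over_ex u N1.
  have := H k k1 kN => /ler_normlP[_]; have := max_over_ge v k1 kN; lin.
by apply/ler_normlP; rewrite opprB; split; apply: half => // k k1 kN; rewrite distrC H.
Qed.

Lemma tent_lip a b x y : `|tent a b x - tent a b y| <= `|x - y|.
Proof.
apply: le_trans (pos_lip _ _) _; apply: minr_lip.
  by rewrite opprB addrA subrK.
by rewrite [b - x - (b - y)](_ : _ = y - x) ?[`|y - x|]distrC//; ring.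
Qed.
Lemma tent_out a b x : x <= a \/ b <= x -> tent a b x = 0.
Proof. by move=> H; apply: pos_le0; rewrite ge_min !subr_le0; case: H => ->; rewrite ?orbT. Qed.

Definition tents h (kap : nat -> R) x := \sum_(1 <= c < njct h) kap c * tent (jpoint h c) (jpoint h c.+1) x.

Lemma tents_lip h kap : exists2 M, 0 <= M & forall x y, `|tents h kap x - tents h kap y| <= M * `|x - y|.
Proof.
exists (\sum_(1 <= c < njct h) `|kap c|); first exact: sumr_ge0.
move=> x y; rewrite /tents -sumrB mulr_suml; apply: le_trans (ler_norm_sum _ _ _) _; apply: ler_sum => c _.
by rewrite -mulrBr normrM ler_wpM2l// tent_lip.
Qed.

Lemma tents_inner h kap a x : wf h -> (1 <= a)%N -> (a < njct h)%N -> jpoint h a <= x -> x <= jpoint h a.+1 ->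
  tents h kap x = kap a * Num.min (x - jpoint h a) (jpoint h a.+1 - x).
Proof.
move=> wh a1 aN x1 x2; rewrite /tents (bigD1_seq a) ?mem_index_iota ?a1 ?iota_uniq//= big_nat_cond big1 ?addr0.
  by rewrite /tent pos_id// le_min !subr_ge0 x1.
move=> c /andP[/andP[c1 cN] ca]; rewrite tent_out ?mulr0//.
have [ca'|ac|E] := ltngtP c a; last by rewrite E eqxx in ca.
  by right; apply: le_trans x1; apply: (jpoint_le wh (ltn0Sn c) ca'); exact: ltnW.
by left; apply: le_trans x2 _; apply: (jpoint_le wh (ltn0Sn a) ac); exact: ltnW.
Qed.
Lemma tents_left h kap x : wf h -> x <= jpoint h 1 -> tents h kap x = 0.
Proof.
move=> wh x1; rewrite /tents big_nat_cond big1// => c /andP[/andP[c1 cN] _].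
by rewrite tent_out ?mulr0//; left; apply: le_trans x1 _; apply: (jpoint_le wh (leqnn 1) c1); exact: ltnW.
Qed.
Lemma tents_right h kap x : wf h -> jpoint h (njct h) <= x -> tents h kap x = 0.
Proof.
move=> wh x1; rewrite /tents big_nat_cond big1// => c /andP[/andP[c1 cN] _].
by rewrite tent_out ?mulr0//; right; apply: le_trans x1; apply: (jpoint_le wh (ltn0Sn c) cN).
Qed.
End LongEdges.

Section LongEdgesLevel.
Context {R : realType}.
Implicit Types (h : hamiltonian R) (w : R -> R -> R) (K : nat) (tau : nat -> R) (A : nat -> nat -> R).

Lemma tents_edge_lip h kap a x y : wf h -> (a <= njct h)%N -> 0 <= kap a ->
  ((1 <= a)%N -> jpoint h a <= x /\ jpoint h a <= y) ->
  ((a < njct h)%N -> x <= jpoint h a.+1 /\ y <= jpoint h a.+1) ->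
  `|tents h kap y - tents h kap x| <= kap a * `|y - x|.
Proof.
move=> wh aN k0 h1 h2; have K0 := mulr_ge0 k0 (normr_ge0 (y - x)).
have [a0|a1] := leqP a 0.
  have aE : a = 0%N by apply/eqP; rewrite -leqn0.
  have [N1 _ _] := wh; have [|hx hy] := h2; first by rewrite aE.
  by rewrite aE in hx hy; rewrite !tents_left// subrr normr0.
have [hx hy] := h1 a1; have [aN'|Na] := ltnP a (njct h); last first.
  have E : a = njct h by apply/eqP; rewrite eqn_leq aN.
  by rewrite !tents_right -?E// subrr normr0.
have [hx2 hy2] := h2 aN'; rewrite !(tents_inner kap wh a1 aN')// -mulrBr normrM (ger0_norm k0) ler_wpM2l//.
apply: minr_lip; first by rewrite opprB addrA subrK.
by rewrite [X in `|X|](_ : _ = x - y) ?[`|x - y|]distrC//; ring.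
Qed.

Lemma long_edges_level h K tau A m kap (g : nat -> R -> R) Mg : grid_adm h K tau A ->
  (forall a, (a <= njct h)%N -> 0 <= kap a) -> kap 0%N = 0 -> kap (njct h) = 0 ->
  (forall a q, (a <= njct h)%N -> `|q - pmin h a| <= kap a -> ham h a q <= m) -> 0 <= Mg ->
  (forall a, (1 <= a)%N -> (a <= njct h)%N ->
    [/\ forall t, g a (t + 1) = g a t, forall s t, `|g a t - g a s| <= Mg * `|t - s|, forall t, 0 <= g a t,
        mean (limiter h a) <= m &
        forall (k : int) i s t, (i <= K)%N -> tau i + k%:~R <= s -> s <= tau i.+1 + k%:~R ->
          tau i + k%:~R <= t -> t <= tau i.+1 + k%:~R -> g a t - g a s = (mean (limiter h a) - A a i) * (t - s)]) ->
  (forall a t, (1 <= a)%N -> (a < njct h)%N -> g a t <= kap a * ((jpoint h a.+1 - jpoint h a) / 2) /\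
    g a.+1 t <= kap a * ((jpoint h a.+1 - jpoint h a) / 2)) ->
  subcorrector_levels h K tau m.
Proof.
move=> ga kap0 k0 kN hH Mg0 hg hw; have [wh tg _] := ga; have [N1 _ ah] := wh.
pose M0 x := pwl h (pmin h) x + tents h kap x.
(* Up to the middle of the adjacent edges the cone of junction [j] cancels the tents of [M0], so
   [V j] has slopes [pmin] exactly; past the middle the width hypothesis makes the cone exceed
   [g j], and [V j] drops below [M0]. Where [W] equals [M0] inside edge [a], slopes are within
   [kap a] of [pmin h a]. *)
pose cone j x := kap j * pos (x - jpoint h j) + kap j.-1 * pos (jpoint h j - x).
pose W t x := M0 x + Num.max 0 (max_over (njct h) (fun j => g j t - cone j x)).
pose V j t x := M0 x + (g j t - cone j x).
have VW j t x : (1 <= j)%N -> (j <= njct h)%N -> V j t x <= W t x.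
  by move=> j1 jN; rewrite lerD2l le_max (max_over_ge (fun j => g j t - cone j x) j1 jN) orbT.
have M0W t x : M0 x <= W t x by rewrite /W lerDl le_max lexx.
have M0E a x y : (a <= njct h)%N ->
    ((1 <= a)%N -> jpoint h a <= x /\ jpoint h a <= y) ->
    ((a < njct h)%N -> x <= jpoint h a.+1 /\ y <= jpoint h a.+1) ->
    M0 y - M0 x = pmin h a * (y - x) + (tents h kap y - tents h kap x).
  by move=> aN h1 h2; rewrite -(pwlE (pmin h) wh aN h1 h2) /M0; ring.
have Vr j s t x y : (1 <= j)%N -> (j <= njct h)%N -> jpoint h j <= x -> jpoint h j <= y ->
    ((j < njct h)%N -> x <= (jpoint h j + jpoint h j.+1) / 2 /\ y <= (jpoint h j + jpoint h j.+1) / 2) ->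
    V j s y - V j t x = pmin h j * (y - x) + (g j s - g j t).
  move=> j1 jN x1 y1 hm.
  have e1 : M0 y - M0 x = pmin h j * (y - x) + (tents h kap y - tents h kap x).
    apply: M0E => // jN'; have [m1 m2] := hm jN'; have := jpoint_lt wh j1 (ltnSn j) jN'.
    by move: m1 m2; clear => *; split; lra.
  have e2 : tents h kap y - tents h kap x = kap j * (y - x).
    have [jN'|Nj] := ltnP j (njct h).
      have [m1 m2] := hm jN'; have l1 := jpoint_lt wh j1 (ltnSn j) jN'.
      rewrite !(tents_inner kap wh j1 jN')//; try by move: m1 m2 l1; lin.
      rewrite !min_l; [ring|..]; move: m1 m2; lin.
    have E : j = njct h by apply/eqP; rewrite eqn_leq jN.
    by rewrite !tents_right -?E// subrr E kN mul0r.
  rewrite /V /cone (pos_id (y := y - _)) ?subr_ge0// (pos_id (y := x - _)) ?subr_ge0//.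
  rewrite (pos_le0 (y := _ - y)) ?subr_le0// (pos_le0 (y := _ - x)) ?subr_le0// !mulr0 !addr0.
  have -> : M0 y + (g j s - kap j * (y - jpoint h j)) - (M0 x + (g j t - kap j * (x - jpoint h j))) =
    (M0 y - M0 x) - kap j * (y - x) + (g j s - g j t) by ring.
  by rewrite e1 e2; ring.
have Vl j s t x y : (1 <= j)%N -> (j <= njct h)%N -> x <= jpoint h j -> y <= jpoint h j ->
    ((1 <= j.-1)%N -> (jpoint h j.-1 + jpoint h j) / 2 <= x /\ (jpoint h j.-1 + jpoint h j) / 2 <= y) ->
    V j s y - V j t x = pmin h j.-1 * (y - x) + (g j s - g j t).
  case: j => // j _ /= jN x1 y1 hm; have jN' := ltnW jN.
  have e1 : M0 y - M0 x = pmin h j * (y - x) + (tents h kap y - tents h kap x).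
    apply: M0E => // j1; have [m1 m2] := hm j1; have := jpoint_lt wh j1 (ltnSn j) jN.
    by move: m1 m2; clear => *; split; lra.
  have e2 : tents h kap y - tents h kap x = - kap j * (y - x).
    have [j1|j0] := ltnP 0 j.
      have [m1 m2] := hm j1; have l1 := jpoint_lt wh j1 (ltnSn j) jN.
      rewrite !(tents_inner kap wh j1 jN)//; try by move: m1 m2 l1; lin.
      rewrite !min_r; [ring|..]; move: m1 m2; lin.
    have E : j = 0%N by apply/eqP; rewrite -leqn0.
    by rewrite E in x1 y1 *; rewrite !tents_left// subrr k0 oppr0 mul0r.
  rewrite /V /cone (pos_le0 (y := y - _)) ?subr_le0// (pos_le0 (y := x - _)) ?subr_le0//.
  rewrite (pos_id (y := _ - y)) ?subr_ge0// (pos_id (y := _ - x)) ?subr_ge0// !mulr0 !add0r /=.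
  have -> : M0 y + (g j.+1 s - kap j * (jpoint h j.+1 - y)) - (M0 x + (g j.+1 t - kap j * (jpoint h j.+1 - x))) =
    (M0 y - M0 x) + kap j * (y - x) + (g j.+1 s - g j.+1 t) by ring.
  by rewrite e1 e2; ring.
have domr j t x : (1 <= j)%N -> (j < njct h)%N -> (jpoint h j + jpoint h j.+1) / 2 <= x -> g j t - cone j x <= 0.
  move=> j1 jN xm; have [hj _] := hw j t j1 jN; have l1 := jpoint_lt wh j1 (ltnSn j) jN.
  have k1 := kap0 j (ltnW jN); have k2 := kap0 j.-1 (leq_trans (leq_pred _) (ltnW jN)).
  rewrite /cone pos_id ?subr_ge0; last by move: l1 xm; lin.
  have h1 := mulr_ge0 k2 (pos_ge0 (jpoint h j - x)).
  have h2 : kap j * ((jpoint h j.+1 - jpoint h j) / 2) <= kap j * (x - jpoint h j).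
    by rewrite ler_wpM2l//; move: xm; lin.
  by move: hj h1 h2; lin.
have doml j t x : (1 <= j)%N -> (j.+1 <= njct h)%N -> x <= (jpoint h j + jpoint h j.+1) / 2 -> g j.+1 t - cone j.+1 x <= 0.
  move=> j1 jN xm; have [_ hj] := hw j t j1 jN; have l1 := jpoint_lt wh j1 (ltnSn j) jN.
  have k1 := kap0 j (ltnW jN); have k2 := kap0 j.+1 jN.
  rewrite /cone (pos_id (y := _ - x)) ?subr_ge0; last by move: l1 xm; lin.
  have h1 := mulr_ge0 k2 (pos_ge0 (x - jpoint h j.+1)).
  have h2 : kap j * ((jpoint h j.+1 - jpoint h j) / 2) <= kap j * (jpoint h j.+1 - x).
    by rewrite ler_wpM2l//; move: xm; lin.
  by move: hj h1 h2 => /=; lin.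
have [Mp Mp0 lp] := pwl_lip h (pmin h); have [Mt Mt0 lt] := tents_lip h kap.
have [Kb Kb0 hKb] := finite_bound kap (njct h).
have conel j x y : (1 <= j)%N -> (j <= njct h)%N -> `|cone j x - cone j y| <= 2 * Kb * `|x - y|.
  move=> j1 jN; have jN' : (j.-1 <= njct h)%N := leq_trans (leq_pred _) jN.
  have -> : cone j x - cone j y = kap j * (pos (x - jpoint h j) - pos (y - jpoint h j)) +
    kap j.-1 * (pos (jpoint h j - x) - pos (jpoint h j - y)) by rewrite /cone; ring.
  apply: le_trans (ler_normD _ _) _; rewrite !normrM (ger0_norm (kap0 j jN)) (ger0_norm (kap0 j.-1 jN')).
  have p1 : `|pos (x - jpoint h j) - pos (y - jpoint h j)| <= `|x - y|.
    by apply: le_trans (pos_lip _ _) _; rewrite opprB addrA subrK.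
  have p2 : `|pos (jpoint h j - x) - pos (jpoint h j - y)| <= `|x - y|.
    by apply: le_trans (pos_lip _ _) _; rewrite [X in `|X|](_ : _ = y - x) ?[`|y - x|]distrC//; ring.
  have := ler_pM (kap0 j jN) (normr_ge0 _) (hKb j jN) p1.
  by have := ler_pM (kap0 j.-1 jN') (normr_ge0 _) (hKb j.-1 jN') p2; lin.
have lW : lipon everywhere (Mp + Mt + Mg + 2 * Kb) W.
  move=> s t x y _ _.
  have h1 : `|max_over (njct h) (fun j => g j s - cone j x) - max_over (njct h) (fun j => g j t - cone j y)|
      <= Mg * `|s - t| + 2 * Kb * `|x - y|.
    apply: max_over_lip => // j j1 jN; have [_ gl _ _ _] := hg j j1 jN.
    have := gl t s; have := conel j x y j1 jN; have := ler_normB (g j s - g j t) (cone j x - cone j y).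
    have -> : g j s - g j t - (cone j x - cone j y) = g j s - cone j x - (g j t - cone j y) by ring.
    by lin.
  have h2 : `|Num.max 0 (max_over (njct h) (fun j => g j s - cone j x)) -
      Num.max 0 (max_over (njct h) (fun j => g j t - cone j y))| <= Mg * `|s - t| + 2 * Kb * `|x - y|.
    by apply: maxr_lip => //; rewrite subrr normr0; apply: le_trans h1.
  have h3 := lp x y; have h4 := lt x y.
  have h5 := ler_normD (pwl h (pmin h) x - pwl h (pmin h) y) (tents h kap x - tents h kap y).
  rewrite /W; set X := Num.max _ _ in h2 *; set Y := Num.max _ _ in h2 *.
  have h6 := ler_normD (pwl h (pmin h) x - pwl h (pmin h) y + (tents h kap x - tents h kap y)) (X - Y).
  have -> : M0 x + X - (M0 y + Y) = pwl h (pmin h) x - pwl h (pmin h) y + (tents h kap x - tents h kap y) + (X - Y).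
    by rewrite /M0; ring.
  have g1 := mulr_ge0 (addr_ge0 Mp0 Mt0) (normr_ge0 (s - t)).
  have g2 := mulr_ge0 Mg0 (normr_ge0 (x - y)).
  have g3 := mulr_ge0 Kb0 (normr_ge0 (s - t)).
  by move: h2 h3 h4 h5 h6 g1 g2 g3; lin.
have MW0 : 0 <= Mp + Mt + Mg + 2 * Kb by move: Mp0 Mt0 Mg0 Kb0; lin.
apply: (level_intro wh MW0 lW).
  move=> t x; rewrite /W; congr (_ + Num.max 0 _); apply: max_over_eq => // j j1 jN.
  by have [gp _ _ _ _] := hg j j1 jN; rewrite gp.
move=> t x [k [i [iK [t1 t2]]]].
have time j : (1 <= j)%N -> (j <= njct h)%N -> exists2 r, 0 < r & forall s, `|s - t| < r ->
    V j t x + (mean (limiter h j) - A j i) * (s - t) <= V j s x.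
  move=> j1 jN; exists (Num.min (t - (tau i + k%:~R)) (tau i.+1 + k%:~R - t)); first by rewrite lt_min !subr_gt0 t1.
  move=> s; rewrite lt_min => /andP[]; rewrite !ltr_norml => /andP[g1 _] /andP[_ g2].
  have [_ _ _ _ gs] := hg j j1 jN.
  rewrite /V -(gs k i t s)//; [lin| | | |]; move: t1 t2 g1 g2; lin.
have touch f : (forall s y, f s y <= W s y) -> f t x = W t x -> subpt h m f t x -> subpt h m W t x.
  by move=> h1 h2; apply: subpt_touch => //; exists 1.
have [[a aN xe]|[a [a1 aN xE]]] := in_edge_cases x wh; last first.
  apply: (touch (V a)); first by move=> s y; exact: VW.
    apply/eqP; rewrite eq_le VW//= lerD2l ge_max.
    have ga0 : 0 <= g a t - cone a x.
      by have [_ _ g0 _ _] := hg a a1 aN; rewrite /cone xE subrr (pos_le0 (lexx 0)) !mulr0 addr0 subr0.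
    rewrite ga0; apply: max_over_le => // j j1 jN.
    have [ja|aj|-> //] := ltngtP j a; apply: le_trans ga0.
    - have jN' : (j < njct h)%N by exact: leq_trans ja aN.
      apply: domr => //; have := jpoint_lt wh j1 (ltnSn j) jN'; have := jpoint_le wh (ltn0Sn j) ja aN.
      by rewrite xE; lin.
    - case: j j1 jN aj => // j _ jN; rewrite ltnS => aj; have j1 := leq_trans a1 aj.
      apply: doml => //; have := jpoint_lt wh j1 (ltnSn j) jN; have := jpoint_le wh a1 aj (ltnW jN).
      by rewrite xE; lin.
  have aN' : (a.-1 <= njct h)%N by apply: leq_trans aN; exact: leq_pred.
  apply: (subpt_junction (pl := pmin h a.-1) (pr := pmin h a) wh a1 aN xE (time a a1 aN)).
  - exists (if (a < njct h)%N then (jpoint h a.+1 - jpoint h a) / 2 else 1).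
      by case: ifP => // aN2; rewrite divr_gt0// subr_gt0; exact: jpoint_lt wh a1 (ltnSn a) aN2.
    move=> y y1 y2; have e : V a t y - V a t x = pmin h a * (y - x) + (g a t - g a t).
      apply: (Vr _ _ _ _ _ a1 aN); [by rewrite xE|by rewrite -xE ltW|move=> aN2; rewrite aN2 in y2].
      by have := jpoint_lt wh a1 (ltnSn a) aN2; move: y1 y2; rewrite xE; clear=> *; split; lra.
    by move: e; lin.
  - exists (if (1 <= a.-1)%N then (jpoint h a - jpoint h a.-1) / 2 else 1).
      case: ifP => // aN2; rewrite divr_gt0// subr_gt0; apply: (jpoint_lt wh aN2) => //.
      by rewrite prednK.
    move=> y y1 y2; have e : V a t y - V a t x = pmin h a.-1 * (y - x) + (g a t - g a t).
      apply: (Vl _ _ _ _ _ a1 aN); [by rewrite xE|by rewrite -xE ltW|move=> aN2; rewrite aN2 in y2].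
      have := jpoint_lt wh aN2 (_ : a.-1 < a)%N aN; rewrite prednK// => /(_ (leqnn _)).
      by move: y1 y2; rewrite xE; clear=> *; split; lra.
    by move: e; lin.
  have [_ _ _ cm _] := hg a a1 aN; have [A1 A2] := grid_adm_ge ga a1 aN iK.
  suff : junction_ham h a t (pmin h a.-1) (pmin h a) <= A a i by move: cm; lin.
  rewrite /junction_ham Hplus_r// Hminus_r// !ge_max A1 A2 /=.
  by rewrite (@step_onE _ K tau _ _ k i t (grid_adm_step ga a1 aN))// ?(ltW t1).
have [e1 e2] := xe.
have [Z0|Zp] := leP (max_over (njct h) (fun j => g j t - cone j x)) 0.
  apply: (touch (fun _ x => M0 x)) => //; first by rewrite /W max_l// addr0.
  have [r r0 hr] := in_edge_nbhs xe.
  have el y : in_edge h a y -> `|tents h kap y - tents h kap x| <= kap a * `|y - x| /\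
      M0 y - M0 x = pmin h a * (y - x) + (tents h kap y - tents h kap x).
    move=> [y1 y2]; split; [apply: tents_edge_lip => //; first exact: kap0|apply: M0E => //].
    - by move=> a1; rewrite !ltW ?e1 ?y1.
    - by move=> a1; rewrite !ltW ?e2 ?y2.
    - by move=> a1; rewrite !ltW ?e1 ?y1.
    - by move=> a1; rewrite !ltW ?e2 ?y2.
  apply: (subpt_edge (th := 0) (pl := pmin h a + kap a) (pr := pmin h a - kap a) wh aN xe).
  - by exists 1 => // s _; rewrite mul0r addr0.
  - exists r => // y y1 y2; have yr : `|y - x| < r by rewrite gtr0_norm ?subr_gt0//; move: y2; lin.
    have [/ler_normlP[h1 _] h2] := el y (hr y yr); rewrite gtr0_norm ?subr_gt0// in h1.
    by move: h1 h2; lin.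
  - exists r => // y y1 y2; have yr : `|y - x| < r by rewrite ltr0_norm ?subr_lt0//; move: y2; lin.
    have [/ler_normlP[h1 _] h2] := el y (hr y yr); rewrite ltr0_norm ?subr_lt0// in h1.
    by move: h1 h2; lin.
  - move=> q /andP[q1 q2]; rewrite add0r; apply: hH => //; rewrite ler_norml; move: q1 q2; lin.
have [j /andP[j1 jN] jE] := max_over_ex (fun j => g j t - cone j x) N1.
rewrite jE in Zp.
apply: (touch (V j)); first by move=> s y; exact: VW.
  by rewrite /V /W jE max_r// ltW.
have [_ _ _ cm _] := hg j j1 jN; have [A1 A2] := grid_adm_ge ga j1 jN iK.
have nr : (j < njct h)%N -> x < (jpoint h j + jpoint h j.+1) / 2.
  by move=> jN'; rewrite ltNge; apply/negP => H; have := domr j t x j1 jN' H; rewrite leNgt Zp.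
have nl : (1 <= j.-1)%N -> (jpoint h j.-1 + jpoint h j) / 2 < x.
  move=> j2; rewrite ltNge; apply/negP => H.
  have := doml j.-1 t x j2; rewrite prednK// => /(_ jN H); by rewrite leNgt Zp.
have [xj|jx|xj] := ltgtP x (jpoint h j); last by case: (edge_junction wh aN xe j1 jN xj).
  have jN' : (j.-1 <= njct h)%N := leq_trans (leq_pred _) jN.
  have xe' : in_edge h j.-1 x.
    split=> [j2|_]; last by rewrite prednK.
    have := nl j2; have := jpoint_lt wh j2 (_ : j.-1 < j)%N jN; rewrite prednK// => /(_ (leqnn _)).
    by lin.
  pose r := Num.min (jpoint h j - x) (if (1 <= j.-1)%N then x - (jpoint h j.-1 + jpoint h j) / 2 else 1).
  have r0 : 0 < r by rewrite lt_min subr_gt0 xj; case: ifP => //= j2; rewrite subr_gt0 nl.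
  have e y : `|y - x| < r -> V j t y - V j t x = pmin h j.-1 * (y - x) + (g j t - g j t).
    rewrite lt_min => /andP[]; rewrite ltr_norml => /andP[_ r1] r2.
    apply: Vl => //; [exact: ltW|move: r1; lin|].
    move=> j2; have := nl j2; move: r2; rewrite j2 ltr_norml => /andP[r2 _] n2; split; move: n2 r2; lin.
  apply: (subpt_edge (pl := pmin h j.-1) (pr := pmin h j.-1) wh jN' xe' (time j j1 jN)).
  - exists r => // y y1 y2; have yr : `|y - x| < r by rewrite gtr0_norm ?subr_gt0//; move: y2; lin.
    by move: (e y yr); lin.
  - exists r => // y y1 y2; have yr : `|y - x| < r by rewrite ltr0_norm ?subr_lt0//; move: y2; lin.
    by move: (e y yr); lin.
  - move=> q /andP[q1 q2]; have -> : q = pmin h j.-1 by apply/eqP; rewrite eq_le q1 q2.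
    by move: A1 cm; lin.
have xe' : in_edge h j x.
  split=> // jN'.
  by have := nr jN'; have := jpoint_lt wh j1 (ltnSn j) jN'; lin.
pose r := Num.min (x - jpoint h j) (if (j < njct h)%N then (jpoint h j + jpoint h j.+1) / 2 - x else 1).
have r0 : 0 < r by rewrite lt_min subr_gt0 jx; case: ifP => //= j2; rewrite subr_gt0 nr.
have e y : `|y - x| < r -> V j t y - V j t x = pmin h j * (y - x) + (g j t - g j t).
  rewrite lt_min => /andP[]; rewrite ltr_norml => /andP[r1 _] r2.
  apply: Vr => //; [exact: ltW|move: r1; lin|].
  move=> j2; have := nr j2; move: r2; rewrite j2 ltr_norml => /andP[_ r2] n2; split; move: n2 r2; lin.
apply: (subpt_edge (pl := pmin h j) (pr := pmin h j) wh jN xe' (time j j1 jN)).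
- exists r => // y y1 y2; have yr : `|y - x| < r by rewrite gtr0_norm ?subr_gt0//; move: y2; lin.
  by move: (e y yr); lin.
- exists r => // y y1 y2; have yr : `|y - x| < r by rewrite ltr0_norm ?subr_lt0//; move: y2; lin.
  by move: (e y yr); lin.
- move=> q /andP[q1 q2]; have -> : q = pmin h j by apply/eqP; rewrite eq_le q1 q2.
  by move: A2 cm; lin.
Qed.
End LongEdgesLevel.

(** * The critical distance *)

Section CriticalDistance.
Context {R : realType}.

Lemma flat_width (H : R -> R) p0 m : goodH H p0 -> exists kap : R, [/\ 0 <= kap, H p0 < m -> 0 < kap &
  H p0 <= m -> forall q, `|q - p0| <= kap -> H q <= m].
Proof.
move=> gH; have [lt|ge] := ltP (H p0) m.
  have e0 : 0 < m - H p0 by rewrite subr_gt0.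
  have [r r0 hr] := goodH_cont gH p0 e0; exists (r / 2); split => [|_|_ q qr].
  - by rewrite ltW// divr_gt0.
  - by rewrite divr_gt0.
  - have : `|q - p0| < r by move: qr r0; lin.
    by move=> /hr /ltr_normlP[_]; lin.
exists 0; split => // le q.
by rewrite normr_le0 subr_eq0 => /eqP ->.
Qed.

Lemma critical_distance (N : nat) (H : nat -> R -> R) (p0 : nat -> R) : (1 <= N)%N -> admissible_hams N H p0 ->
  exists d0 : R -> R -> R, (forall M m, 0 <= d0 M m) /\
    forall K tau A a b, grid_adm (Hamiltonian N b H p0 a) K tau A ->
       let M := max_over N (fun k => sup_norm (a k)) in
       let m := max_over N (fun k => mean (a k)) in
       ((d0 M m)%:E <= min_edge_length N b)%E ->
       effective_limiter (Hamiltonian N b H p0 a) K tau = m.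
Proof.
move=> N1 hH.
have ex (am : nat * R) : exists kap : R, 0 <= kap /\ ((am.1 <= N)%N -> (H am.1 (p0 am.1) < am.2 -> 0 < kap) /\
    (H am.1 (p0 am.1) <= am.2 -> forall q, `|q - p0 am.1| <= kap -> H am.1 q <= am.2)).
  have [aN|aN] := boolP (am.1 <= N)%N; last by exists 0.
  by have [k [k0 k1 k2]] := flat_width am.2 (hH am.1 aN); exists k.
(* The widths are fixed before the limiters, the grid and the points are introduced, so the distance
   depends on the Hamiltonians, [M] and [m] only. *)
have [kf hk] := choice ex; pose kp a (m : R) : R := kf (a, m).
have kp0 a m : 0 <= kp a m by have [] := hk (a, m).
(* A bump is at most [4 * M] and has to be absorbed over half an edge at slope [kp c m], which asks
   for length [8 * M / kp c m]; the sum dominates each of its terms. *)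
pose d0 (M m : R) : R := \sum_(c < N) (if 0 < kp c m then 8 * `|M| / kp c m else 0).
have d00 M m c : 0 <= (if 0 < kp c m then 8 * `|M| / kp c m else 0).
  by case: ifP => // k0; rewrite divr_ge0// ?mulr_ge0.
exists d0; split => [M m|K tau A a b ga M m hd]; first exact: sumr_ge0.
have [wh tg _] := ga; pose h := Hamiltonian N b H p0 a.
have st j : (1 <= j)%N -> (j <= N)%N -> step_on K tau (A j) (a j) by move=> j1 jN; exact: (grid_adm_step ga j1 jN).
have Ab j i : (1 <= j)%N -> (j <= N)%N -> (i <= K)%N -> `|A j i| <= M.
  move=> j1 jN iK; apply: le_trans (step_sup_norm tg (st j j1 jN) iK) _.
  exact: (max_over_ge (fun k => sup_norm (a k)) j1 jN).
have M0 : 0 <= M by apply: le_trans (Ab 1%N 0%N (leqnn 1) N1 (leq0n K)).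
have cm j : (1 <= j)%N -> (j <= N)%N -> mean (a j) <= m.
  by move=> j1 jN; exact: (max_over_ge (fun k => mean (a k)) j1 jN).
have minm j : (j <= N)%N -> H j (p0 j) <= m.
  have aux c i0 : (1 <= c)%N -> (c <= N)%N -> (forall i, (i <= K)%N -> i0 <= A c i) -> i0 <= m.
    move=> c1 cN hi; apply: le_trans (cm c c1 cN); rewrite (mean_step tg (st c c1 cN)).
    have [_ _ lt] := tg; rewrite -[leLHS]mulr1 -(grid_sum1 tg) mulr_sumr; apply: ler_sum => i _.
    have iK : (i <= K)%N by rewrite -ltnS.
    by rewrite ler_wpM2r ?subr_ge0 ?hi// ltW// lt.
  case: j => [|j] jN; first by apply: (aux 1%N) => // i iK; have [] := grid_adm_ge ga (leqnn 1) N1 iK.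
  by apply: (aux j.+1) => // i iK; have [] := grid_adm_ge ga (ltn0Sn j) jN iK.
have exg j : exists gM : (R -> R) * R, (1 <= j)%N -> (j <= N)%N -> [/\ 0 <= gM.2, forall t, gM.1 (t + 1) = gM.1 t,
    forall s t, `|gM.1 t - gM.1 s| <= gM.2 * `|t - s|, forall t, 0 <= gM.1 t <= 4 * M &
    ((forall i, (i <= K)%N -> mean (a j) <= A j i) -> forall t, gM.1 t = 0) /\
    forall (k : int) i s t, (i <= K)%N -> tau i + k%:~R <= s -> s <= tau i.+1 + k%:~R ->
      tau i + k%:~R <= t -> t <= tau i.+1 + k%:~R -> gM.1 t - gM.1 s = (mean (a j) - A j i) * (t - s)].
  have [/andP[j1 jN]|nj] := boolP ((1 <= j) && (j <= N))%N; last first.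
    by exists (fun=> 0, 0) => j1 jN; rewrite j1 jN in nj.
  by have [g [Mg hg]] := bump_primitive tg (st j j1 jN) M0 (fun i => Ab j i j1 jN); exists (g, Mg).
have [gM hgM] := choice exg; have [Mg Mg0 hMg] := finite_bound (fun j => (gM j).2) N.
pose kap c := if (1 <= c)%N && (c < N)%N then kp c m else 0.
have kap0 c : 0 <= kap c by rewrite /kap; case: ifP.
have len c : (1 <= c)%N -> (c < N)%N -> 0 < kp c m -> 8 * M <= kp c m * (b c.+1 - b c).
  move=> c1 cN k0; have : (min_edge_length N b <= edge_length N b c)%E.
    apply: (@ge_bigmin_seq _ _ _ _ _ c) => //; rewrite mem_index_iota /=; exact: ltnW.
  move=> /(le_trans hd); rewrite edge_length_mid// lee_fin => h1.
  rewrite [leRHS]mulrC -ler_pdivrMr//; apply: le_trans h1; rewrite -{1}(ger0_norm M0) /d0 (bigD1 (Ordinal cN))//= k0.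
  by rewrite lerDl; apply: sumr_ge0 => i _; exact: d00.
apply/eqP; rewrite eq_le (max_mean_le_eff ga) andbT.
apply: (eff_le ga); apply: (@long_edges_level _ h K tau A m kap (fun j => (gM j).1) Mg ga) => //.
- by rewrite /kap /= ltnn andbF.
- move=> c q cN qk; have [_ h1] := hk (c, m); have [_ h2] := h1 cN; apply: h2; first exact: minm.
  move: qk; rewrite /kap /=; case: ifP => _ h3; [exact: h3|exact: le_trans h3 (kp0 c m)].
- move=> j j1 jN; have [g1 g2 g3 g4 [g5 g6]] := hgM j j1 jN; split => //.
  + by move=> s t; apply: le_trans (g3 s t) _; rewrite ler_wpM2r// hMg.
  + by move=> t; have /andP[] := g4 t.
  + exact: cm.
- move=> c t c1 cN; have [_ h1] := hk (c, m); have [h2 _] := h1 (ltnW cN).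
  have [_ _ _ /(_ t)/andP[_ g4] [g5 _]] := hgM c c1 (ltnW cN).
  have [_ _ _ /(_ t)/andP[_ g4'] [g5' _]] := hgM c.+1 (ltn0Sn c) cN.
  rewrite /kap c1 cN /=; have [k0|k0] := ltP 0 (kp c m).
    by have := len c c1 cN k0; move: g4 g4'; lin.
  have kE : kp c m = 0 by apply/eqP; rewrite eq_le k0 kp0.
  (* No room to descend means that [m] does not exceed the minimum of this Hamiltonian; the adjacent
     limiters then never fall below their means, and their bumps vanish. *)
  have mle : m <= H c (p0 c).
    by rewrite leNgt; apply/negP => /h2; rewrite -/(kp c m) kE ltxx.
  rewrite kE mul0r; split; [rewrite g5//|rewrite g5'//] => i iK.
    by have [_ e] := grid_adm_ge ga c1 (ltnW cN) iK; apply: le_trans e; apply: le_trans mle; apply: cm => //; exact: ltnW.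
  by have [e _] := grid_adm_ge ga (ltn0Sn c) cN iK; apply: le_trans e; apply: le_trans mle; exact: cm.
Qed.
End CriticalDistance.

(** * Estimates at the unit scale *)
Section UnitScale.
Context {R : realType}.
Implicit Types (h : hamiltonian R) (u v w U V : R -> R -> R) (K : nat) (tau : nat -> R) (A : nat -> nat -> R).

Definition in_cell K tau (s t : R) := exists (k : int) i, [/\ (i <= K)%N, tau i + k%:~R <= s & t <= tau i.+1 + k%:~R].

(** Required on every interval inside a cell, where the limiters are constant; nothing is asked at
    the grid times. *)
Definition gvisc sg h K tau T0 T1 U := forall s t, T0 <= s -> t <= T1 -> in_cell K tau s t ->
  visc sg h 0 s t%:E U.

Lemma gvisc_subpt h K tau T0 T1 U : gvisc 1 h K tau T0 T1 U <->
  forall t x, T0 < t -> t < T1 -> regular K tau t -> subpt h 0 U t x.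
Proof.
split=> [H t x t0 t1 [k [i [iK [t2 t3]]]]|H s t Ts tT [k [i [iK t2 t3]]]]; last first.
  apply/visc_subpt => r x [r1]; rewrite lte_fin => r2; apply: H.
  - exact: le_lt_trans Ts r1.
  - exact: lt_le_trans r2 tT.
  - by exists k, i; split => //; split; [exact: le_lt_trans t2 r1|exact: lt_le_trans r2 t3].
have := H (Num.max T0 (tau i + k%:~R)) (Num.min T1 (tau i.+1 + k%:~R)).
rewrite le_max lexx ge_min lexx => /(_ isT isT) HH.
have /visc_subpt : visc 1 h 0 (Num.max T0 (tau i + k%:~R)) (Num.min T1 (tau i.+1 + k%:~R))%:E U.
  by apply: HH; exists k, i; rewrite iK le_max lexx orbT ge_min lexx orbT.
by apply; split; rewrite ?lte_fin ?lt_min ?gt_max ?t0 ?t1 ?t2 ?t3.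
Qed.

Lemma gvisc_sub sg h K tau T0 T1 T0' T1' U : T0 <= T0' -> T1' <= T1 -> gvisc sg h K tau T0 T1 U ->
  gvisc sg h K tau T0' T1' U.
Proof. by move=> h0 h1 H s t s0 t1; apply: H; [exact: le_trans s0|exact: le_trans h1]. Qed.

Lemma cell_adm_lim h K tau A s t : grid_adm h K tau A -> in_cell K tau s t -> exists al : nat -> R, adm_lim h al s t%:E /\
  forall a, (1 <= a)%N -> (a <= njct h)%N -> exists2 i, (i <= K)%N & al a = A a i.
Proof.
move=> ga [k [i [iK s1 t1]]]; exists (A^~ i); split; last by move=> a _ _; exists i.
have [l1 l2] := grid_adm_lim k ga iK; split => // a r a1 aN [r1]; rewrite lte_fin => r2.
by apply: l1 => //; split; rewrite ?lte_fin; [exact: le_lt_trans r1|exact: lt_le_trans t1].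
Qed.

Lemma lipon_lsc (I : R -> Prop) M v : lipon I M v -> lsc_on I v.
Proof.
move=> lv t x e It e0; have [r r0 hr] := lipon_near x lv It e0.
by exists r => // s y Is h1 h2; have := hr s y Is h1 h2 => /ltr_normlP[]; lin.
Qed.

(** The ordering is propagated from cell to cell. Comparison holds before the final time of a cell,
    and Lipschitz continuity carries it to that time, which starts the next cell. *)
Lemma unit_comparison h K tau A T0 T1 u v Mu Mv : grid_adm h K tau A ->
  lipon (fun s => T0 <= s /\ s <= T1) Mu u -> lipon (fun s => T0 <= s /\ s <= T1) Mv v ->
  gvisc 1 h K tau T0 T1 u -> gvisc (-1) h K tau T0 T1 v -> (forall x, u T0 x <= v T0 x) ->
  forall t x, T0 <= t -> t <= T1 -> u t x <= v t x.
Proof.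
move=> ga lu lv gu gv init t x Tt tT; have [wh tg _] := ga.
pose P s t := T0 <= s -> t <= T1 -> (forall x, u s x <= v s x) -> forall r x, s <= r -> r <= t -> u r x <= v r x.
suff : P T0 t by move=> /(_ (lexx _) tT init t x Tt (lexx _)).
apply: (grid_ind tg (P := P)) => // {t x Tt tT}.
- by move=> t _ _ H r x h1 h2; have -> : r = t by apply/eqP; rewrite eq_le h1 h2.
- move=> r s t rs st H1 H2 Tr tT H r' x h1 h2; have Hs := H1 Tr (le_trans st tT) H.
  have [rs'|sr'] := leP r' s; first exact: Hs.
  by apply: (H2 (le_trans Tr rs) tT) => // [y|]; [exact: Hs|exact: ltW].
move=> k i s t iK s1 st t1 Ts tT H r x sr rt.
have cell : in_cell K tau s t by exists k, i.
have [al [adm _]] := cell_adm_lim ga cell.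
have sub q : in_slab s t%:E q -> T0 <= q /\ q <= T1.
  by move=> [q1]; rewrite lte_fin => q2; split; [exact: le_trans q1|exact: ltW (lt_le_trans q2 tT)].
have lus := lipon_sub sub lu; have lvs := lipon_sub sub lv.
have cmp q y : s <= q -> q < t -> u q y <= v q y.
  move=> sq qt; apply: (comparison wh adm lus (gu s t Ts tT cell) (gv s t Ts tT cell) (lipon_lsc lvs) _ H).
    move=> T' [sT' T't]; exists (`|v s 0| + `|Mv| * (t - s + 1)) => r' y' /andP[h1 h2].
    rewrite lte_fin in T't; have sst : in_slab s t%:E s by split; rewrite ?lte_fin//; exact: le_lt_trans sT' T't.
    have ssr : in_slab s t%:E r' by split; rewrite ?lte_fin//; exact: le_lt_trans h2 T't.
    have := lvs r' s y' 0 ssr sst; rewrite subr0 (ger0_norm (_ : 0 <= r' - s)) ?subr_ge0//.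
    move=> /ler_normlP[h3 _]; have h4 : Mv * (r' - s + `|y'|) <= `|Mv| * (t - s + `|y'|).
      apply: le_trans (ler_norm _) _; rewrite normrM ler_wpM2l// ger0_norm.
        by rewrite lerD2r lerD2r; exact: ltW (le_lt_trans h2 T't).
      by rewrite addr_ge0// subr_ge0.
    have h5 := ler_norm (- v s 0); rewrite normrN in h5.
    have ts0 : 0 <= t - s by rewrite subr_ge0.
    have h6 := mulr_ge0 (normr_ge0 Mv) (mulr_ge0 ts0 (normr_ge0 y')).
    have h7 := mulr_ge0 (normr_ge0 (v s 0)) (normr_ge0 y').
    have h8 := normr_ge0 Mv.
    by move: h3 h4 h5 h6 h7 h8; lin.
  by split; rewrite ?lte_fin.
have [rt'|tr] := ltP r t; first exact: cmp.
have E : r = t by apply/eqP; rewrite eq_le rt tr.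
have [ts|st'] := leP t s.
  have Es : r = s by apply/eqP; rewrite eq_le sr (le_trans rt ts).
  by rewrite Es; exact: H.
rewrite {r sr rt tr}E; apply/ler_addgt0Pr => e e0.
have It : T0 <= t /\ t <= T1 by split => //; exact: le_trans Ts st.
have e2 : 0 < e / 2 by rewrite divr_gt0.
have [r1 r10 hr1] := lipon_near x lu It e2; have [r2 r20 hr2] := lipon_near x lv It e2.
pose d := Num.min (Num.min (r1 / 2) (r2 / 2)) (t - s).
have d0 : 0 < d by rewrite !lt_min (divr_gt0 r10)// (divr_gt0 r20)// subr_gt0.
have [d1 [d2 d3]] : d <= r1 / 2 /\ d <= r2 / 2 /\ d <= t - s by rewrite !ge_min !lexx !orbT.
have I' : T0 <= t - d /\ t - d <= T1.
  by split; [apply: le_trans Ts _; move: d3; lin|apply: le_trans tT; move: d0; lin].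
have nd : `|t - d - t| = d by rewrite addrAC subrr add0r normrN gtr0_norm.
have := hr1 (t - d) x I'; rewrite nd subrr normr0 => /(_ _ r10) h1.
have := hr2 (t - d) x I'; rewrite nd subrr normr0 => /(_ _ r20) h2.
have {}h1 : `|u (t - d) x - u t x| < e / 2 by apply: h1; move: d1 r10; lin.
have {}h2 : `|v (t - d) x - v t x| < e / 2 by apply: h2; move: d2 r20; lin.
have := cmp (t - d) x; have -> : s <= t - d by move: d3; lin.
have -> : t - d < t by move: d0; lin.
move=> /(_ isT isT); move: h1 h2 => /ltr_normlP[h11 h12] /ltr_normlP[h21 h22].
by move: h11 h12 h21 h22; lin.
Qed.
End UnitScale.

(** * Time and space estimates for solutions *)

Section UnitEstimates.
Context {R : realType}.
Implicit Types (h : hamiltonian R) (v w U V : R -> R -> R) (K : nat) (tau : nat -> R) (A : nat -> nat -> R).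

Definition usol h K tau U := [/\ exists2 M, 0 <= M & lipon (fun s => 0 <= s) M U,
  forall T, gvisc 1 h K tau 0 T U & forall T, gvisc (-1) h K tau 0 T U].

Lemma unit_solution_usol h K tau g u : wf h -> time_grid K tau -> unit_solution h K tau g u ->
  usol h K tau (fun t x => u (t, x)) /\ forall x, u (0, x) = g x.
Proof.
move=> wh tg [[L lu] ug us]; split => //.
have l : lipon (fun s => 0 <= s) `|L| (fun t x => u (t, x)).
  have l1 : lipon (in_slab 0 +oo%E) `|L| (fun t x => u (t, x)).
    by apply: lipon_def; rewrite (_ : [set z | in_slab 0 +oo%E z.1] = slab 0 +oo%E).
  by apply: lipon_sub l1 => s s0; split => //; rewrite ltry.
have both sg : sg = 1 \/ sg = -1 -> forall (n i : nat), (i <= K)%N ->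
    visc sg h 0 (tau i + n%:R) (tau i.+1 + n%:R)%:E (fun t x => u (t, x)).
  move=> hsg n i iK; have [sub sup _ _] := us n i iK.
  have l2 : lipon (in_slab (tau i + n%:R) (tau i.+1 + n%:R)%:E) `|L| (fun t x => u (t, x)).
    apply: lipon_sub l => s [s1 _]; apply: le_trans s1.
    by have /andP[t0 _] := grid_bounds tg (leqW iK); rewrite addr_ge0.
  by case: hsg => ->; [apply/(sub_viscP 0 wh l2)|apply/(super_viscP 0 wh l2)].
have gv sg T : sg = 1 \/ sg = -1 -> gvisc sg h K tau 0 T (fun t x => u (t, x)).
  move=> hsg s t s0 tT [k [i [iK s1 t1]]].
  have [ts|st] := leP t s.
    apply: (visc_time_sub _ (both sg hsg 0%N i iK)) => r [r1]; rewrite lte_fin => r2.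
    by have := lt_trans r1 r2; rewrite ltNge ts.
  have k0 : 0 <= k.
    have /andP[_ b] := @grid_bounds R K tau i.+1 tg iK.
    have : (-1)%:~R < k%:~R :> R by rewrite rmorphN1; move: b s0 st t1; lin.
    by rewrite ltr_int; case: (k).
  have kE : k%:~R = `|k|%N%:R :> R by rewrite -[in LHS](gez0_abs k0).
  apply: (visc_time_sub _ (both sg hsg `|k|%N i iK)) => r [r1 r2]; rewrite -kE.
  by split; [exact: le_lt_trans s1 r1|apply: lt_le_trans r2 _; rewrite lee_fin].
split; [by exists `|L|%R |by move=> T; apply: gv; left|by move=> T; apply: gv; right].
Qed.

Lemma unit_bounds h K tau A L0 : grid_adm h K tau A -> exists C, [/\ 0 < C,
  forall a, (a <= njct h)%N -> (forall p, `|p| <= L0 -> ham h a p <= C) /\ - C <= ham h a (pmin h a) &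
  forall a i, (1 <= a)%N -> (a <= njct h)%N -> (i <= K)%N -> A a i <= C].
Proof.
move=> ga; have [wh _ _] := ga; have [C1 C10 h1] := wf_bounds L0 wh; have [C2 C20 h2] := limiter_bound ga.
exists (C1 + C2 + 1); split; first by move: C10 C20; lin.
  move=> a aN; have [h3 h4] := h1 a aN; split; last by move: h4 C20; lin.
  by move=> p pL; have := h3 p pL; move: C20; lin.
by move=> a i a1 aN iK; have := h2 a i a1 aN iK; move: C10; lin.
Qed.

Lemma limiter_periodic h K tau A a t : grid_adm h K tau A -> (1 <= a)%N -> (a <= njct h)%N ->
  limiter h a (t + 1) = limiter h a t.
Proof. by move=> ga a1 aN; have [p _] := grid_adm_step ga a1 aN. Qed.

Lemma usol_shift h K tau A U c : grid_adm h K tau A -> usol h K tau U ->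
  usol h K tau (fun t x => U (t + 1) x + c).
Proof.
move=> ga [[M M0 lU] sub sup].
have gs sg : (forall T, gvisc sg h K tau 0 T U) -> forall T, gvisc sg h K tau 0 T (fun t x => U (t + 1) x + c).
  move=> H T s t s0 tT [k [i [iK s1 t1]]].
  have cell : in_cell K tau (s + 1) (t + 1).
    by exists (k + 1), i; split => //; rewrite intrD1 addrA lerD2r.
  apply: visc_shift; first by move=> a r a1 aN; exact: limiter_periodic ga a1 aN.
  by apply: (H (T + 1)) => //; [rewrite addr_ge0|rewrite lerD2r].
split; [exists M => //|exact: gs|exact: gs].
move=> s t x y s0 t0; have -> : U (s + 1) x + c - (U (t + 1) y + c) = U (s + 1) x - U (t + 1) y by ring.
apply: le_trans (lU (s + 1) (t + 1) x y _ _) _; rewrite ?addr_ge0//.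
by have -> : s + 1 - (t + 1) = s - t by ring.
Qed.

Definition unit_data h K tau A L0 C U := [/\ grid_adm h K tau A, 0 <= L0 /\ 0 < C,
  forall a, (a <= njct h)%N -> (forall p, `|p| <= L0 -> ham h a p <= C) /\ - C <= ham h a (pmin h a),
  forall a i, (1 <= a)%N -> (a <= njct h)%N -> (i <= K)%N -> A a i <= C &
  usol h K tau U /\ forall x y, `|U 0 x - U 0 y| <= L0 * `|x - y|].

Lemma usol_lip h K tau U T0 T1 : usol h K tau U -> 0 <= T0 ->
  exists2 M, 0 <= M & lipon (fun s => T0 <= s /\ s <= T1) M U.
Proof.
move=> [[M M0 lU] _ _] h0; exists M => //.
by apply: lipon_sub lU => s [s0 _]; exact: le_trans s0.
Qed.

Lemma affine_lip (I : R -> Prop) M (f : R -> R) c : 0 <= M -> (forall x y, `|f x - f y| <= M * `|x - y|) ->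
  lipon I (M + `|c|) (fun t x => f x + c * t).
Proof.
move=> M0 lf s t x y _ _; have -> : f x + c * s - (f y + c * t) = (f x - f y) + c * (s - t) by ring.
apply: le_trans (ler_normD _ _) _; rewrite normrM; have := lf x y.
have := mulr_ge0 M0 (normr_ge0 (s - t)); have := mulr_ge0 (normr_ge0 c) (normr_ge0 (x - y)).
by lin.
Qed.

(** The barrier [U t1 + C * (t - t1)] can be started at any time with the same [C], because a
    super-solution barrier sees the minima of the Hamiltonians only and not the slopes of [U t1]. *)
Lemma unit_growth h K tau A L0 C U t1 t2 x : unit_data h K tau A L0 C U ->
  0 <= t1 -> t1 <= t2 -> U t2 x <= U t1 x + C * (t2 - t1).
Proof.
move=> d; have [ga [L00 C0] hH hA [usolU lip0]] := d.
move=> h1 h2; have [[M M0 lU] sub sup] := usolU; have [wh _ _] := ga.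
have lf y z : `|(U t1 y - C * t1) - (U t1 z - C * t1)| <= M * `|y - z|.
  have -> : (U t1 y - C * t1) - (U t1 z - C * t1) = U t1 y - U t1 z by ring.
  by have := lU t1 t1 y z h1 h1; rewrite subrr normr0 add0r.
have [M' _ l1] := usol_lip t2 usolU h1.
have := unit_comparison ga l1 (affine_lip C M0 lf) (gvisc_sub h1 (lexx t2) (sub t2)) _ _ x h2 (lexx t2).
have -> : U t1 x - C * t1 + C * t2 = U t1 x + C * (t2 - t1) by ring.
apply; last by move=> y; rewrite subrK.
by move=> s t _ _ _; apply: barrier_super => // a aN; have [] := hH a aN.
Qed.

Lemma unit_start h K tau A L0 C U t x : unit_data h K tau A L0 C U ->
  0 <= t -> `|U t x - U 0 x| <= C * t.
Proof.
move=> d; have [ga [L00 C0] hH hA [usolU lip0]] := d.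
move=> t0; have [[M M0 lU] sub sup] := usolU; have [wh _ _] := ga.
apply/ler_normlP; split; last by have := (unit_growth x d) (lexx 0) t0; rewrite subr0; lin.
have [M' _ l1] := usol_lip t usolU (lexx 0).
have := unit_comparison ga (affine_lip (- C) L00 lip0) l1 _ (sup t) _ x t0 (lexx t).
move=> H; suff : U 0 x + - C * t <= U t x by lin.
apply: H; last by move=> y; rewrite mulr0 addr0.
move=> s r _ _ cell; have [al [adm hal]] := cell_adm_lim ga cell.
have := @barrier_sub R h s r%:E al L0 C (U 0) wh adm lip0 L00.
rewrite (_ : (fun t0 x0 => U 0 x0 - C * t0) = (fun t0 x0 => U 0 x0 + - C * t0)); last first.
  by apply/funext => a; apply/funext => b; rewrite mulNr.
apply; first by move=> a aN; have [] := hH a aN.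
by move=> a a1 aN; have [i iK ->] := hal a a1 aN; exact: hA.
Qed.

(** Integer shifts in time preserve the equation. Between times zero and one the solution moves by
    at most [C], and comparison with the shifted solution propagates this bound to all times. *)
Lemma unit_period h K tau A L0 C U t x n : unit_data h K tau A L0 C U ->
  0 <= t -> `|U (t + n%:R) x - U t x| <= C * n%:R.
Proof.
move=> d; have [ga [L00 C0] hH hA [usolU lip0]] := d.
have step s : 0 <= s -> `|U (s + 1) x - U s x| <= C.
  move=> s0; have l1 := usol_lip s usolU (lexx 0); have [M _ lM] := l1.
  have Cb y : `|U 1 y - U 0 y| <= C by have := (unit_start y d) ler01; rewrite mulr1.
  have us c := usol_shift c ga usolU.
  have l2 c : exists2 M, 0 <= M & lipon (fun r => 0 <= r /\ r <= s) M (fun t x => U (t + 1) x + c).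
    have [[M' M'0 l'] _ _] := us c; exists M' => //; apply: lipon_sub l' => r; by case.
  have [_ sub sup] := usolU.
  apply/ler_normlP; rewrite opprB; split.
    have [_ _ sup'] := us C; have [M' _ l'] := l2 C.
    suff : U s x <= U (s + 1) x + C by lin.
    apply: (unit_comparison ga lM l' (sub s) (sup' s) _ x s0 (lexx s)) => y.
    by have := Cb y; rewrite add0r => /ler_normlP[]; lin.
  have [_ sub' _] := us (- C); have [M' _ l'] := l2 (- C).
  suff : U (s + 1) x + - C <= U s x by lin.
  apply: (unit_comparison ga l' lM (sub' s) (sup s) _ x s0 (lexx s)) => y.
  by have := Cb y; rewrite add0r => /ler_normlP[]; lin.
move=> t0; elim: n => [|n IH]; first by rewrite addr0 subrr normr0 mulr0.
have := step (t + n%:R) (addr_ge0 t0 (ler0n _ n)); rewrite -natr1 addrA.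
have := ler_normD (U (t + n%:R + 1) x - U (t + n%:R) x) (U (t + n%:R) x - U t x).
by rewrite addrA subrK; move: IH; lin.
Qed.

(** Decrease is controlled over integer durations only, increase by [unit_growth] over any duration:
    going [n] periods forward and correcting the overshoot, shorter than one, costs the additive
    [2 * C]. *)
Lemma unit_past h K tau A L0 C U s t x : unit_data h K tau A L0 C U ->
  0 <= s -> s <= t -> U s x + C * s <= U t x + C * t + 2 * C.
Proof.
move=> d; have [ga [L00 C0] hH hA [usolU lip0]] := d.
move=> s0 st; pose n := `|Num.ceil (t - s)|%N.
have /andP[c1 c2] := Num.Theory.ceil_itv (t - s).
have n0 : (0 <= Num.ceil (t - s))%R.
  have : (-1)%:~R < (Num.ceil (t - s))%:~R :> R by rewrite rmorphN1; move: c2 st; lin.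
  by rewrite ltr_int; case: (Num.ceil _).
have nE : n%:R = (Num.ceil (t - s))%:~R :> R by rewrite /n -[in RHS](gez0_abs n0).
rewrite intrD rmorphN1 -nE in c1; rewrite -nE in c2.
have h1 := unit_period x n d s0.
have h2 : U (s + n%:R) x <= U t x + C * (s + n%:R - t).
  by apply: (unit_growth x d); [exact: le_trans st|move: c2; lin].
have h3 : C * (n%:R + (s + n%:R - t)) <= C * (t - s + 2).
  by rewrite ler_pM2l//; move: c1; lin.
by move: h1 h2 h3 => /ler_normlP[]; lin.
Qed.

(** The running maximum of [U + C * s] is Lipschitz with constant [L + 1] and within [2 * C] of
    [U + C * t] by [unit_past]. Steep contacts cannot be realized at time zero, where slopes are at
    most [L0]. *)
Lemma unit_near_lip_x h K tau A L0 C U L t x y : unit_data h K tau A L0 C U ->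
  0 < L -> L0 <= L -> 0 <= t ->
  (forall a q, (a <= njct h)%N -> L <= `|q| ->
    0 + C + 1 < ham h a q /\ (0 <= q -> pmin h a <= q) /\ (q <= 0 -> q <= pmin h a)) ->
  `|U t x - U t y| <= (L + 1) * `|x - y| + 2 * C.
Proof.
move=> d; have [ga [L00 C0] hH hA [usolU lip0]] := d.
move=> Lp L0L t0 hL; have [[M M0 lU] sub sup] := usolU; have [wh tg _] := ga.
have [F rF] := running_max_ex C t0 lU.
have FU z : U t z + C * t <= F z /\ F z <= U t z + C * t + 2 * C.
  have [[s [s0 st ->]] hF] := rF z; split; last exact: (unit_past z d).
  by have [_ hF'] := rF z; have [[r [r0 rt ->]] hF''] := rF z; apply: hF.
have late y0 y1 : late_max U 0 t C F (fun q => L + 1 <= `|q|) y0 y1.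
  move=> z z' v cz v0 v1 zL hz; have [[s [s0 st Fs]] _] := rF v.
  have [s0'|s0'] := ltP 0 s; first by exists s.
  exfalso; have E : s = 0 by apply/eqP; rewrite eq_le s0 s0'.
  have gmax (w : R) : y0 <= w <= y1 -> U 0 w - z w <= U 0 v - z v.
    move=> hw; have := hz w hw; have [_ /(_ 0 (lexx 0) t0)] := rF w.
    by rewrite Fs E mulr0; lin.
  have dz := cz.2 v; pose r := Num.min (v - y0) (y1 - v).
  have r0 : 0 < r by rewrite lt_min !subr_gt0 v0.
  have b1 : - L0 <= z' v.
    apply: (der_ge_r r0 dz) => w w1; rewrite -ltrBlDl lt_min => /andP[_ w2].
    have := gmax w; have -> : y0 <= w <= y1 by move: v0 w1 w2; lin.
    move=> /(_ isT); have := lip0 w v; rewrite (gtr0_norm (x := w - v)) ?subr_gt0// => /ler_normlP[].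
    by lin.
  have b2 : z' v <= L0.
    apply: (der_ge_l r0 dz) => w w1; rewrite ltrBlDr -ltrBlDl lt_min => /andP[w2 _].
    have := gmax w; have -> : y0 <= w <= y1 by move: v1 w1 w2; lin.
    move=> /(_ isT); have := lip0 w v; rewrite (ltr0_norm (x := w - v)) ?subr_lt0// => /ler_normlP[].
    by lin.
  have : `|z' v| <= L0 by rewrite ler_norml b1 b2.
  by move: zL L0L; lin.
have cw s z : 0 < s -> regular K tau s -> subpt h 0 U s z.
  move=> s0 rs; have /gvisc_subpt H := sub (s + 1); apply: H => //; lin.
have := slope_global y x wh tg lU cw rF hL late Lp.
move=> /ler_normlP[]; have [f1 f2] := FU x; have [f3 f4] := FU y.
by move=> h1 h2; apply/ler_normlP; move: f1 f2 f3 f4 h1 h2; clear => *; split; lra.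
Qed.

(** [C1] does not depend on the solution, and the additive one becomes an error of order epsilon
    after rescaling. *)
Lemma unit_estimates h K tau A L0 : grid_adm h K tau A -> 0 <= L0 -> exists C1, 0 < C1 /\
  forall U, usol h K tau U -> (forall x y, `|U 0 x - U 0 y| <= L0 * `|x - y|) ->
  (forall t x, 0 <= t -> `|U t x - U 0 x| <= C1 * t) /\
  forall s t x y, 0 <= s -> 0 <= t -> `|U s x - U t y| <= C1 * (`|s - t| + `|x - y| + 1).
Proof.
move=> ga L00; have [wh _ _] := ga; have [C [C0 hH hA]] := unit_bounds L0 ga.
have [L Lp hL] := steep_bound (0 + C + 1) wh.
have Lm : 0 < L + L0 by move: Lp L00; lin.
have C1p : 0 < C + (L + L0 + 1) + 4 * C by move: Lm C0; lin.
exists (C + (L + L0 + 1) + 4 * C); split => // U us lip0.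
have d : unit_data h K tau A L0 C U by [].
split.
  move=> t x t0; apply: le_trans (unit_start x d t0) _.
  by rewrite ler_wpM2r//; move: Lm C0; lin.
have time s t x : 0 <= s -> s <= t -> `|U s x - U t x| <= C * (t - s) + 2 * C.
  move=> s0 st; have := unit_past x d s0 st; have := unit_growth x d s0 st.
  by move=> h1 h2; apply/ler_normlP; move: h1 h2 C0; clear => *; split; lra.
move=> s t x y s0 t0; have hL' a q : (a <= njct h)%N -> L + L0 <= `|q| ->
    0 + C + 1 < ham h a q /\ (0 <= q -> pmin h a <= q) /\ (q <= 0 -> q <= pmin h a).
  by move=> aN qL; apply: hL => //; move: qL L00; lin.
have L0L : L0 <= L + L0 by move: Lp; lin.
have h1 := unit_near_lip_x x y d Lm L0L t0 hL'.
have h2 : `|U s x - U t x| <= C * `|s - t| + 2 * C.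
  have [st|ts] := leP s t.
    by rewrite [`|s - t|]distrC [`|t - s|]ger0_norm ?subr_ge0//; exact: time.
  by rewrite distrC [`|s - t|]gtr0_norm ?subr_gt0//; apply: time => //; exact: ltW.
have := ler_normD (U s x - U t x) (U t x - U t y); rewrite addrA subrK.
have := normr_ge0 (s - t); have := normr_ge0 (x - y).
move=> n1 n2; have g1 := mulr_ge0 (ltW Lm) n2; have g2 := mulr_ge0 (ltW C0) n1.
have g3 := mulr_ge0 (ltW C0) n2; have g4 := mulr_ge0 (ltW Lm) n1.
by move: h1 h2 n1 n2 g1 g2 g3 g4 C0 Lm; lin.
Qed.
End UnitEstimates.

(** * Relaxed limits *)
Section SlopeImprovement.
Context {R : realType}.
Implicit Types (f phi : R -> R -> R).

(** One-sided expansion from above at the origin: time slope [- b] up to a small error in time, and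
    slope [p] in space without any error term. *)
Definition touch_r f (t0 b p : R) := forall eta, 0 < eta -> exists2 r, 0 < r & forall t x,
  `|t - t0| < r -> 0 <= x -> x < r -> f t x <= f t0 0 - b * (t - t0) + eta * `|t - t0| + p * x.

Lemma touch_r_le f t0 b p q : p <= q -> touch_r f t0 b p -> touch_r f t0 b q.
Proof.
move=> pq H eta /H[r r0 hr]; exists r => // t x h1 h2 h3; apply: le_trans (hr t x h1 h2 h3) _.
by rewrite lerD2l ler_wpM2r.
Qed.

(** A value larger than all those on the boundary forces the maximum over the box to be interior,
    hence a local one. *)
Lemma box_touch (I : R -> Prop) f M (chi : R -> R -> R) (a b c d : R) : lipon I M f -> cont2 chi ->
  (forall t, a <= t <= b -> I t) ->
  (exists t1 x1, [/\ a <= t1 <= b, c <= x1 <= d &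
    forall t x, a <= t <= b -> c <= x <= d -> [\/ t = a, t = b, x = c | x = d] ->
      f t x - chi t x < f t1 x1 - chi t1 x1]) ->
  exists t x, [/\ a < t < b, c < x < d, locmax (fun s y => f s y - chi s y) t x &
    forall s y, a <= s <= b -> c <= y <= d -> f s y - chi s y <= f t x - chi t x].
Proof.
move=> lf cc hI [t1 [x1 [t1I x1I bd]]].
have ab : a <= b by have /andP[h1 h2] := t1I; exact: le_trans h1 h2.
have cd : c <= d by have /andP[h1 h2] := x1I; exact: le_trans h1 h2.
have usc t x : a <= t <= b -> c <= x <= d -> forall e, 0 < e -> exists2 r, 0 < r &
    forall s y, a <= s <= b -> c <= y <= d -> `|s - t| < r -> `|y - x| < r -> f s y - chi s y < f t x - chi t x + e.
  move=> tI xI e e0; have e2 : 0 < e / 2 by rewrite divr_gt0.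
  have [r1 r10 h1] := lipon_near x lf (hI t tI) e2; have [r2 r20 h2] := cc t x _ e2.
  exists (Num.min r1 r2); first by rewrite lt_min r10.
  move=> s y sI yI; rewrite !lt_min => /andP[s1 s2] /andP[y1 y2].
  have := h1 s y (hI s sI) s1 y1; have := h2 s y s2 y2.
  by move=> /ltr_normlP[h3 h4] /ltr_normlP[h5 h6]; move: h3 h4 h5 h6; lin.
have [t [x [tI xI hm]]] := max2 ab cd usc.
have h1 := hm t1 x1 t1I x1I.
have nb : ~ [\/ t = a, t = b, x = c | x = d].
  by move=> /(bd t x tI xI) => h2; have := lt_le_trans h2 h1; rewrite ltxx.
have ta : a < t by rewrite lt_neqAle (andP tI).1 andbT; apply/eqP => E; apply: nb; rewrite E; exact: Or41.
have tb : t < b by rewrite lt_neqAle (andP tI).2 andbT; apply/eqP => E; apply: nb; exact: Or42.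
have xc : c < x by rewrite lt_neqAle (andP xI).1 andbT; apply/eqP => E; apply: nb; rewrite E; exact: Or43.
have xd : x < d by rewrite lt_neqAle (andP xI).2 andbT; apply/eqP => E; apply: nb; exact: Or44.
exists t, x; split => //; [by rewrite ta tb|by rewrite xc xd|].
exists (Num.min (Num.min (t - a) (b - t)) (Num.min (x - c) (d - x))).
  by rewrite !lt_min !subr_gt0 ta tb xc xd.
move=> s y; rewrite !lt_min !ltr_norml => /andP[/andP[/andP[s1 _] /andP[_ s2]] _].
move=> /andP[_ /andP[/andP[y1 _] /andP[_ y2]]]; apply: hm.
  by move: s1 s2; lin.
by move: y1 y2; lin.
Qed.

(** The critical slope [pb] is the infimum of the admissible ones. Just above it the expansion
    holds, and just below it fails at points that must then have [x > 0]; a parabola in [x] joining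
    the two slopes turns this into contacts in the open half plane, with slopes tending to [pb]. *)
Lemma slope_improve f (t0 b p K : R) : lipon (fun s => 0 <= s) K f -> 0 < t0 -> touch_r f t0 b p ->
  exists pb, [/\ pb <= p, forall q, pb < q -> touch_r f t0 b q &
    forall d, 0 < d -> exists phi phit phix t x, [/\ C1xy phi phit phix, `|t - t0| < d, 0 < x < d,
      locmax (fun s y => f s y - phi s y) t x & `|phit t x + b| <= d /\ `|phix t x - pb| <= d]].
Proof.
move=> lf t0p tp; pose S : set R := [set q | touch_r f t0 b q].
have lbS : has_inf S.
  split; first by exists p.
  exists (- `|K|) => q Sq; have [r r0 hr] := Sq 1 ltr01.
  have := hr t0 (r / 2); rewrite subrr normr0 => /(_ r0).
  have r2 : 0 < r / 2 by rewrite divr_gt0.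
  have rr : r / 2 < r by move: r0; lin.
  move=> /(_ (ltW r2) rr); have := lf t0 t0 (r / 2) 0 (ltW t0p) (ltW t0p).
  rewrite subrr normr0 subr0 (gtr0_norm r2) add0r => /ler_normlP[h1 _] h2.
  have h3 : K * (r / 2) <= `|K| * (r / 2) by rewrite ler_pM2r// ler_norm.
  rewrite -(ler_pM2r r2); move: h1 h2 h3; lin.
pose pb := inf S.
have pbp : pb <= p by apply: ge_inf => //; exact: lbS.2.
have above q : pb < q -> touch_r f t0 b q.
  move=> pq; have q0 : 0 < q - pb by rewrite subr_gt0.
  have [q' Sq' qq'] := inf_adherent q0 lbS; apply: (touch_r_le _ Sq').
  by apply: ltW; move: qq'; rewrite -/pb addrC subrK.
exists pb; split => // d d0.
pose n := d / 4; have n0 : 0 < n by rewrite divr_gt0.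
have nS : ~ touch_r f t0 b (pb - n).
  move=> H; have : pb <= pb - n by apply: ge_inf => //; exact: lbS.2.
  by move: n0; lin.
have [e [e0 ed he]] : exists e, [/\ 0 < e, e <= d & forall r, 0 < r -> exists t x,
    [/\ `|t - t0| < r, 0 <= x, x < r & f t0 0 - b * (t - t0) + e * `|t - t0| + (pb - n) * x < f t x]].
  apply: contrapT => H; apply: nS => e' e'0; apply: contrapT => nr; apply: H.
  exists (Num.min e' d); split; [by rewrite lt_min e'0|by rewrite ge_min lexx orbT|move=> r r0].
  apply: contrapT => H; apply: nr; exists r => // t x h1 h2 h3; rewrite leNgt; apply/negP => h4.
  apply: H; exists t, x; split => //; apply: le_lt_trans h4.
  by rewrite lerD2r lerD2l ler_wpM2r// ge_min lexx.
have e2 : 0 < e / 2 by rewrite divr_gt0.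
have pn : pb < pb + n by rewrite ltrDl.
have [r r0 hr] := above (pb + n) pn (e / 2) e2.
pose T := Num.min (Num.min (r / 2) (t0 / 2)) (d / 2).
have T0 : 0 < T by rewrite !lt_min (divr_gt0 r0)// (divr_gt0 t0p)// (divr_gt0 d0).
have [T1 [T2 T3]] : T <= r / 2 /\ T <= t0 / 2 /\ T <= d / 2 by rewrite !ge_min !lexx !orbT.
pose X := Num.min (Num.min (r / 2) (d / 2)) (e * T / (6 * n)).
have n6 : 0 < 6 * n by rewrite mulr_gt0.
have X0 : 0 < X by rewrite !lt_min (divr_gt0 r0)// (divr_gt0 d0)// (divr_gt0 (mulr_gt0 e0 T0)).
have [X1 [X2 X3]] : X <= r / 2 /\ X <= d / 2 /\ X <= e * T / (6 * n) by rewrite !ge_min !lexx !orbT.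
have X3' : 6 * n * X <= e * T by move: X3; rewrite ler_pdivlMr// mulrC.
pose B := 3 * n / X.
have B0 : 0 < B by rewrite divr_gt0// mulr_gt0.
have BX : B * X = 3 * n by rewrite /B divfK// gt_eqF.
have rho0 : 0 < Num.min T (X / 3) by rewrite lt_min T0 divr_gt0.
have [t1 [x1 [t1r x10 x1r viol]]] := he _ rho0.
have [q1 q2] : Num.min T (X / 3) <= T /\ Num.min T (X / 3) <= X / 3 by move: (T) (X) => T' X'; rewrite !ge_min !lexx !orbT.
have t1T := lt_le_trans t1r q1; have x1X := lt_le_trans x1r q2.
have x1p : 0 < x1.
  rewrite lt_neqAle x10 andbT; apply/negP => /eqP E; rewrite -E mulr0 addr0 in viol.
  have := hr t1 0; rewrite mulr0 addr0 lexx => /(_ _ isT r0).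
  have h1 : `|t1 - t0| < r by move: t1T T1 r0; lin.
  move=> /(_ h1) h2; have := lt_le_trans viol h2; have := mulr_ge0 (ltW e0) (normr_ge0 (t1 - t0)).
  by lin.
have Bx1 : B * x1 ^+ 2 <= n * x1.
  rewrite expr2 mulrA ler_wpM2r// -(@ler_pM2r _ 3)// ; have : B * (x1 * 3) <= B * X.
    by rewrite ler_pM2l//; move: x1X; lin.
  by rewrite BX; lin.
pose G (y : R) x := - b * y + (pb - 2 * n) * x + B * x ^+ 2.
pose ex := f t1 x1 - (f t0 0 + G (t1 - t0) x1 + e * `|t1 - t0|).
have ex0 : 0 < ex.
  have := mulr_gt0 n0 x1p; rewrite /ex /G; move: viol Bx1; lin.
pose dd := ex / e; have dd0 : 0 < dd by rewrite divr_gt0.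
have edd : e * dd = ex by rewrite /dd mulrC divfK// gt_eqF.
have ct : C1 (fun t : R => - b * (t - t0) + e * hub dd (t - t0)) (fun t => - b + e * hub' dd (t - t0)).
  have h1 := C1D (C1_aff (- b) (b * t0)) (C1Z e (C1_comp (C1_hub dd0) (C1_aff 1 (- t0)))).
  by apply: (C1_eq h1) => y; rewrite !mul1r ?mulr1//; ring.
have cx : C1 (fun x : R => (pb - 2 * n) * x + B * x ^+ 2) (fun x => pb - 2 * n + 2 * B * x).
  have h1 := C1D (C1_aff (pb - 2 * n) 0) (C1_quad B 0).
  by apply: (C1_eq h1) => y; rewrite ?subr0 ?addr0//.
have cchi := C1xyD (C1xy_t ct) (C1xy_x cx); set chi := (X in C1xy X) in cchi.
have chiE t x : chi t x = G (t - t0) x + e * hub dd (t - t0) by rewrite /chi /G; ring.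
have hubb y := hub_bnd y dd0.
have big : ex + f t0 0 <= f t1 x1 - chi t1 x1.
  have [_ /andP[_ h1]] := hubb (t1 - t0); have h2 := ler_wpM2l (ltW e0) h1.
  by rewrite chiE /ex; move: h2; lin.
have [cc _ _ _ _] := cchi.
have hI t : t0 - T <= t <= t0 + T -> 0 <= t by move: T2 t0p; clear => *; lra.
have [|t [x [tI xI lm _]]] := box_touch (c := 0) (d := X) lf cc hI.
  exists t1, x1; split.
  - by move: t1T => /ltr_normlP[g1 g2]; move: g1 g2; lin.
  - by rewrite x10 /=; move: x1X X0; lin.
  move=> t x tI xI bd; apply: lt_le_trans big.
  suff : f t x - chi t x <= f t0 0 + ex / 2 by move: ex0; lin.
  have tT : `|t - t0| <= T by apply/ler_normlP; move: tI; clear => *; split; lra.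
  have /andP[x0 xX] := xI.
  have fb : f t x <= f t0 0 - b * (t - t0) + e / 2 * `|t - t0| + (pb + n) * x.
    apply: hr => //; first by move: tT T1 r0; lin.
    by move: xX X1 r0; lin.
  have [hub0 /andP[h1 _]] := hubb (t - t0); have h2 := ler_wpM2l (ltW e0) h1.
  have h3 : e * (dd / 2) = ex / 2 by rewrite mulrA edd.
  rewrite mulrBr h3 in h2; rewrite chiE /G.
  have Bx0 := mulr_ge0 (ltW B0) (sqr_ge0 x).
  have nX : n * x <= n * X by rewrite ler_pM2l.
  have en := mulr_ge0 (ltW e0) (normr_ge0 (t - t0)).
  have endpt : `|t - t0| = T -> f t x - (- b * (t - t0) + (pb - 2 * n) * x + B * x ^+ 2 + e * hub dd (t - t0)) <= f t0 0 + ex / 2.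
    by move=> E; rewrite E in h2 fb; move: fb h2 Bx0 nX X3'; lin.
  case: bd => E.
  - by apply: endpt; rewrite E addrAC subrr add0r normrN gtr0_norm.
  - by apply: endpt; rewrite E addrAC subrr add0r gtr0_norm.
  - by rewrite E !mulr0 !addr0 expr0n /= mulr0 addr0 in fb *; move: fb h2 en; lin.
  - rewrite E in fb *; have h4 : B * X ^+ 2 = 3 * n * X by rewrite expr2 mulrA BX.
    by rewrite h4; move: fb h2 en; lin.
have [xp xX] := andP xI.
exists chi, (fun t _ => - b + e * hub' dd (t - t0) + 0), (fun _ x => 0 + (pb - 2 * n + 2 * B * x)), t, x.
split => //.
- by apply/ltr_normlP; move: tI T3 d0; clear => *; split; lra.
- by rewrite xp /=; move: xX X2 d0; lin.
split.
  have /andP[h1 h2] := hub'_bnd (t - t0) dd0.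
  have h3 := ler_wpM2l (ltW e0) h1; have h4 := ler_wpM2l (ltW e0) h2.
  by apply/ler_normlP; move: h3 h4 ed; clear => *; split; lra.
have h1 : B * x <= 3 * n by rewrite -BX ler_pM2l// ltW.
have h2 := mulr_ge0 (ltW B0) (ltW xp).
by apply/ler_normlP; move: h1 h2; rewrite /n; clear => *; split; lra.
Qed.
End SlopeImprovement.

(** * Upper relaxed limits and their contacts *)

Section RelaxedLimits.
Context {R : realType}.
Implicit Types (h : hamiltonian R) (K : nat) (tau : nat -> R) (g : R -> R) (v w : R -> R -> R -> R) (phi psi U W : R -> R -> R).

Definition eventual_ub g : set R := [set c | exists2 e0, 0 < e0 & forall e, 0 < e -> e < e0 -> g e <= c].
Definition limsup0 g := inf (eventual_ub g).
Definition bounded0 g := exists e0 M, 0 < e0 /\ forall e, 0 < e -> e < e0 -> `|g e| <= M.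

Lemma has_inf_ub g : bounded0 g -> has_inf (eventual_ub g).
Proof.
move=> [e0 [M [e00 hM]]]; split.
  by exists M; exists e0 => // e e1 e2; have := hM e e1 e2; have := ler_norm (g e); lin.
exists (- M) => c [e1 e10 he]; pose m := Num.min e0 e1 / 2.
have mm : 0 < Num.min e0 e1 by rewrite lt_min e00.
have [m1 m2] : Num.min e0 e1 <= e0 /\ Num.min e0 e1 <= e1 by rewrite !ge_min !lexx orbT.
have h1 := he m _ _; have h2 := hM m _ _.
have m0 : 0 < m by rewrite divr_gt0.
have me0 : m < e0 by rewrite /m; move: m1 mm; lin.
have me1 : m < e1 by rewrite /m; move: m2 mm; lin.
have /ler_normlP[] := h2 m0 me0; have := h1 m0 me1; lin.
Qed.

Lemma limsup0_le g e : bounded0 g -> 0 < e -> exists2 e0, 0 < e0 & forall d, 0 < d -> d < e0 -> g d <= limsup0 g + e.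
Proof.
move=> bg e0; have [c [e1 e10 he] hc] := inf_adherent e0 (has_inf_ub bg).
by exists e1 => // d d1 d2; apply: le_trans (he d d1 d2) _; exact: ltW.
Qed.
Lemma limsup0_ge g e e0 : bounded0 g -> 0 < e -> 0 < e0 -> exists d, [/\ 0 < d, d < e0 & limsup0 g - e <= g d].
Proof.
move=> bg ep e0p; apply: contrapT => H.
have : limsup0 g <= limsup0 g - e.
  apply: ge_inf; first by case: (has_inf_ub bg).
  exists e0 => // d d1 d2; rewrite leNgt; apply/negP => lt.
  by apply: H; exists d; split => //; exact: ltW.
by move: ep; lin.
Qed.
Lemma limsup0_ub g c : bounded0 g -> (forall e, 0 < e -> exists2 e0, 0 < e0 & forall d, 0 < d -> d < e0 -> g d <= c + e) ->
  limsup0 g <= c.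
Proof.
move=> bg H; apply/ler_addgt0Pr => e e0; apply: ge_inf; first by case: (has_inf_ub bg).
exact: H.
Qed.

(** The error [e] vanishes in the limit, so pointwise upper limits are already the half-relaxed
    ones: they are Lipschitz, and approached uniformly from above on boxes ([upper_limit_unif]). *)
Definition near_lip (C : R) w := forall e s t x y, 0 < e -> 0 <= s -> 0 <= t ->
  `|w e s x - w e t y| <= C * (`|s - t| + `|x - y| + e).

Definition upper_limit w t x := limsup0 (fun e => w e t x).

Lemma upper_limit_half C w s t x y : (forall t x, 0 <= t -> bounded0 (fun e => w e t x)) -> near_lip C w -> 0 < C ->
  0 <= s -> 0 <= t -> upper_limit w s x <= upper_limit w t y + C * (`|s - t| + `|x - y|).
Proof.
move=> bw lw C0 s0 t0; apply: limsup0_ub; first exact: bw.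
move=> e ep; have e2 : 0 < e / 2 by rewrite divr_gt0.
have [e1 e10 h1] := limsup0_le (bw t y t0) e2.
exists (Num.min e1 (e / (2 * C))); first by rewrite lt_min e10 divr_gt0// mulr_gt0.
move=> d d0; rewrite lt_min ltr_pdivlMr ?mulr_gt0// => /andP[d1 d2].
have := h1 d d0 d1; have /ler_normlP[_] := lw d s t x y d0 s0 t0.
by rewrite -/(upper_limit w t y); move: d2; lin.
Qed.

Lemma upper_limit_lip C w : (forall t x, 0 <= t -> bounded0 (fun e => w e t x)) -> near_lip C w -> 0 < C ->
  lipon (fun s => 0 <= s) C (upper_limit w).
Proof.
move=> bw lw C0 s t x y s0 t0; apply/ler_normlP; rewrite opprB.
have := upper_limit_half x y bw lw C0 s0 t0; have := upper_limit_half y x bw lw C0 t0 s0.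
by rewrite [`|t - s|]distrC [`|y - x|]distrC; clear => *; split; lra.
Qed.

Lemma upper_limit_unif C w (a b c d e : R) : (forall t x, 0 <= t -> bounded0 (fun e => w e t x)) -> near_lip C w -> 0 < C ->
  0 <= a -> 0 < e -> exists2 e0, 0 < e0 & forall n t x, 0 < n -> n < e0 -> a <= t <= b -> c <= x <= d ->
  w n t x <= upper_limit w t x + e.
Proof.
move=> bw lw C0 a0 ep.
have [|e0 e00 he] := @cover2 R a b c d (fun n t x => 0 <= t -> w n t x <= upper_limit w t x + e); last first.
  by exists e0 => // n t x n0 n1 /andP[t1 t2] xI; apply: he => //; [rewrite t1|exact: le_trans t1].
move=> t x /andP[at_ _] _; have t0 := le_trans a0 at_; have e4 : 0 < e / 4 by rewrite divr_gt0.
have [e1 e10 h1] := limsup0_le (bw t x t0) e4.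
exists (Num.min e1 (e / (12 * C))); first by rewrite lt_min e10 divr_gt0// mulr_gt0.
move=> s y n; rewrite !lt_min !ltr_pdivlMr ?mulr_gt0// => /andP[_ s1] /andP[_ y1] n0 /andP[n1 n2] s0.
have /ler_normlP[_ g1] := lw n s t y x n0 s0 t0.
have g2 : w n t x <= upper_limit w t x + e / 4 := h1 n n0 n1.
have := upper_limit_half x y bw lw C0 t0 s0; rewrite [`|t - s|]distrC [`|x - y|]distrC.
by move: ep g1 g2 s1 y1 n2; lin.
Qed.

Definition rescale (e : R) U : R -> R -> R := fun t x => e^-1 * U (e * t) (e * x).

Lemma C1xy_rescale e phi phit phix : 0 < e -> C1xy phi phit phix ->
  C1xy (rescale e phi) (fun t x => phit (e * t) (e * x)) (fun t x => phix (e * t) (e * x)).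
Proof.
move=> e0 cphi; have ce : C1 (fun x : R => e * x) (fun=> e).
  by apply: (C1_eq (C1_aff e 0)) => x; rewrite ?addr0.
have := C1xyZ e^-1 (C1xy_comp cphi ce ce) => hh.
by apply: (C1xy_eq hh) => t x; rewrite // mulrCA mulVf ?mulr1// gt_eqF.
Qed.

Definition family h K tau C v := [/\ 0 < C, near_lip C v, forall t x, 0 <= t -> bounded0 (fun e => v e t x) &
  forall e, 0 < e -> usol h K tau (rescale e (v e))].

(** The lower relaxed limit is minus the upper relaxed limit of the opposite family; carrying the
    sign treats both at once. *)
Definition signed (sg : R) v : R -> R -> R -> R := fun e t x => sg * v e t x.

Lemma sg_norm (sg x : R) : sg = 1 \/ sg = -1 -> `|sg * x| = `|x|.
Proof. by case=> ->; rewrite ?mul1r// mulN1r normrN. Qed.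

Lemma signed_bounded sg v : sg = 1 \/ sg = -1 -> (forall t x, 0 <= t -> bounded0 (fun e => v e t x)) ->
  forall t x, 0 <= t -> bounded0 (fun e => signed sg v e t x).
Proof.
move=> hsg bv t x t0; have [e0 [M [e00 hM]]] := bv t x t0; exists e0, M; split => // e e1 e2.
by rewrite /signed sg_norm// hM.
Qed.
Lemma signed_lip sg C v : sg = 1 \/ sg = -1 -> near_lip C v -> near_lip C (signed sg v).
Proof. by move=> hsg lv e s t x y e0 s0 t0; rewrite /signed -mulrBr sg_norm// lv. Qed.

Lemma gvisc_at sg h K tau T U s : gvisc sg h K tau 0 T U -> 0 < s -> s < T -> regular K tau s ->
  exists T0 T1, in_time T0 T1 s /\ visc sg h 0 T0 T1 U.
Proof.
move=> H s0 sT [k [i [iK [s1 s2]]]].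
exists (Num.max 0 (tau i + k%:~R)), (Num.min T (tau i.+1 + k%:~R))%:E; split.
  by split; rewrite ?lte_fin ?lt_min ?gt_max ?s0 ?sT ?s1 ?s2.
apply: H; [by rewrite le_max lexx|by rewrite ge_min lexx|].
by exists k, i; rewrite iK le_max lexx orbT ge_min lexx orbT.
Qed.

(** Quadratic terms make the contact strict, so that it persists for some small [e]; at the unit
    scale [terminal_touch] then moves it to a regular time. *)
Lemma relaxed_touch h K tau C v sg phi phit phix (t0 x0 d e0 : R) : time_grid K tau -> family h K tau C v -> sg = 1 \/ sg = -1 ->
  C1xy phi phit phix -> 0 < t0 -> locmax (fun t x => upper_limit (signed sg v) t x - phi t x) t0 x0 ->
  0 < d -> 0 < e0 -> exists e s y psi psit psix, [/\ 0 < e, e < e0, `|e * y - x0| < d, 0 < s & regular K tau s] /\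
    [/\ C1xy psi psit psix, locmax (fun s y => sg * rescale e (v e) s y - psi s y) s y,
      phit t0 x0 - d <= psit s y & `|psix s y - phix t0 x0| <= d].
Proof.
move=> tg [C0 lv bv us] hsg cphi t0p [r1 r10 hr1] d0 e00.
have [_ ct cx _ _] := cphi; have d4 : 0 < d / 4 by rewrite divr_gt0.
have [r2 r20 hr2] := ct t0 x0 _ d4; have [r3 r30 hr3] := cx t0 x0 _ d4.
have [r [rp [ra [rb [rc [rd re]]]]]] : exists r, 0 < r /\ r < r1 /\ r < r2 /\ r < r3 /\ r < t0 /\ r <= d / 16.
  pose m := Num.min (Num.min (Num.min r1 r2) (Num.min r3 t0)) (d / 16).
  have m0 : 0 < m by rewrite !lt_min r10 r20 r30 t0p divr_gt0.
  have [m1 [m2 [m3 [m4 m5]]]] : m <= r1 /\ m <= r2 /\ m <= r3 /\ m <= t0 /\ m <= d / 16 by rewrite !ge_min !lexx !orbT.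
  by exists (m / 2); move: m0 m1 m2 m3 m4 m5; clear => *; do ![split]; lra.
pose W := upper_limit (signed sg v).
have cq := C1xyD (C1xy_t (C1_quad 1 t0)) (C1xy_x (C1_quad 1 x0)).
have cphi2 := C1xyD cphi cq; set phi2 := (X in C1xy X) in cphi2.
have bs := signed_bounded hsg bv; have ls := signed_lip hsg lv.
have k4 : 0 < r ^+ 2 / 4 by rewrite divr_gt0// exprn_gt0.
have tr0 : 0 <= t0 - r by move: rd; lin.
have [e1 e10 h1] := @upper_limit_unif C (signed sg v) (t0 - r) (t0 + r) (x0 - r) (x0 + r) _ bs ls C0 tr0 k4.
have e01 : 0 < Num.min e0 e1 by rewrite lt_min e00.
have [e [ep e2 h2]] := limsup0_ge (bs t0 x0 (ltW t0p)) k4 e01.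
move: e2; rewrite lt_min => /andP[ee0 ee1].
have [M [M0 lw]] : exists M, 0 <= M /\ lipon (fun s => 0 <= s) M (fun t x => sg * v e t x).
  have [[M M0 lU] _ _] := us e ep; exists M; split=> // s t x y s0 t0'.
  rewrite -mulrBr sg_norm//.
  have := lU (e^-1 * s) (e^-1 * t) (e^-1 * x) (e^-1 * y) (mulr_ge0 (ltW _) s0) (mulr_ge0 (ltW _) t0').
  rewrite invr_gt0 ep => /(_ isT isT); rewrite /rescale !mulVKf ?gt_eqF// -!mulrBr !normrM -mulrDr.
  by rewrite [M * _]mulrCA ler_pM2l// normr_gt0 invr_eq0 gt_eqF.
have [cc _ _ _ _] := cphi2.
have hI t : t0 - r <= t <= t0 + r -> 0 <= t by move: rd t0p; clear => *; lra.
have phi20 : phi2 t0 x0 = phi t0 x0 by rewrite /phi2 !subrr expr0n /= !mulr0 !addr0.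
have [|t [x [tI xI lm _]]] := box_touch (c := x0 - r) (d := x0 + r) lw cc hI.
  exists t0, x0; split; [by move: rp; lin|by move: rp; lin|].
  move=> t x tI xI bd.
  have g1 := h1 e t x ep ee1 tI xI; rewrite /signed -/(signed sg v) -/W in g1.
  have g2 : W t x - phi t x <= W t0 x0 - phi t0 x0.
    by apply: hr1; apply/ltr_normlP; move: tI xI ra; clear => *; split; lra.
  have g3 : r ^+ 2 <= (t - t0) ^+ 2 + (x - x0) ^+ 2.
    have := sqr_ge0 (t - t0); have := sqr_ge0 (x - x0).
    case: bd => ->; rewrite ?[_ - r - _]addrAC ?[_ + r - _]addrAC subrr add0r ?sqrrN; lin.
  rewrite phi20 /phi2; move: h2; rewrite -/(upper_limit (signed sg v) t0 x0) -/W /signed.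
  by move: g1 g2 g3 k4; lin.
have tI' : t0 - r <= t <= t0 + r by move: tI; clear => *; lra.
have t_gt0 : 0 < t by move: tI rd t0p; clear => *; lra.
have cs := C1xy_rescale ep cphi2.
have ie : 0 < e^-1 by rewrite invr_gt0.
have t's : 0 < e^-1 * t by rewrite mulr_gt0.
have [k [i [iK /andP[k1 k2]]]] := grid_left (e^-1 * t) tg.
have [q q0 hq] := lm.
pose r0 := Num.min (Num.min (e^-1 * q) (e^-1 * t)) 1.
have r00 : 0 < r0 by rewrite !lt_min t's mulr_gt0// ltr01.
pose eta := Num.min (Num.min (e^-1 * t - (tau i + k%:~R)) (e^-1 * t)) (Num.min (d / 4) (e^-1 * (d / 4))).
have eta0 : 0 < eta by rewrite !lt_min subr_gt0 k1 t's d4 mulr_gt0.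
have lU : lipon (fun s => 0 <= s) M (fun s y => sg * rescale e (v e) s y).
  move=> a b y z a0 b0; rewrite /rescale !(mulrCA sg) -mulrBr normrM (gtr0_norm ie).
  have := lw (e * a) (e * b) (e * y) (e * z) (mulr_ge0 (ltW ep) a0) (mulr_ge0 (ltW ep) b0).
  by rewrite -!mulrBr !normrM (gtr0_norm ep) -mulrDr mulrCA ler_pdivrMl.
have [||s [y [psi [psit [psix [a1 a2 a3 a4 [a5 a6 a7]]]]]]] :=
    @terminal_touch R (fun s => 0 <= s) M _ _ _ _ (e^-1 * t) (e^-1 * x) eta r0 lU cs r00 _ _ eta0.
- move=> s; rewrite ltrBlDr -ltrBlDl !lt_min => /andP[/andP[_ h3] _] _; move: h3; lin.
- move=> s y; rewrite ltrBlDr -ltrBlDl !lt_min => /andP[/andP[h3 _] _] h4 /andP[/andP[h5 _] _].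
  rewrite /rescale !mulVKf ?gt_eqF// !(mulrCA sg) -!mulrBr ler_pM2l//; apply: hq.
    have -> : e * s - t = e * (s - e^-1 * t) by rewrite mulrBr mulVKf// gt_eqF.
    rewrite normrM (gtr0_norm ep) -ltr_pdivlMl// ler0_norm; last by move: h4; lin.
    by move: h3; lin.
  have -> : e * y - x = e * (y - e^-1 * x) by rewrite mulrBr mulVKf// gt_eqF.
  by rewrite normrM (gtr0_norm ep) -ltr_pdivlMl.
move: a1 a3 a6 a7; rewrite /eta; set E := Num.min _ _ => a1 a3 a6 a7.
have [E1 [E2 [E3 E4]]] : E <= e^-1 * t - (tau i + k%:~R) /\ E <= e^-1 * t /\ E <= d / 4 /\ E <= e^-1 * (d / 4).
  by rewrite !ge_min !lexx !orbT.
rewrite /= !mulVKf ?gt_eqF// in a6 a7.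
have b1 : `|t - t0| < r by apply/ltr_normlP; move: tI; clear => *; split; lra.
have b2 : `|x - x0| < r by apply/ltr_normlP; move: xI; clear => *; split; lra.
have c1 := hr2 t x (lt_trans b1 rb) (lt_trans b2 rb).
have c2 := hr3 t x (lt_trans b1 rc) (lt_trans b2 rc).
exists e, s, y, psi, psit, psix; split; split => //.
- have -> : e * y - x0 = e * (y - e^-1 * x) + (x - x0) by rewrite mulrBr mulVKf ?gt_eqF// addrA subrK.
  have h3 : `|e * (y - e^-1 * x)| < d / 4.
    by rewrite normrM (gtr0_norm ep) -ltr_pdivlMl//; exact: lt_le_trans a3 E4.
  by apply: le_lt_trans (ler_normD _ _) _; move: h3 b2 re d0; lin.
- by move: a1 E2; lin.
- by exists k, i; split => //; split; [move: a1 E1; lin|exact: lt_le_trans a2 k2].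
- move: c1 b1 => /ltr_normlP[c11 c12] /ltr_normlP[b11 b12].
  by move: a6 E3 c11 c12 b11 b12 re; lin.
- move: c2 b2 a7 => /ltr_normlP[c11 c12] /ltr_normlP[b11 b12] /ler_normlP[a71 a72].
  by apply/ler_normlP; move: E3 c11 c12 b11 b12 re a71 a72; clear => *; split; lra.
Qed.
End RelaxedLimits.

(** * The equations away from the origin *)

Section RelaxedEdges.
Context {R : realType}.
Implicit Types (h : hamiltonian R) (K : nat) (tau : nat -> R) (v : R -> R -> R -> R) (phi : R -> R -> R).

Lemma wf_limit h (L : R) : wf h -> wf (limit_hamiltonian h L).
Proof.
move=> [N1 _ ah]; split => //; first by move=> a a1; rewrite ltnNge a1.
move=> a a1 /=; case: eqP => _; exact: ah.
Qed.

(** After rescaling all junctions collapse to the origin, so away from it only the two unbounded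
    edges are seen. *)
Lemma far_edge h x : wf h -> x != 0 -> exists2 e0, 0 < e0 & forall e y, 0 < e -> e < e0 ->
  `|e * y - x| < `|x| / 2 -> in_edge h (if x < 0 then 0%N else njct h) y.
Proof.
move=> wh xn0; have [N1 _ _] := wh; have [Z Z0 hZ] := finite_bound (fun a => `|jpoint h a|) (njct h).
have x0 : 0 < `|x| by rewrite normr_gt0.
have Z1 : 0 < Z + 1 by move: Z0; lin.
exists (`|x| / 2 / (Z + 1)); first by rewrite !divr_gt0.
move=> e y ep; rewrite ltr_pdivlMr// => eZ /ltr_normlP[h1 h2].
have jb a : (a <= njct h)%N -> `|e * jpoint h a| < `|x| / 2.
  move=> aN; apply: le_lt_trans eZ; rewrite normrM (gtr0_norm ep) ler_pM2l//.
  by have := hZ a aN; lin.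
case: ifP => xs.
  split=> // _; rewrite -(ltr_pM2l ep); have /ltr_normlP[j1 j2] := jb 1%N N1.
  by rewrite (ltr0_norm xs) in h1 h2 j1 j2; move: h1 h2 j1 j2; lin.
have xp : 0 < x by rewrite lt_neqAle eq_sym xn0 leNgt xs.
split; last by rewrite ltnn.
move=> _; rewrite -(ltr_pM2l ep); have /ltr_normlP[j1 j2] := jb _ (leqnn _).
by rewrite (gtr0_norm xp) in h1 h2 j1 j2; move: h1 h2 j1 j2; lin.
Qed.

Lemma relaxed_edge h K tau C v sg phi phit phix (t0 x0 : R) : wf h -> time_grid K tau -> family h K tau C v ->
  sg = 1 \/ sg = -1 -> C1xy phi phit phix -> 0 < t0 -> x0 != 0 ->
  locmax (fun t x => upper_limit (signed sg v) t x - phi t x) t0 x0 ->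
  phit t0 x0 + sg * ham h (if x0 < 0 then 0%N else njct h) (sg * phix t0 x0) <= 0.
Proof.
move=> wh tg fam hsg cphi t0p xn0 lm; set a := if _ then _ else _.
have aN : (a <= njct h)%N by rewrite /a; case: ifP.
have [_ _ ah] := wh; rewrite leNgt; apply/negP => lt; set m := (X in 0 < X) in lt.
have m2 : 0 < m / 2 by rewrite divr_gt0.
have [r r0 hr] := goodH_cont (ah a aN) (sg * phix t0 x0) m2.
have x0' : 0 < `|x0| by rewrite normr_gt0.
pose d := Num.min (Num.min (r / 2) (m / 4)) (`|x0| / 2).
have d0 : 0 < d by rewrite !lt_min (divr_gt0 r0)// (divr_gt0 lt)// (divr_gt0 x0').
have [d1 [d2 d3]] : d <= r / 2 /\ d <= m / 4 /\ d <= `|x0| / 2 by rewrite !ge_min !lexx !orbT.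
have [e0 e00 he] := far_edge wh xn0.
have [e [s [y [psi [psit [psix [[ep ee0 yx s0 rs] [cpsi lm' a1 a2]]]]]]]] :=
  relaxed_touch tg fam hsg cphi t0p lm d0 e00.
have ye := he e y ep ee0 (lt_le_trans yx d3); rewrite -/a in ye.
have [_ _ _ us] := fam; have [_ sub sup] := us e ep.
have sg2 x : sg * (sg * x) = x by case: hsg => ->; ring.
have gv : gvisc sg h K tau 0 (s + 1) (rescale e (v e)).
  by case: hsg => ->; [exact: sub|exact: sup].
have s1 : s < s + 1 by rewrite ltrDl.
have [T0 [T1 [sT [V _]]]] := gvisc_at gv s0 s1 rs.
have := V a _ _ _ s y aN (C1xyZ sg cpsi) sT ye; rewrite mulr0 => H.
have : sg * (sg * psit s y + ham h a (sg * psix s y)) <= 0.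
  apply: H; case: lm' => q q0 hq; exists q => // s' y' h1 h2.
  by have := hq s' y' h1 h2; rewrite !mulrBr !sg2.
rewrite mulrDr sg2 => H1.
have : `|sg * psix s y - sg * phix t0 x0| < r.
  by rewrite -mulrBr sg_norm//; move: a2 d1 r0; lin.
move=> /hr; rewrite -(sg_norm (ham h a _ - _) hsg) mulrBr => /ltr_normlP[h1 h2].
by move: H1 h1 h2 a1 d2 m2; rewrite /m; lin.
Qed.

Lemma C1xy_flip phi phit phix : C1xy phi phit phix ->
  C1xy (fun t x => phi t (- x)) (fun t x => phit t (- x)) (fun t x => - phix t (- x)).
Proof.
move=> cphi; have hh := C1xy_comp cphi (@C1_id R) (C1_aff (-1) 0).
by apply: (C1xy_eq hh) => t x; rewrite addr0 mulN1r// ?mulr1// mulrN1.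
Qed.

Definition flip (f : R -> R -> R) : R -> R -> R := fun t x => f t (- x).

(** The contacts whose slopes tend to [pb] lie at [x > 0], where the equation of the right edge
    holds; passing to the limit puts it on the critical slope itself. *)
Lemma improve_right h K tau C v sg (t0 b p : R) : wf h -> time_grid K tau -> family h K tau C v ->
  sg = 1 \/ sg = -1 -> 0 < t0 -> touch_r (upper_limit (signed sg v)) t0 b p ->
  exists pb, [/\ pb <= p, forall q, pb < q -> touch_r (upper_limit (signed sg v)) t0 b q &
    sg * ham h (njct h) (sg * pb) <= b].
Proof.
move=> wh tg fam hsg t0p tp; have [C0 lv bv us] := fam; have [_ _ ah] := wh.
have lW := upper_limit_lip (signed_bounded hsg bv) (signed_lip hsg lv) C0.
have [pb [h1 h2 h3]] := slope_improve lW t0p tp; exists pb; split => //.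
apply/ler_addgt0Pr => e e0; have e2 : 0 < e / 2 by rewrite divr_gt0.
have [r r0 hr] := goodH_cont (ah _ (leqnn _)) (sg * pb) e2.
pose d := Num.min (Num.min (r / 2) (e / 2)) (t0 / 2).
have d0 : 0 < d by rewrite !lt_min (divr_gt0 r0)// e2 (divr_gt0 t0p).
have [d1 [d2 d3]] : d <= r / 2 /\ d <= e / 2 /\ d <= t0 / 2 by rewrite !ge_min !lexx !orbT.
have [phi [phit [phix [t [x [cphi tt xx lm [b1 b2]]]]]]] := h3 d d0.
have [xp _] := andP xx.
have t_gt0 : 0 < t by move: tt => /ltr_normlP[]; move: d3 t0p; lin.
have := relaxed_edge wh tg fam hsg cphi t_gt0 _ lm; rewrite (gt_eqF xp) => /(_ isT).
rewrite ltNge (ltW xp) /= => H.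
have : `|sg * phix t x - sg * pb| < r.
  by rewrite -mulrBr sg_norm//; move: b2 d1 r0; lin.
move=> /hr; rewrite -(sg_norm (ham h _ _ - _) hsg) mulrBr => /ltr_normlP[g1 g2].
by move: b1 => /ler_normlP[g3 g4]; move: H g1 g2 g3 g4 d2; lin.
Qed.

Lemma improve_left h K tau C v sg (t0 b p : R) : wf h -> time_grid K tau -> family h K tau C v ->
  sg = 1 \/ sg = -1 -> 0 < t0 -> touch_r (flip (upper_limit (signed sg v))) t0 b p ->
  exists pb, [/\ pb <= p, forall q, pb < q -> touch_r (flip (upper_limit (signed sg v))) t0 b q &
    sg * ham h 0 (- (sg * pb)) <= b].
Proof.
move=> wh tg fam hsg t0p tp; have [C0 lv bv us] := fam; have [_ _ ah] := wh.
have lW := upper_limit_lip (signed_bounded hsg bv) (signed_lip hsg lv) C0.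
have lF : lipon (fun s => 0 <= s) C (flip (upper_limit (signed sg v))).
  move=> s t x y s0 t0'; apply: le_trans (lW s t (- x) (- y) s0 t0') _.
  by rewrite -opprD normrN.
have [pb [h1 h2 h3]] := slope_improve lF t0p tp; exists pb; split => //.
apply/ler_addgt0Pr => e e0; have e2 : 0 < e / 2 by rewrite divr_gt0.
have [r r0 hr] := goodH_cont (ah _ (leq0n _)) (- (sg * pb)) e2.
pose d := Num.min (Num.min (r / 2) (e / 2)) (t0 / 2).
have d0 : 0 < d by rewrite !lt_min (divr_gt0 r0)// e2 (divr_gt0 t0p).
have [d1 [d2 d3]] : d <= r / 2 /\ d <= e / 2 /\ d <= t0 / 2 by rewrite !ge_min !lexx !orbT.
have [phi [phit [phix [t [x [cphi tt xx lm [b1 b2]]]]]]] := h3 d d0.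
have [xp _] := andP xx.
have t_gt0 : 0 < t by move: tt => /ltr_normlP[]; move: d3 t0p; lin.
have lm' : locmax (fun t x => upper_limit (signed sg v) t x - phi t (- x)) t (- x).
  case: lm => q q0 hq; exists q => // s y s1 y1; have := hq s (- y) s1; rewrite /flip !opprK; apply.
  by have -> : - y - x = - (y - - x) by [ring]; rewrite normrN.
have := relaxed_edge wh tg fam hsg (C1xy_flip cphi) t_gt0 _ lm'.
rewrite oppr_eq0 (gt_eqF xp) => /(_ isT); rewrite oppr_lt0 xp !opprK mulrN => H.
have : `|- (sg * phix t x) - - (sg * pb)| < r.
  by rewrite -opprD normrN -mulrBr sg_norm//; move: b2 d1 r0; lin.
move=> /hr; rewrite -(sg_norm (ham h _ _ - _) hsg) mulrBr => /ltr_normlP[g1 g2].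
by move: b1 => /ler_normlP[g3 g4]; move: H g1 g2 g3 g4 d2; lin.
Qed.
End RelaxedEdges.

(** * The junction condition *)
Section UnitCorrectors.
Context {R : realType}.
Implicit Types (h : hamiltonian R) (K : nat) (tau : nat -> R) (A : nat -> nat -> R) (U V w : R -> R -> R).

Lemma subpt_shift h lam k U t x : (forall a, (1 <= a)%N -> (a <= njct h)%N -> limiter h a (t + k) = limiter h a t) ->
  subpt h lam U (t + k) x -> subpt h lam (fun s y => U (s + k) y) t x.
Proof.
move=> lk [s1 s2].
have cs phi phit phix : C1xy phi phit phix ->
    C1xy (fun t x => phi (t - k) x) (fun t x => phit (t - k) x) (fun t x => phix (t - k) x).
  move=> cphi; have := C1xy_comp cphi (C1_aff 1 (- k)) (@C1_id R) => hh.
  by apply: (C1xy_eq hh) => s y; rewrite mul1r// mulr1.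
split.
  move=> a phi phit phix aN cphi xe [r r0 hr].
  have := s1 a _ _ _ aN (cs _ _ _ cphi) xe; rewrite addrK; apply.
  exists r => // s y h1 h2; have := hr (s - k) y; rewrite subrK addrK.
  by have -> : s - k - t = s - (t + k) by [ring]; move=> /(_ h1 h2).
move=> a phi phit phix pl pr a1 aN cphi xb [r r0 hr].
have := s2 a _ _ _ pl pr a1 aN (cs _ _ _ cphi) xb; rewrite addrK /junction_ham lk//; apply.
exists r => // s y h1 h2; have := hr (s - k) y; rewrite subrK addrK.
by have -> : s - k - t = s - (t + k) by [ring]; move=> /(_ h1 h2).
Qed.

(** The maximum over one period, without drift, dominates the corrector at all times. Beyond the
    extreme junctions its slopes are limited by [pR] and [pL], and the part in between is
    bounded. *)
Lemma corrector_growth h K tau A lam M w pR pL : grid_adm h K tau A -> 0 <= M -> lipon everywhere M w ->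
  (forall t x, w (t + 1) x = w t x) -> corrector h lam K tau w ->
  (forall q, pR <= q -> lam < ham h (njct h) q) -> (forall q, q <= pL -> lam < ham h 0 q) ->
  exists c, [/\ 0 <= c, forall t x, w t x <= c + pR * pos x - pL * pos (- x) & forall t, - c <= w t 0].
Proof.
move=> ga M0 lw wp cw hR hL; have [wh tg _] := ga; have [N1 _ _] := wh.
have lwS : lipon (fun s => -1 <= s) M w by move=> s t x y _ _; exact: lw.
have m10 : -1 <= 0 :> R by rewrite oppr_le0.
have [F rF] := running_max_ex 0 m10 lwS.
have cw' s z : -1 < s -> regular K tau s -> subpt h lam w s z by move=> _; exact: cw.
have late P y0 y1 : late_max w (-1) 0 0 F P y0 y1.
  move=> z z' x _ _ _ _ _; have [[s [s1 s2 s3]] _] := rF x.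
  have [h1|h1] := ltP (-1) s; first by exists s.
  (* By periodicity, a maximum at the start of the window is also reached at its end. *)
  exists 0; split; [by rewrite oppr_lt0|by []|].
  have E : s = -1 by apply/eqP; rewrite eq_le s1 h1.
  by rewrite s3 E !mul0r -[in w (-1) x]wp addNr.
have wF t x : w t x <= F x.
  have -> : w t x = w (t - (Num.floor t)%:~R - 1) x.
    rewrite -[in RHS]wp subrK -[in RHS](periodic_int (Num.floor t) _ (f := w ^~ x)) ?subrK//.
  have [_ /(_ (t - (Num.floor t)%:~R - 1))] := rF x; rewrite mul0r addr0; apply.
    by have := Num.Theory.floor_le t; lin.
  by have /andP[_] := Num.Theory.floor_itv t; rewrite intrD1; lin.
have lF x y := running_max_lip x y lwS rF.
set b1 := jpoint h 1; set bN := jpoint h (njct h).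
have rb x : bN <= x -> F x - F bN <= pR * (x - bN).
  move=> xb; apply: (slope_le_edge wh tg lwS cw' rF xb (leqnn _)).
  - by move=> y y1 y2; split => //; rewrite ltnn.
  - by move=> q /hR; rewrite addr0.
  - exact: late.
have lb x : x <= b1 -> pL * (b1 - x) <= F b1 - F x.
  move=> xb; apply: (slope_ge_edge wh tg lwS cw' rF xb (leq0n _)).
  - by move=> y y1 y2; split.
  - by move=> q /hL; rewrite addr0.
  - exact: late.
pose Z := `|b1| + `|bN|.
have Z0 : 0 <= Z by rewrite addr_ge0.
have Zb : `|b1| <= Z /\ `|bN| <= Z by rewrite /Z; have := normr_ge0 b1; have := normr_ge0 bN; clear => *; split; lra.
have F0 x : F x <= `|F 0| + M * `|x|.
  by have := lF x 0; rewrite subr0 => /ler_normlP[_]; have := ler_norm (F 0); lin.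
have pp p x : `|x| <= Z -> - (`|p| * Z) <= p * x /\ p * x <= `|p| * Z.
  move=> xZ; have : `|p * x| <= `|p| * Z by rewrite normrM ler_wpM2l.
  by move=> /ler_normlP[]; clear => *; split; lra.
have w0 t : `|w t 0 - w 0 0| <= M.
  apply: (periodic_bound (g := w ^~ 0) _ M0) => [s|s r]; first exact: wp.
  by have := lw r s 0 0 I I; rewrite subrr normr0 addr0.
have MZ0 := mulr_ge0 M0 Z0; have pR0 := mulr_ge0 (normr_ge0 pR) Z0; have pL0 := mulr_ge0 (normr_ge0 pL) Z0.
exists (`|F 0| + M * Z + (`|pR| * Z + `|pL| * Z) + (`|w 0 0| + M)); split.
- by have := normr_ge0 (F 0); have := normr_ge0 (w 0 0); move: MZ0 pR0 pL0 M0; lin.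
- move=> t x; apply: le_trans (wF t x) _; have n1 := normr_ge0 (w 0 0).
  have g (y : R) : `|y| <= Z -> F y <= `|F 0| + M * Z.
    by move=> yZ; apply: le_trans (F0 y) _; rewrite lerD2l ler_wpM2l.
  have [xZ|Zx] := leP `|x| Z.
    have h1 := g x xZ; have [x0|x0] := leP 0 x.
      rewrite (pos_id x0) (pos_le0 (y := - x)) ?oppr_le0// mulr0.
      by have [h2 h3] := pp pR x xZ; move: h1 h2 n1 M0 pL0; lin.
    rewrite (pos_le0 (ltW x0)) (pos_id (y := - x)) ?oppr_ge0 ?(ltW x0)// mulr0.
    by have [h2 h3] := pp pL x xZ; move: h1 h2 n1 M0 pR0; lin.
  have [x0|x0] := leP 0 x.
    rewrite (ger0_norm x0) in Zx; rewrite (pos_id x0) (pos_le0 (y := - x)) ?oppr_le0// mulr0.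
    have xb : bN <= x by apply: le_trans (ler_norm _) _; apply: le_trans Zb.2 (ltW Zx).
    have h1 := rb x xb; have h2 := g bN Zb.2; have [h3 h4] := pp pR bN Zb.2.
    by move: h1 h2 h3 n1 M0 pL0; lin.
  rewrite (ltr0_norm x0) in Zx; rewrite (pos_le0 (ltW x0)) (pos_id (y := - x)) ?oppr_ge0 ?(ltW x0)// mulr0.
  have xb : x <= b1.
    by have := ler_norm (- b1); rewrite normrN; move: Zx Zb.1; lin.
  have h1 := lb x xb; have h2 := g b1 Zb.1; have [h3 h4] := pp pL b1 Zb.1.
  by move: h1 h2 h3 n1 M0 pR0; lin.
- move=> t; have /ler_normlP[h1 h2] := w0 t; have := ler_norm (- w 0 0); rewrite normrN.
  by have := normr_ge0 (F 0); move: h1 h2 MZ0 pR0 pL0; lin.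
Qed.

Definition clamp (a b x : R) := Num.max a (Num.min x b).
Lemma clamp_lip a b x y : `|clamp a b x - clamp a b y| <= `|x - y|.
Proof.
apply: maxr_lip; first by rewrite subrr normr0.
by apply: minr_lip => //; rewrite subrr normr0.
Qed.
Lemma clamp_in a b x : a <= b -> a <= clamp a b x <= b.
Proof. by move=> ab; rewrite /clamp le_max lexx ge_max ab ge_min lexx orbT. Qed.
Lemma clamp_id a b x : a <= x <= b -> clamp a b x = x.
Proof. by move=> /andP[h1 h2]; rewrite /clamp min_l// max_r. Qed.
Lemma clamp_l a b x : a <= b -> x <= a -> clamp a b x = a.
Proof. by move=> ab h1; rewrite /clamp max_l// ge_min h1. Qed.
Lemma clamp_r a b x : a <= b -> b <= x -> clamp a b x = b.
Proof. by move=> ab h1; rewrite /clamp min_r// max_r. Qed.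

(** The positive part of [V - U] vanishes on the sides of the box, so clamping extends [max(U, V)]
    outside by [U]; the result is a sub-solution on the whole line, which [unit_comparison] places
    below [U]. *)
Lemma box_comparison h K tau A U V ta tb X M : grid_adm h K tau A -> usol h K tau U -> 0 <= ta -> 0 < X ->
  lipon (fun s => ta <= s /\ s <= tb) M V -> 0 <= M ->
  (forall t x, ta < t -> t < tb -> regular K tau t -> subpt h 0 V t x) ->
  (forall x, - X <= x <= X -> V ta x <= U ta x) ->
  (forall t, ta <= t <= tb -> V t X <= U t X /\ V t (- X) <= U t (- X)) ->
  forall t x, ta <= t <= tb -> - X <= x <= X -> V t x <= U t x.
Proof.
move=> ga [[MU MU0 lU] sub sup] ta0 X0 lV M0 sV init side t x /andP[t1 t2] xI.
have XX : - X <= X by move: X0; lin.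
pose D t x := pos (V t (clamp (- X) X x) - U t (clamp (- X) X x)).
pose E t x := U t x + D t x.
have lU' : lipon (fun s => ta <= s /\ s <= tb) MU U.
  by apply: lipon_sub lU => s [s1 _]; exact: le_trans s1.
have lE : lipon (fun s => ta <= s /\ s <= tb) (2 * MU + M) E.
  move=> s r y z Is Ir; have h1 := lU' s r y z Is Ir.
  have h2 := lV s r (clamp (- X) X y) (clamp (- X) X z) Is Ir.
  have h3 := lU' s r (clamp (- X) X y) (clamp (- X) X z) Is Ir.
  have h4 := clamp_lip (- X) X y z.
  have h5 := pos_lip (V s (clamp (- X) X y) - U s (clamp (- X) X y)) (V r (clamp (- X) X z) - U r (clamp (- X) X z)).
  have h6 := ler_normD (U s y - U r z) (D s y - D r z).
  have h7 := ler_normB (V s (clamp (- X) X y) - V r (clamp (- X) X z)) (U s (clamp (- X) X y) - U r (clamp (- X) X z)).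
  have e1 : E s y - E r z = U s y - U r z + (D s y - D r z) by rewrite /E; ring.
  have e2 : V s (clamp (- X) X y) - U s (clamp (- X) X y) - (V r (clamp (- X) X z) - U r (clamp (- X) X z)) =
    V s (clamp (- X) X y) - V r (clamp (- X) X z) - (U s (clamp (- X) X y) - U r (clamp (- X) X z)) by ring.
  rewrite e1; rewrite e2 in h5.
  have g1 := ler_wpM2l M0 h4; have g2 := ler_wpM2l MU0 h4.
  by move: h1 h2 h3 h5 h6 h7 g1 g2; rewrite /D; lin.
have sE : gvisc 1 h K tau ta tb E.
  apply/gvisc_subpt => s y s1 s2 rs; have [D0|Dp] := leP (V s (clamp (- X) X y) - U s (clamp (- X) X y)) 0.
    apply: (subpt_touch (V := U)).
    - by exists 1 => // r z _ _; rewrite /E lerDl pos_ge0.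
    - by rewrite /E /D pos_le0// addr0.
    - have /gvisc_subpt H := sub tb; apply: H => //; exact: le_lt_trans ta0 s1.
  have yX : - X < y < X.
    have sI : ta <= s <= tb by rewrite !ltW.
    have [q1 q2] := side s sI.
    apply/andP; split; rewrite ltNge; apply/negP => yy; move: Dp.
      by rewrite clamp_l// ltNge subr_le0 q2.
    by rewrite clamp_r// ltNge subr_le0 q1.
  have [y1 y2] := andP yX.
  apply: (subpt_touch (V := V)).
  - exists (Num.min (y + X) (X - y)); first by rewrite lt_min; move: y1 y2; lin.
    move=> r z _; rewrite lt_min !ltr_norml => /andP[/andP[z1 _] /andP[_ z2]].
    rewrite /E /D clamp_id; last by move: z1 z2; lin.
    by have := pos_ge (V r z - U r z); lin.
  - rewrite /E /D !clamp_id ?(ltW y1) ?(ltW y2)// in Dp *; rewrite pos_id ?(ltW Dp)//; ring.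
  - exact: sV.
have sup' : gvisc (-1) h K tau ta tb U by exact: (gvisc_sub ta0 (lexx tb) (sup tb)).
have := unit_comparison ga lE lU' sE sup' _ x t1 t2; rewrite /E /D clamp_id// => H.
suff : U t x + pos (V t x - U t x) <= U t x by have := pos_ge (V t x - U t x); lin.
apply: H => y; rewrite pos_le0 ?addr0// subr_le0; apply: init; exact: clamp_in.
Qed.
End UnitCorrectors.

(** * Sub-correctors built from solutions *)

Section BuildSubcorrector.
Context {R : realType}.
Implicit Types (h : hamiltonian R) (K : nat) (tau : nat -> R) (A : nat -> nat -> R) (U V w D : R -> R -> R).

Lemma C1_lip_on (f f' : R -> R) (a b M : R) s t : C1 f f' -> (forall x, a <= x <= b -> `|f' x| <= M) ->
  a <= s <= b -> a <= t <= b -> `|f s - f t| <= M * `|s - t|.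
Proof.
move=> cf hM; wlog st : s t / s <= t => [H|] sI tI.
  by have [st|ts] := leP s t; [exact: H|rewrite distrC [`|s - t|]distrC H// ltW].
rewrite distrC [`|s - t|]distrC (ger0_norm (_ : 0 <= t - s)) ?subr_ge0//.
have := @mvt_bound R f f' s t 0 M st _ _ _; rewrite mul0r subr0; apply.
- by move=> z _; exact: cf.2.
- by move=> z _; exact: C1_cont cf z.
- by move=> z zI; rewrite subr0; apply: hM; move: zI sI tI; clear => *; lra.
Qed.

(** At a given time only finitely many integer translates of [D] can be nonzero, so the supremum is
    attained and contact arguments apply to it. *)
Lemma translates_max D ta tb t x : ta <= tb -> (forall t x, 0 <= D t x) -> (forall t x, t <= ta -> D t x = 0) ->
  (forall t x, tb <= t -> D t x = 0) ->
  exists S, (forall k : int, D (t - k%:~R) x <= S) /\ exists k : int, S = D (t - k%:~R) x.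
Proof.
move=> ab D0 Da Db; pose n := `|Num.ceil (tb - ta)|%N; pose k0 := Num.floor (t - tb).
have /andP[f1 f2] := Num.Theory.floor_itv (t - tb); rewrite intrD1 -/k0 in f1 f2.
have nE : tb - ta <= n%:R.
  have /andP[c1 c2] := Num.Theory.ceil_itv (tb - ta).
  have c0 : 0 <= Num.ceil (tb - ta).
    have : (-1)%:~R < (Num.ceil (tb - ta))%:~R :> R by rewrite rmorphN1; move: c2 ab; lin.
    by rewrite ltr_int; case: (Num.ceil _).
  by rewrite /n; have -> : `|Num.ceil (tb - ta)|%N%:R = (Num.ceil (tb - ta))%:~R :> R by rewrite -[in RHS](gez0_abs c0).
pose f j := D (t - (k0 + j%:Z)%:~R) x.
have [j jN jE] := max_over_ex f (ltn0Sn n); exists (max_over n.+1 f); split; last by exists (k0 + j%:Z).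
move=> k; have S0 : 0 <= max_over n.+1 f by rewrite jE; exact: D0.
have [kk|kk] := leP k k0.
  rewrite Db//; have : k%:~R <= k0%:~R :> R by rewrite ler_int.
  by move: f1; lin.
have kp : 0 <= k - k0 by rewrite subr_ge0 ltW.
have kE : k = k0 + `|k - k0|%N%:Z by rewrite (gez0_abs kp) addrC subrK.
have [kn|nk] := leqP `|k - k0|%N n.+1.
  rewrite kE; apply: (max_over_ge f) => //; rewrite absz_gt0 subr_eq0.
  by rewrite gt_eqF.
rewrite Da// {1}kE intrD.
have : n.+2%:R <= (`|k - k0|%N%:Z)%:~R :> R by rewrite -pmulrn ler_nat.
rewrite -!natr1; move: f2 nE; lin.
Qed.

(** The excess of the tilted solution over the profile [B] is confined to a box on whose boundary it
    vanishes, and the supremum of its integer translates is added to [B]. Where this supremum is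
    positive, a translate of the solution carries the inequality; where it vanishes, [B] does. The
    last hypothesis covers a whole period, so the latter never happens near the junctions. *)
Lemma subcorrector_build h K tau A U psi psi' lam Mp ta tb t1 X Z pR pL c : grid_adm h K tau A -> usol h K tau U ->
  0 <= ta -> ta <= t1 -> t1 + 1 <= tb -> C1 psi psi' -> (forall t, ta <= t <= tb -> psi' t <= lam /\ `|psi' t| <= Mp) ->
  0 <= Z -> Z < X -> (forall a, (1 <= a)%N -> (a <= njct h)%N -> `|jpoint h a| <= Z) ->
  ham h (njct h) pR <= lam -> ham h 0 (- pL) <= lam ->
  let B x := pR * pos x + pL * pos (- x) + c in
  (forall t x, ta <= t <= tb -> - X <= x <= X -> [\/ t = ta, t = tb, x = - X | x = X] -> U t x + psi t <= B x) ->
  (forall t x, t1 <= t <= t1 + 1 -> - Z <= x <= Z -> B x < U t x + psi t) ->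
  subcorrector_levels h K tau lam.
Proof.
move=> ga [[MU MU0 lU] sub sup] ta0 tat t1b cpsi hpsi Z0 ZX hZ hR hL B bd core; have [wh tg _] := ga; have [N1 _ _] := wh.
have ab : ta <= tb by move: tat t1b; lin.
have XX : - X <= X by move: Z0 ZX; lin.
pose G t x := U t x + psi t.
pose D t x := pos (G (clamp ta tb t) (clamp (- X) X x) - B (clamp (- X) X x)).
have D0 t x : 0 <= D t x by exact: pos_ge0.
have tin t := @clamp_in R ta tb t ab; have xin x := @clamp_in R (- X) X x XX.
have Da t x : t <= ta -> D t x = 0.
  move=> h1; rewrite /D clamp_l// pos_le0// subr_le0; apply: bd; [by rewrite lexx|exact: xin|exact: Or41].
have Db t x : tb <= t -> D t x = 0.
  move=> h1; rewrite /D clamp_r// pos_le0// subr_le0; apply: bd; [by rewrite lexx ab|exact: xin|exact: Or42].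
have Dx t x : x <= - X \/ X <= x -> D t x = 0.
  case=> h1; rewrite /D pos_le0// subr_le0.
    by rewrite (clamp_l (x := x))//; apply: bd; [exact: tin|by rewrite lexx|exact: Or43].
  by rewrite (clamp_r (x := x))//; apply: bd; [exact: tin|by rewrite lexx XX|exact: Or44].
have Bl x y : `|B x - B y| <= (`|pR| + `|pL|) * `|x - y|.
  have -> : B x - B y = pR * (pos x - pos y) + pL * (pos (- x) - pos (- y)) by rewrite /B; ring.
  apply: le_trans (ler_normD _ _) _; rewrite !normrM mulrDl; apply: lerD; rewrite ler_wpM2l//.
    exact: pos_lip.
  by apply: le_trans (pos_lip _ _) _; rewrite -opprD normrN.
have taI : ta <= ta <= tb by rewrite lexx.
have Mp0 : 0 <= Mp := le_trans (normr_ge0 _) (hpsi ta taI).2.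
pose MD := MU + Mp + `|pR| + `|pL|.
have MD0 : 0 <= MD by rewrite /MD; have := normr_ge0 pR; have := normr_ge0 pL; move: MU0 Mp0; lin.
have lD s t x y : `|D s x - D t y| <= MD * (`|s - t| + `|x - y|).
  have h1 := clamp_lip ta tb s t; have h2 := clamp_lip (- X) X x y.
  have c0 r : 0 <= clamp ta tb r by have /andP[q _] := tin r; exact: le_trans q.
  have h3 := lU (clamp ta tb s) (clamp ta tb t) (clamp (- X) X x) (clamp (- X) X y) (c0 s) (c0 t).
  have h4 := C1_lip_on cpsi (fun x hx => (hpsi x hx).2) (tin s) (tin t).
  have h5 := Bl (clamp (- X) X x) (clamp (- X) X y).
  rewrite /D /G; set a1 := clamp ta tb s in h1 h3 h4 *; set a2 := clamp ta tb t in h1 h3 h4 *.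
  set b1 := clamp _ _ x in h2 h3 h5 *; set b2 := clamp _ _ y in h2 h3 h5 *.
  apply: le_trans (pos_lip _ _) _.
  have -> : U a1 b1 + psi a1 - B b1 - (U a2 b2 + psi a2 - B b2) = (U a1 b1 - U a2 b2) + (psi a1 - psi a2) - (B b1 - B b2) by ring.
  apply: le_trans (ler_normB _ _) _; apply: le_trans (lerD (ler_normD _ _) (lexx _)) _.
  have g1 := ler_wpM2l MU0 (lerD h1 h2); have g2 := ler_wpM2l Mp0 h1.
  have P0 : 0 <= `|pR| + `|pL| by rewrite addr_ge0.
  have g3 := ler_wpM2l P0 h2; have g4 := mulr_ge0 Mp0 (normr_ge0 (x - y)); have g5 := mulr_ge0 P0 (normr_ge0 (s - t)).
  by move: h3 h4 h5 g1 g2 g3 g4 g5; rewrite /MD; lin.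
have exS (z : R * R) : exists S, (forall k : int, D (z.1 - k%:~R) z.2 <= S) /\ exists k : int, S = D (z.1 - k%:~R) z.2.
  exact: translates_max ab D0 Da Db.
have [S' hS'] := choice exS; pose S t x := S' (t, x).
have Sub t x (k : int) : D (t - k%:~R) x <= S t x by have [+ _] := hS' (t, x); exact.
have Sex t x : exists k : int, S t x = D (t - k%:~R) x by have [_] := hS' (t, x).
have Shalf s t x y : S s x - S t y <= MD * (`|s - t| + `|x - y|).
  have [k ->] := Sex s x; have := Sub t y k; have /ler_normlP[_] := lD (s - k%:~R) (t - k%:~R) x y.
  by have -> : s - k%:~R - (t - k%:~R) = s - t by [ring]; lin.
have lS s t x y : `|S s x - S t y| <= MD * (`|s - t| + `|x - y|).
  apply/ler_normlP; rewrite opprB; split; last exact: Shalf.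
  by rewrite [`|s - t|]distrC [`|x - y|]distrC; exact: Shalf.
pose W t x := B x + S t x.
have lW : lipon everywhere (MD + (`|pR| + `|pL|)) W.
  move=> s t x y _ _; have -> : W s x - W t y = (B x - B y) + (S s x - S t y) by rewrite /W; ring.
  apply: le_trans (ler_normD _ _) _; have := Bl x y; have := lS s t x y.
  have P0 : 0 <= `|pR| + `|pL| by rewrite addr_ge0.
  by have := mulr_ge0 P0 (normr_ge0 (s - t)); lin.
apply: (level_intro wh _ lW); first by rewrite addr_ge0// addr_ge0.
  move=> t x; congr (_ + _); apply/eqP; rewrite eq_le; apply/andP; split.
    have [k ->] := Sex (t + 1) x; have := Sub t x (k - 1).
    by rewrite intrD rmorphN1 opprB addrA [t + 1 - _]addrAC addrAC.
  have [k ->] := Sex t x; have := Sub (t + 1) x (k + 1).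
  by rewrite intrD1 opprD addrA [t + 1 - _]addrAC addrK.
move=> t x rt; have [k kE] := Sex t x.
have S0 : 0 <= S t x by rewrite kE.
have [Sp|Sn] := ltP 0 (S t x).
  set s := t - k%:~R; have sE : t = s + k%:~R by rewrite /s subrK.
  have D1 : 0 < D s x by rewrite /s -kE.
  have ts : ta < s < tb.
    by apply/andP; split; rewrite ltNge; apply/negP => hh; move: D1; rewrite ?(Da _ _ hh) ?(Db _ _ hh) ltxx.
  have xX : - X < x < X.
    by apply/andP; split; rewrite ltNge; apply/negP => hh; move: D1; rewrite Dx ?ltxx//; [left|right].
  have [s1 s2] := andP ts; have [x1 x2] := andP xX.
  have Gin s' y : ta <= s' <= tb -> - X <= y <= X -> D s' y = pos (G s' y - B y).
    by move=> h1 h2; rewrite /D !clamp_id.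
  have lk r (j : int) a : (1 <= a)%N -> (a <= njct h)%N -> limiter h a (r + j%:~R) = limiter h a r.
    by move=> a1 aN; apply: periodic_int => q; exact: limiter_periodic ga a1 aN.
  apply: (subpt_touch (V := fun t y => G (t + (- k)%:~R) y)).
  - pose q := Num.min (Num.min (s - ta) (tb - s)) (Num.min (x + X) (X - x)).
    exists q; first by rewrite !lt_min !subr_gt0 s1 s2 x2 /=; move: x1; lin.
    move=> r y; rewrite !lt_min !ltr_norml => /andP[/andP[/andP[r1 _] /andP[_ r2]] _].
    move=> /andP[_ /andP[/andP[y1 _] /andP[_ y2]]].
    have rI : ta <= r - k%:~R <= tb by move: r1 r2; rewrite sE; lin.
    have yI : - X <= y <= X by move: y1 y2; lin.
    have := Sub r y k; rewrite Gin// rmorphN /W; have := pos_ge (G (r - k%:~R) y - B y); lin.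
  - rewrite rmorphN -/s /W kE -/s Gin ?(ltW s1) ?(ltW s2) ?(ltW x1) ?(ltW x2)//.
    by move: D1; rewrite Gin ?(ltW s1) ?(ltW s2) ?(ltW x1) ?(ltW x2)//; case: (posP (G s x - B x)) => -[_ ->]; [lin|rewrite ltxx].
  - apply: (subpt_shift (k := (- k)%:~R) (U := G)); first by move=> a a1 aN; exact: lk.
    rewrite rmorphN -/s.
    have rs : regular K tau s.
      have [j [i [iK [q1 q2]]]] := rt; exists (j - k), i; split => //.
      by rewrite intrD rmorphN /s; move: q1 q2; clear => *; split; lra.
    have us : subpt h 0 U s x.
      by have /gvisc_subpt H := sub tb; apply: H => //; exact: le_lt_trans ta0 s1.
    have sI : ta <= s <= tb by rewrite !ltW.
    by have := subpt_tilt cpsi (hpsi s sI).1 us; rewrite add0r.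
have SE : S t x = 0 by apply/eqP; rewrite eq_le Sn S0.
have xZ : Z < `|x|.
  rewrite ltNge; apply/negP => xZ; have xI : - Z <= x <= Z by rewrite -ler_norml.
  pose j := Num.floor (t - t1); have /andP[f1 f2] := Num.Theory.floor_itv (t - t1); rewrite intrD1 in f2.
  have tI : t1 <= t - j%:~R <= t1 + 1 by rewrite /j; move: f1 f2; lin.
  have := core _ _ tI xI; have := Sub t x j; rewrite SE /D !clamp_id.
  - by have := pos_ge (G (t - j%:~R) x - B x); rewrite /G; lin.
  - by move: xI ZX; clear => *; lra.
  - by move: tI tat t1b; clear => *; lra.
apply: (subpt_touch (V := fun _ y => B y)).
- by exists 1 => // r y _ _; rewrite /W lerDl; have [j ->] := Sex r y.
- by rewrite /W SE addr0.
have hth : exists2 r, 0 < r & forall s, `|s - t| < r -> B x + 0 * (s - t) <= B x.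
  by exists 1 => // s _; rewrite mul0r addr0.
have r0 : 0 < `|x| - Z by rewrite subr_gt0.
have [x0|x0] := leP 0 x.
  rewrite (ger0_norm x0) in xZ r0.
  have Br y : `|y - x| < x - Z -> B y = B x + pR * (y - x).
    rewrite ltr_norml => /andP[y1 _]; have y0 : 0 <= y by move: y1 Z0; lin.
    rewrite /B (pos_id y0) (pos_id x0) (pos_le0 (y := - x)) ?oppr_le0// (pos_le0 (y := - y)) ?oppr_le0//; ring.
  have xe : in_edge h (njct h) x.
    split=> [_|]; last by rewrite ltnn.
    by have := hZ _ N1 (leqnn _); have := ler_norm (jpoint h (njct h)); move: xZ; lin.
  apply: (subpt_edge (pl := pR) (pr := pR) wh (leqnn _) xe hth).
  - exists (x - Z) => // y y1 y2.
    have yr : `|y - x| < x - Z by rewrite gtr0_norm ?subr_gt0//; move: y2; lin.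
    by rewrite (Br y yr).
  - exists (x - Z) => // y y1 y2.
    have yr : `|y - x| < x - Z by rewrite ltr0_norm ?subr_lt0//; move: y2; lin.
    by rewrite (Br y yr).
  - by move=> q /andP[q1 q2]; have -> : q = pR by [apply/eqP; rewrite eq_le q1 q2]; rewrite add0r.
rewrite (ltr0_norm x0) in xZ r0.
have Br y : `|y - x| < - x - Z -> B y = B x + (- pL) * (y - x).
  rewrite ltr_norml => /andP[_ y1]; have y0 : y <= 0 by move: y1 Z0; lin.
  rewrite /B (pos_le0 y0) (pos_le0 (ltW x0)) (pos_id (y := - x)) ?oppr_ge0 ?(ltW x0)// (pos_id (y := - y)) ?oppr_ge0//; ring.
have xe : in_edge h 0 x.
  split=> // _; have := hZ _ (leqnn 1) N1; have := ler_norm (- jpoint h 1); rewrite normrN.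
  by move: xZ; lin.
apply: (subpt_edge (pl := - pL) (pr := - pL) wh (leq0n _) xe hth).
- exists (- x - Z) => // y y1 y2.
    have yr : `|y - x| < - x - Z by rewrite gtr0_norm ?subr_gt0//; move: y2; lin.
    by rewrite (Br y yr).
- exists (- x - Z) => // y y1 y2.
    have yr : `|y - x| < - x - Z by rewrite ltr0_norm ?subr_lt0//; move: y2; lin.
    by rewrite (Br y yr).
- by move=> q /andP[q1 q2]; have -> : q = - pL by [apply/eqP; rewrite eq_le q1 q2]; rewrite add0r.
Qed.
End BuildSubcorrector.

(** * The two arguments at the junction *)

Section Junction.
Context {R : realType}.
Implicit Types (h : hamiltonian R) (K : nat) (tau : nat -> R) (A : nat -> nat -> R) (v : R -> R -> R -> R) (w : R -> R -> R).

Lemma pos_scale (e x : R) : 0 < e -> pos (e * x) = e * pos x.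
Proof.
move=> e0; have [x0|x0] := leP 0 x.
  by rewrite !pos_id// mulr_ge0// ltW.
by rewrite !pos_le0 ?mulr0 ?(ltW x0)// pmulr_rle0// ltW.
Qed.

Lemma touch_two_sided (W : R -> R -> R) t0 b qR qL eta : touch_r W t0 b qR -> touch_r (flip W) t0 b qL -> 0 < eta ->
  exists2 r, 0 < r & forall t y, `|t - t0| < r -> `|y| < r ->
    W t y <= W t0 0 - b * (t - t0) + eta * `|t - t0| + (qR * pos y + qL * pos (- y)).
Proof.
move=> tR tL e0; have [r1 r10 h1] := tR eta e0; have [r2 r20 h2] := tL eta e0.
exists (Num.min r1 r2); first by rewrite lt_min r10.
move=> t y; rewrite !lt_min => /andP[t1 t2] /andP[y1 y2]; have [y0|y0] := leP 0 y.
  rewrite (pos_id y0) (pos_le0 (y := - y)) ?oppr_le0// mulr0 addr0; apply: h1 => //.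
  by rewrite (ger0_norm y0) in y1.
have := h2 t (- y) t2; rewrite /flip oppr0 opprK (ltr0_norm y0) in y2 *.
rewrite (pos_le0 (ltW y0)) (pos_id (y := - y)) ?oppr_ge0 ?(ltW y0)// mulr0 add0r; apply => //.
Qed.

Lemma C1_tilt (b k d e t0 c : R) : 0 < e -> 0 < d ->
  C1 (fun t => e^-1 * (b * (e * t - t0) - k * hub d (e * t - t0) + c)) (fun t => b - k * hub' d (e * t - t0)).
Proof.
move=> e0 d0; have h1 := C1Z e^-1 (C1D (C1D (C1_aff (b * e) (c - b * t0)) (C1Z (- k) (C1_comp (C1_hub d0) (C1_aff e (- t0))))) (C1_cst 0)).
by apply: (C1_eq h1) => t; [congr (_ * _); ring|field; rewrite gt_eqF].
Qed.

Lemma junction_level h K tau A C v lam b t0 qR qL pR pL : grid_adm h K tau A -> family h K tau C v -> 0 < t0 ->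
  b < lam -> touch_r (upper_limit (signed 1 v)) t0 b qR -> touch_r (flip (upper_limit (signed 1 v))) t0 b qL ->
  qR < pR -> qL < pL -> ham h (njct h) pR <= lam -> ham h 0 (- pL) <= lam ->
  subcorrector_levels h K tau lam.
Proof.
move=> ga fam t0p bl tR tL qpR qpL hR hL; have [C0 lv bv us] := fam.
have hsg : (1 = 1 :> R) \/ 1 = -1 :> R by left.
have bs := signed_bounded hsg bv; have ls := signed_lip hsg lv.
set W := upper_limit _ in tR tL; pose eta := (lam - b) / 4.
have eta0 : 0 < eta by rewrite divr_gt0// subr_gt0.
have etaE : 4 * eta = lam - b by rewrite /eta mulrC divfK.
have [r r0 hr] := touch_two_sided tR tL eta0.
pose dp := Num.min (pR - qR) (pL - qL); have dp0 : 0 < dp by rewrite lt_min !subr_gt0 qpR.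
have [dp1 dp2] : dp <= pR - qR /\ dp <= pL - qL by rewrite !ge_min !lexx orbT.
pose T := Num.min (r / 2) (t0 / 2); have T0 : 0 < T by rewrite lt_min !divr_gt0.
have [T1 T2] : T <= r / 2 /\ T <= t0 / 2 by rewrite !ge_min !lexx orbT.
pose X := r / 2; have X0 : 0 < X by rewrite divr_gt0.
(* On the boundary of the box the profile gains at least [th] over the solution, through the slope
   gap [dp] or the time penalty. Smoothing and the approximation by [v e] consume fractions of it,
   and [c] puts the profile [th / 4] below the contact value. *)
pose th := Num.min (dp * X) (eta * T); have th0 : 0 < th by rewrite lt_min (mulr_gt0 dp0 X0) (mulr_gt0 eta0 T0).
have [th1 th2] : th <= dp * X /\ th <= eta * T by rewrite !ge_min !lexx orbT.
pose d := th / (4 * eta); have eta4 : 0 < 4 * eta by rewrite mulr_gt0.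
have d0 : 0 < d by rewrite divr_gt0.
have ed : eta * d = th / 4 by rewrite /d; field; rewrite gt_eqF.
have [Z Z0 hZ] := finite_bound (fun a => `|jpoint h a|) (njct h).
pose P := `|pR| + `|pL|; have P0 : 0 <= P by rewrite addr_ge0.
(* Variation, per unit of [e], of all the terms over the core, which has size [e] in time and
   [e * Z] in space. *)
pose Q := C * (Z + 2) + `|b| + 2 * eta + P * Z + 1.
have Q0 : 0 < Q.
  by rewrite /Q; have := mulr_ge0 (ltW C0) Z0; have := mulr_ge0 P0 Z0; have := normr_ge0 b; move: C0 eta0; lin.
have Z1 : 0 < Z + 1 by move: Z0; lin.
have th16 : 0 < th / 16 by rewrite divr_gt0.
have tT0 : 0 <= t0 - T by move: T2 t0p; lin.
have [e1 e10 he1] := @upper_limit_unif R C (signed 1 v) (t0 - T) (t0 + T) (- X) X _ bs ls C0 tT0 th16.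
pose em := Num.min (Num.min e1 T) (Num.min (th / 16 / Q) (X / (Z + 1))).
have em0 : 0 < em by rewrite lt_min [0 < Num.min e1 T]lt_min e10 T0 lt_min (divr_gt0 th16 Q0) (divr_gt0 X0 Z1).
have [e [ep eem he]] := limsup0_ge (bs t0 0 (ltW t0p)) th16 em0.
have [m1 [m2 [m3 m4]]] : em <= e1 /\ em <= T /\ em <= th / 16 / Q /\ em <= X / (Z + 1).
  by rewrite /em; move: (T) => T'; rewrite !ge_min !lexx !orbT.
have ee1 := lt_le_trans eem m1; have eT := lt_le_trans eem m2.
have := lt_le_trans eem m3; rewrite ltr_pdivlMr// => eQ.
have := lt_le_trans eem m4; rewrite ltr_pdivlMr// => eX.
have {}he : W t0 0 - th / 16 <= v e t0 0 by move: he; rewrite /signed mul1r.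
have ie : 0 < e^-1 by rewrite invr_gt0.
pose psi t := e^-1 * (b * (e * t - t0) - 2 * eta * hub d (e * t - t0) + 0).
pose psi' t := b - 2 * eta * hub' d (e * t - t0).
have cpsi : C1 psi psi' by exact: C1_tilt.
have psib t : psi' t <= lam /\ `|psi' t| <= `|b| + 2 * eta.
  have /andP[h1 h2] := hub'_bnd (e * t - t0) d0.
  have g1 := ler_wpM2l (ltW eta0) h1; have g2 := ler_wpM2l (ltW eta0) h2.
  have := ler_norm b; have := ler_norm (- b); rewrite normrN => g3 g4; rewrite /psi'; split.
    by move: g1 g2 etaE eta0; lin.
  by apply/ler_normlP; move: g1 g2 g3 g4; clear => *; split; lra.
pose c := e^-1 * (W t0 0 - th / 4).
have scale (f : R) x : e^-1 * (pR * pos (e * x) + pL * pos (- (e * x)) + f) = pR * pos x + pL * pos (- x) + e^-1 * f.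
  by rewrite -mulrN !pos_scale//; field; rewrite gt_eqF.
apply: (@subcorrector_build R h K tau A (rescale e (v e)) psi psi' lam (`|b| + 2 * eta) (e^-1 * (t0 - T))
  (e^-1 * (t0 + T)) (e^-1 * t0) (e^-1 * X) Z pR pL c ga (us e ep)) => //.
- by rewrite mulr_ge0// ltW.
- by rewrite ler_pM2l//; move: T0; lin.
- have : e^-1 * e <= e^-1 * T by rewrite ler_pM2l// ltW.
  by rewrite mulVf ?gt_eqF//; lin.
- by rewrite ltr_pdivlMl//; move: eX ep; lin.
- by move=> a a1 aN; exact: hZ.
- move=> t x tI xI bd.
  pose s := e * t; pose y := e * x.
  have sI : t0 - T <= s <= t0 + T.
    by move: tI; rewrite ler_pdivrMl// ler_pdivlMl.
  have yI : - X <= y <= X.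
    by move: xI; rewrite -mulrN ler_pdivrMl// ler_pdivlMl.
  have bd' : `|s - t0| = T \/ `|y| = X.
    case: bd => E; [left|left|right|right].
    - by rewrite /s E mulVKf ?gt_eqF// addrAC subrr add0r normrN gtr0_norm.
    - by rewrite /s E mulVKf ?gt_eqF// addrAC subrr add0r gtr0_norm.
    - by rewrite /y E mulrN mulVKf ?gt_eqF// normrN gtr0_norm.
    - by rewrite /y E mulVKf ?gt_eqF// gtr0_norm.
  have sT : `|s - t0| <= T by apply/ler_normlP; move: sI; clear => *; split; lra.
  have yX : `|y| <= X by apply/ler_normlP; move: yI; clear => *; split; lra.
  have h1 := hr s y _ _; have {}h1 : W s y <= W t0 0 - b * (s - t0) + eta * `|s - t0| + (qR * pos y + qL * pos (- y)).
    apply: h1; first by move: sT T1 r0; lin.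
    by move: yX r0; rewrite /X; lin.
  have h2 : v e s y <= W s y + th / 16 by have := he1 e s y ep ee1 sI yI; rewrite /signed mul1r.
  have [_ /andP[h3 _]] := hub_bnd (s - t0) d0; have {}h3 := ler_wpM2l (ltW eta0) h3.
  rewrite mulrBr mulrA ed in h3.
  rewrite /psi /c -scale -mulrDr ler_pM2l// addr0 -/s -/y.
  have yE : pos y + pos (- y) = `|y|.
    have [y0|y0] := leP 0 y; first by rewrite (pos_id y0) pos_le0 ?oppr_le0// addr0 ger0_norm.
    by rewrite (pos_le0 (ltW y0)) pos_id ?oppr_ge0 ?(ltW y0)// add0r ltr0_norm.
  have q1 : dp * pos y <= (pR - qR) * pos y by rewrite ler_wpM2r// pos_ge0.
  have q2 : dp * pos (- y) <= (pL - qL) * pos (- y) by rewrite ler_wpM2r// pos_ge0.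
  have q3 : dp * pos y + dp * pos (- y) = dp * `|y| by rewrite -mulrDr yE.
  have q4 : th <= eta * `|s - t0| + dp * `|y|.
    have := mulr_ge0 (ltW eta0) (normr_ge0 (s - t0)); have := mulr_ge0 (ltW dp0) (normr_ge0 y).
    by case: bd' => ->; move: th1 th2; lin.
  by move: h1 h2 h3 q1 q2 q3 q4 th0; lin.
- move=> t x tI xI; pose s := e * t; pose y := e * x.
  have s1 : t0 <= s /\ s <= t0 + e.
    move: tI => /andP[]; rewrite ler_pdivrMl// -/s => g1 g2; split=> //.
    have g3 : e * t <= e * (e^-1 * t0 + 1) by rewrite ler_pM2l.
    by rewrite mulrDr mulr1 mulVKf ?gt_eqF// in g3.
  have y1 : `|y| <= e * Z.
    by rewrite /y normrM (gtr0_norm ep) ler_pM2l// ler_norml.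
  have [s1a s1b] := s1; have s0 : 0 <= s by exact: le_trans (ltW t0p) s1a.
  have := lv e t0 s 0 y ep (ltW t0p) s0; rewrite sub0r normrN [`|t0 - s|]distrC (ger0_norm (_ : 0 <= s - t0)) ?subr_ge0//.
  move=> /ler_normlP[_ h1].
  have h2 : C * (s - t0 + `|y| + e) <= C * (e + e * Z + e) by rewrite ler_pM2l//; move: y1 s1b; lin.
  have h3 : - (`|b| * e) <= b * (s - t0).
    have g1 : `|b * (s - t0)| <= `|b| * e.
      by rewrite normrM (ger0_norm (_ : 0 <= s - t0)) ?subr_ge0// ler_wpM2l//; move: s1b; lin.
    by move: g1 => /ler_normlP[]; lin.
  have [_ /andP[_ h4]] := hub_bnd (s - t0) d0; rewrite ger0_norm ?subr_ge0// in h4.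
  have {}h4 : eta * hub d (s - t0) <= eta * e by rewrite ler_pM2l//; move: h4 s1b; lin.
  have pb (p z : R) : `|z| <= e * Z -> p * pos z <= `|p| * (e * Z).
    move=> zZ; apply: le_trans (ler_norm _) _; rewrite normrM ler_wpM2l//.
    have := pos_lip z 0; rewrite (pos_le0 (lexx 0)) !subr0 => g; exact: le_trans g zZ.
  have h5 := pb pR y y1; have h6 : pL * pos (- y) <= `|pL| * (e * Z) by apply: pb; rewrite normrN.
  rewrite /psi /c -scale -mulrDr ltr_pM2l// addr0 -/s -/y.
  by move: h1 h2 h3 h4 h5 h6 he eQ ep th0; rewrite /Q /P; lin.
Qed.

(** A sub-corrector of level below [be], tilted in time, lies under the rescaled solution on the
    boundary of a box, thanks to the slope gaps and the time penalty; by [box_comparison] it stays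
    below inside. At the centre, however, it exceeds the solution by a fraction of [th / e], as its
    value there is at least [- c]. *)
Lemma junction_contra h K tau A C v lam M w c be t0 qR qL pR pL : grid_adm h K tau A -> family h K tau C v -> 0 < t0 ->
  lam < be -> 0 <= M -> lipon everywhere M w -> corrector h lam K tau w -> 0 <= c ->
  (forall t x, w t x <= c + pR * pos x - pL * pos (- x)) -> (forall t, - c <= w t 0) ->
  touch_r (upper_limit (signed (-1) v)) t0 (- be) qR -> touch_r (flip (upper_limit (signed (-1) v))) t0 (- be) qL ->
  qR < - pR -> qL < pL -> False.
Proof.
move=> ga fam t0p bl M0 lw cw c0 wu wl tR tL qpR qpL; have [C0 lv bv us] := fam.
have hsg : (-1 = 1 :> R) \/ -1 = -1 :> R by right.
have bs := signed_bounded hsg bv; have ls := signed_lip hsg lv.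
set W := upper_limit _ in tR tL; pose eta := (be - lam) / 4.
have eta0 : 0 < eta by rewrite divr_gt0// subr_gt0.
have etaE : 4 * eta = be - lam by rewrite /eta mulrC divfK.
have [r r0 hr] := touch_two_sided tR tL eta0.
pose dp := Num.min (- pR - qR) (pL - qL); have dp0 : 0 < dp by rewrite lt_min !subr_gt0 qpR.
have [dp1 dp2] : dp <= - pR - qR /\ dp <= pL - qL by rewrite !ge_min !lexx orbT.
pose T := Num.min (r / 2) (t0 / 2); have T0 : 0 < T by rewrite lt_min !divr_gt0.
have [T1 T2] : T <= r / 2 /\ T <= t0 / 2 by rewrite !ge_min !lexx orbT.
pose X := r / 2; have X0 : 0 < X by rewrite divr_gt0.
pose th := Num.min (dp * X) (eta * T); have th0 : 0 < th by rewrite lt_min (mulr_gt0 dp0 X0) (mulr_gt0 eta0 T0).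
have [th1 th2] : th <= dp * X /\ th <= eta * T by rewrite !ge_min !lexx orbT.
pose d := th / (4 * eta); have eta4 : 0 < 4 * eta by rewrite mulr_gt0.
have d0 : 0 < d by rewrite divr_gt0.
have ed : eta * d = th / 4 by rewrite /d; field; rewrite gt_eqF.
have c1 : 0 < c + 1 by move: c0; lin.
have th16 : 0 < th / 16 by rewrite divr_gt0.
have tT0 : 0 <= t0 - T by move: T2 t0p; lin.
have [e1 e10 he1] := @upper_limit_unif R C (signed (-1) v) (t0 - T) (t0 + T) (- X) X _ bs ls C0 tT0 th16.
pose em := Num.min e1 (th / 16 / (c + 1)).
have em0 : 0 < em by rewrite lt_min e10 (divr_gt0 th16 c1).
have [e [ep eem he]] := limsup0_ge (bs t0 0 (ltW t0p)) th16 em0.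
have [m1 m2] : em <= e1 /\ em <= th / 16 / (c + 1) by rewrite !ge_min !lexx orbT.
have ee1 := lt_le_trans eem m1.
have := lt_le_trans eem m2; rewrite ltr_pdivlMr// => ec.
have {}he : v e t0 0 <= - W t0 0 + th / 16 by move: he; rewrite /signed -/(upper_limit (signed (-1) v) t0 0) -/W; lin.
have ie : 0 < e^-1 by rewrite invr_gt0.
pose psi t := e^-1 * (- be * (e * t - t0) - 2 * eta * hub d (e * t - t0) + (th / 4 - W t0 0)).
pose psi' t := - be - 2 * eta * hub' d (e * t - t0).
have cpsi : C1 psi psi' by exact: C1_tilt.
have psib t : psi' t <= - lam /\ `|psi' t| <= `|be| + 2 * eta.
  have /andP[h1 h2] := hub'_bnd (e * t - t0) d0.
  have g1 := ler_wpM2l (ltW eta0) h1; have g2 := ler_wpM2l (ltW eta0) h2.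
  have := ler_norm be; have := ler_norm (- be); rewrite normrN => g3 g4; rewrite /psi'; split.
    by move: g1 g2 etaE eta0; lin.
  by apply/ler_normlP; move: g1 g2 g3 g4; clear => *; split; lra.
pose V t x := w t x + psi t.
have Mp0 : 0 <= `|be| + 2 * eta by have := normr_ge0 be; move: eta0; lin.
have lV : lipon (fun s => e^-1 * (t0 - T) <= s /\ s <= e^-1 * (t0 + T)) (M + (`|be| + 2 * eta)) V.
  move=> s t x y [s1 s2] [t1 t2]; have := lw s t x y I I.
  have := C1_lip_on (a := e^-1 * (t0 - T)) (b := e^-1 * (t0 + T)) (s := s) (t := t) cpsi (fun x _ => (psib x).2).
  rewrite s1 s2 t1 t2 => /(_ isT isT) h1 h2.
  have := ler_normD (w s x - w t y) (psi s - psi t).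
  have -> : w s x - w t y + (psi s - psi t) = V s x - V t y by rewrite /V; ring.
  by have := mulr_ge0 Mp0 (normr_ge0 (x - y)); move: h1 h2; lin.
have sV t x : e^-1 * (t0 - T) < t -> t < e^-1 * (t0 + T) -> regular K tau t -> subpt h 0 V t x.
  move=> _ _ rt; have := subpt_tilt cpsi (psib t).1 (cw t x rt); by rewrite subrr.
have scale (f : R) t : e^-1 * f = t <-> f = e * t.
  by split=> [<-|->]; [rewrite mulVKf// gt_eqF|rewrite mulKf// gt_eqF].
have key t x : e^-1 * (t0 - T) <= t <= e^-1 * (t0 + T) -> - (e^-1 * X) <= x <= e^-1 * X ->
    `|e * t - t0| = T \/ `|e * x| = X -> V t x <= rescale e (v e) t x.
  move=> tI xI bd'; pose s := e * t; pose y := e * x.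
  have sI : t0 - T <= s <= t0 + T by move: tI; rewrite ler_pdivrMl// ler_pdivlMl.
  have yI : - X <= y <= X by move: xI; rewrite -mulrN ler_pdivrMl// ler_pdivlMl.
  rewrite -/s -/y in bd'.
  have sT : `|s - t0| <= T by apply/ler_normlP; move: sI; clear => *; split; lra.
  have yX : `|y| <= X by apply/ler_normlP; move: yI; clear => *; split; lra.
  have h1 := hr s y _ _; have {}h1 : W s y <= W t0 0 - - be * (s - t0) + eta * `|s - t0| + (qR * pos y + qL * pos (- y)).
    apply: h1; first by move: sT T1 r0; lin.
    by move: yX r0; rewrite /X; lin.
  have h2 : - v e s y <= W s y + th / 16 by have := he1 e s y ep ee1 sI yI; rewrite /signed mulN1r.
  have [_ /andP[h3 _]] := hub_bnd (s - t0) d0; have {}h3 := ler_wpM2l (ltW eta0) h3.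
  rewrite mulrBr mulrA ed in h3.
  have h4 : e * w t x <= e * c + pR * pos y - pL * pos (- y).
    have -> : - y = e * - x by rewrite mulrN.
    rewrite /y !pos_scale//; have g := wu t x.
    have {}g : e * w t x <= e * (c + pR * pos x - pL * pos (- x)) by rewrite ler_pM2l.
    by move: g; lin.
  rewrite -(ler_pM2l ep) /rescale mulVKf ?gt_eqF// /V mulrDr /psi mulVKf ?gt_eqF// -/s -/y.
  have yE : pos y + pos (- y) = `|y|.
    have [y0|y0] := leP 0 y; first by rewrite (pos_id y0) pos_le0 ?oppr_le0// addr0 ger0_norm.
    by rewrite (pos_le0 (ltW y0)) pos_id ?oppr_ge0 ?(ltW y0)// add0r ltr0_norm.
  have q1 : dp * pos y <= (- pR - qR) * pos y by rewrite ler_wpM2r// pos_ge0.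
  have q2 : dp * pos (- y) <= (pL - qL) * pos (- y) by rewrite ler_wpM2r// pos_ge0.
  have q3 : dp * pos y + dp * pos (- y) = dp * `|y| by rewrite -mulrDr yE.
  have q4 : th <= eta * `|s - t0| + dp * `|y|.
    have := mulr_ge0 (ltW eta0) (normr_ge0 (s - t0)); have := mulr_ge0 (ltW dp0) (normr_ge0 y).
    by case: bd' => ->; move: th1 th2; lin.
  by move: h1 h2 h3 h4 q1 q2 q3 q4 th0 ec ep; lin.
have TT : e^-1 * (t0 - T) <= e^-1 * t0 <= e^-1 * (t0 + T) by rewrite !ler_pM2l//; move: T0; lin.
have XX : - (e^-1 * X) <= 0 <= e^-1 * X by rewrite oppr_le0 andbb mulr_ge0// ltW.
have MM : 0 <= M + (`|be| + 2 * eta) by rewrite addr_ge0.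
have ta0 : 0 <= e^-1 * (t0 - T) by rewrite mulr_ge0// ltW.
have psi0 : psi (e^-1 * t0) = e^-1 * (th / 4 - W t0 0).
  by rewrite /psi mulVKf ?gt_eqF// subrr (hub0 d0) !mulr0 subrr add0r.
have init x : - (e^-1 * X) <= x <= e^-1 * X -> V (e^-1 * (t0 - T)) x <= rescale e (v e) (e^-1 * (t0 - T)) x.
  move=> xI; apply: key => //; first by have /andP[g1 g2] := TT; rewrite lexx (le_trans g1 g2).
  by left; rewrite mulVKf ?gt_eqF// addrAC subrr add0r normrN gtr0_norm.
have side t : e^-1 * (t0 - T) <= t <= e^-1 * (t0 + T) ->
    V t (e^-1 * X) <= rescale e (v e) t (e^-1 * X) /\ V t (- (e^-1 * X)) <= rescale e (v e) t (- (e^-1 * X)).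
  move=> tI; have Xp : - (e^-1 * X) <= e^-1 * X by have /andP[g1 g2] := XX; exact: le_trans g1 g2.
  split; apply: key => //; rewrite ?lexx ?Xp//; right.
    by rewrite mulVKf ?gt_eqF// gtr0_norm.
  by rewrite mulrN mulVKf ?gt_eqF// normrN gtr0_norm.
have := box_comparison ga (us e ep) ta0 (mulr_gt0 ie X0) lV MM sV init side TT XX.
rewrite {1}/V psi0 {1}/rescale mulVKf ?gt_eqF// mulr0.
rewrite -(ler_pM2l ep) mulrDr !mulVKf ?gt_eqF// => H.
have := wl (e^-1 * t0); rewrite -(ler_pM2l ep) => H2.
by move: H H2 he ec ep th0; lin.
Qed.
End Junction.

(** * The equations satisfied by the relaxed limits *)

Section LimitEquation.
Context {R : realType}.
Implicit Types (h : hamiltonian R) (K : nat) (tau : nat -> R) (A : nat -> nat -> R) (v : R -> R -> R -> R) (W : R -> R -> R).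

Lemma kink_touch W psi psi' pl pr t0 : C1 psi psi' ->
  locmax (fun s y => W s y - psi s - kink pl pr 0 y) t0 0 ->
  touch_r W t0 (- psi' t0) pr /\ touch_r (flip W) t0 (- psi' t0) (- pl).
Proof.
move=> cpsi [r r0 hr].
have k0 : kink pl pr 0 0 = 0 by rewrite /kink subrr (pos_le0 (lexx 0)) !mulr0 subrr.
have kp y : 0 <= y -> kink pl pr 0 y = pr * y.
  by move=> y0; rewrite /kink subr0 sub0r (pos_id y0) pos_le0 ?oppr_le0// mulr0 subr0.
have kn y : 0 <= y -> kink pl pr 0 (- y) = - pl * y.
  by move=> y0; rewrite /kink subr0 sub0r opprK (pos_id y0) pos_le0 ?oppr_le0// mulr0 sub0r mulNr.
split=> eta eta0; have [q q0 hq] := cpsi.2 t0 eta eta0; exists (Num.min r q); rewrite ?lt_min ?r0// => t x;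
  rewrite !lt_min => /andP[t1 t2] x0 /andP[x1 _]; have /ler_normlP[_ h2] := hq t t2.
  have := hr t x t1; rewrite subr0 (ger0_norm x0) => /(_ x1); rewrite k0 kp//.
  by move: h2; lin.
have := hr t (- x) t1; rewrite subr0 normrN (ger0_norm x0) => /(_ x1); rewrite k0 kn// /flip oppr0.
by move: h2; lin.
Qed.

Lemma limit_int h K tau C v sg U L : wf h -> time_grid K tau -> family h K tau C v -> sg = 1 \/ sg = -1 ->
  (forall t x, upper_limit (signed sg v) t x = sg * U t x) ->
  visc_int sg (limit_hamiltonian h L) 0 0 +oo%E U.
Proof.
move=> wh tg fam hsg UE a phi phit phix t x aN cphi [t0 _] [e1 e2] lm.
have sg2 y : sg * (sg * y) = y by case: hsg => ->; ring.
have xn0 : x != 0 /\ (if x < 0 then 0%N else njct h) = (if a == 0%N then 0%N else njct h).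
  case: a aN e1 e2 => [|[|//]] _ e1 e2 /=.
    by have x0 := e2 isT; rewrite x0 (lt_eqF x0).
  by have x0 := e1 isT; rewrite ltNge (ltW x0) (gt_eqF x0).
have lm' : locmax (fun t x => upper_limit (signed sg v) t x - sg * phi t x) t x.
  by case: lm => r r0 hr; exists r => // s y h1 h2; have := hr s y h1 h2; rewrite !UE !mulrBr.
have := relaxed_edge wh tg fam hsg (C1xyZ sg cphi) t0 xn0.1 lm'.
rewrite xn0.2 sg2 mulr0 mulrDr /=; by case: ifP.
Qed.

(** At the critical slopes the equations of both edges give the two monotone parts. If the limiter
    part failed, slopes slightly above the critical ones would still have Hamiltonians at most
    [lam < L], and [junction_level] would yield a sub-corrector at that level. *)
Lemma limit_sub h K tau A C v : grid_adm h K tau A -> family h K tau C v ->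
  visc 1 (limit_hamiltonian h (effective_limiter h K tau)) 0 0 +oo%E (upper_limit (signed 1 v)).
Proof.
move=> ga fam; have [wh tg _] := ga; have [C0 lv bv us] := fam; set L := effective_limiter _ _ _.
have hsg : (1 = 1 :> R) \/ 1 = -1 :> R by left.
have lW := upper_limit_lip (signed_bounded hsg bv) (signed_lip hsg lv) C0.
have lW' : lipon (in_slab 0 +oo%E) C (upper_limit (signed 1 v)) by apply: lipon_sub lW => s [].
apply: (visc_sep_visc (wf_limit L wh) hsg lW'); split.
  exact: (@limit_int h K tau C v 1 _ L wh tg fam hsg (fun t x => esym (mul1r _))).
move=> a psi psi' pl pr t a1 aN cpsi [t0 _] lm; have aE : a = 1%N by apply/eqP; rewrite eqn_leq aN.
have lm' : locmax (fun s y => upper_limit (signed 1 v) s y - psi s - kink pl pr 0 y) t 0.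
  by case: lm => r r0 hr; exists r => // s y h1 h2; have := hr s y h1 h2; rewrite !mul1r.
have [tR tL] := kink_touch cpsi lm'.
have [pR [pRp tR' hR]] := improve_right wh tg fam hsg t0 tR.
have [pL [pLp tL' hL]] := improve_left wh tg fam hsg t0 tL.
rewrite !mul1r in hR hL; set b := - psi' t in tR tL tR' tL' hR hL.
have [_ _ ah] := wh; have aR := ah _ (leqnn _); have aL := ah _ (leq0n _).
rewrite mulr0 mul1r aE -[psi' t]opprK -/b addrC subr_le0 /junction_ham /= !ge_max; apply/and3P; split.
- apply: le_trans hL; apply: le_trans (Hplus_le (- pL) aL); apply: (Hplus_ndec aL).
  by move: pLp; lin.
- apply: le_trans hR; apply: le_trans (Hminus_le pR aR); exact: (Hminus_ninc aR).
rewrite leNgt; apply/negP => bL; pose lam := (b + L) / 2.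
have bl : b < lam by rewrite /lam; move: bL; lin.
have lL : lam < L by rewrite /lam; move: bL; lin.
have lb0 : 0 < lam - b by rewrite subr_gt0.
have [r1 r10 hr1] := goodH_cont aR pR lb0; have [r2 r20 hr2] := goodH_cont aL (- pL) lb0.
have levels : subcorrector_levels h K tau lam.
  apply: (junction_level (pR := pR + r1 / 2) (pL := pL + r2 / 2) (qR := pR + r1 / 4) (qL := pL + r2 / 4) ga fam t0 bl).
  - by apply: tR'; move: r10; lin.
  - by apply: tL'; move: r20; lin.
  - by move: r10; lin.
  - by move: r20; lin.
  - have : `|pR + r1 / 2 - pR| < r1 by rewrite addrAC subrr add0r gtr0_norm; move: r10; lin.
    by move=> /hr1 /ltr_normlP[_]; move: hR; lin.
  - have : `|- (pL + r2 / 2) - - pL| < r2.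
      have -> : - (pL + r2 / 2) - - pL = - (r2 / 2) by ring.
      by rewrite normrN gtr0_norm; move: r20; lin.
    by move=> /hr2 /ltr_normlP[_]; move: hL; lin.
by have := eff_le ga levels; rewrite -/L leNgt lL.
Qed.

Lemma steep_right (H : R -> R) p0 lam P : goodH H p0 -> p0 < P -> lam < H P -> exists p, p < P /\ forall q, p <= q -> lam < H q.
Proof.
move=> gH pP lP; have l0 : 0 < H P - lam by rewrite subr_gt0.
have [r r0 hr] := goodH_cont gH P l0; pose m := Num.min (r / 2) ((P - p0) / 2).
have m0 : 0 < m by rewrite lt_min !divr_gt0// subr_gt0.
have [m1 m2] : m <= r / 2 /\ m <= (P - p0) / 2 by rewrite !ge_min !lexx orbT.
exists (P - m); split; first by move: m0; lin.
move=> q pq; have : `|P - m - P| < r by rewrite addrAC subrr add0r normrN gtr0_norm//; move: m1 r0; lin.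
move=> /hr /ltr_normlP[h1 _].
have p1 : p0 <= P - m by move: m2 pP; lin.
by have := goodH_ndec gH p1 pq; move: h1; lin.
Qed.

Lemma steep_left (H : R -> R) p0 lam P : goodH H p0 -> P < p0 -> lam < H P -> exists p, P < p /\ forall q, q <= p -> lam < H q.
Proof.
move=> gH pP lP; have [|||p [h1 h2]] := @steep_right (fun q => H (- q)) (- p0) lam (- P).
- exact: goodH_refl.
- by rewrite ltrN2.
- by rewrite opprK.
exists (- p); split; first by rewrite ltrNr.
by move=> q qp; have := h2 (- q); rewrite opprK; apply; rewrite lerNr.
Qed.

(** If the inequality failed with time slope [- be], the critical slopes would lie on the outer
    branches, strictly beyond the minimizers, with Hamiltonians at least [be]. A sub-corrector with
    level below [be] then grows strictly less than the solution on both sides, against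
    [junction_contra]. *)
Lemma limit_super h K tau A C v U : grid_adm h K tau A -> family h K tau C v ->
  (forall t x, upper_limit (signed (-1) v) t x = -1 * U t x) ->
  visc (-1) (limit_hamiltonian h (effective_limiter h K tau)) 0 0 +oo%E U.
Proof.
move=> ga fam UE; have [wh tg _] := ga; have [C0 lv bv us] := fam; set L := effective_limiter _ _ _.
have hsg : (-1 = 1 :> R) \/ -1 = -1 :> R by right.
have lW := upper_limit_lip (signed_bounded hsg bv) (signed_lip hsg lv) C0.
have lW' : lipon (in_slab 0 +oo%E) C U.
  move=> s t x y [s0 _] [t0 _]; have := lW s t x y s0 t0; rewrite !UE -mulrBr mulN1r normrN; exact.
apply: (visc_sep_visc (wf_limit L wh) hsg lW'); split; first exact: (@limit_int h K tau C v (-1) U L wh tg fam hsg UE).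
move=> a psi psi' pl pr t a1 aN cpsi [t0 _] lm; have aE : a = 1%N by apply/eqP; rewrite eqn_leq aN.
have lm' : locmax (fun s y => upper_limit (signed (-1) v) s y - -1 * psi s - kink (- pl) (- pr) 0 y) t 0.
  case: lm => r r0 hr; exists r => // s y h1 h2; have := hr s y h1 h2; rewrite !UE /kink /=.
  by lin.
have [tR tL] := kink_touch (C1Z (-1) cpsi) lm'.
have [pR [pRp tR' hR]] := improve_right wh tg fam hsg t0 tR.
have [pL [pLp tL' hL]] := improve_left wh tg fam hsg t0 tL.
rewrite !mulN1r !opprK in pRp tR' hR pLp tL' hL; rewrite mulr0 aE mulN1r oppr_le0 leNgt; apply/negP => lt.
set be := - psi' t; have beE : psi' t = - be by rewrite /be opprK.
rewrite beE in lt tR' tL' hR hL.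
have [_ _ ah] := wh; have aR := ah _ (leqnn _); have aL := ah _ (leq0n _).
move: lt; rewrite addrC subr_lt0 /junction_ham /= !gt_max => /and3P[jL jR jA].
rewrite lerN2 in hR; rewrite lerN2 in hL.
have PR : pmin h (njct h) < - pR.
  rewrite ltNge; apply/negP => hh; have := Hminus_ninc aR (_ : pr <= - pR).
  rewrite lerNr => /(_ pRp); rewrite (Hminus_l _ hh) leNgt.
  by rewrite (lt_le_trans jR hR).
have PL : pL < pmin h 0.
  rewrite ltNge; apply/negP => hh; have := Hplus_ndec aL pLp.
  by rewrite (Hplus_r _ hh) leNgt (lt_le_trans jL hL).
have Le : 0 < be - L by rewrite subr_gt0.
have [lam Hlam laml] := inf_adherent Le (has_inf_levels ga).
have {}laml : lam < be by move: laml; rewrite -/L; lin.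
have [M [w [M0 lw wp cw]]] := level_elim wh Hlam.
have [sR [sR1 sR2]] := steep_right aR PR (lt_le_trans laml hR).
have [sL [sL1 sL2]] := steep_left aL PL (lt_le_trans laml hL).
have [c [c0 wu wl]] := corrector_growth ga M0 lw wp cw sR2 sL2.
apply: (junction_contra (qR := (pR - sR) / 2) (qL := (pL + sL) / 2) ga fam t0 laml M0 lw cw c0 wu wl).
- by apply: tR'; move: sR1; lin.
- by apply: tL'; move: sL1; lin.
- by move: sR1; lin.
- by move: sL1; lin.
Qed.
End LimitEquation.

(** * Uniqueness for the limit problem *)
Section Envelopes.
Context {R : realType}.
Implicit Types (u : R * R -> R) (g phi : R -> R -> R).

(** Local boundedness makes the envelope finite, so that it can be handled as a real function; the
    last clause is its upper semi-continuity. *)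
Lemma env_real (D : set (R * R)) u :
  (forall z, D z -> exists M, \forall y \near z, D y -> `|u y| <= M) -> exists E : R -> R -> R,
  [/\ forall t x, D (t, x) -> usc_env D u (t, x) = (E t x)%:E, forall t x, D (t, x) -> u (t, x) <= E t x,
    forall t x c r, D (t, x) -> 0 < r -> (forall s y, D (s, y) -> `|s - t| < r -> `|y - x| < r -> u (s, y) <= c) -> E t x <= c &
    forall t x e, D (t, x) -> 0 < e -> exists2 r, 0 < r & forall s y, D (s, y) -> `|s - t| < r -> `|y - x| < r -> E s y < E t x + e].
Proof.
move=> bu; exists (fun t x => fine (usc_env D u (t, x))).
have ub t x c r : D (t, x) -> 0 < r -> (forall s y, D (s, y) -> `|s - t| < r -> `|y - x| < r -> u (s, y) <= c) ->
    (usc_env D u (t, x) <= c%:E)%E.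
  move=> Dz r0 hr; rewrite /usc_env limf_esupE; apply: ereal_inf_le.
  exists (ereal_sup ((EFin \o u) @` [set y | D y /\ u y <= c])).
    exists [set y | D y /\ u y <= c] => //; apply/near2P; exists r => // s y h1 h2 Dy; split => //; exact: hr.
  by apply: ge_ereal_sup => _ [y [_ h] <-]; rewrite /= lee_fin.
have lb t x : D (t, x) -> ((u (t, x))%:E <= usc_env D u (t, x))%E.
  move=> Dz; rewrite /usc_env limf_esupE; apply: le_ereal_inf_tmp => _ [V zV <-]; apply: ereal_sup_ubound.
  by exists (t, x) => //; apply: nbhs_singleton zV _.
have fin t x : D (t, x) -> usc_env D u (t, x) \is a fin_num.
  move=> Dz; have [M /near2P [r r0 hr]] := bu _ Dz.
  rewrite fin_numElt (lt_le_trans (ltNyr _) (lb t x Dz)) /=.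
  apply: le_lt_trans (ltry M); apply: (ub t x M r Dz r0) => s y Dy h1 h2.
  exact: le_trans (ler_norm _) (hr s y h1 h2 Dy).
have ub' t x c r : D (t, x) -> 0 < r -> (forall s y, D (s, y) -> `|s - t| < r -> `|y - x| < r -> u (s, y) <= c) ->
    fine (usc_env D u (t, x)) <= c.
  by move=> Dz r0 hr; rewrite -lee_fin fineK ?fin//; exact: ub hr.
split=> //.
- by move=> t x Dz; rewrite fineK// fin.
- by move=> t x Dz; rewrite -lee_fin fineK ?fin// lb.
move=> t x e Dz e0.
have lt : (usc_env D u (t, x) < (fine (usc_env D u (t, x)) + e / 2)%:E)%E.
  by rewrite -[X in (X < _)%E](fineK (fin _ _ Dz)) lte_fin ltrDl divr_gt0.
move: (lt); rewrite {1}/usc_env limf_esupE => /ereal_inf_lt [_ [V zV <-]] supV.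
have /near2P [r r0 hr] : nbhs (t, x) [set y | D y -> V y] by [].
exists (r / 2); first by rewrite divr_gt0.
move=> s y Dy h1 h2; apply: le_lt_trans (_ : fine (usc_env D u (t, x)) + e / 2 < _); last first.
  by rewrite ltrD2l ltr_pdivrMr// ltr_pMr// ltr1n.
apply: (ub' s y _ (r / 2) Dy); first by rewrite divr_gt0.
move=> s' y' Dy' h3 h4; rewrite -lee_fin; apply: le_trans (ltW supV); apply: ereal_sup_ubound.
exists (s', y') => //; apply: hr => //=.
  have := ler_normD (s' - s) (s - t); rewrite addrA subrK; move: h1 h3; lin.
have := ler_normD (y' - y) (y - x); rewrite addrA subrK; move: h2 h4; lin.
Qed.

(** Counterpart of [terminal_touch] for a merely semi-continuous function, which has no Lipschitz
    constant for a linear penalty to beat. The steep term [k * psq] acts after [ts] only and is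
    non-decreasing, so the contact may fall after [ts], but its time slope is still almost bounded
    below by that of [phi]. *)
Lemma usc_terminal g phi phit phix (ts xs r0 eta : R) : C1xy phi phit phix -> 0 < r0 ->
  (forall t x e, `|t - ts| < r0 -> `|x - xs| < r0 -> 0 < e -> exists2 r, 0 < r &
    forall s y, `|s - t| < r -> `|y - x| < r -> g s y < g t x + e) ->
  (forall s y, ts - r0 < s -> s <= ts -> `|y - xs| < r0 -> g s y - phi s y <= g ts xs - phi ts xs) ->
  0 < eta -> exists s y psi psit psix, [/\ `|s - ts| < eta, `|y - xs| < eta, C1xy psi psit psix,
    locmax (fun s y => g s y - psi s y) s y & phit ts xs - eta <= psit s y /\ `|psix s y - phix ts xs| <= eta].
Proof.
move=> cphi r00 usc hm eta0; have [cp ct cx _ _] := cphi.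
have e2 : 0 < eta / 2 by rewrite divr_gt0.
have [r1 r10 h1] := ct ts xs _ e2; have [r2 r20 h2] := cx ts xs _ e2.
have [r [rp [ra [rb [rc rd]]]]] : exists r, 0 < r /\ r < r0 /\ r < r1 /\ r < r2 /\ r <= eta / 4.
  pose m := Num.min (Num.min r0 r1) (Num.min r2 (eta / 4)).
  have m0 : 0 < m by rewrite !lt_min r00 r10 r20 divr_gt0.
  have [m1 [m2 [m3 m4]]] : m <= r0 /\ m <= r1 /\ m <= r2 /\ m <= eta / 4 by rewrite !ge_min !lexx !orbT.
  by exists (m / 2); move: m0 m1 m2 m3 m4; clear => *; do ![split]; lra.
set m := g ts xs - phi ts xs in hm.
pose Phi s y := g s y - phi s y.
have uscP t x e : `|t - ts| < r0 -> `|x - xs| < r0 -> 0 < e -> exists2 q, 0 < q &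
    forall s y, `|s - t| < q -> `|y - x| < q -> Phi s y < Phi t x + e.
  move=> tI xI e0; have e02 : 0 < e / 2 by rewrite divr_gt0.
  have [q1 q10 g1] := usc t x _ tI xI e02; have [q2 q20 g2] := cp t x _ e02.
  exists (Num.min q1 q2); first by rewrite lt_min q10.
  move=> s y; rewrite !lt_min => /andP[s1 s2] /andP[y1 y2].
  have := g1 s y s1 y1; have /ltr_normlP[] := g2 s y s2 y2; rewrite /Phi; lin.
have box t x : ts - r <= t <= ts + r -> xs - r <= x <= xs + r -> `|t - ts| < r0 /\ `|x - xs| < r0.
  by move=> /andP[t1 t2] /andP[x1 x2]; split; apply/ltr_normlP; move: t1 t2 x1 x2 ra; clear => *; split; lra.
have k4 : 0 < r ^+ 2 / 2 by rewrite divr_gt0// exprn_gt0.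
(* Upper semi-continuity, uniform in [y] by compactness: just after [ts] the excess over [m] is at
   most [r ^ 2 / 2], which the quadratic terms beat on the boundary of the box; later times are left
   to [k]. *)
have [|rho rho0 hrho] := @cover2 R ts ts (xs - r) (xs + r) (fun e t y => forall s, `|s - ts| <= e -> Phi s y <= m + r ^+ 2 / 2).
  move=> t x /andP[t1 t2] xI; have tE : t = ts by apply/eqP; rewrite eq_le t1 t2.
  have tsI : ts - r <= ts <= ts + r by move: rp; lin.
  have [b1 b2] := box ts x tsI xI.
  have [q q0 hq] := uscP ts x _ b1 b2 k4; exists q => // s' y e _ yq e0 eq s se.
  apply: ltW; apply: lt_le_trans (hq s y (le_lt_trans se eq) yq) _; rewrite lerD2r.
  apply: hm => //; by move: r00; lin.
pose rh := Num.min (rho / 2) r.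
have rh0 : 0 < rh by rewrite lt_min divr_gt0.
have [rh1 rh2] : rh <= rho / 2 /\ rh <= r by rewrite !ge_min !lexx orbT.
have rr : rh < rho by move: rh1 rho0; lin.
have nearb s y : `|s - ts| <= rh -> xs - r <= y <= xs + r -> Phi s y <= m + r ^+ 2 / 2.
  by move=> s1 yI; apply: (hrho ts y rh _ yI rh0 rr _ s1); rewrite lexx.
have ab : ts - r <= ts + r by move: rp; lin.
have cd : xs - r <= xs + r by move: rp; lin.
have [|tM [xM [tMI xMI hM]]] := @max2 R Phi (ts - r) (ts + r) (xs - r) (xs + r) ab cd.
  move=> t x tI xI e e0; have [b1 b2] := box t x tI xI; have [q q0 hq] := uscP t x e b1 b2 e0.
  by exists q => // s y _ _; exact: hq.
pose k := (`|Phi tM xM - m| + 1) / rh ^+ 2.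
have k0 : 0 < k by rewrite divr_gt0 ?exprn_gt0// ltr_wpDl.
have krh : k * rh ^+ 2 = `|Phi tM xM - m| + 1 by rewrite /k divfK// gt_eqF// exprn_gt0.
have cpsi := C1xyD cphi (C1xyD (C1xyD (C1xy_t (C1_quad 1 ts)) (C1xy_x (C1_quad 1 xs)))
  (C1xy_t (C1Z k (C1_comp C1_psq (C1_aff 1 (- ts)))))).
set psi := (X in C1xy X) in cpsi.
have psiE s y : psi s y = phi s y + ((s - ts) ^+ 2 + (y - xs) ^+ 2 + k * psq (s - ts)).
  by rewrite /psi !mul1r.
have psq0 s : s <= ts -> psq (s - ts) = 0 by move=> ss; rewrite /psq pos_le0 ?subr_le0// expr0n.
have psq_ge s : 0 <= psq (s - ts) by exact: sqr_ge0.
have start : Phi ts xs = m by [].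
have [|t [x [tI xI hmax]]] := @max2 R (fun s y => g s y - psi s y) (ts - r) (ts + r) (xs - r) (xs + r) ab cd.
  move=> t x tI xI e e0; have [b1 b2] := box t x tI xI; have e02 : 0 < e / 2 by rewrite divr_gt0.
  have [q1 q10 g1] := usc t x _ b1 b2 e02; have [cc _ _ _ _] := cpsi; have [q2 q20 g2] := cc t x _ e02.
  exists (Num.min q1 q2); first by rewrite lt_min q10.
  move=> s y _ _; rewrite !lt_min => /andP[s1 s2] /andP[y1 y2].
  have := g1 s y s1 y1; have /ltr_normlP[] := g2 s y s2 y2; lin.
have tsI : ts - r <= ts <= ts + r by move: rp; lin.
have xsI : xs - r <= xs <= xs + r by move: rp; lin.
have val : m <= g t x - psi t x.
  have := hmax ts xs tsI xsI; rewrite psiE (psq0 ts (lexx ts)) !subrr expr0n /= mulr0 !addr0.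
  exact.
have bnd s y : ts - r <= s <= ts + r -> xs - r <= y <= xs + r -> `|s - ts| = r \/ `|y - xs| = r -> g s y - psi s y < m.
  move=> sI yI bd; rewrite psiE.
  have q1 : r ^+ 2 <= (s - ts) ^+ 2 + (y - xs) ^+ 2.
    rewrite -(real_normK (num_real (s - ts))) -(real_normK (num_real (y - xs))).
    by have := sqr_ge0 `|s - ts|; have := sqr_ge0 `|y - xs|; case: bd => ->; lin.
  have k2 := mulr_ge0 (ltW k0) (psq_ge s).
  have [b1 b2] := box s y sI yI.
  have [ss|ss] := leP s ts.
    have := hm s y _ ss b2; have -> : ts - r0 < s by move: b1 => /ltr_normlP[]; lin.
    by move=> /(_ isT); move: q1 k2 k4; lin.
  have [sr|rs] := leP (s - ts) rh.
    have := nearb s y _ yI; rewrite gtr0_norm ?subr_gt0// => /(_ sr); rewrite /Phi.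
    by move: q1 k2 k4; lin.
  have := hM s y sI yI; rewrite {1}/Phi => g1.
  have : k * rh ^+ 2 <= k * psq (s - ts).
    rewrite ler_pM2l// /psq pos_id; last by rewrite subr_ge0 ltW.
    by rewrite ler_pXn2r ?nnegrE ?(ltW rh0) ?(ltW rs)// subr_ge0 ltW.
  rewrite krh => g2; have := ler_norm (Phi tM xM - m); move: g1 g2 q1 k4; lin.
have tr : `|t - ts| < r.
  rewrite lt_neqAle; apply/andP; split; last by apply/ler_normlP; move: tI; clear => *; split; lra.
  by apply/eqP => E; have := bnd t x tI xI (or_introl E); rewrite ltNge val.
have xr : `|x - xs| < r.
  rewrite lt_neqAle; apply/andP; split; last by apply/ler_normlP; move: xI; clear => *; split; lra.
  by apply/eqP => E; have := bnd t x tI xI (or_intror E); rewrite ltNge val.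
exists t, x, psi, (fun s y => phit s y + (2 * 1 * (s - ts) + 0 + k * (2 * pos (1 * s + - ts) * 1))),
  (fun s y => phix s y + (0 + 2 * 1 * (y - xs) + 0)); split; [| |exact: cpsi| |].
- by move: tr rd eta0; lin.
- by move: xr rd eta0; lin.
- exists (Num.min (r - `|t - ts|) (r - `|x - xs|)); first by rewrite lt_min !subr_gt0 tr.
  move=> s y; rewrite !lt_min => /andP[s1 _] /andP[_ y1]; apply: hmax; rewrite -ler_distl.
    by have := ler_normD (s - t) (t - ts); rewrite addrA subrK; move: s1; lin.
  by have := ler_normD (y - x) (x - xs); rewrite addrA subrK; move: y1; lin.
have c1 := h1 t x (lt_trans tr rb) (lt_trans xr rb); have c2 := h2 t x (lt_trans tr rc) (lt_trans xr rc).
split.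
  have := mulr_ge0 (ltW k0) (pos_ge0 (1 * t + - ts)); move: c1 tr => /ltr_normlP[c11 c12] /ltr_normlP[b1 b2].
  by move: c11 c12 b1 b2 rd; lin.
move: c2 xr => /ltr_normlP[c11 c12] /ltr_normlP[b1 b2].
by apply/ler_normlP; move: c11 c12 b1 b2 rd; clear => *; split; lra.
Qed.
End Envelopes.

(** * Lipschitz regularization of semi-continuous sub-solutions *)

Section SubSolutions.
Context {R : realType}.
Implicit Types (h : hamiltonian R) (v U F g : R -> R -> R).

Lemma steep_contra h c w (s y : R) psi psit psix L : wf h -> subpt h 0 w s y -> C1xy psi psit psix ->
  locmax (fun s y => w s y - psi s y) s y -> - c <= psit s y -> L <= `|psix s y| ->
  (forall a q, (a <= njct h)%N -> L <= `|q| -> c < ham h a q /\ (0 <= q -> pmin h a <= q) /\ (q <= 0 -> q <= pmin h a)) ->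
  False.
Proof.
move=> wh [S1 S2] cpsi lm pt px hL; set q := psix s y in px.
have [[a aN ye]|[a [a1 aN yE]]] := in_edge_cases y wh.
  have := S1 a _ _ _ aN cpsi ye lm; have [h1 _] := hL a q aN px.
  by move: pt h1; rewrite /q; lin.
have lm0 : locmax (fun s y' => w s y' - psi s y' - kink 0 0 y y') s y.
  by case: lm => r r0 hr; exists r => // t x h1 h2; rewrite !kink00 !subr0; exact: hr.
have := S2 a _ _ _ 0 0 a1 aN cpsi yE lm0; rewrite !addr0 -/q.
have aN' : (a.-1 <= njct h)%N by apply: leq_trans aN; exact: leq_pred.
have [h1 [h2 h3]] := hL a q aN px; have [g1 [g2 g3]] := hL _ q aN' px.
suff : c < junction_ham h a s q q by move: pt; lin.
rewrite /junction_ham !lt_max; have [q0|q0] := leP 0 q; first by rewrite Hplus_r ?g1// g2.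
by rewrite Hminus_l ?h1 ?orbT// h3// ltW.
Qed.

Lemma fast_contra h c w (s y : R) psi psit psix : wf h -> subpt h 0 w s y -> C1xy psi psit psix ->
  locmax (fun s y => w s y - psi s y) s y -> c < psit s y ->
  (forall a, (a <= njct h)%N -> - c <= ham h a (pmin h a)) -> False.
Proof.
move=> wh [S1 S2] cpsi lm pt hc; have [_ _ ah] := wh.
have [[a aN ye]|[a [a1 aN yE]]] := in_edge_cases y wh.
  have := S1 a _ _ _ aN cpsi ye lm; have := goodH_min (psix s y) (ah a aN); have := hc a aN.
  by move: pt; lin.
have lm0 : locmax (fun s y' => w s y' - psi s y' - kink 0 0 y y') s y.
  by case: lm => r r0 hr; exists r => // t x h1 h2; rewrite !kink00 !subr0; exact: hr.
have := S2 a _ _ _ 0 0 a1 aN cpsi yE lm0; rewrite !addr0 /junction_ham.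
set J := Num.max _ _ => HJ; have : ham h a (pmin h a) <= J.
  by rewrite /J !le_max (Hminus_ge _ (ah a aN)) orbT.
by have := hc a aN; move: pt HJ; lin.
Qed.

(* [g] itself is only upper semi-continuous; its decayed running maximum [F] is a Lipschitz
   sub-solution above it, to which the comparison principle applies. *)
Definition past_max g C F := forall t x, 0 <= t ->
  (exists s, [/\ 0 <= s, s <= t & F t x = g s x - C * (t - s)]) /\
  forall s, 0 <= s -> s <= t -> g s x - C * (t - s) <= F t x.

Definition usc_all g := forall t x e, 0 < e -> exists2 r, 0 < r &
  forall s y, `|s - t| < r -> `|y - x| < r -> g s y < g t x + e.

Lemma past_max_ex g C : usc_all g -> exists F, past_max g C F.
Proof.
move=> gu; have ex (z : R * R) : exists f, 0 <= z.1 -> (exists s, [/\ 0 <= s, s <= z.1 & f = g s z.2 - C * (z.1 - s)]) /\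
    forall s, 0 <= s -> s <= z.1 -> g s z.2 - C * (z.1 - s) <= f.
  case: z => t x /=; have [t0|t0] := leP 0 t; last by exists 0.
  have [|s /andP[s1 s2] hs] := @max1 R (fun s => g s x - C * (t - s)) 0 t t0.
    move=> s _ e e0; have e2 : 0 < e / 2 by rewrite divr_gt0.
    have [r r0 hr] := gu s x _ e2; have c0 : 0 < `|C| + 1 by rewrite ltr_wpDl.
    exists (Num.min r (e / 2 / (`|C| + 1))); first by rewrite lt_min r0 divr_gt0.
    move=> y _; rewrite lt_min ltr_pdivlMr// => /andP[y1 y2].
    have := hr y x y1; rewrite subrr normr0 => /(_ r0) h1.
    have h2 : C * (y - s) <= `|C| * `|y - s| by rewrite -normrM ler_norm.
    by have := normr_ge0 (y - s); move: h1 h2 y2; lin.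
  exists (g s x - C * (t - s)) => _; split; first by exists s.
  by move=> r r1 r2; apply: hs; rewrite r1.
have [f hf] := choice ex; exists (fun t x => f (t, x)) => t x t0; exact: (hf (t, x) t0).
Qed.

Section Regularized.
Context (h : hamiltonian R) (al : nat -> R) (u0 : R -> R) (v g F : R -> R -> R) (L0 C L B T : R).

Definition reg_data := [/\ wf h /\ adm_lim h al 0 +oo%E, [/\ 0 <= L0, 0 <= C, 0 <= B & 0 < L],
  (forall x y, `|u0 x - u0 y| <= L0 * `|x - y|) /\ usc_all g /\ past_max g C F,
  [/\ forall a, (a <= njct h)%N -> (forall p, `|p| <= L0 -> ham h a p <= C) /\ - C <= ham h a (pmin h a),
    forall a, (1 <= a)%N -> (a <= njct h)%N -> al a <= C &
    forall a q, (a <= njct h)%N -> L <= `|q| -> C + 1 < ham h a q /\ (0 <= q -> pmin h a <= q) /\ (q <= 0 -> q <= pmin h a)] &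
  [/\ forall t x, 0 < t -> subpt h 0 g t x, forall x, g 0 x = u0 x & forall t x, 0 <= t -> t <= T -> `|g t x| <= B * (1 + `|x|)]].
End Regularized.

Lemma side_abs (y z : R) : z != y -> exists k : R, `|k| = 1 /\ forall z', `|z' - z| < `|z - y| -> `|z' - y| = k * (z' - y).
Proof.
move=> zy; have [lt|ge] := ltP y z.
  exists 1; rewrite normr1; split => // z'; rewrite (gtr0_norm (x := z - y)) ?subr_gt0// => /ltr_normlP[h1 h2].
  by rewrite mul1r ger0_norm//; move: h1 h2; lin.
have {ge}lt : z < y by rewrite lt_neqAle zy.
exists (-1); rewrite normrN1; split => // z'; rewrite (ltr0_norm (x := z - y)) ?subr_lt0// => /ltr_normlP[h1 h2].
by rewrite mulN1r ler0_norm//; move: h1 h2; lin.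
Qed.

Lemma cont2_usc g phi t x e : usc_all g -> cont2 phi -> 0 < e -> exists2 r, 0 < r &
  forall s y, `|s - t| < r -> `|y - x| < r -> g s y - phi s y < g t x - phi t x + e.
Proof.
move=> gu cp e0; have e2 : 0 < e / 2 by rewrite divr_gt0.
have [r1 r10 h1] := gu t x _ e2; have [r2 r20 h2] := cp t x _ e2.
exists (Num.min r1 r2); first by rewrite lt_min r10.
move=> s y; rewrite !lt_min => /andP[s1 s2] /andP[y1 y2].
by have := h1 s y s1 y1; have /ltr_normlP[] := h2 s y s2 y2; lin.
Qed.

(** If the bound failed, the maximum of [g] minus a cone of slope [L1] with drift [- C] would exceed
    [F t y + C * t]. It is not on the axis of the cone, by definition of [F]; not at time zero, by
    the Lipschitz bound on [u0]; not on the sides, by linear growth. A contact with slope close to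
    [L1] remains, too steep for a sub-solution. *)
Lemma reg_lip_x h al u0 g F L0 C L B T t x y : reg_data h al u0 g F L0 C L B T -> 0 <= t -> t <= T ->
  F t x - F t y <= (L + B + L0 + 2) * `|x - y|.
Proof.
move=> [[wh adm] [L00 C0 B0 Lp] [lu [gu pF]] [hC hal hL] [sg g0 gb]] t0 tT.
set L1 := L + B + L0 + 2; rewrite leNgt; apply/negP => lt.
have L1p : 0 < L1 by rewrite /L1; move: L00 B0 Lp; lin.
pose X := 2 * B * (1 + `|y|) + C * t + `|x - y| + 1.
have y1 : 0 <= 1 + `|y| by rewrite addr_ge0.
have hBy := mulr_ge0 B0 y1; have Ct := mulr_ge0 C0 t0; have nxy := normr_ge0 (x - y).
have X0 : 0 < X by rewrite /X; move: hBy Ct nxy; lin.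
have Fy s : 0 <= s -> s <= t -> g s y + C * s <= F t y + C * t.
  by move=> s0 st; have [_ H] := pF t y t0; have := H s s0 st; lin.
have Fy0 : - (B * (1 + `|y|)) <= F t y + C * t.
  by have := Fy 0 (lexx 0) t0; have := gb 0 y (lexx 0) (le_trans t0 tT) => /ler_normlP[]; lin.
have [[s0 [s00 s0t s0E]] _] := pF t x t0.
pose phi0 (s z : R) := L1 * `|z - y| - C * s.
have cphi0 : cont2 phi0.
  apply: cont2D.
    apply: cont2_x; apply: (@cont1_lip _ _ L1) => a b; rewrite -mulrBr normrM (gtr0_norm L1p) ler_pM2l//.
    by apply: le_trans (ler_dist_dist _ _) _; rewrite opprB addrA subrK.
  by apply: cont2_t; apply: (@cont1_lip _ _ C) => a b; rewrite -opprD normrN -mulrBr normrM (ger0_norm C0).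
have cd : y - X <= y + X by move: X0; lin.
have [|s1 [z1 [s1I z1I hm]]] := @max2 R (fun s z => g s z - phi0 s z) 0 t (y - X) (y + X) t0 cd.
  by move=> s z _ _ e e0; have [r r0 hr] := cont2_usc s z gu cphi0 e0; exists r => // s' y' _ _; exact: hr.
have val : F t y + C * t < g s1 z1 - phi0 s1 z1.
  have xI : y - X <= x <= y + X.
    have /ler_normlP[h1 h2] : `|x - y| <= X by rewrite /X; move: hBy Ct; lin.
    by move: h1 h2; lin.
  have := hm s0 x; rewrite s00 s0t => /(_ isT xI); rewrite {1}/phi0; move: lt; rewrite s0E; lin.
have /andP[s10 s1t] := s1I; have Cs1 := mulr_ge0 C0 s10.
have Cs1t : C * s1 <= C * t by rewrite ler_wpM2l.
have zy : z1 != y.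
  apply/eqP => E; move: val; rewrite /phi0 E subrr normr0 mulr0; have := Fy s1 s10 s1t; lin.
have gz : g s1 z1 <= B * (1 + `|y|) + B * `|z1 - y|.
  have /ler_normlP[_ gb1] := gb s1 z1 s10 (le_trans s1t tT); apply: le_trans gb1 _; rewrite -mulrDr ler_wpM2l//.
  by rewrite -addrA lerD2l -{1}(subrK y z1) addrC ler_normD.
have nz := normr_ge0 (z1 - y).
have zX : `|z1 - y| < X.
  rewrite ltNge; apply/negP => zX.
  have h2 : X <= (L1 - B) * `|z1 - y|.
    apply: le_trans zX _; rewrite ler_peMl// /L1; move: Lp L00; lin.
  move: val gz Fy0 h2 Cs1t hBy nxy; rewrite /phi0 /X; lin.
have s1p : 0 < s1.
  rewrite lt_neqAle s10 andbT; apply/negP => /eqP E; move: val; rewrite /phi0 -E g0 => v1.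
  have /ler_normlP[_ h1] := lu z1 y; have := Fy 0 (lexx 0) t0; rewrite g0 => h2.
  have h3 : 0 <= (L1 - L0) * `|z1 - y| by rewrite mulr_ge0// /L1; move: Lp B0; lin.
  by move: v1 h1 h2 h3; lin.
have rho0 : 0 < `|z1 - y| by rewrite normr_gt0 subr_eq0.
have [k [k1 hk]] := side_abs zy.
pose r0 := Num.min (Num.min `|z1 - y| (X - `|z1 - y|)) s1.
have r00 : 0 < r0 by rewrite !lt_min rho0 s1p subr_gt0 zX.
have [ra [rb rc]] : r0 <= `|z1 - y| /\ r0 <= X - `|z1 - y| /\ r0 <= s1 by rewrite !ge_min !lexx !orbT.
have cphi := C1xyD (C1xy_x (C1_aff (L1 * k) (- (L1 * k * y)))) (C1xy_t (C1_aff (- C) 0)).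
pose eta := Num.min 1 s1; have eta0 : 0 < eta by rewrite lt_min ltr01.
have [ea eb] : eta <= 1 /\ eta <= s1 by rewrite !ge_min !lexx orbT.
have near_z z' : `|z' - z1| < r0 -> y - X <= z' <= y + X /\ `|z' - y| = k * (z' - y).
  move=> zr; split; last by apply: hk; exact: lt_le_trans zr ra.
  have : `|z' - y| <= X.
    have := ler_normD (z' - z1) (z1 - y); rewrite addrA subrK; move: zr rb; lin.
  by move=> /ler_normlP[]; lin.
have z1z1 : `|z1 - z1| < r0 by rewrite subrr normr0.
have [|||s [z [psi [psit [psix [d1 d2 cpsi lm [d3 d4]]]]]]] := usc_terminal (g := g) (ts := s1) (xs := z1) (eta := eta) cphi r00.
- by move=> t' x' e _ _ e0; exact: gu.
- move=> s z ls sl zz; have [zI zE] := near_z z zz; have [_ z1E] := near_z z1 z1z1.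
  have sI : 0 <= s <= t by apply/andP; split; [move: ls rc; lin|exact: le_trans sl s1t].
  by have := hm s z sI zI; rewrite /phi0 zE z1E; lin.
- exact: eta0.
have sp : 0 < s by have /ltr_normlP[h1 h2] := d1; move: h1 h2 eb; lin.
apply: (steep_contra (c := C + 1) wh (sg s z sp) cpsi lm _ _ hL); first by move: d3 ea; lin.
have n1 : `|L1 * k + 0| = L1 by rewrite addr0 normrM k1 mulr1 gtr0_norm.
have := ler_normD (psix s z) (L1 * k + 0 - psix s z); rewrite addrC subrK n1 [X in _ + X]distrC => h1.
by move: h1 d4 ea B0 L00; rewrite /L1; lin.
Qed.

(** [F t x] is realized either at a positive time, by a time translate of [g] minus a constant,
    admissible as the limiters do not depend on time, or at time zero, by the barrier
    [u0 - C * t]. *)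
Lemma reg_visc h al u0 g F L0 C L B T t x : reg_data h al u0 g F L0 C L B T -> 0 < t -> subpt h 0 F t x.
Proof.
move=> [[wh adm] [L00 C0 B0 Lp] [lu [gu pF]] [hC hal hL] [sg g0 gb]] t0.
have [[s0 [s00 s0t s0E]] pFt] := pF t x (ltW t0).
have [s0p|s0n] := ltP 0 s0.
  have ts0 : t + (s0 - t) = s0 by ring.
  pose V t' y := g (t' + (s0 - t)) y + - C * (t - s0).
  apply: (@subpt_touch _ _ _ _ V).
  - exists s0 => // s y /ltr_normlP[h1 _] _; rewrite /V.
    have h2 : 0 <= s + (s0 - t) by move: h1; lin.
    have h3 : s + (s0 - t) <= s by move: s0t; lin.
    by have [_ H] := pF s y (le_trans h2 h3); have := H _ h2 h3; lin.
  - by rewrite /V ts0 s0E mulNr.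
  have -> : (0 : R) = 0 + 0 by rewrite addr0.
  apply: (subpt_tilt (C1_cst (- C * (t - s0))) (lexx 0) (U := fun s y => g (s + (s0 - t)) y)) => //.
  apply: subpt_shift; last by apply: sg; rewrite ts0.
  move=> a a1 aN; have [la _] := adm; rewrite !la//; split; rewrite ?ltry//.
  by rewrite ts0.
have s0z : s0 = 0 by apply/eqP; rewrite eq_le s0n.
apply: (@subpt_touch _ _ _ _ (fun t x => u0 x - C * t)).
- exists t => // s y /ltr_normlP[h1 _] _; have s1 : 0 <= s by move: h1; lin.
  by have [_ H] := pF s y s1; have := H 0 (lexx 0) s1; rewrite g0 subr0.
- by rewrite s0E s0z g0 subr0.
have /visc_subpt H := barrier_sub wh adm lu L00 (fun a aN => (hC a aN).1) hal.
by apply: H; split => //; rewrite ltry.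
Qed.

(** The drift built into [F] bounds its decrease. A faster increase would come from a rise of [g]
    after [t1], and a contact of [g] with time slope close to [C + 2] contradicts [fast_contra]. *)
Lemma reg_lip_t h al u0 g F L0 C L B T t1 t2 x : reg_data h al u0 g F L0 C L B T -> 0 <= t1 -> t1 <= t2 -> t2 <= T ->
  `|F t1 x - F t2 x| <= (C + 2) * (t2 - t1).
Proof.
move=> rd t10 t12 t2T; have [[wh adm] [L00 C0 B0 Lp] [lu [gu pF]] [hC hal hL] [sg g0 gb]] := rd.
have t20 := le_trans t10 t12; have d0 : 0 <= t2 - t1 by rewrite subr_ge0.
have low : F t1 x - C * (t2 - t1) <= F t2 x.
  have [[s [s0 st ->]] _] := pF t1 x t10; have [_ H] := pF t2 x t20.
  by have := H s s0 (le_trans st t12); lin.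
have Cd := mulr_ge0 C0 d0.
suff up : F t2 x <= F t1 x + (C + 2) * (t2 - t1).
  by apply/ler_normlP; move: low up Cd d0; clear => *; split; lra.
rewrite leNgt; apply/negP => lt; set M := C + 2 in lt.
have [[s0 [s00 s0t s0E]] _] := pF t2 x t20; have [_ Ft1] := pF t1 x t10.
have [st|ts] := leP s0 t1.
  by have := Ft1 s0 s00 st; move: lt Cd d0; rewrite s0E /M; lin.
have s0T := le_trans s0t t2T; have t1T := le_trans t12 t2T.
have M0 : 0 < M by rewrite /M; move: C0; lin.
have C2 : 0 <= C * (t2 - s0) by rewrite mulr_ge0// subr_ge0.
pose e0 := g s0 x - F t1 x - M * (s0 - t1).
have e00 : 0 < e0.
  have : 0 <= M * (t2 - s0) by rewrite mulr_ge0 ?(ltW M0)// subr_ge0.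
  by move: lt C2; rewrite s0E /e0; lin.
set L1 := L + B + L0 + 2.
have x2 : 0 <= 2 + `|x| by rewrite addr_ge0.
have Bx := mulr_ge0 B0 x2; have q0 : 0 <= L1 ^+ 2 / e0 by rewrite divr_ge0 ?sqr_ge0// ltW.
have qe : L1 ^+ 2 / e0 * e0 = L1 ^+ 2 by rewrite divfK// gt_eqF.
(* At time [t1], [g] exceeds [F t1 x] by at most [L1 * |z - x|]; by completing the square, [q] keeps
   this minus the quadratic term below [e0]. The rest of [n] handles [|z - x| = 1]. *)
set q := L1 ^+ 2 / e0 in q0 qe; pose n := q + 2 * (B * (2 + `|x|)) + 1.
have cphi := C1xyD (C1xy_t (C1_aff M 0)) (C1xy_x (C1_quad n x)).
have [cp _ _ _ _] := cphi; set phi := (X in cont2 X) in cp.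
have cd : x - 1 <= x + 1 by lin.
have [|s1 [z1 [s1I z1I hm]]] := @max2 R (fun s z => g s z - phi s z) t1 s0 (x - 1) (x + 1) (ltW ts) cd.
  by move=> s z _ _ e ep; have [r r0 hr] := cont2_usc s z gu cp ep; exists r => // s' y' _ _; exact: hr.
have /andP[s11 s12] := s1I; have s10 := le_trans t10 s11.
have val : F t1 x - M * t1 + e0 <= g s1 z1 - phi s1 z1.
  have := hm s0 x; rewrite lexx (ltW ts) => /(_ isT).
  have -> : x - 1 <= x <= x + 1 by lin.
  by move=> /(_ isT); rewrite {1}/phi subrr /e0 expr0n mulr0 /=; lin.
have z1n : `|z1 - x| <= 1 by apply/ler_normlP; move/andP: z1I => [h1 h2]; move: h1 h2; clear => *; split; lra.
have z1lt : `|z1 - x| < 1.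
  rewrite lt_neqAle z1n andbT; apply/negP => /eqP E.
  have E2 : (z1 - x) ^+ 2 = 1 by rewrite -(real_normK (num_real _)) E expr1n.
  have h1 : g s1 z1 <= B * (2 + `|x|).
    have /ler_normlP[_ gb1] := gb s1 z1 s10 (le_trans s12 s0T); apply: le_trans gb1 _; rewrite ler_wpM2l//.
    by have := ler_normD (z1 - x) x; rewrite subrK E; lin.
  have h2 : - (B * (2 + `|x|)) <= F t1 x.
    have := Ft1 t1 t10 (lexx _); rewrite subrr mulr0 subr0; have /ler_normlP[gb2 _] := gb t1 x t10 t1T.
    have : B * (1 + `|x|) <= B * (2 + `|x|) by rewrite ler_wpM2l// lerD2r ler1n.
    by move: gb2; lin.
  have h3 : 0 <= M * (s1 - t1) by rewrite mulr_ge0 ?(ltW M0)// subr_ge0.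
  by move: val h1 h2 h3 e00 q0; rewrite /phi E2 /n; lin.
have s1t : t1 < s1.
  rewrite lt_neqAle s11 andbT; apply/negP => /eqP E.
  have h1 : g s1 z1 <= F t1 x + L1 * `|z1 - x|.
    have [_ H] := pF t1 z1 t10; have := H t1 t10 (lexx _); rewrite subrr mulr0 subr0 -E.
    by have := reg_lip_x z1 x rd t10 t1T; rewrite -/L1; lin.
  have E2 : (z1 - x) ^+ 2 = `|z1 - x| ^+ 2 by rewrite real_normK// num_real.
  set d := `|z1 - x| in h1 E2.
  have h2 : e0 <= L1 * d - n * d ^+ 2.
    by move: val h1; rewrite /phi E2 -E; lin.
  have h3 : q * d ^+ 2 <= n * d ^+ 2 by rewrite ler_wpM2r ?sqr_ge0// /n; move: Bx; lin.
  have h4 : e0 + q * d ^+ 2 <= L1 * d by move: h2 h3; lin.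
  have : e0 * (e0 + q * d ^+ 2) <= e0 * (L1 * d) by rewrite ler_pM2l.
  have -> : e0 * (e0 + q * d ^+ 2) = e0 ^+ 2 + (q * e0) * d ^+ 2 by ring.
  rewrite qe; have := sqr_ge0 (e0 - L1 * d); have : 0 < e0 ^+ 2 by rewrite exprn_gt0.
  have := sqr_ge0 (L1 * d); clear; nra.
have s1p : 0 < s1 by apply: le_lt_trans s1t.
pose r0 := Num.min (s1 - t1) (1 - `|z1 - x|).
have r00 : 0 < r0 by rewrite lt_min !subr_gt0 s1t.
have [ra rb] : r0 <= s1 - t1 /\ r0 <= 1 - `|z1 - x| by rewrite !ge_min !lexx orbT.
pose eta := Num.min (1/2) s1; have eta0 : 0 < eta by rewrite lt_min divr_gt0.
have [ea eb] : eta <= 1/2 /\ eta <= s1 by rewrite !ge_min !lexx orbT.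
have [|||s [z [psi [psit [psix [e1 e2 cpsi lm [d3 d4]]]]]]] := usc_terminal (g := g) (ts := s1) (xs := z1) (eta := eta) cphi r00.
- by move=> t' x' e _ _ ep; exact: gu.
- move=> s z ls sl zz; apply: hm.
    by apply/andP; split; [move: ls ra; lin|exact: le_trans sl s12].
  have : `|z - x| <= 1.
    have := ler_normD (z - z1) (z1 - x); rewrite addrA subrK; move: zz rb; lin.
  by move=> /ler_normlP[]; lin.
- exact: eta0.
have sp : 0 < s by have /ltr_normlP[h1 h2] := e1; move: h1 h2 eb; lin.
apply: (fast_contra (c := C) wh (sg s z sp) cpsi lm _ (fun a aN => (hC a aN).2)).
by move: d3 ea; rewrite /M; lin.
Qed.

(** Up to time zero [E] is replaced by [u0], which preserves semi-continuity since [E 0 <= u0];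
    [past_max] then provides a Lipschitz sub-solution above [E], to which [comparison] applies. *)
Lemma usc_sub_le h al u0 E U L0 M : wf h -> adm_lim h al 0 +oo%E -> 0 <= L0 ->
  (forall x y, `|u0 x - u0 y| <= L0 * `|x - y|) ->
  (forall t x, 0 < t -> subpt h 0 E t x) ->
  (forall t x e, 0 <= t -> 0 < e -> exists2 r, 0 < r & forall s y, 0 <= s -> `|s - t| < r -> `|y - x| < r -> E s y < E t x + e) ->
  (forall x, E 0 x <= u0 x) -> (forall T, exists C, forall t x, 0 <= t -> t <= T -> `|E t x| <= C * (1 + `|x|)) ->
  lipon (fun s => 0 <= s) M U -> visc (-1) h 0 0 +oo%E U -> (forall x, u0 x <= U 0 x) ->
  forall t x, 0 <= t -> E t x <= U t x.
Proof.
move=> wh adm L00 lu sE uE E0 gE lU vU U0 t x t0.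
pose g s y := if s <= 0 then u0 y else E s y.
have g0 y : g 0 y = u0 y by rewrite /g lexx.
have gp s y : 0 < s -> g s y = E s y by rewrite /g leNgt => ->.
have gge s y : 0 <= s -> E s y <= g s y.
  by rewrite le_eqVlt => /orP[/eqP <-|s0]; rewrite ?g0// gp.
have cu (y e : R) : 0 < e -> exists2 r, 0 < r & forall z, `|z - y| < r -> u0 z < u0 y + e.
  move=> e0; have k0 : 0 < L0 + 1 by move: L00; lin.
  exists (e / (L0 + 1)); first by rewrite divr_gt0.
  move=> z; rewrite ltr_pdivlMr// => h1; have /ler_normlP[_] := lu z y; have := normr_ge0 (z - y).
  by move: h1; lin.
have gu : usc_all g.
  move=> s y e e0; have [r1 r10 h1] := cu y e e0.
  have [s0|s0|sz] := ltgtP (s : R) 0.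
  - exists (Num.min r1 (- s)); first by rewrite lt_min r10 oppr_gt0.
    move=> s' y'; rewrite !lt_min => /andP[_ /ltr_normlP[_ a2]] /andP[b1 _].
    by rewrite /g (ltW s0) ifT ?h1//; move: a2; lin.
  - have [r2 r20 h2] := uE s y e (ltW s0) e0.
    exists (Num.min r2 s); first by rewrite lt_min r20.
    move=> s' y'; rewrite !lt_min => /andP[a1 /ltr_normlP[a2 _]] /andP[b1 _].
    have s'p : 0 < s' by move: a2; lin.
    by rewrite !gp// h2// ltW.
  rewrite sz; have [r2 r20 h2] := uE 0 y e (lexx 0) e0.
  exists (Num.min r1 r2); first by rewrite lt_min r10.
  move=> s' y'; rewrite !lt_min => /andP[a1 a2] /andP[b1 b2]; rewrite g0 /g; case: (leP s' 0) => s'0; first exact: h1.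
  by apply: lt_le_trans (h2 s' y' (ltW s'0) a2 b2) _; rewrite lerD2r.
have sg s y : 0 < s -> subpt h 0 g s y.
  move=> s0; apply: (@subpt_touch _ _ _ _ E); last exact: sE.
    by exists s => // s' y' /ltr_normlP[a1 _] _; apply: gge; move: a1; lin.
  by rewrite gp.
have [C1 C10 hC1] := wf_bounds L0 wh; have [C2 C20 hC2] := finite_bound al (njct h).
pose C := C1 + C2; have [L Lp hL] := steep_bound (C + 1) wh.
have C0 : 0 <= C by rewrite addr_ge0.
pose T := t + 1; have [B1 hB1] := gE T.
pose B := `|B1| + `|u0 0| + L0.
have n1 := normr_ge0 B1; have n2 := normr_ge0 (u0 0).
have B0 : 0 <= B by rewrite /B; move: n1 n2 L00; lin.
have [F pF] := past_max_ex C gu.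
have rd : reg_data h al u0 g F L0 C L B T.
  split => //.
    split => [a aN|a a1 aN|//].
      have [h1 h2] := hC1 a aN; split => [p pL|]; rewrite /C; first by have := h1 p pL; move: C20; lin.
      by move: h2 C20; lin.
    by have := hC2 a aN; rewrite /C; move: C10; lin.
  split => // s y s0 sT; have y0 := normr_ge0 y.
  have y1 : 0 <= 1 + `|y| by move: y0; lin.
  rewrite /g; case: (leP s 0) => sp.
    have := ler_normD (u0 y - u0 0) (u0 0); rewrite subrK; have := lu y 0; rewrite subr0.
    have := mulr_ge0 n1 y1; have := mulr_ge0 n2 y0; rewrite /B; move: L00; lin.
  apply: le_trans (hB1 s y s0 sT) _; rewrite ler_wpM2r//.
  by have := ler_norm B1; rewrite /B; move: n2 L00; lin.
have L10 : 0 <= L + B + L0 + 2 by move: Lp B0 L00; lin.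
have lF : lipon (in_slab 0 T%:E) (C + 2 + (L + B + L0 + 2)) F.
  move=> s r y z [s0 sT] [r0 rT]; rewrite lte_fin in sT; rewrite lte_fin in rT.
  have ht : `|F s y - F r y| <= (C + 2) * `|s - r|.
    have [sr|rs] := leP s r.
      by rewrite (ler0_norm (x := s - r)) ?subr_le0// opprB; exact: reg_lip_t y rd s0 sr (ltW rT).
    by rewrite (gtr0_norm (x := s - r)) ?subr_gt0// distrC; exact: reg_lip_t y rd r0 (ltW rs) (ltW sT).
  have hx : `|F r y - F r z| <= (L + B + L0 + 2) * `|y - z|.
    apply/ler_normlP; have := reg_lip_x y z rd r0 (ltW rT); have := reg_lip_x z y rd r0 (ltW rT).
    by rewrite [`|z - y|]distrC; clear => *; split; lra.
  have := ler_normD (F s y - F r y) (F r y - F r z); rewrite addrA subrK.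
  have := mulr_ge0 L10 (normr_ge0 (s - r)).
  have c2 : 0 <= C + 2 by move: C0; lin.
  by have := mulr_ge0 c2 (normr_ge0 (y - z)); move: ht hx; lin.
have tT : in_slab 0 T%:E t by split => //; rewrite lte_fin /T ltrDl.
have admT : adm_lim h al 0 T%:E.
  by case: adm => la lm; split => // a s a1 aN [s0 _]; apply: la => //; split => //; rewrite ltry.
have vF : visc 1 h 0 0 T%:E F by apply/visc_subpt => s y [s0 _]; exact: reg_visc rd s0.
have vU' : visc (-1) h 0 0 T%:E U.
  by apply: visc_time_sub vU => s [s0 _]; split => //; rewrite ltry.
have lU' : lipon (in_slab 0 T%:E) M U by apply: lipon_sub lU => s [].
apply: le_trans (gge t x t0) _; apply: (@le_trans _ _ (F t x)).
  by have [_ H] := pF t x t0; have := H t t0 (lexx t); rewrite subrr mulr0 subr0.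
apply: (comparison wh admT lF vF vU' (lipon_lsc lU')) tT => [T' [T'0 T'T]|y].
  exists (`|U 0 0| + `|M| * (T' + 1)) => s y /andP[s0 sT'].
  have := ler_norm (U 0 0 - U s y); have := lU 0 s 0 y (lexx 0) s0; rewrite !sub0r !normrN (ger0_norm s0) => h1 h2.
  have k0 : 0 <= s + `|y| by rewrite addr_ge0.
  have h3 : M * (s + `|y|) <= `|M| * (s + `|y|) by rewrite ler_wpM2r// ler_norm.
  have h4 : s + `|y| <= (T' + 1) * (1 + `|y|).
    by have y0 := normr_ge0 y; have := mulr_ge0 T'0 y0; move: sT' y0; lin.
  have h5 := ler_wpM2l (normr_ge0 M) h4.
  have h6 := ler_norm (- U 0 0); rewrite normrN in h6.
  have h7 := mulr_ge0 (normr_ge0 (U 0 0)) (normr_ge0 y).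
  by move: h1 h2 h3 h5 h6 h7; lin.
have [[s [s0 sn ->]] _] := pF 0 y (lexx 0).
have -> : s = 0 by apply/eqP; rewrite eq_le sn.
by rewrite g0 subrr mulr0 subr0.
Qed.
End SubSolutions.

(** * Homogenization *)
Section Homogenization.
Context {R : realType}.
Implicit Types (h : hamiltonian R) (U E : R -> R -> R) (v : R -> R -> R -> R).

Lemma mean_ge K tau (A : nat -> R) f c : time_grid K tau -> step_on K tau A f ->
  (forall i, (i <= K)%N -> c <= A i) -> c <= mean f.
Proof.
move=> tg st hA; rewrite (mean_step tg st) -[c]mulr1 -(grid_sum1 tg) mulr_sumr; have [_ _ lt] := tg.
apply: ler_sum => i _; have iK : (i <= K)%N by rewrite -ltnS.
by rewrite ler_wpM2r ?hA// subr_ge0 ltW// lt.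
Qed.

Lemma limit_adm h K tau A : grid_adm h K tau A -> let L := effective_limiter h K tau in
  adm_lim (limit_hamiltonian h L) (fun=> L) 0 +oo%E.
Proof.
move=> ga L; have [[N1 _ _] tg _] := ga; split => // a a1 aN.
have -> : a = 1%N by apply/eqP; rewrite eqn_leq a1 aN.
split => /=; [have := mean_le_eff ga (leqnn 1) N1 | have := mean_le_eff ga N1 (leqnn _)]; apply: le_trans.
  by apply: (mean_ge tg (grid_adm_step ga (leqnn 1) N1)) => i iK; have [] := grid_adm_ge ga (leqnn 1) N1 iK.
by apply: (mean_ge tg (grid_adm_step ga N1 (leqnn _))) => i iK; have [] := grid_adm_ge ga N1 (leqnn _) iK.
Qed.

Lemma visc_eq (sg : R) h lam T0 T1 U E : (forall t x, T0 < t -> U t x = E t x) ->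
  visc sg h lam T0 T1 U -> visc sg h lam T0 T1 E.
Proof.
move=> UE [v1 v2].
have key (F : R -> R -> R) t x : T0 < t -> locmax (fun s y => sg * (E s y - F s y)) t x ->
    locmax (fun s y => sg * (U s y - F s y)) t x.
  move=> t0; have d0 : 0 < t - T0 by rewrite subr_gt0.
  apply: (locmax_ext d0); last by rewrite UE.
  by move=> s y /ltr_normlP[s1 _] _; rewrite UE//; move: s1; lin.
split=> [a phi phit phix t x aN cphi tT xe lm|a phi phit phix pl pr t a1 aN cphi tT lm].
  by apply: (v1 a _ _ _ _ _ aN cphi tT xe); apply: key => //; case: tT.
apply: (v2 a _ _ _ _ _ _ a1 aN cphi tT).
have [r r0 hr] : locmax (fun s y => sg * (U s y - (phi s y + kink pl pr (jpoint h a) y))) t (jpoint h a).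
  apply: key; first by case: tT.
  by case: lm => r r0 hr; exists r => // s y h1 h2; have := hr s y h1 h2; rewrite !opprD !addrA.
by exists r => // s y h1 h2; have := hr s y h1 h2; rewrite !opprD !addrA.
Qed.

Lemma growth_env (u : R * R -> R) : linear_growth u -> exists E : R -> R -> R,
  [/\ forall t x, 0 <= t -> usc_env (slab 0 +oo%E) u (t, x) = (E t x)%:E, forall t x, 0 <= t -> u (t, x) <= E t x,
    forall T, exists C, forall t x, 0 <= t -> t <= T -> `|E t x| <= C * (1 + `|x|) &
    forall t x e, 0 <= t -> 0 < e -> exists2 r, 0 < r & forall s y, 0 <= s -> `|s - t| < r -> `|y - x| < r -> E s y < E t x + e].
Proof.
move=> gu; have D0 (t x : R) : 0 <= t -> slab 0 +oo%E (t, x) by move=> t0; split; rewrite //= ltry.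
have gb T : exists C : R, forall s y : R, 0 <= s -> s <= T -> `|u (s, y)| <= `|C| * (1 + `|y|).
  have [C hC] := gu T; exists C => s y s0 st.
  by apply: le_trans (hC s y _) _; rewrite ?s0// ler_wpM2r ?ler_norm// addr_ge0.
have [|E [E1 E2 E3 E4]] := @env_real R (slab 0 +oo%E) u.
  move=> [t x] [/= t0 _]; have [C hC] := gb (t + 1); exists (`|C| * (2 + `|x|)); apply/near2P; exists 1 => // s y s1 y1 [/= s0 _].
  have st : s <= t + 1 by move: s1 => /ltr_normlP[_]; lin.
  apply: le_trans (hC s y s0 st) _; rewrite ler_wpM2l//.
  by have := ler_normD (y - x) x; rewrite subrK; move: y1; lin.
exists E; split.
- by move=> t x t0; rewrite E1//; exact: D0.
- by move=> t x t0; apply: E2; exact: D0.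
- move=> T; have [C hC'] := gb (T + 1); exists (2 * `|C|) => t x t0 tT.
  have c0 := normr_ge0 C; have x0 := normr_ge0 x; have cx := mulr_ge0 c0 x0.
  apply/ler_normlP; split.
    have tT1 : t <= T + 1 by move: tT; lin.
    have /ler_normlP[h1 _] := hC' t x t0 tT1; have := E2 t x (D0 t x t0).
    by move: h1 cx c0; lin.
  apply: (E3 t x _ 1 (D0 t x t0)) => // s y [/= s0 _] s1 y1.
  have sT : s <= T + 1 by move: s1 tT => /ltr_normlP[_]; lin.
  have /ler_normlP[_ h1] := hC' s y s0 sT; apply: le_trans h1 _.
  have : `|C| * (1 + `|y|) <= `|C| * (2 + `|x|).
    by rewrite ler_wpM2l//; have := ler_normD (y - x) x; rewrite subrK; move: y1; lin.
  by move: cx; lin.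
move=> t x e t0 e0; have [r r0 hr] := E4 t x e (D0 t x t0) e0; exists r => // s y s0; apply: hr; exact: D0.
Qed.

(** The two halves are not symmetric: the upper envelope of the competitor needs the regularization
    of [usc_sub_le], while its lower envelope, semi-continuous with linear growth, enters
    [comparison] directly. *)
Lemma visc_unique h al (u0 : R -> R) U M (w : R * R -> R) : wf h -> adm_lim h al 0 +oo%E -> 0 <= M ->
  lipon (fun s => 0 <= s) M U -> visc 1 h 0 0 +oo%E U -> visc (-1) h 0 0 +oo%E U -> (forall x, U 0 x = u0 x) ->
  cauchy_solution h 0 +oo%E u0 w -> linear_growth w -> forall t x, 0 <= t -> w (t, x) = U t x.
Proof.
move=> wh adm M0 lU sU vU U0 [w1 w2 w3 w4] gw t x t0.
have lu x' y : `|u0 x' - u0 y| <= M * `|x' - y|.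
  by rewrite -!U0; have := lU 0 0 x' y (lexx 0) (lexx 0); rewrite subrr normr0 add0r.
apply/eqP; rewrite eq_le; apply/andP; split.
  have [E [E1 E2 E3 E4]] := growth_env gw.
  have sE : visc 1 h 0 0 +oo%E E.
    apply: (visc_of_def wh _ ((is_visc_sub _ _ _ _ _).1 w1)) => s y [s0 _]; exact/E1/ltW.
  apply: le_trans (E2 t x t0) _; apply: (usc_sub_le wh adm M0 lu _ E4 _ E3 lU vU _ x t0).
  - by move=> s y s0; apply: ((visc_subpt _ _ _ _ _).1 sE); split; rewrite ?ltry.
  - by move=> y; rewrite -lee_fin -E1.
  - by move=> y; rewrite U0.
have gnw : linear_growth (fun z => - w z).
  by move=> T; have [C hC] := gw T; exists C => s y st; rewrite normrN; exact: hC.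
have [E [E1 E2 E3 E4]] := growth_env gnw.
have le s y : 0 <= s -> lsc_env (slab 0 +oo%E) w (s, y) = (- E s y)%:E.
  by move=> s0; rewrite lsc_usc_env E1.
have vE : visc (-1) h 0 0 +oo%E (fun s y => - E s y).
  by apply: (visc_of_def wh _ ((is_visc_super _ _ _ _ _).1 w2)) => s y [s0 _]; exact/le/ltW.
have := E2 t x t0; rewrite lerNl; apply: le_trans.
have lU' : lipon (in_slab 0 +oo%E) M U by apply: lipon_sub lU => s [].
apply: (comparison wh adm lU' sU vE).
- move=> s y e [s0 _] e0; have [r r0 hr] := E4 s y e s0 e0; exists r => // s' y' [s'0 _] h1 h2.
  by have := hr s' y' s'0 h1 h2; lin.
- move=> T _; have [C hC] := E3 T; exists C => s y /andP[s0 sT]; rewrite lerN2.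
  by have /ler_normlP[_] := hC s y s0 sT.
- by move=> y; rewrite U0 -lee_fin -le.
by split; rewrite ?ltry.
Qed.

Lemma limsup0_cvg (g : R -> R) c : (forall e, 0 < e -> exists2 e0, 0 < e0 & forall d, 0 < d -> d < e0 -> `|g d - c| <= e) ->
  bounded0 g /\ limsup0 g = c.
Proof.
move=> H; have bg : bounded0 g.
  have [e0 e00 he] := H 1 ltr01; exists e0, (1 + `|c|); split => // d d0 d1.
  by have := he d d0 d1; have := ler_normD (g d - c) c; rewrite subrK; lin.
split=> //; apply/eqP; rewrite eq_le; apply/andP; split.
  apply: (limsup0_ub bg) => e e0; have [r r0 hr] := H e e0; exists r => // d d0 d1.
  by have /ler_normlP[_] := hr d d0 d1; lin.
apply/ler_addgt0Pr => e e0; have e2 : 0 < e / 2 by rewrite divr_gt0.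
have [r1 r10 h1] := limsup0_le bg e2; have [r2 r20 h2] := H _ e2.
have m0 : 0 < Num.min r1 r2 by rewrite lt_min r10.
have [m1 m2] : Num.min r1 r2 <= r1 /\ Num.min r1 r2 <= r2 by rewrite !ge_min !lexx orbT.
pose d := Num.min r1 r2 / 2.
have [d0 [d1 d2]] : 0 < d /\ d < r1 /\ d < r2.
  by rewrite /d; move: m0 m1 m2; clear => *; do ![split]; lra.
by have := h1 d d0 d1; have /ler_normlP[] := h2 d d0 d2; lin.
Qed.

Lemma lower_le_upper C v t x : near_lip C v -> bounded0 (fun e => v e t x) ->
  - upper_limit (signed (-1) v) t x <= upper_limit (signed 1 v) t x.
Proof.
move=> lv bv; have b sg : sg = 1 \/ sg = -1 -> bounded0 (fun e => signed sg v e t x).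
  by move=> hs; have [e0 [M [e00 hM]]] := bv; exists e0, M; split => // d d0 d1; rewrite /signed sg_norm//; exact: hM.
apply/ler_addgt0Pr => e e0; have e2 : 0 < e / 2 by rewrite divr_gt0.
have [r1 r10 h1] := limsup0_le (b 1 (or_introl erefl)) e2.
have [r2 r20 h2] := limsup0_le (b (-1) (or_intror erefl)) e2.
have m0 : 0 < Num.min r1 r2 by rewrite lt_min r10.
have [m1 m2] : Num.min r1 r2 <= r1 /\ Num.min r1 r2 <= r2 by rewrite !ge_min !lexx orbT.
pose d := Num.min r1 r2 / 2.
have [d0 [d1 d2]] : 0 < d /\ d < r1 /\ d < r2.
  by rewrite /d; move: m0 m1 m2; clear => *; do ![split]; lra.
by have := h1 d d0 d1; have := h2 d d0 d2; rewrite /signed /upper_limit; lin.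
Qed.

Lemma near_right (P : R -> Prop) : (\forall e \near 0^'+, P e) <->
  exists2 r, 0 < r & forall e, 0 < e -> e < r -> P e.
Proof.
split=> [[r /= r0 hr]|[r r0 hr]].
  by exists r => // e e0 er; apply: hr => //=; rewrite sub0r normrN gtr0_norm.
by exists r => //= e /=; rewrite sub0r normrN => er e0; apply: hr => //; rewrite -(gtr0_norm e0).
Qed.

Lemma family_near0P (T : topologicalType) (fam : set T -> Prop) (f : R -> T -> R) (g : T -> R) :
  {family fam, f e @[e --> 0^'+] --> g} <->
  forall D, fam D -> forall e, 0 < e -> exists2 r, 0 < r & forall d, 0 < d -> d < r -> forall z, D z -> `|f d z - g z| < e.
Proof.
split.
  move=> /fam_cvgP H D fD e e0; have := H D fD.
  have nb : nbhs (g : {uniform` D -> R^o}) [set k | forall z, D z -> `|k z - g z| < e].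
    apply/uniform_nbhs; exists [set z : R * R | `|z.1 - z.2| < e]; split.
      by rewrite -entourage_ballE; exists e.
    by move=> k hk z Dz; rewrite distrC; exact: hk.
  by move=> /(_ _ nb) /near_right [r r0 hr]; exists r.
move=> H; apply/fam_cvgP => D fD P /uniform_nbhs [V [entV VP]].
move: entV; rewrite -entourage_ballE => -[e /= e0 eV].
have [r r0 hr] := H D fD e e0; apply/near_right; exists r => // d d0 dr.
by apply: VP => z Dz; apply: eV; rewrite /= /ball /= distrC; exact: hr.
Qed.

Lemma klipschitzP L (f : R -> R) : L.-lipschitz f -> forall x y, `|f x - f y| <= `|L| * `|x - y|.
Proof.
move=> H x y; apply: le_trans (H (x, y) (conj I I)) _; rewrite ler_wpM2r//; exact: ler_norm.
Qed.

Lemma homogenization h K tau A : grid_adm h K tau A -> homogenizes_to h K tau (effective_limiter h K tau).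
Proof.
move=> ga U u0 u [L LU] cU su; have [wh tg _] := ga.
set Lb := effective_limiter _ _ _; have wl := wf_limit Lb wh; have adm := limit_adm ga; rewrite -/Lb in adm.
pose v (e t x : R) := u e (t, x).
have uv e : 0 < e -> usol h K tau (rescale e (v e)) /\ forall x, v e 0 x = U e x.
  move=> e0; have [h1 h2] := unit_solution_usol wh tg (su e e0); split => // x.
  have := h2 (e^-1 * x); rewrite /= mulr0 mulrA divff ?gt_eqF// mul1r => hh.
  by apply: (mulfI (x := e^-1)); rewrite ?invr_neq0 ?gt_eqF.
have [C [C0 hC]] := unit_estimates ga (normr_ge0 L).
have est e : 0 < e -> (forall t x, 0 <= t -> `|v e t x - v e 0 x| <= C * t) /\
    forall s t x y, 0 <= s -> 0 <= t -> `|v e s x - v e t y| <= C * (`|s - t| + `|x - y| + e).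
  move=> e0; have [us v0] := uv e e0; have en := gt_eqF e0; have ei : 0 < e^-1 by rewrite invr_gt0.
  have li x y : `|rescale e (v e) 0 x - rescale e (v e) 0 y| <= `|L| * `|x - y|.
    rewrite /rescale !mulr0 !v0 -mulrBr normrM (gtr0_norm ei) mulrC ler_pdivrMr//.
    apply: le_trans (klipschitzP (LU e e0) _ _) _.
    by rewrite -mulrBr normrM (gtr0_norm e0) mulrCA mulrC.
  have [h1 h2] := hC _ us li.
  have resc t x : v e t x = e * rescale e (v e) (e^-1 * t) (e^-1 * x).
    by rewrite /rescale !mulrA divff ?en// !mul1r.
  split=> [t x t0|s t x y s0 t0]; rewrite !resc -mulrBr normrM (gtr0_norm e0) mulrC -ler_pdivlMr//.
    by rewrite mulr0 -mulrA [t / e]mulrC; apply: h1; rewrite mulr_ge0// ltW.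
  apply: le_trans (h2 _ _ _ _ _ _) _; rewrite ?mulr_ge0// ?(ltW ei)// -!mulrBr !normrM (gtr0_norm ei).
  by rewrite -mulrA ler_pM2l// !mulrDl divff ?en// ![_ * e^-1]mulrC.
have lv : near_lip C v by move=> e s t x y e0; exact: (est e e0).2.
have U0 x e : 0 < e -> exists2 e0, 0 < e0 & forall d, 0 < d -> d < e0 -> `|U d x - u0 x| <= e.
  move=> e0; have cx : compact [set x] by exact: compact_set1.
  have [r r0 hr] := (family_near0P _ _ _).1 cU _ cx e e0; exists r => // d d0 dr.
  by apply: ltW; apply: hr.
have bv t x : 0 <= t -> bounded0 (fun e => v e t x).
  move=> t0; have [r r0 hr] := U0 x 1 ltr01; exists r, (`|u0 x| + 1 + C * t); split => // d d0 dr.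
  have := (est d d0).1 t x t0; rewrite (uv d d0).2; have := hr d d0 dr.
  have := ler_normD (v d t x - U d x) (U d x); have := ler_normD (U d x - u0 x) (u0 x); rewrite !subrK.
  by lin.
have fam : family h K tau C v by split => // e e0; exact: (uv e e0).1.
have h1 : 1 = 1 :> R \/ 1 = -1 :> R by left.
have hN1 : -1 = 1 :> R \/ -1 = -1 :> R by right.
pose W := upper_limit (signed 1 v); pose V t x := - upper_limit (signed (-1) v) t x.
have lW : lipon (fun s => 0 <= s) C W := upper_limit_lip (signed_bounded h1 bv) (signed_lip h1 lv) C0.
have lV : lipon (fun s => 0 <= s) C V.
  move=> s t x y s0 t0; have := upper_limit_lip (signed_bounded hN1 bv) (signed_lip hN1 lv) C0 x y s0 t0.
  by rewrite /V; move: (upper_limit _ s x) (upper_limit _ t y) => a b; rewrite opprK [- a + b]addrC [`|b - a|]distrC.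
have init sg : sg = 1 \/ sg = -1 -> forall x, upper_limit (signed sg v) 0 x = sg * u0 x.
  move=> hs x; apply: (@limsup0_cvg _ (sg * u0 x) _).2 => e e0; have [r r0 hr] := U0 x e e0.
  by exists r => // d d0 dr; rewrite /signed (uv d d0).2 -mulrBr sg_norm// hr.
have W0 x : W 0 x = u0 x by rewrite /W init// mul1r.
have V0 x : V 0 x = u0 x by rewrite /V init// mulN1r opprK.
have sW : visc 1 (limit_hamiltonian h Lb) 0 0 +oo%E W := limit_sub ga fam.
have sV : visc (-1) (limit_hamiltonian h Lb) 0 0 +oo%E V.
  by apply: (limit_super ga fam) => t x; rewrite /V mulN1r opprK.
have slabW : lipon (in_slab 0 +oo%E) C W by apply: lipon_sub lW => s [].
have slabV : lipon (in_slab 0 +oo%E) C V by apply: lipon_sub lV => s [].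
have growth E : lipon (fun s => 0 <= s) C E -> forall T, exists k, forall t x, 0 <= t <= T -> `|E t x| <= k * (1 + `|x|).
  move=> lE T; exists (`|E 0 0| + C * (`|T| + 1)) => t x /andP[t0 tT].
  have := lE t 0 x 0 t0 (lexx 0); rewrite !subr0 (ger0_norm t0) => e1.
  have := ler_normD (E t x - E 0 0) (E 0 0); rewrite subrK => e2.
  have x0 := normr_ge0 x; have T0 := normr_ge0 T.
  have e3 : C * (t + `|x|) <= C * ((`|T| + 1) * (1 + `|x|)).
    rewrite ler_pM2l//; have := ler_norm T; have := mulr_ge0 T0 x0; move: tT x0; lin.
  by have := mulr_ge0 (normr_ge0 (E 0 0)) x0; move: e1 e2 e3; lin.
have WV t x : 0 <= t -> W t x = V t x.
  move=> t0; apply/eqP; rewrite eq_le; apply/andP; split; last exact: lower_le_upper lv (bv t x t0).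
  apply: (comparison wl adm slabW sW sV (lipon_lsc slabV)) => [T _|y|]; last by split; rewrite ?ltry.
    by have [k hk] := growth V lV T; exists k => s y sT; have /ler_normlP[] := hk s y sT; lin.
  by rewrite W0 V0.
have vW : visc (-1) (limit_hamiltonian h Lb) 0 0 +oo%E W.
  by apply: visc_eq sV => t x t0; rewrite WV// ltW.
have Ws : forall x (e : R), 0 < e -> \forall z \near (0, x), slab 0 +oo%E z -> `|W z.1 z.2 - W 0 x| < e.
  move=> x e e0; apply/near2P.
  have in0 : in_slab 0 +oo%E (0 : R) by split; rewrite ?ltry.
  by have [r r0 hr] := lipon_near x slabW in0 e0; exists r => // s y s1 y1 ss; exact: hr.
have S0 x : slab 0 +oo%E (0 : R, x : R) by split; rewrite //= ltry.
exists (fun z => W z.1 z.2); split.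
- split; last by move=> T; exact: growth.
  split.
  + exact/(sub_viscP 0 wl (u := fun z => W z.1 z.2) slabW).
  + exact/(super_viscP 0 wl (u := fun z => W z.1 z.2) slabW).
  + move=> x; rewrite usc_envE ?W0// => e e0; apply: filterS (Ws x e e0) => z hz /hz /ltr_normlP[_] /=.
    by rewrite -W0; lin.
  + move=> x; rewrite lsc_envE ?W0// => e e0; apply: filterS (Ws x e e0) => z hz /hz /ltr_normlP[] /=.
    by rewrite -W0; lin.
- move=> w [cw gw] t x t0; exact: (visc_unique wl adm (ltW C0) lW sW vW W0 cw gw).
apply/family_near0P => D [cD sD] e e0; have e2 : 0 < e / 2 by rewrite divr_gt0.
have [M [_ hM]] := compact_bounded cD; have {}hM := hM (M + 1) (ltr_pwDr ltr01 (lexx M)).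
have box t x : D (t, x) -> 0 <= t <= M + 1 /\ - (M + 1) <= x <= M + 1.
  move=> Dz; have /= := hM _ Dz; rewrite prod_normE ge_max /= => /andP[/ler_normlP[_ b1] /ler_normlP[b2 b3]].
  by have [/= t0 _] := sD _ Dz; rewrite t0 b1; split => //; move: b2 b3; lin.
(* Uniform upper bounds for the family and for its opposite, whose limits agree up to sign, combine
   into uniform convergence on a box containing the compact set. *)
have [r1 r10 g1] := upper_limit_unif (M + 1) (- (M + 1)) (M + 1) (signed_bounded h1 bv) (signed_lip h1 lv) C0 (lexx 0) e2.
have [r2 r20 g2] := upper_limit_unif (M + 1) (- (M + 1)) (M + 1) (signed_bounded hN1 bv) (signed_lip hN1 lv) C0 (lexx 0) e2.
exists (Num.min r1 r2); first by rewrite lt_min r10.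
move=> d d0; rewrite lt_min => /andP[d1 d2] [t x] Dz; have [tI xI] := box t x Dz.
have := g1 d t x d0 d1 tI xI; have := g2 d t x d0 d2 tI xI; rewrite /signed -/W => g3 g4.
have /andP[t0 _] := tI; have := WV t x t0; rewrite /V => g5.
apply: le_lt_trans (_ : e / 2 < e); last by rewrite ltr_pdivrMr// ltr_pMr// ltr1n.
by apply/ler_normlP; move: g3 g4 g5; rewrite /v /=; clear => *; split; lra.
Qed.
End Homogenization.

Theorem theorem1p12 (R : realType) (N : nat) (H : nat -> R -> R)
    (p0 : nat -> R) (hN : (1 <= N)%N) (hH : admissible_hams N H p0) :
  (forall (K : nat) (tau : nat -> R) (A : nat -> nat -> R) (a : nat -> R -> R),
     time_grid K tau -> admissible_limiters N H p0 K tau A a ->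
     let hamil := fun b : nat -> R => Hamiltonian N b H p0 a in
     let Abar := fun b : nat -> R => effective_limiter (hamil b) K tau in
     [/\ (forall b, increasing_points N b ->
            has_inf (subcorrector_levels (hamil b) K tau) /\
            homogenizes_to (hamil b) K tau (Abar b)),
         (forall (b b' : nat -> R) (k : nat),
            increasing_points N b -> increasing_points N b' -> (k <= N)%N ->
            (forall j, (j <= N)%N -> j != k ->
               edge_length N b' j = edge_length N b j) ->
            (edge_length N b k <= edge_length N b' k)%E ->
            Abar b' <= Abar b),
         (N = 1%N -> forall b, increasing_points N b -> Abar b = mean (a 1%N)),
         (forall b, increasing_points N b ->
            max_over N (fun k => mean (a k)) <= Abar b) &
         (forall e : R, 0 < e -> exists2 d : R, 0 < d &
            forall b, increasing_points N b ->
              (forall k, (1 <= k)%N -> (k < N)%N ->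
                 (edge_length N b k < d%:E)%E) ->
              `|Abar b - mean (fun s => max_over N (fun k => a k s))| < e)]) /\
  ((2 <= N)%N ->
   exists d0 : R -> R -> R,
     (forall M m, 0 <= d0 M m) /\
     forall (K : nat) (tau : nat -> R) (A : nat -> nat -> R)
       (a : nat -> R -> R) (b : nat -> R),
       time_grid K tau -> admissible_limiters N H p0 K tau A a ->
       increasing_points N b ->
       let M := max_over N (fun k => sup_norm (a k)) in
       let m := max_over N (fun k => mean (a k)) in
       ((d0 M m)%:E <= min_edge_length N b)%E ->
       effective_limiter (Hamiltonian N b H p0 a) K tau = m).
Proof.
split=> [K tau A a tg ha hamil Abar|N2]; last first.
  have [d0 [d1 d2]] := critical_distance hN hH; exists d0; split => // K tau A a b tg ha ib.
  have gb : grid_adm (Hamiltonian N b H p0 a) K tau A by [].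
  exact: d2 gb.
have ga b : increasing_points N b -> grid_adm (hamil b) K tau A by move=> ib; split.
split.
- by move=> b /ga gb; split; [exact: has_inf_levels gb|exact: homogenization gb].
- move=> b b' k ib ib' kN same le; exact: (eff_monotone (ga b ib) ib' kN same le).
- by move=> N1 b ib; exact: (eff_one_junction (ga b ib)).
- by move=> b ib; exact: (max_mean_le_eff (ga b ib)).
(* [eff_short] starts from one admissible configuration, but its threshold serves all positions of
   the points; the integers provide that configuration. *)
move=> e e0; have ib : increasing_points N (fun n : nat => n%:R : R) by move=> n _ _; rewrite ltr_nat.
have [d d0 hd] := eff_short (ga _ ib) e0; exists d => // b hb short; exact: hd.
Qed.
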